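(* Let $\mathbf{A}\in\mathbb{R}^{n\times d}$ have nonzero rows $a_1,\dots,a_n$, let $b\in\mathbb{R}^n$, suppose $\mu=\lambda_d(\mathbf{A}^\top\mathbf{A})>0$, and suppose $\kappa\le d^2$. Then there is a randomized algorithm that, given an initial point $x_0\in\mathbb{R}^d$, computes an $\epsilon$-approximate solution to the regression problem in running time $$O\left(\left(\mathrm{nnz}(\mathbf{A})+\mathrm{nnz}(\mathbf{A})^{2/3}\kappa^{1/6}\left(\sum_{i=1}^n\frac{\|a_i\|_2^2}{\mu}\sqrt{s_i}\right)^{1/3}\log(\kappa)\right)\log\left(\frac{1}{\epsilon}\right)\right).$$
   Context: $\mathrm{nnz}(\mathbf{A})$ is the number of nonzero entries of $\mathbf{A}$; $s_i=\|a_i\|_1^2/\|a_i\|_2^2$ is the numerical sparsity of row $a_i$; $\lambda_d(\mathbf{A}^\top\mathbf{A})$ is the smallest eigenvalue of $\mathbf{A}^\top\mathbf{A}$; $\kappa=\|\mathbf{A}\|_F^2/\mu$. The regression problem is to find $x^*=\arg\min_{x\in\mathbb{R}^d}\|\mathbf{A}x-b\|_2^2$; given $x_0$, a point $x$ is an $\epsilon$-approximate solution if $\|x-x^*\|_{\mathbf{A}^\top\mathbf{A}}\le\epsilon\|x_0-x^*\|_{\mathbf{A}^\top\mathbf{A}}$, where $\|y\|_{\mathbf{M}}^2=y^\top\mathbf{M}y$. *)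

(* Defs.v *)
From HB Require Import structures.
From mathcomp Require Import all_boot all_order all_algebra.
From mathcomp Require Import boolp classical_sets reals topology normedtype.
From mathcomp Require Import sequences exp.

Set Implicit Arguments.
Unset Strict Implicit.
Unset Printing Implicit Defensive.

Import Order.TTheory GRing.Theory Num.Theory.

Local Open Scope ring_scope.

Definition nnz (R : realType) (n d : nat) (A : 'M[R]_(n, d)) : nat :=
  #|[set p : 'I_n * 'I_d | A p.1 p.2 != 0]|.

Definition norm1 (R : realType) (d : nat) (v : 'rV[R]_d) : R :=
  \sum_j `|v 0 j|.

Definition norm2 (R : realType) (d : nat) (v : 'rV[R]_d) : R :=
  Num.sqrt (\sum_j v 0 j ^+ 2).

Definition num_sparsity (R : realType) (d : nat) (v : 'rV[R]_d) : R :=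
  norm1 v ^+ 2 / norm2 v ^+ 2.

Definition frobenius (R : realType) (n d : nat) (A : 'M[R]_(n, d)) : R :=
  Num.sqrt (\sum_i \sum_j A i j ^+ 2).

(* For the symmetric matrix A^T A all eigenvalues are real, so ranging over
   the eigenvalues in R loses none of them. *)
Definition smallest_eigenvalue (R : realType) (d : nat) (M : 'M[R]_d)
    (mu : R) : Prop :=
  eigenvalue M mu /\ (forall a : R, eigenvalue M a -> mu <= a).

Definition kappa (R : realType) (n d : nat) (A : 'M[R]_(n, d)) (mu : R) : R :=
  frobenius A ^+ 2 / mu.

Definition residual_sq (R : realType) (n d : nat) (A : 'M[R]_(n, d))
    (b : 'cV[R]_n) (x : 'cV[R]_d) : R :=
  \sum_i (A *m x - b) i 0 ^+ 2.

Definition regression_argmin (R : realType) (n d : nat) (A : 'M[R]_(n, d))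
    (b : 'cV[R]_n) (xs : 'cV[R]_d) : Prop :=
  forall y : 'cV[R]_d, residual_sq A b xs <= residual_sq A b y.

Definition mxnorm_by (R : realType) (d : nat) (M : 'M[R]_d)
    (y : 'cV[R]_d) : R :=
  Num.sqrt ((y^T *m M *m y) 0 0).

Definition approx_solution (R : realType) (n d : nat) (A : 'M[R]_(n, d))
    (b : 'cV[R]_n) (x0 : 'cV[R]_d) (eps : R) (x : 'cV[R]_d) : Prop :=
  exists2 xs : 'cV[R]_d, regression_argmin A b xs &
    mxnorm_by (A^T *m A) (x - xs) <= eps * mxnorm_by (A^T *m A) (x0 - xs).

Definition runtime_bound (R : realType) (n d : nat) (A : 'M[R]_(n, d))
    (mu eps : R) : R :=
  ((nnz A)%:R +
   (nnz A)%:R `^ (2 / 3) * kappa A mu `^ (1 / 6) *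
   (\sum_i norm2 (row i A) ^+ 2 / mu * Num.sqrt (num_sparsity (row i A)))
     `^ (1 / 3) *
   ln (kappa A mu)) * ln (1 / eps).

(* A randomized real RAM.  A program uses finitely many natural-number and real
   variables and arrays, named by natural numbers.  Real arithmetic is exact.
   The only constants are naturals (no information can be hidden in a real
   constant) and there is no conversion from reals to naturals.  [CUnif x e]
   draws x uniformly below e; [CFlip x e] sets x to 1 with probability e,
   clipped to [0, 1], and to 0 otherwise. *)

Inductive nexp : Type :=
| NConst of nat
| NVar of nat
| NGet of nat & nexp
| NAdd of nexp & nexp
| NSub of nexp & nexp.

Inductive rexp : Type :=
| RNat of nexp
| RVar of nat
| RGet of nat & nexp
| RAdd of rexp & rexp
| RSub of rexp & rexp
| RMul of rexp & rexp
| RDiv of rexp & rexp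
| RSqrt of rexp.

Inductive bexp : Type :=
| BLeN of nexp & nexp
| BLeR of rexp & rexp
| BNot of bexp
| BAnd of bexp & bexp.

Inductive cmd : Type :=
| CSkip
| CSetN of nat & nexp
| CSetR of nat & rexp
| CPutN of nat & nexp & nexp
| CPutR of nat & nexp & rexp
| CUnif of nat & nexp
| CFlip of nat & rexp
| CSeq of cmd & cmd
| CIf of bexp & cmd & cmd
| CWhile of bexp & cmd.

Record store (R : Type) : Type := Store {
  nvar : nat -> nat;
  rvar : nat -> R;
  narr : nat -> nat -> nat;
  rarr : nat -> nat -> R }.

Definition upd (T : Type) (f : nat -> T) (i : nat) (v : T) : nat -> T :=
  fun j => if j == i then v else f j.

Definition set_nvar (R : Type) (s : store R) (x v : nat) : store R :=
  Store (upd (nvar s) x v) (rvar s) (narr s) (rarr s).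

Definition set_rvar (R : Type) (s : store R) (x : nat) (v : R) : store R :=
  Store (nvar s) (upd (rvar s) x v) (narr s) (rarr s).

Definition put_narr (R : Type) (s : store R) (a i v : nat) : store R :=
  Store (nvar s) (rvar s) (upd (narr s) a (upd (narr s a) i v)) (rarr s).

Definition put_rarr (R : Type) (s : store R) (a i : nat) (v : R) : store R :=
  Store (nvar s) (rvar s) (narr s) (upd (rarr s) a (upd (rarr s a) i v)).

Fixpoint neval (R : Type) (s : store R) (e : nexp) : nat :=
  match e with
  | NConst k => k
  | NVar x => nvar s x
  | NGet a i => narr s a (neval s i)
  | NAdd e1 e2 => (neval s e1 + neval s e2)%N
  | NSub e1 e2 => (neval s e1 - neval s e2)%N
  end.

Fixpoint reval (R : realType) (s : store R) (e : rexp) : R :=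
  match e with
  | RNat e1 => (neval s e1)%:R
  | RVar x => rvar s x
  | RGet a i => rarr s a (neval s i)
  | RAdd e1 e2 => reval s e1 + reval s e2
  | RSub e1 e2 => reval s e1 - reval s e2
  | RMul e1 e2 => reval s e1 * reval s e2
  | RDiv e1 e2 => reval s e1 / reval s e2
  | RSqrt e1 => Num.sqrt (reval s e1)
  end.

Fixpoint beval (R : realType) (s : store R) (e : bexp) : bool :=
  match e with
  | BLeN e1 e2 => (neval s e1 <= neval s e2)%N
  | BLeR e1 e2 => reval s e1 <= reval s e2
  | BNot e1 => ~~ beval s e1
  | BAnd e1 e2 => beval s e1 && beval s e2
  end.

(* The commands still to be executed, and the memory; the computation has
   halted when the list is empty. *)
Definition config (R : Type) : Type := (seq cmd * store R)%type.

(* One step, costing one unit of time, from a configuration with head command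
   [c]: the possible successors with their probabilities.  The expressions of
   a program have bounded size, so counting the individual operations instead
   would change the running time by at most a constant factor. *)
Definition step (R : realType) (c : cmd) (k : seq cmd) (s : store R) :
    seq (R * config R) :=
  match c with
  | CSkip => [:: (1, (k, s))]
  | CSetN x e => [:: (1, (k, set_nvar s x (neval s e)))]
  | CSetR x e => [:: (1, (k, set_rvar s x (reval s e)))]
  | CPutN a i e => [:: (1, (k, put_narr s a (neval s i) (neval s e)))]
  | CPutR a i e => [:: (1, (k, put_rarr s a (neval s i) (reval s e)))]
  | CUnif x e =>
      let m := neval s e in
      if m == 0%N then [:: (1, (k, set_nvar s x 0%N))]
      else [seq (m%:R^-1, (k, set_nvar s x v)) | v <- iota 0 m]
  | CFlip x e =>
      let p := Num.max 0 (Num.min 1 (reval s e)) in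
      [:: (p, (k, set_nvar s x 1%N)); (1 - p, (k, set_nvar s x 0%N))]
  | CSeq c1 c2 => [:: (1, (c1 :: c2 :: k, s))]
  | CIf e c1 c2 => [:: (1, ((if beval s e then c1 else c2) :: k, s))]
  | CWhile e c1 =>
      [:: (1, (if beval s e then c1 :: CWhile e c1 :: k else k, s))]
  end.

(* The probability that the computation started in [cf] halts within [t] steps
   in a memory satisfying [P]. *)
Fixpoint halt_prob (R : realType) (t : nat) (P : store R -> Prop)
    (cf : config R) : R :=
  if cf.1 is c :: k then
    if t is t'.+1 then
      \sum_(w <- step c k cf.2) w.1 * halt_prob t' P w.2
    else 0
  else (`[< P cf.2 >])%:R.

Definition nonzeros (R : realType) (n d : nat) (A : 'M[R]_(n, d)) :
    seq ('I_n * 'I_d) :=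
  [seq p <- [seq (i, j) | i <- enum 'I_n, j <- enum 'I_d] | A p.1 p.2 != 0].

Definition load_seq (T : Type) (x0 : T) (l : seq T) : nat -> T :=
  fun k => nth x0 l k.

(* A is stored sparsely, as the lists of row indices, column indices and
   values of its nonzero entries, row by row; unused memory is zero.  As usual
   for methods whose step sizes depend on it, mu is part of the problem data. *)
Definition regression_input (R : realType) (n d : nat) (A : 'M[R]_(n, d))
    (b : 'cV[R]_n) (mu : R) (x0 : 'cV[R]_d) (eps : R) : store R :=
  {| nvar := load_seq 0%N [:: n; d; nnz A];
     rvar := load_seq 0 [:: eps; mu];
     narr := load_seq (fun=> 0%N)
       [:: load_seq 0%N [seq val p.1 | p <- nonzeros A];
           load_seq 0%N [seq val p.2 | p <- nonzeros A]];
     rarr := load_seq (fun=> 0)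
       [:: load_seq 0 [seq A p.1 p.2 | p <- nonzeros A];
           load_seq 0 [seq b i 0 | i <- enum 'I_n];
           load_seq 0 [seq x0 j 0 | j <- enum 'I_d]] |}.

Definition regression_output (R : realType) (d : nat) (s : store R) :
    'cV[R]_d :=
  \col_(j < d) rarr s 3%N j.

(* Main.v *)
(* Write m = nnz A, F for the squared Frobenius norm, S for the sum of the products
   |a_i|_1 |a_i|_2, and M = A^T A.  An outer accelerated proximal iteration with
   regularization g = F / N contracts a potential by 1 - sqrt(mu / (mu + g)) / 64 in
   expectation, so about sqrt(1 + F / (N mu)) log(1 / eps) rounds suffice.

   Each round needs an approximate proximal step, which is found by stochastic gradient
   descent on sampled rows, stopped at a geometric time of mean of order N: the geometric
   law makes the expected payoff of one more step an exact one-step recursion.  A row is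
   sampled with frequency proportional to its squared norm (rounded up to integer slots, so
   that a uniform draw suffices), and within a row the large entries are treated exactly
   and the others sampled proportionally to their absolute values, so that a step on row
   a_i costs about 1 + sqrt(N) |a_i|_1 / |a_i|_2.  N is doubled while N^3 S^2 <= m^2 F^2
   and N mu <= F, which keeps the expected cost of a round of order m.

   Scalar products with the rows that have |a_i|_1^2 > N |a_i|_2^2, for which sampling is
   too noisy, are computed together: the entries of A are rounded to multiples of a grid
   size, the at most m / N such rows are packed as the digits of one large number in each
   column, and the digits of the packed scalar product are extracted bit by bit.  The
   number of bits is O(log kappa), which is where the factor log(kappa) comes from.

   The budgets on the number of steps are enforced by counters, and the expected values of
   all quantities are propagated through the program by a weakest-precondition calculus. *)

Require Import Defs.
From HB Require Import structures.
From mathcomp Require Import all_boot all_order all_algebra.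
From mathcomp Require Import boolp classical_sets reals topology normedtype.
From mathcomp Require Import sequences exp.
From mathcomp Require Import zify ring lra.

Set Implicit Arguments.
Unset Strict Implicit.
Unset Printing Implicit Defensive.
Import Order.TTheory GRing.Theory Num.Theory.
Local Open Scope ring_scope.

(** * Expected values of programs *)

(** Rounding the entries cannot bias the solution: the gradient of each round is taken with the
    exact matrix, and the rounded one only enters the form in which the proximal step is solved,
    which has to be comparable with A^T A + g. The inner descent has no regularization in its drift.
    It stops with probability p at each step, where (1 - p) * eta * gam = p; geometric killing acts
    as the resolvent, so the stopped iterate started at 0 has exactly the solution of the
    regularized system as its mean, and only second moments need estimates.

    The time bound must hold for every run while all estimates are means. The analysis therefore
    follows one affine quantity: 1, minus prices for the steps and samples spent, minus a multiple
    of the squared error; running out of budget is worth a constant [dv]. Zero prices and [dv = 1]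
    give termination with probability 1, and prices fixed by Markov's inequality give the success
    probability.

    A dense iterate is too long to be updated in every step, so it is kept as the implicit sum [yv];
    a light row is sampled twice independently, which makes its step unbiased. *)

Section Logic.
Variable R : realType.
Implicit Types (c : cmd) (s : store R) (T t : nat).
Implicit Types (P : store R -> Prop) (Q : store R -> Prop) (psi : store R -> R).

(** Configurations contain functions and have no decidable equality, hence [List.In] in place of
    [\in]. *)
Lemma step_ge0 c k s w : List.In w (step c k s) -> 0 <= w.1.
Proof.
case: c => [|x e|x e|a i e|a i e|x e|x e|c1 c2|e c1 c2|e c1] /=;
  try by case=> // <-.
- case: ifP => _ /=; first by case=> // <-.
  elim: (iota _ _) => //= v l IH [<-|/IH //] /=; by rewrite invr_ge0 ler0n.
- case=> [<-|[<-|//]] /=; first by rewrite le_max lexx.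
  by rewrite subr_ge0 ge_max ler01 ge_min lexx.
Qed.

Lemma step_sum1 c k s : \sum_(w <- step c k s) w.1 = 1.
Proof.
case: c => [|x e|x e|a i e|a i e|x e|x e|c1 c2|e c1 c2|e c1] /=;
  try by rewrite big_seq1.
- case: ifP => m0; first by rewrite big_seq1.
  rewrite big_map /= big_const_seq count_predT size_iota iter_addr_0.
  by rewrite -[LHS]mulr_natr mulVf // pnatr_eq0 m0.
- by rewrite big_cons big_seq1 /= subrKC.
Qed.

Lemma ler_sum_In (I : Type) (r : seq I) (F G : I -> R) :
  (forall i, List.In i r -> F i <= G i) -> \sum_(i <- r) F i <= \sum_(i <- r) G i.
Proof.
elim: r => [|i r IH] H; first by rewrite !big_nil.
rewrite !big_cons lerD //; first by apply: H; left.
by apply: IH => j Hj; apply: H; right.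
Qed.

Lemma halt_prob_ge0 t P cf : 0 <= halt_prob t P cf.
Proof.
elim: t cf => [|t IH] [[|c k] s] //=; rewrite ?ler0n //.
rewrite -[leLHS](_ : \sum_(w <- step c k s) 0 = 0); last by rewrite big1_eq.
by apply: ler_sum_In => w Hw; rewrite mulr_ge0 // (step_ge0 Hw).
Qed.

Lemma halt_prob_le1 t P cf : halt_prob t P cf <= 1.
Proof.
elim: t cf => [|t IH] [[|c k] s] //=; rewrite ?lern1 ?leq_b1 ?ler01 //.
rewrite -(step_sum1 c k s); apply: ler_sum_In => w Hw.
by rewrite ler_piMr // (step_ge0 Hw).
Qed.

Lemma halt_prob_leS t P cf : halt_prob t P cf <= halt_prob t.+1 P cf.
Proof.
elim: t cf => [|t IH] [[|c k] s] //; first exact: (halt_prob_ge0 1).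
rewrite [leLHS]/= [leRHS]/=; apply: ler_sum_In => w Hw.
by rewrite ler_wpM2l // ?(step_ge0 Hw) //; apply: IH.
Qed.

Lemma halt_prob_mono t t' P cf :
  (t <= t')%N -> halt_prob t P cf <= halt_prob t' P cf.
Proof.
move=> /subnK <-; elim: (t' - t)%N => // u IH.
by rewrite addSn; apply: le_trans IH (halt_prob_leS _ _ _).
Qed.

(* [wp c s T Q psi v]: from memory [s], within [T] steps, [c] terminates in
   memories satisfying [Q], and the expectation of [psi] there is at least
   [v]; [det] is the special case of a single final memory. *)
Definition wp c s T Q psi (v : R) : Prop :=
  forall k t P, (forall s', Q s' -> psi s' <= halt_prob t P (k, s')) ->
  v <= halt_prob (T + t) P (c :: k, s).

Definition det c s T Q : Prop :=
  exists2 s', Q s' &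
  forall k t P, halt_prob t P (k, s') <= halt_prob (T + t) P (c :: k, s).

Lemma det_wp c s T Q Q' psi v :
  det c s T Q -> (forall s', Q s' -> Q' s' /\ v <= psi s') ->
  wp c s T Q' psi v.
Proof.
move=> [s' Qs' H] HQ k t P Hk; have [Q's' vle] := HQ _ Qs'.
exact: le_trans vle (le_trans (Hk _ Q's') (H _ _ _)).
Qed.

Lemma wp_conseq c s T T' Q Q' psi psi' v v' :
  (T <= T')%N -> v' <= v ->
  (forall s', Q s' -> Q' s' /\ psi s' <= psi' s') ->
  wp c s T Q psi v -> wp c s T' Q' psi' v'.
Proof.
move=> leT lev HQ H k t P Hk; apply: le_trans lev _.
apply: (le_trans (H k t P _)); last by apply: halt_prob_mono; rewrite leq_add2r.
by move=> s' /HQ [Qs' le']; apply: le_trans le' (Hk _ Qs').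
Qed.

Lemma det_conseq c s T T' Q Q' :
  (T <= T')%N -> (forall s', Q s' -> Q' s') -> det c s T Q -> det c s T' Q'.
Proof.
move=> leT HQ [s' Qs' H]; exists s'; first exact: HQ.
move=> k t P; apply: le_trans (H k t P) _.
by apply: halt_prob_mono; rewrite leq_add2r.
Qed.

Lemma det_skip s Q : Q s -> det CSkip s 1 Q.
Proof. by exists s => // k t P; rewrite /= big_seq1 mul1r. Qed.

Lemma det_setN s x e Q :
  Q (set_nvar s x (neval s e)) -> det (CSetN x e) s 1 Q.
Proof. by eexists; [eassumption|] => k t P; rewrite /= big_seq1 mul1r. Qed.

Lemma det_setR s x e Q :
  Q (set_rvar s x (reval s e)) -> det (CSetR x e) s 1 Q.
Proof. by eexists; [eassumption|] => k t P; rewrite /= big_seq1 mul1r. Qed.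

Lemma det_putN s a i e Q :
  Q (put_narr s a (neval s i) (neval s e)) -> det (CPutN a i e) s 1 Q.
Proof. by eexists; [eassumption|] => k t P; rewrite /= big_seq1 mul1r. Qed.

Lemma det_putR s a i e Q :
  Q (put_rarr s a (neval s i) (reval s e)) -> det (CPutR a i e) s 1 Q.
Proof. by eexists; [eassumption|] => k t P; rewrite /= big_seq1 mul1r. Qed.

Lemma det_seq c1 c2 s T1 T2 Q :
  det c1 s T1 (fun s1 => det c2 s1 T2 Q) -> det (CSeq c1 c2) s (T1 + T2).+1 Q.
Proof.
move=> [s1 [s2 Qs2 H2] H1]; exists s2 => // k t P.
rewrite addSn /= big_seq1 mul1r -addnA.
exact: le_trans (H2 _ _ _) (H1 _ _ _).
Qed.

Lemma det_if b c1 c2 s T Q :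
  (beval s b -> det c1 s T Q) -> (~~ beval s b -> det c2 s T Q) ->
  det (CIf b c1 c2) s T.+1 Q.
Proof.
case E: (beval s b) => H1 H2.
  have [s' Qs' H] := H1 isT; exists s' => // k t P.
  by rewrite addSn /= big_seq1 mul1r E.
have [s' Qs' H] := H2 isT; exists s' => // k t P.
by rewrite addSn /= big_seq1 mul1r E.
Qed.

Lemma det_whileF b c s Q : ~~ beval s b -> Q s -> det (CWhile b c) s 1 Q.
Proof.
move=> /negbTE E Qs; exists s => // k t P.
by rewrite /= big_seq1 mul1r E.
Qed.

Lemma det_whileT b c s T1 T2 Q :
  beval s b -> det c s T1 (fun s1 => det (CWhile b c) s1 T2 Q) ->
  det (CWhile b c) s (T1 + T2).+1 Q.
Proof.
move=> E [s1 [s2 Qs2 H2] H1]; exists s2 => // k t P.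
rewrite addSn [leRHS]/= big_seq1 mul1r E -addnA.
exact: le_trans (H2 _ _ _) (H1 _ _ _).
Qed.

Lemma wp_seq c1 c2 s T1 T2 Q psi v Q1 psi1 :
  wp c1 s T1 Q1 psi1 v ->
  (forall s1, Q1 s1 -> wp c2 s1 T2 Q psi (psi1 s1)) ->
  wp (CSeq c1 c2) s (T1 + T2).+1 Q psi v.
Proof.
move=> H1 H2 k t P Hk; rewrite addSn /= big_seq1 mul1r -addnA.
by apply: H1 => s1 Qs1; apply: H2.
Qed.

Lemma wp_detseq c1 c2 s T1 T2 Q psi v :
  det c1 s T1 (fun s1 => wp c2 s1 T2 Q psi v) ->
  wp (CSeq c1 c2) s (T1 + T2).+1 Q psi v.
Proof.
move=> H; apply: (@wp_seq _ _ _ _ _ _ _ _ (fun s1 => wp c2 s1 T2 Q psi v) (fun=> v)) => //.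
exact: det_wp H _.
Qed.

Lemma wp_if b c1 c2 s T Q psi v :
  (beval s b -> wp c1 s T Q psi v) -> (~~ beval s b -> wp c2 s T Q psi v) ->
  wp (CIf b c1 c2) s T.+1 Q psi v.
Proof.
move=> H1 H2 k t P Hk; rewrite addSn /= big_seq1 mul1r.
by case: ifP => E; [apply: H1|apply: H2; rewrite ?E].
Qed.

Lemma wp_unif x e s Q psi v :
  (0 < neval s e)%N ->
  (forall u, (u < neval s e)%N -> Q (set_nvar s x u)) ->
  v <= (\sum_(u < neval s e) psi (set_nvar s x u)) / (neval s e)%:R ->
  wp (CUnif x e) s 1 Q psi v.
Proof.
move=> m0 HQ Hv k t P Hk; rewrite /= -[_ == _]negbK -lt0n m0 /=.
apply: le_trans Hv _; rewrite big_map mulr_suml.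
rewrite -(big_mkord xpredT (fun u => psi (set_nvar s x u) / (neval s e)%:R)).
rewrite /index_iota subn0; apply: ler_sum_In => u /= Hu.
rewrite mulrC ler_wpM2l ?invr_ge0 ?ler0n //; apply: Hk; apply: HQ.
suff: u \in iota 0 (neval s e) by rewrite mem_iota.
elim: (iota _ _) Hu => //= w l IH [->|/IH Hu]; by rewrite inE ?eqxx // Hu orbT.
Qed.

Lemma wp_flip x e s Q psi v :
  0 <= reval s e <= 1 -> Q (set_nvar s x 1%N) -> Q (set_nvar s x 0%N) ->
  v <= reval s e * psi (set_nvar s x 1%N) +
       (1 - reval s e) * psi (set_nvar s x 0%N) ->
  wp (CFlip x e) s 1 Q psi v.
Proof.
move=> /andP[p0 p1] Q1 Q0 Hv k t P Hk; rewrite /= big_cons big_seq1 /=.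
rewrite (min_r p1) (max_r p0); apply: le_trans Hv _.
by rewrite lerD // ler_wpM2l ?subr_ge0 //; apply: Hk.
Qed.

Lemma wp_whileF b c s Q psi v :
  ~~ beval s b -> Q s -> v <= psi s -> wp (CWhile b c) s 1 Q psi v.
Proof.
move=> E Qs Hv; apply: (det_wp (Q := fun s' => s' = s)).
  exact: det_whileF.
by move=> s' ->.
Qed.

Lemma wp_whileT b c s T1 T2 Q psi v Q1 psi1 :
  beval s b -> wp c s T1 Q1 psi1 v ->
  (forall s1, Q1 s1 -> wp (CWhile b c) s1 T2 Q psi (psi1 s1)) ->
  wp (CWhile b c) s (T1 + T2).+1 Q psi v.
Proof.
move=> E H1 H2 k t P Hk; rewrite addSn /= big_seq1 mul1r E -addnA.
by apply: H1 => s1 Qs1; apply: H2.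
Qed.

(** Code without loops and random choices. For it [run] computes the final memory, so that a
    specification reduces to evaluation. *)
Fixpoint simple c : bool :=
  match c with
  | CSkip | CSetN _ _ | CSetR _ _ | CPutN _ _ _ | CPutR _ _ _ => true
  | CSeq c1 c2 => simple c1 && simple c2
  | CIf _ c1 c2 => simple c1 && simple c2
  | _ => false
  end.

Fixpoint cost c : nat :=
  match c with
  | CSeq c1 c2 => (cost c1 + cost c2).+1
  | CIf _ c1 c2 => (maxn (cost c1) (cost c2)).+1
  | _ => 1
  end.

Fixpoint run c s : store R :=
  match c with
  | CSetN x e => set_nvar s x (neval s e)
  | CSetR x e => set_rvar s x (reval s e)
  | CPutN a i e => put_narr s a (neval s i) (neval s e)
  | CPutR a i e => put_rarr s a (neval s i) (reval s e)
  | CSeq c1 c2 => run c2 (run c1 s)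
  | CIf b c1 c2 => if beval s b then run c1 s else run c2 s
  | _ => s
  end.

Lemma det_run c s T Q : simple c -> (cost c <= T)%N -> Q (run c s) -> det c s T Q.
Proof.
move=> Sc leT HQ; apply: det_conseq leT (fun s' H => H) _.
elim: c s Q Sc HQ {T} => //=.
- by move=> s Q _ HQ; apply: det_skip.
- by move=> x e s Q _ HQ; apply: det_setN.
- by move=> x e s Q _ HQ; apply: det_setR.
- by move=> a i e s Q _ HQ; apply: det_putN.
- by move=> a i e s Q _ HQ; apply: det_putR.
- move=> c1 IH1 c2 IH2 s Q /andP[S1 S2] HQ.
  by apply: det_seq; apply: IH1 => //; apply: IH2.
- move=> b c1 IH1 c2 IH2 s Q /andP[S1 S2] HQ.
  apply: det_if => Hb; move: HQ; rewrite ?Hb ?(negbTE Hb) => HQ.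
    by apply: (det_conseq (leq_maxl _ _) (fun s' H => H)); apply: IH1.
  by apply: (det_conseq (leq_maxr _ _) (fun s' H => H)); apply: IH2.
Qed.

Lemma det_seqT c1 c2 s T1 T2 T Q :
  (T1 + T2 < T)%N -> det c1 s T1 (fun s1 => det c2 s1 T2 Q) ->
  det (CSeq c1 c2) s T Q.
Proof. by move=> leT H; apply: det_conseq leT (fun s' H => H) (det_seq H). Qed.

Lemma wp_seqT c1 c2 s T1 T2 T Q psi v Q1 psi1 :
  (T1 + T2 < T)%N -> wp c1 s T1 Q1 psi1 v ->
  (forall s1, Q1 s1 -> wp c2 s1 T2 Q psi (psi1 s1)) ->
  wp (CSeq c1 c2) s T Q psi v.
Proof.
by move=> leT H1 H2; apply: wp_conseq leT (lexx v) _ (wp_seq H1 H2) => s' Hs'.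
Qed.

Lemma wp_detseqT c1 c2 s T1 T2 T Q psi v :
  (T1 + T2 < T)%N -> det c1 s T1 (fun s1 => wp c2 s1 T2 Q psi v) ->
  wp (CSeq c1 c2) s T Q psi v.
Proof.
by move=> leT H; apply: wp_conseq leT (lexx v) _ (wp_detseq H) => s' Hs'.
Qed.

Lemma wp_run c s T Q psi v : simple c -> (cost c <= T)%N -> Q (run c s) ->
  v <= psi (run c s) -> wp c s T Q psi v.
Proof.
move=> Sc leT HQ Hv; apply: (det_wp (Q := fun s' => s' = run c s)).
  exact: det_run.
by move=> s' ->.
Qed.

Definition NLt e1 e2 := BNot (BLeN e2 e1).

Definition CFor (x : nat) (e : nexp) (body : cmd) : cmd :=
  CSeq (CSetN x (NConst 0))
    (CWhile (NLt (NVar x) e) (CSeq body (CSetN x (NAdd (NVar x) (NConst 1))))).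

(** Each round adds 3 to the cost of the body: the guard, the sequencing and the increment. The last
    3 pays for the initial assignment, its sequencing and the final guard. *)
Lemma det_for x e body s n (I : nat -> store R -> Prop) (T : nat -> nat) Q :
  I 0%N (set_nvar s x 0%N) ->
  (forall (k : nat) s', (k <= n)%N -> I k s' -> nvar s' x = k /\ neval s' e = n) ->
  (forall (k : nat) s', (k < n)%N -> I k s' ->
     det body s' (T k) (fun s2 => nvar s2 x = k /\ I k.+1 (set_nvar s2 x k.+1))) ->
  (forall s', I n s' -> Q s') ->
  det (CFor x e body) s ((\sum_(0 <= k < n) (T k + 3)) + 3) Q.
Proof.
move=> I0 Ix Istep IQ.
rewrite [(_ + 3)%N](_ : _ = (1 + (\sum_(0 <= k < n) (T k + 3) + 1)).+1); last by lia.
apply: det_seq; apply: det_setN => /=.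
move: {s}(set_nvar _ _ _) I0 => s Is.
suff H j (k0 : nat) s0 : (k0 <= n)%N -> (n - k0)%N = j -> I k0 s0 ->
    det (CWhile (NLt (NVar x) e) (CSeq body (CSetN x (NAdd (NVar x) (NConst 1))))) s0
      (\sum_(k0 <= k < n) (T k + 3) + 1) Q by exact: (H n 0%N s (leq0n _) (subn0 _) Is).
elim: j k0 s0 {s Is} => [|j IH] k0 s Hk Hj Is.
  have Ek : k0 = n by lia.
  have [E1 E2] := Ix _ _ Hk Is; subst k0.
  rewrite big_geq //; apply: det_whileF; last exact: IQ.
  by rewrite /= E1 E2 leqnn.
have ltk : (k0 < n)%N by lia.
have [E1 E2] := Ix _ _ Hk Is.
rewrite big_ltn //.
apply: (@det_conseq _ _ ((T k0 + 1).+1 + (\sum_(k0.+1 <= i < n) (T i + 3) + 1)).+1 _ Q) => //.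
  by lia.
apply: det_whileT; first by rewrite /= E1 E2 -ltnNge.
apply: det_seq; have [s2 [Ex I2] H2] := Istep _ _ ltk Is.
exists s2 => //; apply: det_setN => /=; rewrite Ex addn1; apply: IH => //; lia.
Qed.

(** The step condition says that [V k] is at most the expectation of [V k.+1]: along the loop [V] is
    a submartingale, so its initial value bounds the final expectation from below. *)
Lemma wp_for x e body s n (I : nat -> store R -> Prop)
    (V : nat -> store R -> R) (T : nat -> nat) Q psi v :
  I 0%N (set_nvar s x 0%N) -> v <= V 0%N (set_nvar s x 0%N) ->
  (forall (k : nat) s', (k <= n)%N -> I k s' -> nvar s' x = k /\ neval s' e = n) ->
  (forall (k : nat) s', (k < n)%N -> I k s' ->
     wp body s' (T k) (fun s2 => nvar s2 x = k /\ I k.+1 (set_nvar s2 x k.+1))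
       (fun s2 => V k.+1 (set_nvar s2 x k.+1)) (V k s')) ->
  (forall s', I n s' -> Q s' /\ V n s' <= psi s') ->
  wp (CFor x e body) s ((\sum_(0 <= k < n) (T k + 3)) + 3) Q psi v.
Proof.
move=> I0 V0 Ix Istep IQ.
rewrite [(_ + 3)%N](_ : _ = (1 + (\sum_(0 <= k < n) (T k + 3) + 1)).+1); last by lia.
apply: wp_detseq; apply: det_setN => /=.
move: {s}(set_nvar _ _ _) I0 V0 => s Is Vs.
apply: (@wp_conseq _ _ (\sum_(0 <= k < n) (T k + 3) + 1) _ Q Q psi psi (V 0%N s)) => // {Vs v}.
suff H j (k0 : nat) s0 : (k0 <= n)%N -> I k0 s0 -> (n - k0)%N = j ->
    wp (CWhile (NLt (NVar x) e) (CSeq body (CSetN x (NAdd (NVar x) (NConst 1))))) s0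
      (\sum_(k0 <= k < n) (T k + 3) + 1) Q psi (V k0 s0) by exact: (H n 0%N s (leq0n _) Is (subn0 _)).
elim: j k0 s0 {s Is} => [|j IH] k0 s Hk Is Hj.
  have Ek : k0 = n by lia.
  have [E1 E2] := Ix _ _ Hk Is; subst k0.
  have [Qs Hp] := IQ _ Is.
  by rewrite big_geq //; apply: wp_whileF => //=; rewrite /= E1 E2 leqnn.
have ltk : (k0 < n)%N by lia.
have [E1 E2] := Ix _ _ Hk Is.
rewrite big_ltn //.
apply: (@wp_conseq _ _ ((T k0 + 1).+1 + (\sum_(k0.+1 <= i < n) (T i + 3) + 1)).+1 _ Q Q psi psi (V k0 s)) => //.
  by lia.
apply: (@wp_whileT _ _ _ _ _ _ _ _ (I k0.+1) (V k0.+1)).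
- by rewrite /= E1 E2 -ltnNge.
- apply: wp_seq (Istep _ _ ltk Is) _ => s2 [Ex I2].
  apply: (det_wp (Q := fun s' => s' = set_nvar s2 x k0.+1)).
    by apply: det_setN; rewrite /= Ex addn1.
  by move=> s' ->.
- by move=> s1 I1; apply: IH => //; lia.
Qed.

Lemma det_forT x e body s n (I : nat -> store R -> Prop) t T Q :
  (n * (t + 3) + 3 <= T)%N ->
  I 0%N (set_nvar s x 0%N) ->
  (forall (k : nat) s', (k <= n)%N -> I k s' -> nvar s' x = k /\ neval s' e = n) ->
  (forall (k : nat) s', (k < n)%N -> I k s' ->
     det body s' t (fun s2 => nvar s2 x = k /\ I k.+1 (set_nvar s2 x k.+1))) ->
  (forall s', I n s' -> Q s') ->
  det (CFor x e body) s T Q.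
Proof.
move=> leT H0 H1 H2 H3.
apply: det_conseq (fun s' H => H) (det_for H0 H1 H2 H3) => //.
by rewrite sum_nat_const_nat subn0.
Qed.

Lemma wp_forT x e body s n (I : nat -> store R -> Prop)
    (V : nat -> store R -> R) t T Q psi v :
  (n * (t + 3) + 3 <= T)%N ->
  I 0%N (set_nvar s x 0%N) -> v <= V 0%N (set_nvar s x 0%N) ->
  (forall (k : nat) s', (k <= n)%N -> I k s' -> nvar s' x = k /\ neval s' e = n) ->
  (forall (k : nat) s', (k < n)%N -> I k s' ->
     wp body s' t (fun s2 => nvar s2 x = k /\ I k.+1 (set_nvar s2 x k.+1))
       (fun s2 => V k.+1 (set_nvar s2 x k.+1)) (V k s')) ->
  (forall s', I n s' -> Q s' /\ V n s' <= psi s') ->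
  wp (CFor x e body) s T Q psi v.
Proof.
move=> leT H0 H1 H2 H3 H4.
apply: (wp_conseq _ (lexx v) _ (wp_for H0 H1 H2 H3 H4)) => //.
by rewrite sum_nat_const_nat subn0.
Qed.

End Logic.

(** * Which memory cells a program fragment may change *)

Section Frame.
Variable R : realType.
Implicit Types (s : store R) (L x : nat).

(* Variables and arrays 4 to 15 are scratch memory; the persistent data of each
   phase are allocated at increasing indices from 16 on. *)
Definition kept L x := (x < 4)%N || (16 <= x < L)%N.

Definition same L s s' := forall x, kept L x ->
  [/\ nvar s' x = nvar s x, rvar s' x = rvar s x,
      narr s' x = narr s x & rarr s' x = rarr s x].

Definition fresh L s := forall x, (L <= x)%N ->
  [/\ nvar s x = 0%N, rvar s x = 0, narr s x = (fun=> 0%N) &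
      rarr s x = (fun=> 0)].

Lemma same_refl L s : same L s s. Proof. by []. Qed.

Lemma same_trans L s1 s2 s3 : same L s1 s2 -> same L s2 s3 -> same L s1 s3.
Proof.
by move=> H1 H2 x Hx; have [-> -> -> ->] := H2 _ Hx; exact: H1.
Qed.

Lemma same_le L L' s s' : (L <= L')%N -> same L' s s' -> same L s s'.
Proof. by move=> leL H x Hx; apply: H; move: Hx; rewrite /kept; lia. Qed.

Lemma same_setN L s s' x v :
  ~~ kept L x -> same L s s' -> same L s (set_nvar s' x v).
Proof.
move=> Hx H y Hy; have [E1 E2 E3 E4] := H _ Hy; split=> //=.
by rewrite /upd; case: eqP Hy Hx => // -> ->.
Qed.

Lemma same_setR L s s' x v :
  ~~ kept L x -> same L s s' -> same L s (set_rvar s' x v).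
Proof.
move=> Hx H y Hy; have [E1 E2 E3 E4] := H _ Hy; split=> //=.
by rewrite /upd; case: eqP Hy Hx => // -> ->.
Qed.

Lemma same_putN L s s' x i v :
  ~~ kept L x -> same L s s' -> same L s (put_narr s' x i v).
Proof.
move=> Hx H y Hy; have [E1 E2 E3 E4] := H _ Hy; split=> //=.
by rewrite /upd; case: eqP Hy Hx => // -> ->.
Qed.

Lemma same_putR L s s' x i v :
  ~~ kept L x -> same L s s' -> same L s (put_rarr s' x i v).
Proof.
move=> Hx H y Hy; have [E1 E2 E3 E4] := H _ Hy; split=> //=.
by rewrite /upd; case: eqP Hy Hx => // -> ->.
Qed.

Lemma fresh_le L L' s : (L <= L')%N -> fresh L s -> fresh L' s.
Proof. by move=> leL H x Hx; apply: H; lia. Qed.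

Lemma fresh_setN L s x v : (x < L)%N -> fresh L s -> fresh L (set_nvar s x v).
Proof.
move=> Hx H y Hy; have [E1 E2 E3 E4] := H _ Hy; split=> //=.
by rewrite /upd; case: eqP => // E; lia.
Qed.

Lemma fresh_setR L s x v : (x < L)%N -> fresh L s -> fresh L (set_rvar s x v).
Proof.
move=> Hx H y Hy; have [E1 E2 E3 E4] := H _ Hy; split=> //=.
by rewrite /upd; case: eqP => // E; lia.
Qed.

Lemma fresh_putN L s x i v : (x < L)%N -> fresh L s -> fresh L (put_narr s x i v).
Proof.
move=> Hx H y Hy; have [E1 E2 E3 E4] := H _ Hy; split=> //=.
by rewrite /upd; case: eqP => // E; lia.
Qed.

Lemma fresh_putR L s x i v : (x < L)%N -> fresh L s -> fresh L (put_rarr s x i v).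
Proof.
move=> Hx H y Hy; have [E1 E2 E3 E4] := H _ Hy; split=> //=.
by rewrite /upd; case: eqP => // E; lia.
Qed.

End Frame.

Ltac keep := repeat first
  [ assumption | apply: same_refl
  | apply: same_setN; [by []|] | apply: same_setR; [by []|]
  | apply: same_putN; [by []|] | apply: same_putR; [by []|]
  | apply: fresh_setN; [by []|] | apply: fresh_setR; [by []|]
  | apply: fresh_putN; [by []|] | apply: fresh_putR; [by []|] ].

(** * Abstract quadratic forms and the accelerated outer step *)

Section Forms.
Variable R : realType.
Implicit Types (u v w x y z : nat -> R) (B : (nat -> R) -> (nat -> R) -> R).

(** Vectors are functions on all naturals, of which only the first [d] values will matter. The
    estimates are proved for abstract forms, so that [d] does not occur in them. *)
Definition lc (a : R) u (b : R) v : nat -> R := fun j => a * u j + b * v j.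

Definition bilin B := (forall u v, B u v = B v u) /\
  (forall a u b v w, B (lc a u b v) w = a * B u w + b * B v w).

Lemma bilinC B u v : bilin B -> B u v = B v u. Proof. by case. Qed.
Lemma bilinl B a u b v w : bilin B -> B (lc a u b v) w = a * B u w + b * B v w.
Proof. by case. Qed.
Lemma bilinr B a u b v w : bilin B -> B w (lc a u b v) = a * B w u + b * B w v.
Proof. by move=> HB; rewrite bilinC // bilinl // !(bilinC w _ HB). Qed.

Lemma bilin_amgm B u v : bilin B -> (forall w, 0 <= B w w) ->
  2 * B u v <= B u u / 2 + 2 * B v v.
Proof.
move=> HB B0; have := B0 (lc 1 u (-2) v).
rewrite bilinl // !bilinr // (bilinC v u HB); lra.
Qed.

Lemma bilin_sqD B u v : bilin B -> (forall w, 0 <= B w w) ->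
  B (lc 1 u 1 v) (lc 1 u 1 v) <= 2 * B u u + 2 * B v v.
Proof.
move=> HB B0; have := B0 (lc 1 u (-1) v).
rewrite !(bilinl,bilinr) // (bilinC v u HB); lra.
Qed.

Section Outer.
Variables (md hd : (nat -> R) -> (nat -> R) -> R) (nu al be : R).
Hypotheses (Bm : bilin md) (Bh : bilin hd).
Hypotheses (m0 : forall u, 0 <= md u u) (mh : forall u, md u u <= 2 * hd u u).
Hypotheses (hm : forall u, nu * hd u u <= md u u).
Hypotheses (al0 : 0 < al) (al1 : al <= 1) (nu0 : 0 < nu) (beE : be * nu = al).
Hypothesis (alE : al ^+ 2 * 2048 = nu).
Variables (x z : nat -> R).

(** The coupling of accelerated descent in error coordinates: [x] and [z] stand for distances from
    the minimizer, and the weights are those for which al * (z - V) = V - x. *)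
Definition Vv := lc (1 / (1 + al)) x (al / (1 + al)) z.
Definition Wv := lc (1 - al) z al Vv.
Definition potential x z := md x x / 2 + nu * hd z z / 2.
Definition outer_value y := potential (lc 1 Vv (-1/64) y) (lc 1 Wv (- be) y).
(** The coefficient of [hd y y] in [outer_value y]: the [x] part gives [md y y / (2 * 64 ^ 2)], at
    most [hd y y / 4096], and the [z] part gives [nu * be ^+ 2 / 2]. Under [beE] and [alE] both
    summands are 1/4096. *)
Definition theta := 1 / 4096 + nu * be ^+ 2 / 2.

Lemma theta_ge0 : 0 <= theta.
Proof.
have : 0 <= nu * be ^+ 2 by rewrite mulr_ge0 ?sqr_ge0 // ltW.
by rewrite /theta; lra.
Qed.

Lemma hd_ge0 u : 0 <= hd u u.
Proof. by have := m0 u; have := mh u; lra. Qed.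

Variable yh : nat -> R.
Hypothesis yhE : forall u, hd yh u = md Vv u.
(** Represents the linear part of [outer_value] in the form [hd]. This is possible because [yh]
    represents [md Vv], and it lets the inner iteration work with [hd] alone. *)
Definition lam := lc (-1/64) yh (- (nu * be)) Wv.
Definition value0 := potential Vv Wv.

Lemma outer_value_le y :
  outer_value y <= value0 + hd lam y + theta * hd y y.
Proof.
rewrite /outer_value /value0 /potential /lam /theta.
move: yhE; move: Vv Wv => V W yhE'.
rewrite !(bilinl _ _ _ _ _ Bm, bilinr _ _ _ _ _ Bm).
rewrite !(bilinl _ _ _ _ _ Bh, bilinr _ _ _ _ _ Bh).
rewrite yhE' (bilinC y V Bm) (bilinC y W Bh).
have := mh y; lra.
Qed.

(** The descent [- hd yh yh / 64] inside [hd lam yh] pays exactly for the error of the inner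
    iteration, as [theta * 32 = 1 / 64]. What remains is the usual argument for accelerated descent:
    al * (z - V) = V - x turns the cross term into [md V V - md V x], and convexity of both forms
    does the rest. *)
Lemma outer_contract :
  value0 + hd lam yh + theta * (32 * hd yh yh) <= (1 - al) * potential x z.
Proof.
have [al0' al1' nu0'] := And3 al0 al1 nu0.
set g := hd yh yh.
have a1 : 1 + al != 0 by rewrite gt_eqF //; have := al0; lra.
have g0 : 0 <= g by exact: hd_ge0.
have Evx : forall u, md (lc 1 Vv (-1) x) u = al * md (lc 1 z (-1) Vv) u.
  move=> u; rewrite /Vv !bilinl //.
  by field.
have WE : Wv = lc (1 - al) z al Vv by [].
rewrite /value0 /lam; move: WE Evx yhE; move: Vv Wv => V W WE Evx yhE'.
have Eg : md V yh = g by rewrite -yhE'.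
have EW : hd W yh = md V V + (1 - al) * md V (lc 1 z (-1) V).
  rewrite (bilinC W yh Bh) yhE' WE !bilinr //; ring.
have ER : hd (lc (-1/64) yh (- (nu * be)) W) yh = - g / 64 - al * hd W yh.
  rewrite bilinl // -/g (_ : nu * be = al); last by rewrite mulrC.
  ring.
have Hz : al * md V (lc 1 z (-1) V) = md V V - md V x.
  rewrite (bilinC V (lc 1 z (-1) V) Bm) -Evx bilinl // (bilinC x V Bm); ring.
have Hconv : md V x - md V V <= md x x / 2 - md V V / 2.
  have := m0 (lc 1 x (-1) V).
  rewrite !(bilinl _ _ _ _ _ Bm, bilinr _ _ _ _ _ Bm) (bilinC x V Bm); lra.
have HW : hd W W <= (1 - al) * hd z z + al * hd V V.
  have c1 : 0 <= al * (1 - al) by rewrite mulr_ge0 ?subr_ge0 // ltW.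
  have := mulr_ge0 c1 (hd_ge0 (lc 1 z (-1) V)).
  rewrite WE !(bilinl _ _ _ _ _ Bh, bilinr _ _ _ _ _ Bh) (bilinC V z Bh).
  nra.
have Hnu := hm V.
have Hth : theta * (32 * g) = g / 64.
  have E : nu * be ^+ 2 * 2048 = 1.
    have nz : nu != 0 by rewrite gt_eqF.
    have -> : nu * be ^+ 2 = (be * nu) ^+ 2 / nu by field.
    by rewrite beE -alE; field; rewrite gt_eqF.
  rewrite /theta; have -> : nu * be ^+ 2 = 1 / 2048 by lra.
  by field.
rewrite /potential ER EW Hth.
set VV := md V V in Hconv Hz Hnu *; set xV := md V x in Hconv Hz.
set D := md V _ in Hz *.
have -> : al * (VV + (1 - al) * D) = al * VV + (1 - al) * (VV - xV).
  by rewrite -Hz; ring.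
have H1 : nu * hd W W / 2 <= (1 - al) * (nu * hd z z / 2) + al * (nu * hd V V / 2).
  have : nu * hd W W <= nu * ((1 - al) * hd z z + al * hd V V) by rewrite ler_pM2l.
  lra.
have H2 : al * (nu * hd V V / 2) <= al * (VV / 2).
  by rewrite ler_pM2l //; lra.
have H3 : (1 - al) * (xV - VV) <= (1 - al) * (md x x / 2 - VV / 2).
  by rewrite ler_wpM2l //; lra.
lra.
Qed.

End Outer.

(** * The stopped stochastic iteration: value function and one-step inequality *)

Section Inner.
Variables (dd ad : (nat -> R) -> (nat -> R) -> R) (F gam eta p : R).
Hypotheses (Bd : bilin dd) (Ba : bilin ad).
Hypotheses (d0 : forall u, 0 <= dd u u) (a0 : forall u, 0 <= ad u u).
Hypotheses (aF : forall u, ad u u <= F * dd u u).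
Hypotheses (F0 : 0 < F) (g0 : 0 < gam) (gF : gam <= F).
Hypotheses (etaE : eta * (768 * F) = 1) (p0 : 0 < p) (p1 : p < 1).
Hypothesis (pE : (1 - p) * (eta * gam) = p).

Definition hform u v := ad u v + gam * dd u v.

Lemma bilin_hform : bilin hform.
Proof.
split=> [u v|a u b v w]; rewrite /hform; first by rewrite (bilinC u v Ba) (bilinC u v Bd).
by rewrite !(bilinl _ _ _ _ _ Ba, bilinl _ _ _ _ _ Bd); ring.
Qed.

Lemma hform_ge0 u : 0 <= hform u u.
Proof. by rewrite /hform addr_ge0 // mulr_ge0 // ltW. Qed.

Variables (r yh lam : nat -> R) (c0 th : R).
Hypothesis rE : forall u, dd r u = hform yh u.
Hypothesis th0 : 0 <= th.

(** [r] is the operator H of [hform] applied to [yh], and H <= F + gam <= 2 F. The inequality H^2 <=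
    (F + gam) H is obtained without operator norms by expanding [hform] at [yh - t r] with t = 1 /
    (F + gam). *)
Lemma residual_le : dd r r <= 2 * F * hform yh yh.
Proof.
have HB := bilin_hform; have [F0' g0' gF'] := And3 F0 g0 gF.
set t := 1 / (F + gam).
have t0 : 0 < t by rewrite divr_gt0 //; lra.
have tE : t * (F + gam) = 1 by rewrite /t mul1r mulVf // gt_eqF //; lra.
have := hform_ge0 (lc 1 yh (- t) r).
rewrite !(bilinl _ _ _ _ _ HB, bilinr _ _ _ _ _ HB) (bilinC r yh HB) -(rE r).
have H1 : hform r r <= (F + gam) * dd r r.
  by rewrite /hform mulrDl lerD2r.
have H2 : t * t * hform r r <= t * dd r r.
  have : t * t * hform r r <= t * t * ((F + gam) * dd r r).
    by rewrite ler_wpM2l // mulr_ge0 // ltW.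
  have -> : t * t * ((F + gam) * dd r r) = t * (t * (F + gam)) * dd r r by ring.
  by rewrite tE mulr1.
set h := hform yh yh => H3.
have H4 : t * dd r r <= h by lra.
have h0 : 0 <= h := hform_ge0 yh.
have : (F + gam) * (t * dd r r) <= (F + gam) * h by rewrite ler_wpM2l //; lra.
rewrite mulrA [(F + gam) * t]mulrC tE mul1r; nra.
Qed.

(** A bound for the expected payoff of a run that is at [y]. Its linear part is exact: the stopped
    iterate has mean yh + gam H^-1 y, where H is the operator of [hform]. The coefficients 8 and 21
    make [inner_step] close, and at [y = 0] they add up to less than the 32 allowed by
    [outer_contract]. *)
Definition inner_value y :=
  c0 + hform lam yh + gam * dd lam y +
  th * (8 * gam * dd (lc 1 y (-1) yh) (lc 1 y (-1) yh) + 21 * hform yh yh).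

Definition iw := lc gam lam (- (16 * th * gam)) yh.
Definition ic0 := c0 + hform lam yh + th * (8 * gam * dd yh yh + 21 * hform yh yh).

Lemma inner_valueE y :
  inner_value y = ic0 + dd iw y + (8 * th * gam) * dd y y.
Proof.
rewrite /inner_value /ic0 /iw !(bilinl _ _ _ _ _ Bd, bilinr _ _ _ _ _ Bd).
rewrite (bilinC y yh Bd); ring.
Qed.

(* The right-hand side is [p] times the stopping payoff plus [1 - p] times the
   bound for the expectation of [inner_value] after one more step. *)
Lemma inner_step y :
  p * (c0 + hform lam y + th * hform y y) +
  (1 - p) * (ic0 + dd iw (lc 1 y eta r) - eta * ad iw y +
    8 * th * gam * (dd (lc 1 y eta r) (lc 1 y eta r)
       - 2 * eta * ad (lc 1 y eta r) y + 48 * eta ^+ 2 * F * hform y y))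
  <= inner_value y.
Proof.
have HB := bilin_hform; have [F0' g0' gF'] := And3 F0 g0 gF.
have [p0' p1' pE' th0'] := And4 p0 p1 pE th0.
have e0 : 0 < eta by have := etaE; nra.
have HR := residual_le.
set Y := hform yh yh in HR *.
pose e := lc 1 y (-1) yh.
have Y0 : 0 <= Y := hform_ge0 yh.
have He0 : 0 <= hform e e := hform_ge0 e.
have Hy : hform y y <= 2 * hform e e + 2 * Y.
  have -> : hform y y = hform (lc 1 e 1 yh) (lc 1 e 1 yh).
    by rewrite /e !(bilinl _ _ _ _ _ HB, bilinr _ _ _ _ _ HB); ring.
  by apply: bilin_sqD => //; exact: hform_ge0.
have Had : dd e yh * 2 <= dd e e / 2 + 2 * dd yh yh.
  by rewrite mulrC; apply: bilin_amgm.
have Hyy : gam * dd yh yh <= Y by rewrite /Y /hform lerDr.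
(* The linear parts cancel exactly because (1 - p) * eta * gam = p. What is left compares p times
   the gap between the quadratic bound and the stopping payoff with the second-order cost of one
   step. *)
have E1 : inner_value y - p * (c0 + hform lam y) - p * (th * hform y y) -
  (1 - p) * (ic0 + dd iw (lc 1 y eta r) - eta * ad iw y +
    8 * th * gam * (dd (lc 1 y eta r) (lc 1 y eta r)
       - 2 * eta * ad (lc 1 y eta r) y + 48 * eta ^+ 2 * F * hform y y)) =
  th * p * (21 * Y - hform y y + 8 * gam * dd e e
    + 16 * ad e e - 16 * gam * dd e yh)
  - (1 - p) * eta * (8 * th * gam * eta) *
       (dd r r - 2 * ad r y + 48 * F * hform y y).
  rewrite !inner_valueE /ic0 /iw /e /Y.
  rewrite !(bilinl _ _ _ _ _ Bd, bilinr _ _ _ _ _ Bd, bilinl _ _ _ _ _ Ba, bilinr _ _ _ _ _ Ba).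
  rewrite !(bilinC _ r Bd) !rE (bilinC y yh Bd) (bilinC y yh Ba).
  rewrite /hform !(bilinC yh lam Bd) !(bilinC yh lam Ba).
  have enz : eta != 0 by rewrite gt_eqF.
  have pnz : 1 - p != 0 by rewrite gt_eqF //; lra.
  have gE : gam = p / ((1 - p) * eta).
    by rewrite -[X in X / _]pE; field; rewrite ?pnz ?enz.
  rewrite gE.
  move: (ad r y) (ad yh r) (dd yh r) (dd lam y) (ad lam y) (dd lam yh) (ad lam yh) (dd yh yh) (ad yh yh) (dd yh y) (ad yh y) (dd y y) (ad y y) => ary ar rr ly aly lyh alyh yhyh ayhyh yhy ayhy yy ayy.
  by field; rewrite ?pnz ?enz.
have Hary : - 2 * ad r y <= dd r r + F * hform y y.
  have := a0 (lc 1 r F y).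
  rewrite !(bilinl _ _ _ _ _ Ba, bilinr _ _ _ _ _ Ba) (bilinC y r Ba) => H.
  have H1 := aF r; have H2 : ad y y <= hform y y by rewrite /hform lerDl mulr_ge0 // ltW.
  have : F * (F * ad y y) <= F * (F * hform y y) by rewrite !ler_pM2l.
  move=> H3; rewrite -(ler_pM2l F0); nra.
have Hbr : (1 - p) * eta * (8 * th * gam * eta) *
   (dd r r - 2 * ad r y + 48 * F * hform y y) <=
   th * p * ((102 * Y + 98 * hform e e) / 96).
  have -> : (1 - p) * eta * (8 * th * gam * eta) = th * p * (8 * eta) by rewrite -{2}pE; ring.
  rewrite -[leLHS]mulrA; apply: ler_wpM2l; first by rewrite mulr_ge0 // ltW.
  (* Here 768 = 8 * 96 is used: 8 * eta * F = 1/96, so the noise costs only a little more than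
     [Y + hform e e]. *)
  have -> : (102 * Y + 98 * hform e e) / 96 = 8 * eta * (F * (102 * Y + 98 * hform e e)).
    have -> : 8 * eta * (F * (102 * Y + 98 * hform e e)) = eta * (768 * F) * ((102 * Y + 98 * hform e e) / 96).
      by field.
    by rewrite etaE mul1r.
  apply: ler_wpM2l; first by rewrite mulr_ge0 // ltW.
  have : F * hform y y <= F * (2 * hform e e + 2 * Y) by rewrite ler_pM2l.
  lra.
have Hm : 0 <= th * p * (21 * Y - hform y y + 8 * gam * dd e e
    + 16 * ad e e - 16 * gam * dd e yh - (102 * Y + 98 * hform e e) / 96).
  rewrite mulr_ge0 ?mulr_ge0 ?(ltW p0) //.
  have H8 : gam * (dd e yh * 2) <= gam * (dd e e / 2 + 2 * dd yh yh) by rewrite ler_pM2l.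
  have HE : hform e e = ad e e + gam * dd e e by [].
  have := a0 e; have : 0 <= gam * dd e e by rewrite mulr_ge0 // ltW.
  lra.
lra.
Qed.

End Inner.
End Forms.

(** * Expectations of quadratic functions of sampled sparse vectors *)

Section Sampler.
Variable R : realType.
Implicit Types (u v w x y z acc f : nat -> R).

Definition delta (j : nat) : nat -> R := fun j' => (j' == j)%:R.
Definition add1 acc (j : nat) (v : R) : nat -> R :=
  fun j' => acc j' + (if j' == j then v else 0).

Lemma add1E acc j (v : R) : add1 acc j v = lc 1 acc v (delta j).
Proof.
apply/funext => i; rewrite /add1 /lc /delta mul1r; case: ifP => _.
  by rewrite mulr1.
by rewrite mulr0.
Qed.

Lemma add10 acc j : add1 acc j 0 = acc.
Proof. by apply/funext => i; rewrite /add1 if_same addr0. Qed.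

Definition linear_fun (L : (nat -> R) -> R) :=
  forall a u b v, L (lc a u b v) = a * L u + b * L v.

Lemma bilin_linear B w : bilin B -> linear_fun (B w).
Proof. by move=> HB a u b v; rewrite bilinr. Qed.

Variable d : nat.
Definition dot u v := \sum_(0 <= j < d) u j * v j.

Lemma bilin_dot : bilin dot.
Proof.
split=> [u v|a u b v w]; first by apply: eq_bigr => j _; rewrite mulrC.
rewrite /dot !mulr_sumr -big_split; apply: eq_bigr => j _ /=.
by rewrite /lc; ring.
Qed.

Lemma dot_ge0 u : 0 <= dot u u.
Proof. by apply: sumr_ge0 => j _; rewrite -expr2 sqr_ge0. Qed.

Lemma dot_delta u j : (j < d)%N -> dot u (delta j) = u j.
Proof.
move=> jd; rewrite /dot (bigD1_seq j) ?mem_index_iota ?iota_uniq //=.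
rewrite /delta eqxx mulr1 big1 ?addr0 // => i /negbTE ne.
by rewrite ne mulr0.
Qed.

Lemma eq_dot u u' v v' : (forall j, (j < d)%N -> u j = u' j) ->
  (forall j, (j < d)%N -> v j = v' j) -> dot u v = dot u' v'.
Proof.
by move=> Hu Hv; apply: eq_big_nat => j /andP[_ Hj]; rewrite Hu // Hv.
Qed.

Definition dotsq y u v := dot u y * dot v y.
Lemma bilin_dotsq y : bilin (dotsq y).
Proof.
split=> [u v|a u b v w]; rewrite /dotsq; first by rewrite mulrC.
by rewrite (bilinl _ _ _ _ _ bilin_dot); ring.
Qed.

Section Table.
Variables (W : nat) (te : nat -> nat) (pr vl : nat -> R) (cl : nat -> nat).
Hypothesis W0 : (0 < W)%N.
Hypothesis pr01 : forall u : nat, (u < W)%N -> 0 <= pr (te u) <= 1.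

Definition avg f := (\sum_(u < W) f u) / W%:R.

(** A rejected draw still adds 0 at the drawn column, because the program writes a buffer entry in
    either case and the buffer length must not depend on the outcome. *)
Definition Ex (h : (nat -> R) -> R) acc := avg (fun u : nat =>
  pr (te u) * h (add1 acc (cl (te u)) (vl (te u))) +
  (1 - pr (te u)) * h (add1 acc (cl (te u)) 0)).

Fixpoint gE k (h : (nat -> R) -> R) acc :=
  if k is k'.+1 then Ex (gE k' h) acc else h acc.

Lemma Ex_le h h' acc : (forall a, h a <= h' a) -> Ex h acc <= Ex h' acc.
Proof.
move=> H; rewrite /Ex /avg ler_wpM2r ?invr_ge0 ?ler0n //.
apply: ler_sum => u _; have /andP[p0 p1] := pr01 (ltn_ord u).
by rewrite lerD // ler_wpM2l // subr_ge0.
Qed.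

Lemma gE_le k h h' acc : (forall a, h a <= h' a) -> gE k h acc <= gE k h' acc.
Proof.
move=> H; elim: k acc => [|k IH] acc /=; first exact: H.
by apply: Ex_le.
Qed.

(** [wp] yields lower bounds, whereas losses are bounded from above; subtracting from a constant
    passes from one to the other. *)
Lemma gE_opp k (g : R) h acc : gE k (fun a => g - h a) acc = g - gE k h acc.
Proof.
elim: k acc => [//|k IH] acc /=.
have cW (a : R) : a = (\sum_(u < W) a) / W%:R.
  by rewrite sumr_const card_ord -[a *+ W]mulr_natr mulfK // pnatr_eq0 -lt0n.
rewrite /Ex /avg [in RHS](cW g) -mulrBl -sumrB; congr (_ / _).
by apply: eq_bigr => u _; rewrite !IH; ring.
Qed.

Definition xmean : nat -> R := fun j =>
  \sum_(u < W) (pr (te u) * vl (te u) / W%:R) * delta (cl (te u)) j.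

Definition xsq (B : (nat -> R) -> (nat -> R) -> R) :=
  avg (fun u : nat => pr (te u) * vl (te u) ^+ 2 *
     B (delta (cl (te u))) (delta (cl (te u)))).

Lemma linear_sum L (I : finType) (c : I -> R) (g : I -> nat -> R) :
  linear_fun L -> L (fun j => \sum_i c i * g i j) = \sum_i c i * L (g i).
Proof.
move=> HL; elim: (index_enum I) => [|i r IH].
  rewrite big_nil (_ : (fun j => _) = lc 0 (fun=> 0) 0 (fun=> 0)).
    by rewrite HL !mul0r addr0.
  by apply/funext => j; rewrite big_nil /lc !mul0r addr0.
rewrite big_cons -IH -[X in _ + X]mul1r -HL; congr (L _).
by apply/funext => j; rewrite big_cons /lc mul1r.
Qed.

Lemma Ex_quad L B c0 c2 acc : linear_fun L -> bilin B ->
  Ex (fun a => c0 + L a + c2 * B a a) acc =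
  c0 + L acc + L xmean + c2 * (B acc acc + 2 * B acc xmean + xsq B).
Proof.
move=> HL HB.
rewrite /xmean (linear_sum _ _ HL).
have -> := linear_sum (fun i : 'I_W => pr (te i) * vl (te i) / W%:R)
   (fun i : 'I_W => delta (cl (te i))) (bilin_linear acc HB).
have W1 : W%:R != 0 :> R by rewrite pnatr_eq0 -lt0n.
have cW a : a = (\sum_(u < W) a) / W%:R :> R.
  by rewrite sumr_const card_ord -[a *+ W]mulr_natr mulfK.
rewrite /Ex /xsq /avg [in RHS](cW (c0 + L acc)) [in RHS](cW (B acc acc)).
rewrite !mulr_sumr !mulr_suml -!big_split /= mulr_sumr -big_split /=.
apply: eq_bigr => u _; rewrite add10 add1E HL.
rewrite !(bilinl _ _ _ _ _ HB, bilinr _ _ _ _ _ HB).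
rewrite (bilinC (delta _) acc HB); field.
exact: W1.
Qed.

(** Each draw adds the variance [xsq B - B xmean xmean] to the square of the mean. The bound keeps
    [xsq B] only, and in the induction step exactly the dropped [c2 * B xmean xmean] is left
    over. *)
Lemma gE_quad L B c0 c2 k acc : linear_fun L -> bilin B ->
  (forall u, 0 <= B u u) -> 0 <= c2 ->
  gE k (fun a => c0 + L a + c2 * B a a) acc <=
  c0 + L (lc 1 acc k%:R xmean) +
  c2 * (B (lc 1 acc k%:R xmean) (lc 1 acc k%:R xmean) + k%:R * xsq B).
Proof.
move=> HL HB B0 c20; elim: k acc => [|k IH] acc /=.
  by rewrite HL !(bilinl _ _ _ _ _ HB, bilinr _ _ _ _ _ HB) !mul0r !mul1r !addr0.
apply: le_trans (Ex_le _ IH) _.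
pose L' a := L a + 2 * c2 * k%:R * B xmean a.
have HL' : linear_fun L'.
  by move=> a u b v; rewrite /L' HL bilinr //; ring.
rewrite (_ : (fun a => _) = fun a => (c0 + k%:R * L xmean +
    c2 * (k%:R ^+ 2 * B xmean xmean + k%:R * xsq B)) + L' a + c2 * B a a); last first.
  apply/funext => a; rewrite /L' HL !(bilinl _ _ _ _ _ HB, bilinr _ _ _ _ _ HB).
  by rewrite (bilinC a xmean HB); ring.
rewrite (Ex_quad _ _ _ HL' HB) /L' HL !(bilinl _ _ _ _ _ HB, bilinr _ _ _ _ _ HB).
rewrite (bilinC acc xmean HB) -natr1 -subr_ge0.
set K := k%:R; set b := B xmean xmean.
rewrite (_ : _ - _ = c2 * b); first by rewrite mulr_ge0 // B0.
by ring.
Qed.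

(** With independent samples [b] and [b'] of the same row, the step (b . y) b' has mean (a . y) a
    and its second moment is bounded by a product of two second moments. Averaging over [b'] first
    leaves a quadratic function of [b], to which [gE_quad] applies again. *)
Lemma row_step w y y1 c0 c2 kk K a0 :
  0 <= c2 ->
  let a := lc 1 a0 K%:R xmean in
  let Q := fun u => c0 + dot w u + c2 * dot u u in
  gE K (fun b => gE K (fun b' => Q (lc 1 y1 (- (kk * dot b y)) b')) a0) a0 <=
  Q y1 - kk * dot a y * dot (lc 1 w (2 * c2) y1) a +
  c2 * kk ^+ 2 * (dot a a + K%:R * xsq dot) *
     (dot a y ^+ 2 + K%:R * xsq (dotsq y)).
Proof.
move=> c20; cbv zeta; set a := lc 1 a0 K%:R xmean.
set Q := fun u => c0 + dot w u + c2 * dot u u.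
set A2 := dot a a + K%:R * xsq dot.
have A20 : 0 <= A2.
  rewrite addr_ge0 ?dot_ge0 // mulr_ge0 ?ler0n // /xsq /avg divr_ge0 ?ler0n //.
  apply: sumr_ge0 => u _; have /andP[p0 _] := pr01 (ltn_ord u).
  by rewrite mulr_ge0 ?dot_ge0 // mulr_ge0 // sqr_ge0.
pose beta := dot (lc 1 w (2 * c2) y1) a.
have H1 b : gE K (fun b' => Q (lc 1 y1 (- (kk * dot b y)) b')) a0 <=
    Q y1 + (- (kk * beta)) * dot y b + c2 * kk ^+ 2 * A2 * dotsq y b b.
  set q := kk * dot b y.
  have HL : linear_fun (fun b' => - q * dot (lc 1 w (2 * c2) y1) b').
    by move=> c u e v; rewrite (bilinr _ _ _ _ _ bilin_dot); ring.
  have c2q : 0 <= c2 * q ^+ 2 by rewrite mulr_ge0 // sqr_ge0.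
  have := gE_quad (Q y1) K a0 HL bilin_dot dot_ge0 c2q.
  rewrite -/a -/beta => H; apply: le_trans (le_trans _ H) _.
    apply: gE_le => b'; rewrite /Q.
    rewrite !(bilinl _ _ _ _ _ bilin_dot, bilinr _ _ _ _ _ bilin_dot).
    by rewrite (bilinC b' y1 bilin_dot) le_eqVlt; apply/orP; left; apply/eqP; ring.
  rewrite -/A2 /dotsq (bilinC y b bilin_dot) le_eqVlt; apply/orP; left.
  by apply/eqP; rewrite /q; ring.
apply: le_trans (gE_le _ _ H1) _.
have HL : linear_fun (fun b => - (kk * beta) * dot y b).
  by move=> c u e v; rewrite (bilinr _ _ _ _ _ bilin_dot); ring.
have c2q : 0 <= c2 * kk ^+ 2 * A2.
  by apply: mulr_ge0 => //; apply: mulr_ge0 => //; exact: sqr_ge0.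
have D0 u : 0 <= dotsq y u u by rewrite /dotsq -expr2 sqr_ge0.
have := gE_quad (Q y1) K a0 HL (bilin_dotsq y) D0 c2q.
rewrite -/a => H; apply: le_trans H _.
rewrite /dotsq -/beta (bilinC y a bilin_dot) le_eqVlt; apply/orP; left.
by apply/eqP; ring.
Qed.

End Table.
End Sampler.

(** * One stochastic gradient step on a matrix given by its list of entries *)

Section StepMath.
Variable R : realType.
Variables (n d m : nat) (er ec : nat -> nat) (ev we : nat -> R).

Definition rsum (i : nat) (f : nat -> R) := \sum_(0 <= e < m | er e == i) f e.
Definition norm1f i := rsum i (fun e => `|ev e|).
Definition norm2f i := rsum i (fun e => ev e ^+ 2).
Definition frob := \sum_(0 <= e < m) ev e ^+ 2.
Definition wrow (v : nat -> R) i : nat -> R :=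
  fun j => rsum i (fun e => v e * delta R (ec e) j).
Definition gram (v : nat -> R) u w :=
  \sum_(0 <= i < n) dot d (wrow v i) u * dot d (wrow v i) w.

Hypothesis er_lt : forall e, (e < m)%N -> (er e < n)%N.
Hypothesis ec_lt : forall e, (e < m)%N -> (ec e < d)%N.
Hypothesis erc_inj : forall e e', (e < m)%N -> (e' < m)%N ->
  er e = er e' -> ec e = ec e' -> e = e'.

Lemma bilin_gram v : bilin (gram v).
Proof.
split=> [u w|a u b w z]; first by apply: eq_bigr => i _; rewrite mulrC.
rewrite /gram !mulr_sumr -big_split; apply: eq_bigr => i _ /=.
by rewrite (bilinr _ _ _ _ _ (bilin_dot R d)); ring.
Qed.

Lemma gram_ge0 v u : 0 <= gram v u u.
Proof. by apply: sumr_ge0 => i _; rewrite -expr2 sqr_ge0. Qed.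

Lemma rsum_ge0 i f : (forall e, (e < m)%N -> 0 <= f e) -> 0 <= rsum i f.
Proof.
move=> H; rewrite /rsum big_seq_cond; apply: sumr_ge0 => e.
by rewrite mem_index_iota => /andP[/andP[_ He] _]; apply: H.
Qed.

Lemma rsum_le i f g : (forall e, (e < m)%N -> er e = i -> f e <= g e) ->
  rsum i f <= rsum i g.
Proof.
move=> H; rewrite /rsum !(big_seq_cond (fun e => er e == i)).
by apply: ler_sum => e; rewrite mem_index_iota => /andP[/andP[_ He] /eqP Ee]; apply: H.
Qed.

Lemma eq_rsum i f g : (forall e, (e < m)%N -> er e = i -> f e = g e) ->
  rsum i f = rsum i g.
Proof.
by move=> H; apply: le_anti; rewrite !rsum_le // => e He Ee; rewrite H.
Qed.

Lemma sum_rsum f : \sum_(0 <= i < n) rsum i f = \sum_(0 <= e < m) f e.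
Proof.
rewrite /rsum (exchange_big_dep_nat xpredT) //=; apply: eq_big_nat => e /andP[_ He].
rewrite (eq_bigl (fun i => i == er e)); last by move=> i; rewrite eq_sym.
by rewrite big_nat1_eq leq0n /= er_lt.
Qed.

Lemma dot_wrow v i y : dot d (wrow v i) y = rsum i (fun e => v e * y (ec e)).
Proof.
transitivity (rsum i (fun e => \sum_(0 <= j < d) v e * delta R (ec e) j * y j)).
  rewrite /dot /wrow /rsum; under eq_bigr do rewrite mulr_suml.
  rewrite (exchange_big_dep_nat (fun e => er e == i)) //=.
  by apply: eq_bigr => e ->.
apply: eq_rsum => e He _; have /(dot_delta y) <- := ec_lt He.
by rewrite /dot mulr_sumr; apply: eq_bigr => j _; ring.
Qed.

Lemma wrow_ec v e : (e < m)%N -> wrow v (er e) (ec e) = v e.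
Proof.
move=> He; rewrite /wrow /rsum big_mkcond (bigD1_seq e) ?mem_index_iota ?iota_uniq //=.
rewrite eqxx {1}/delta eqxx mulr1 big_seq_cond big1 ?addr0 // => e'.
rewrite mem_index_iota => /andP[/andP[_ He'] ne]; case: eqP => // E.
rewrite /delta; case: eqP => [E2|_]; last by rewrite mulr0.
by rewrite (erc_inj He' He E (esym E2)) eqxx in ne.
Qed.

Lemma dot_wrow_self v i : dot d (wrow v i) (wrow v i) = rsum i (fun e => v e ^+ 2).
Proof.
rewrite dot_wrow; apply: eq_rsum => e He <-.
by rewrite wrow_ec // expr2.
Qed.

Lemma norm2f_ge0 i : 0 <= norm2f i.
Proof. by apply: rsum_ge0 => e _; rewrite sqr_ge0. Qed.

Lemma norm1f_ge0 i : 0 <= norm1f i.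
Proof. exact: rsum_ge0. Qed.

Lemma sum_norm2f : \sum_(0 <= i < n) norm2f i = frob.
Proof. exact: sum_rsum. Qed.

Section Row.
Variables (N K i W : nat) (te : nat -> nat) (ce : nat -> R) (kap : R).
Variables (head : nat -> bool) (a0 : nat -> R).
Hypothesis a0E : forall j, a0 j =
  \sum_(0 <= e < m | (er e == i) && head e) we e * delta R (ec e) j.
Hypothesis wev : forall e, (e < m)%N -> `|we e| <= `|ev e|.
Hypothesis N0 : (0 < N)%N.
Variable smp : nat.
Hypothesis smp0 : smp = 0%N -> forall e, (e < m)%N -> er e = i -> head e.

Section Tail.
Variables (pr vl : nat -> R).
Hypothesis smpK : smp = K.
Hypothesis K0 : (0 < K)%N.
Hypothesis KN : N%:R * norm1f i ^+ 2 <= K%:R ^+ 2 * norm2f i.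
Hypothesis W0 : (0 < W)%N.
Hypothesis teE : forall f, \sum_(u < W) f (te u) =
  \sum_(0 <= e < m | (er e == i) && ~~ head e) ce e * f e.
Hypothesis te_lt : forall u, (u < W)%N ->
  [/\ (te u < m)%N, er (te u) = i & ~~ head (te u)].
Hypothesis ce0 : forall e, (e < m)%N -> er e = i -> ~~ head e ->
  0 < ce e /\ `|ev e| * W%:R <= 2 * norm1f i * ce e.
Hypothesis tail_le : forall e, (e < m)%N -> er e = i -> ~~ head e ->
  K%:R * `|ev e| <= norm1f i.
Hypothesis kap0 : 0 < kap.
Hypothesis kapK : 2 * norm1f i <= K%:R * kap.
Hypothesis kapw : forall e, (e < m)%N -> er e = i ->
  kap * `|we e| <= 2 * norm1f i / K%:R * `|ev e| + ev e ^+ 2.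
Hypothesis prE : forall e, pr e = `|we e| * W%:R / (ce e * K%:R * kap).
Hypothesis vlE : forall e, vl e = kap * (we e / `|we e|).

Lemma pr01 u : (u < W)%N -> 0 <= pr (te u) <= 1.
Proof.
move=> /te_lt [He Ee Hh]; have [c0 cW] := ce0 He Ee Hh.
have kk := kap0; have Kp : 0 < K%:R :> R by rewrite ltr0n.
rewrite prE divr_ge0 ?mulr_ge0 ?ler0n //=; last by rewrite ltW.
  rewrite ler_pdivrMr ?mulr_gt0 // mul1r.
  have H1 : `|we (te u)| * W%:R <= 2 * norm1f i * ce (te u).
    by apply: le_trans cW; rewrite ler_wpM2r ?ler0n // wev.
  apply: le_trans H1 _; rewrite mulrC -mulrA ler_pM2l //.
by rewrite ltW.
Qed.

(** An accepted draw contributes plus or minus [kap], so that all randomness is in the acceptance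
    and sampled values stay on the grid. Slot frequency [ce e / W] times acceptance probability
    times value is [we e / K], and [K] draws add up to the tail of the row in the mean. *)
Lemma prvl e : 0 < ce e -> ce e * (pr e * vl e / W%:R) = we e / K%:R.
Proof.
move=> c0; have [wz|wn] := eqVneq (we e) 0.
  by rewrite prE wz normr0 !(mul0r, mulr0).
rewrite prE vlE; field.
rewrite normr_eq0 wn !pnatr_eq0 -!lt0n K0 W0 /=.
by rewrite (gt_eqF c0) (gt_eqF kap0).
Qed.

Lemma prvl2 e : 0 < ce e -> ce e * (pr e * vl e ^+ 2) / W%:R = kap * `|we e| / K%:R.
Proof.
move=> c0; have [wz|wn] := eqVneq (we e) 0.
  by rewrite prE wz normr0 !(mul0r, mulr0).
rewrite prE vlE.
have E : (we e / `|we e|) ^+ 2 = 1.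
  by rewrite exprMn exprVn real_normK ?num_real // divff // sqrf_eq0.
rewrite exprMn E; field.
by rewrite !pnatr_eq0 -!lt0n K0 W0 (gt_eqF c0) (gt_eqF kap0).
Qed.

Lemma tail_sum_eq (f g : nat -> R) :
  (forall e, (e < m)%N -> er e = i -> ~~ head e -> f e = g e) ->
  \sum_(0 <= e < m | (er e == i) && ~~ head e) f e =
  \sum_(0 <= e < m | (er e == i) && ~~ head e) g e.
Proof.
move=> H; rewrite [LHS]big_seq_cond [RHS]big_seq_cond; apply: eq_bigr => e.
by rewrite mem_index_iota => /andP[/andP[_ He] /andP[/eqP Ee Hh]]; apply: H.
Qed.

Lemma mean_row : lc 1 a0 K%:R (xmean W te pr vl ec) = wrow we i.
Proof.
apply/funext => j; rewrite /lc mul1r a0E /xmean.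
rewrite (teE (fun e => pr e * vl e / W%:R * delta R (ec e) j)) mulr_sumr.
rewrite (@tail_sum_eq _ (fun e => we e * delta R (ec e) j)).
  by rewrite /wrow /rsum [RHS](bigID head).
move=> e He Ee Hh; have [c0 _] := ce0 He Ee Hh.
rewrite [ce e * _]mulrA (prvl c0); field.
by rewrite pnatr_eq0 -lt0n.
Qed.

Lemma tail_xsq B : (forall e, (e < m)%N -> er e = i -> 0 <= B (delta R (ec e)) (delta R (ec e))) ->
  K%:R * xsq W te pr vl ec B =
  \sum_(0 <= e < m | (er e == i) && ~~ head e)
     kap * `|we e| * B (delta R (ec e)) (delta R (ec e)).
Proof.
move=> B0; rewrite /xsq /avg.
rewrite (teE (fun e => pr e * vl e ^+ 2 * B (delta R (ec e)) (delta R (ec e)))).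
rewrite mulr_suml mulr_sumr; apply: tail_sum_eq => e He Ee Hh.
have [c0 _] := ce0 He Ee Hh.
set b := B _ _.
have -> : ce e * (pr e * vl e ^+ 2 * b) / W%:R = ce e * (pr e * vl e ^+ 2) / W%:R * b by ring.
rewrite (prvl2 c0); field.
by rewrite pnatr_eq0 -lt0n.
Qed.

Lemma n1K2 : (norm1f i / K%:R) ^+ 2 <= norm2f i / N%:R.
Proof.
have Kp : 0 < K%:R :> R by rewrite ltr0n.
have Np : 0 < N%:R :> R by rewrite ltr0n.
rewrite expr_div_n ler_pdivlMr // mulrAC ler_pdivrMr ?exprn_gt0 //.
by rewrite mulrC [norm2f i * _]mulrC.
Qed.

(** For a tail entry [|ev e| <= norm1f i / K], and (norm1f i / K)^2 <= norm2f i / N, so each weight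
    [kap * |we e|] is at most three times the latter. This holds for heavy rows too, unlike
    [tail_norm]. *)
Lemma tail_var y : K%:R * xsq W te pr vl ec (dotsq d y) <= 3 * (norm2f i / N%:R) * dot d y y.
Proof.
have Kp : 0 < K%:R :> R by rewrite ltr0n.
rewrite tail_xsq => [|e _ _]; last by rewrite /dotsq -expr2 sqr_ge0.
apply: (@le_trans _ _ (\sum_(0 <= e < m | (er e == i) && ~~ head e)
    3 * (norm2f i / N%:R) * y (ec e) ^+ 2)).
  rewrite [leLHS]big_seq_cond [leRHS]big_seq_cond; apply: ler_sum => e.
  rewrite mem_index_iota => /andP[/andP[_ He] /andP[/eqP Ee Hh]].
  rewrite /dotsq !(bilinC (delta _ _) y (bilin_dot R d)) dot_delta ?ec_lt // -expr2.
  rewrite ler_wpM2r ?sqr_ge0 //; apply: le_trans (kapw He Ee) _.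
  have H1 := tail_le He Ee Hh.
  have H2 : `|ev e| <= norm1f i / K%:R by rewrite ler_pdivlMr // mulrC.
  have H3 : ev e ^+ 2 <= (norm1f i / K%:R) ^+ 2.
    by rewrite -real_normK ?num_real // lerXn2r // nnegrE // divr_ge0 ?norm1f_ge0 // ltW.
  have H4 : norm1f i / K%:R * `|ev e| <= (norm1f i / K%:R) ^+ 2.
    by rewrite expr2 ler_wpM2l // divr_ge0 ?norm1f_ge0 // ltW.
  have := n1K2; lra.
rewrite -mulr_sumr; apply: ler_wpM2l.
  by rewrite mulr_ge0 // divr_ge0 ?norm2f_ge0 ?ler0n.
apply: (@le_trans _ _ (rsum i (fun e => y (ec e) ^+ 2))).
  rewrite /rsum [X in _ <= X](bigID head) /= -[X in X <= _]add0r lerD //.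
  by apply: sumr_ge0 => e _; exact: sqr_ge0.
(* The row with values [y (ec e)] is [y] restricted to the columns of row [i], each of which occurs
   once; so its product with [y] is at most [dot d y y]. *)
have E : dot d (wrow (fun e => y (ec e)) i) y = rsum i (fun e => y (ec e) ^+ 2).
  by rewrite dot_wrow; apply: eq_rsum => e _ _; rewrite expr2.
rewrite -E.
rewrite /dot big_seq [leRHS]big_seq; apply: ler_sum => j; rewrite mem_index_iota => /andP[_ Hj].
rewrite /wrow /rsum.
have [/hasP[e]|/hasPn H] := boolP (has (fun e => (er e == i) && (ec e == j)) (index_iota 0 m)).
  rewrite mem_index_iota => /andP[_ He] /andP[/eqP Ee /eqP Ej].
  by have := wrow_ec (fun e => y (ec e)) He; rewrite /wrow /rsum Ee Ej => ->.
rewrite big_seq_cond big1 ?mul0r -?expr2 ?sqr_ge0 // => e /andP[He Ee].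
have := H e He; rewrite Ee /= => /negbTE ne.
by rewrite /delta eq_sym ne mulr0.
Qed.

(** The point is norm1f^2 <= K * norm2f, the geometric mean of the assumption norm1f^2 <= N * norm2f
    and of [KN]. *)
Lemma tail_norm : norm1f i ^+ 2 <= N%:R * norm2f i ->
  K%:R * xsq W te pr vl ec (dot d) <= 3 * norm2f i.
Proof.
move=> nH.
have Kp : 0 < K%:R :> R by rewrite ltr0n.
have Np : 0 < N%:R :> R by rewrite ltr0n.
rewrite tail_xsq => [|e _ _]; last exact: dot_ge0.
apply: (@le_trans _ _ (rsum i (fun e => 2 * norm1f i / K%:R * `|ev e| + ev e ^+ 2))).
  rewrite /rsum [X in _ <= X](bigID head) /= -[X in X <= _]add0r lerD //.
    apply: sumr_ge0 => e _; rewrite addr_ge0 ?sqr_ge0 // mulr_ge0 //.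
    by rewrite divr_ge0 ?mulr_ge0 ?norm1f_ge0 ?ler0n.
  rewrite [leLHS]big_seq_cond [leRHS]big_seq_cond; apply: ler_sum => e.
  rewrite mem_index_iota => /andP[/andP[_ He] /andP[/eqP Ee Hh]].
  rewrite dot_delta ?ec_lt // {1}/delta eqxx mulr1; exact: kapw.
rewrite /rsum big_split /= -mulr_sumr -/(rsum i _) -/(rsum i _) -/(norm1f i) -/(norm2f i).
suff : norm1f i ^+ 2 <= K%:R * norm2f i.
  move=> H; have : norm1f i ^+ 2 / K%:R <= norm2f i by rewrite ler_pdivrMr // mulrC.
  have -> : 2 * norm1f i / K%:R * norm1f i = 2 * (norm1f i ^+ 2 / K%:R) by ring.
  lra.
have n20 := norm2f_ge0 i.
have h1 : (norm1f i ^+ 2) ^+ 2 <= (K%:R * norm2f i) ^+ 2.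
  rewrite exprMn; apply: (@le_trans _ _ (N%:R * norm2f i * norm1f i ^+ 2)).
    by rewrite expr2 ler_wpM2r ?sqr_ge0.
  rewrite [N%:R * _]mulrC -mulrA [X in _ <= X](_ : _ = norm2f i * (K%:R ^+ 2 * norm2f i)); last by ring.
  by rewrite ler_wpM2l.
by have := h1; rewrite ler_sqr // nnegrE ?sqr_ge0 ?mulr_ge0 ?ler0n.
Qed.

End Tail.

Definition tail_ok := [/\ smp = K, (0 < K)%N, N%:R * norm1f i ^+ 2 <= K%:R ^+ 2 * norm2f i & (0 < W)%N]
  /\ (forall f : nat -> R, \sum_(u < W) f (te u) =
        \sum_(0 <= e < m | (er e == i) && ~~ head e) ce e * f e)
  /\ (forall u, (u < W)%N -> [/\ (te u < m)%N, er (te u) = i & ~~ head (te u)])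
  /\ (forall e, (e < m)%N -> er e = i -> ~~ head e ->
        [/\ 0 < ce e, `|ev e| * W%:R <= 2 * norm1f i * ce e & K%:R * `|ev e| <= norm1f i])
  /\ [/\ 0 < kap, 2 * norm1f i <= K%:R * kap &
      forall e, (e < m)%N -> er e = i ->
        kap * `|we e| <= 2 * norm1f i / K%:R * `|ev e| + ev e ^+ 2].

Definition accept e := `|we e| * W%:R / (ce e * K%:R * kap).
Definition svalue e := kap * (we e / `|we e|).

(** For a heavy row the second sample is replaced by the exact row: its sample would have too large
    a norm, and the exact update only changes one stored coefficient. *)
Definition row_expect (inH : bool) (Q : (nat -> R) -> R) y y1 (kk : R) :=
  gE W te accept svalue ec smp (fun b =>
    if inH then Q (lc 1 y1 (- (kk * dot d b y)) (wrow we i))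
    else gE W te accept svalue ec smp
      (fun b' => Q (lc 1 y1 (- (kk * dot d b y)) b')) a0) a0.

Lemma row_bound inH w y y1 c0 (c2 : R) kk :
  0 <= c2 -> (smp = 0%N \/ tail_ok) ->
  (~~ inH -> norm1f i ^+ 2 <= N%:R * norm2f i) ->
  let a := wrow we i in
  let Q := fun u => c0 + dot d w u + c2 * dot d u u in
  row_expect inH Q y y1 kk <=
  Q y1 - kk * dot d a y * dot d (lc 1 w (2 * c2) y1) a +
  c2 * kk ^+ 2 * (4 * norm2f i) * (dot d a y ^+ 2 + 3 * (norm2f i / N%:R) * dot d y y).
Proof.
move=> c20 Hs Hin; cbv zeta; set a := wrow we i.
set Q := fun u : nat -> R => c0 + dot d w u + c2 * dot d u u.
have aa : dot d a a <= norm2f i.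
  rewrite /a dot_wrow_self; apply: rsum_le => e He _.
  by rewrite -real_normK ?num_real // -[leRHS]real_normK ?num_real // lerXn2r ?nnegrE // wev.
have n20 := norm2f_ge0 i.
have kk2 : 0 <= c2 * kk ^+ 2 by rewrite mulr_ge0 // sqr_ge0.
have V0 : 0 <= 3 * (norm2f i / N%:R) * dot d y y.
  by rewrite !mulr_ge0 ?dot_ge0 ?invr_ge0 ?ler0n.
set V := 3 * (norm2f i / N%:R) * dot d y y in V0 *.
have QE b t : Q (lc 1 y1 (- t) b) = Q y1 - t * dot d (lc 1 w (2 * c2) y1) b + c2 * t ^+ 2 * dot d b b.
  rewrite /Q !(bilinl _ _ _ _ _ (bilin_dot R d), bilinr _ _ _ _ _ (bilin_dot R d)).
  by rewrite (bilinC b y1 (bilin_dot R d)); ring.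
have fin X Y : X <= 4 * norm2f i -> 0 <= Y -> Y <= dot d a y ^+ 2 + V ->
   c2 * kk ^+ 2 * X * Y <= c2 * kk ^+ 2 * (4 * norm2f i) * (dot d a y ^+ 2 + V).
  move=> H1 Y0 H2; rewrite -[leLHS]mulrA -[leRHS]mulrA; apply: ler_wpM2l => //.
  apply: (@le_trans _ _ (4 * norm2f i * Y)); first exact: ler_wpM2r.
  by apply: ler_wpM2l => //; rewrite mulr_ge0.
case: Hs => [s0|[[sK K0 KN W0] [teE [te_lt [tl [kap0 kapK kapw]]]]]].
  have Ea : a0 = a.
    apply/funext => j; rewrite a0E /a /wrow /rsum [LHS]big_seq_cond [RHS]big_seq_cond.
    apply: eq_bigl => e; have [He|//] := boolP (e \in index_iota 0 m).
    rewrite /=; case: eqP => //= Ee; apply: smp0 => //.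
    by move: He; rewrite mem_index_iota.
  rewrite /row_expect s0 /= Ea -/a if_same QE.
  have -> : c2 * (kk * dot d a y) ^+ 2 * dot d a a = c2 * kk ^+ 2 * dot d a a * dot d a y ^+ 2 by ring.
  apply: lerD => //; apply: fin; rewrite ?sqr_ge0 //; [lra|by rewrite lerDl].
have ce0 e : (e < m)%N -> er e = i -> ~~ head e -> 0 < ce e /\ `|ev e| * W%:R <= 2 * norm1f i * ce e.
  by move=> He Ee Hh; have [] := tl e He Ee Hh.
have tail_le e : (e < m)%N -> er e = i -> ~~ head e -> K%:R * `|ev e| <= norm1f i.
  by move=> He Ee Hh; have [] := tl e He Ee Hh.
have prE e : accept e = `|we e| * W%:R / (ce e * K%:R * kap) by [].
have vlE e : svalue e = kap * (we e / `|we e|) by [].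
have p01 u : (u < W)%N -> 0 <= accept (te u) <= 1 by apply: pr01.
have mean : lc 1 a0 K%:R (xmean W te accept svalue ec) = wrow we i by apply: mean_row.
have tv : K%:R * xsq W te accept svalue ec (dotsq d y) <= V by apply: tail_var.
have xs0 B : (forall u, 0 <= B u u) -> 0 <= K%:R * xsq W te accept svalue ec B.
  move=> B0; rewrite mulr_ge0 ?ler0n // /xsq /avg divr_ge0 ?ler0n //.
  apply: sumr_ge0 => u _; have /andP[q0 _] := p01 u (ltn_ord u).
  by rewrite mulr_ge0 // mulr_ge0 // sqr_ge0.
have D0 u : 0 <= dotsq d y u u by rewrite /dotsq -expr2 sqr_ge0.
rewrite /row_expect sK; case: inH Hin => Hin.
  pose beta := dot d (lc 1 w (2 * c2) y1) a.
  have HL : linear_fun (fun b => - (kk * beta) * dot d y b).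
    by move=> c u e v; rewrite (bilinr _ _ _ _ _ (bilin_dot R d)); ring.
  have c2q : 0 <= c2 * kk ^+ 2 * dot d a a by rewrite mulr_ge0 ?dot_ge0.
  have := gE_quad svalue ec W0 p01 (Q y1) K a0 HL (bilin_dotsq d y) D0 c2q.
  rewrite mean -/a => H; apply: le_trans (le_trans _ H) _.
    apply: (gE_le _ _ p01) => b; rewrite QE le_eqVlt; apply/orP; left; apply/eqP.
    by rewrite /beta /dotsq (bilinC y b (bilin_dot R d)); ring.
  rewrite -/beta (bilinC y a (bilin_dot R d)); apply: lerD; first by rewrite le_eqVlt; apply/orP; left; apply/eqP; ring.
  have xd := xs0 (dotsq d y) D0.
  apply: fin; [lra | by rewrite addr_ge0 | by rewrite /dotsq -expr2 lerD2l].
have tn : K%:R * xsq W te accept svalue ec (dot d) <= 3 * norm2f i.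
  by apply: tail_norm => //; exact: Hin.
have := row_step d svalue ec W0 p01 w y y1 c0 kk K a0 c20; cbv zeta; rewrite mean -/a -/Q => H.
apply: le_trans H _; rewrite lerD2l; apply: fin.
- lra.
- by rewrite addr_ge0 ?sqr_ge0 // xs0.
- by rewrite lerD2l.
Qed.

End Row.

(** Row [i] is drawn with probability [cr i / Wr] and its step carries the inverse weight, so the
    drift averages to [gram]. As [Wr * norm2f i <= 2 * frob * cr i], the factor [4 * norm2f i] of
    the second moment becomes at most [8 * frob] uniformly in [i], and summing the remaining factors
    gives [gram + 3 * gam * dot]. *)
Lemma step_bound (N Wr : nat) (cr : nat -> nat) (RE : nat -> R) (eta gam : R)
    (w y r : nat -> R) (c0 c2 : R) :
  (0 < Wr)%N -> (0 < N)%N -> 0 <= c2 -> 0 < eta -> 0 < frob -> gam = frob / N%:R ->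
  \sum_(0 <= i < n) (cr i)%:R = Wr%:R :> R ->
  (forall i, (i < n)%N -> (0 < cr i)%N /\ Wr%:R * norm2f i <= 2 * frob * (cr i)%:R) ->
  let y1 := lc 1 y eta r in
  let Q := fun u => c0 + dot d w u + c2 * dot d u u in
  (forall i, (i < n)%N -> let kk := eta * Wr%:R / (cr i)%:R in
    let a := wrow we i in
    RE i <= Q y1 - kk * dot d a y * dot d (lc 1 w (2 * c2) y1) a +
      c2 * kk ^+ 2 * (4 * norm2f i) *
        (dot d a y ^+ 2 + 3 * (norm2f i / N%:R) * dot d y y)) ->
  (\sum_(0 <= i < n) (cr i)%:R * RE i) / Wr%:R <=
  Q y1 - eta * gram we (lc 1 w (2 * c2) y1) y +
  c2 * (48 * eta ^+ 2 * frob * (gram we y y + gam * dot d y y)).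
Proof.
move=> W0 N0 c20 eta0 F0 gE sumW crP; cbv zeta => H.
have Wp : 0 < Wr%:R :> R by rewrite ltr0n.
have Np : 0 < N%:R :> R by rewrite ltr0n.
set y1 := lc 1 y eta r in H *.
set Q := fun u : nat -> R => c0 + dot d w u + c2 * dot d u u in H *.
set v := lc 1 w (2 * c2) y1 in H *.
have E1 : gram we v y = \sum_(0 <= i < n) dot d (wrow we i) y * dot d v (wrow we i).
  by apply: eq_bigr => i _; rewrite mulrC (bilinC v _ (bilin_dot R d)).
apply: (@le_trans _ _ (\sum_(0 <= i < n) ((cr i)%:R / Wr%:R * Q y1
   - eta * (dot d (wrow we i) y * dot d v (wrow we i)) +
   c2 * (8 * eta ^+ 2 * frob * (dot d (wrow we i) y ^+ 2 + 3 * (norm2f i / N%:R) * dot d y y))))).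
  rewrite mulr_suml big_seq [leRHS]big_seq; apply: ler_sum => i.
  rewrite mem_index_iota => /andP[_ Hi]; have [c0' cW] := crP i Hi.
  have cp : 0 < (cr i)%:R :> R by rewrite ltr0n.
  have := H i Hi; set a := wrow we i; set kk := eta * _ / _.
  set T := dot d a y ^+ 2 + _ => Hi2.
  have T0 : 0 <= T.
    by rewrite addr_ge0 ?sqr_ge0 // !mulr_ge0 ?dot_ge0 ?invr_ge0 ?ler0n ?norm2f_ge0.
  apply: (@le_trans _ _ ((cr i)%:R * (Q y1 - kk * dot d a y * dot d v a + c2 * kk ^+ 2 * (4 * norm2f i) * T) / Wr%:R)).
    by rewrite ler_pM2r ?invr_gt0 // ler_pM2l.
  have -> : (cr i)%:R * (Q y1 - kk * dot d a y * dot d v a + c2 * kk ^+ 2 * (4 * norm2f i) * T) / Wr%:R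
     = (cr i)%:R / Wr%:R * Q y1 - eta * (dot d a y * dot d v a) + c2 * (eta ^+ 2 * (4 * (Wr%:R * norm2f i / (cr i)%:R)) * T).
    by rewrite /kk; field; rewrite !gt_eqF.
  rewrite lerD2l; apply: ler_wpM2l => //; apply: ler_wpM2r => //.
  have -> : 8 * eta ^+ 2 * frob = eta ^+ 2 * (4 * (2 * frob)) by ring.
  apply: ler_wpM2l; first exact: sqr_ge0.
  by rewrite ler_pM2l // ler_pdivrMr.
rewrite !big_split /= -!mulr_suml sumrN -!mulr_sumr -E1 sumW divff ?gt_eqF // mul1r.
apply: lerD => //; apply: ler_wpM2l => //.
rewrite big_split /= -mulr_suml -mulr_sumr -mulr_suml sum_norm2f -gE.
have -> : \sum_(0 <= i < n) dot d (wrow we i) y ^+ 2 = gram we y y.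
  by apply: eq_bigr => i _; rewrite expr2.
have G0 := gram_ge0 we y; have D0 := dot_ge0 d y.
have gp : 0 < gam by rewrite gE divr_gt0.
have : 0 <= eta ^+ 2 * frob by rewrite mulr_ge0 ?sqr_ge0 // ltW.
have : 0 <= gam * dot d y y by rewrite mulr_ge0 // ltW.
have -> : 8 * eta ^+ 2 * frob * (gram we y y + 3 * gam * dot d y y) =
  8 * (eta ^+ 2 * frob * (gram we y y + 3 * (gam * dot d y y))) by ring.
have -> : 48 * eta ^+ 2 * frob * (gram we y y + gam * dot d y y) =
  48 * (eta ^+ 2 * frob * (gram we y y + gam * dot d y y)) by ring.
set g := gam * _; set e := eta ^+ 2 * frob => g0 e0.
have : 0 <= e * gram we y y by rewrite mulr_ge0.
have : 0 <= e * g by rewrite mulr_ge0.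
lra.
Qed.

End StepMath.

Notation "c1 ;; c2" := (CSeq c1 c2) (at level 60, right associativity).

(** * Program text of one stochastic gradient step *)

Definition RLt e1 e2 := BNot (BLeR e2 e1).
Definition RC k := RNat (NConst k).
Definition RAbs e := RSqrt (RMul e e).
Definition incN x := CSetN x (NAdd (NVar x) (NConst 1)).

(** The machine cannot convert a real to a natural: the number of slots, [rvar 4 / rvar 5] rounded
    up, is found by counting while the slots are written. *)
Definition cfill arr :=
  let put := CPutN arr (NAdd (NVar 4) (NVar 5)) (NVar 6) in
  put;; incN 5;; CSetN 7 (NConst 1);;
  CWhile (RLt (RMul (RNat (NVar 7)) (RVar 5)) (RVar 4)) (put;; incN 5;; incN 7).

(** Binary long division of [rvar 6] by [rvar 7], starting from the unit in [rvar 8]. The quotient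
    is collected in [rvar 9] and the remainder stays in [rvar 6]. *)
Definition cbits :=
  CSetR 9 (RC 0);;
  CFor 8 (NVar 28)
    (CIf (BLeR (RMul (RVar 8) (RVar 7)) (RVar 6))
      (CSetR 6 (RSub (RVar 6) (RMul (RVar 8) (RVar 7)));;
       CSetR 9 (RAdd (RVar 9) (RVar 8))) CSkip;;
     CSetR 8 (RDiv (RVar 8) (RC 2))).

(** Writes a random sparse vector whose mean is row [nvar 57]: the head entries as they are, then
    one buffer entry per draw, zeroed when the coin in variable 13 rejects it. *)
Definition cgen :=
  CFor 10 (NGet 32 (NVar 57))
    (CSetN 11 (NGet 33 (NAdd (NGet 21 (NVar 57)) (NVar 10)));;
     CPutN 64 (NVar 10) (NGet 1 (NVar 11));;
     CPutR 64 (NVar 10) (RGet 28 (NVar 11)));;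
  CFor 10 (NGet 38 (NVar 57))
    (CUnif 11 (NGet 34 (NVar 57));;
     CSetN 11 (NGet 35 (NAdd (NGet 22 (NVar 57)) (NVar 11)));;
     CFlip 13 (RDiv (RMul (RAbs (RGet 28 (NVar 11))) (RNat (NGet 34 (NVar 57))))
       (RMul (RMul (RNat (NGet 36 (NVar 11))) (RNat (NGet 20 (NVar 57))))
         (RGet 38 (NVar 57))));;
     CPutN 64 (NAdd (NGet 32 (NVar 57)) (NVar 10)) (NGet 1 (NVar 11));;
     CPutR 64 (NAdd (NGet 32 (NVar 57)) (NVar 10))
       (RMul (RNat (NVar 13)) (RMul (RGet 38 (NVar 57))
         (RDiv (RGet 28 (NVar 11)) (RAbs (RGet 28 (NVar 11)))))));;
  CSetN 64 (NAdd (NGet 32 (NVar 57)) (NGet 38 (NVar 57))).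

(** Scalar product of the buffer with the implicit iterate. Array 43 holds the packed heavy rows, so
    [rvar 6] collects the products with all of them at once; it starts at the shift [rvar 42] that
    makes every digit nonnegative. The digits are then read from the top and weighted by the
    coefficients in array 62. *)
Definition cdot :=
  CSetR 10 (RC 0);; CSetR 6 (RVar 42);;
  CFor 10 (NVar 64)
    (CSetN 11 (NGet 64 (NVar 10));;
     CSetR 10 (RAdd (RVar 10) (RMul (RGet 64 (NVar 10))
        (RAdd (RGet 61 (NVar 11)) (RMul (RVar 56) (RGet 59 (NVar 11))))));;
     CSetR 6 (RAdd (RVar 6) (RMul (RGet 64 (NVar 10)) (RGet 43 (NVar 11)))));;
  CFor 11 (NVar 25)
    (CSetN 10 (NSub (NSub (NVar 25) (NConst 1)) (NVar 11));;
     CSetR 7 (RGet 41 (NVar 10));; CSetR 8 (RVar 29);;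
     cbits;;
     CSetR 10 (RAdd (RVar 10)
       (RMul (RGet 62 (NGet 41 (NVar 10))) (RSub (RVar 9) (RVar 29))))).

(** A heavy row costs one coefficient update. For a light row [cgen] is run again: the scalar
    product in [rvar 12] came from the first sample, and independence of the two is what [row_step]
    needs. *)
Definition cupdate :=
  CIf (BLeN (NConst 1) (NGet 25 (NVar 57)))
    (CPutR 62 (NVar 57) (RSub (RGet 62 (NVar 57)) (RVar 12)))
    (cgen;;
     CFor 10 (NVar 64)
       (CSetN 11 (NGet 64 (NVar 10));;
        CPutR 61 (NVar 11) (RSub (RGet 61 (NVar 11)) (RMul (RVar 12) (RGet 64 (NVar 10)))))).

Definition crow :=
  cgen;; cdot;;
  CSetR 12 (RMul (RDiv (RMul (RVar 48) (RNat (NVar 24))) (RNat (NGet 23 (NVar 57)))) (RVar 10));;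
  cupdate;;
  CSetR 56 (RAdd (RVar 56) (RVar 48)).

(** * Bit extraction and table filling *)

Section Macros.
Variable R : realType.
Implicit Types (s : store R).

Definition scr s s' := [/\ narr s' = narr s, rarr s' = rarr s &
  forall x, ~~ (4 <= x < 16)%N -> nvar s' x = nvar s x /\ rvar s' x = rvar s x].

Lemma scr_refl s : scr s s. Proof. by split. Qed.

Lemma scr_setN s s' x v : (4 <= x < 16)%N -> scr s s' -> scr s (set_nvar s' x v).
Proof.
move=> Hx [a b c]; split=> //= y Hy; have [c1 c2] := c y Hy; split=> //.
by rewrite /upd; case: eqP Hy => // ->; rewrite Hx.
Qed.

Lemma scr_setR s s' x v : (4 <= x < 16)%N -> scr s s' -> scr s (set_rvar s' x v).
Proof.
move=> Hx [a b c]; split=> //= y Hy; have [c1 c2] := c y Hy; split=> //.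
by rewrite /upd; case: eqP Hy => // ->; rewrite Hx.
Qed.

Lemma scr_same L s s0 s' : scr s s' -> same L s0 s -> same L s0 s'.
Proof.
move=> [E1 E2 E3] H x Hx; have [a b c e] := H x Hx.
have Hx' : ~~ (4 <= x < 16)%N by move: Hx; rewrite /kept; lia.
by have [-> ->] := E3 x Hx'; rewrite E1 E2.
Qed.

Lemma cbits_spec s (u X pw : R) nb Q :
  nvar s 28 = nb.+1 -> rvar s 6 = X -> rvar s 7 = pw ->
  rvar s 8 = u * 2 ^+ nb -> 0 < u -> 0 < pw -> 0 <= X < 2 * (u * 2 ^+ nb) * pw ->
  (forall s' (z : nat), scr s s' ->
     (forall x, x != 8%N -> nvar s' x = nvar s x) ->
     (forall x, x \notin [:: 6%N; 8%N; 9%N] -> rvar s' x = rvar s x) ->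
     rvar s' 9 = u * z%:R -> rvar s' 6 = X - u * z%:R * pw ->
     0 <= X - u * z%:R * pw < u * pw -> Q s') ->
  det cbits s (12 * nb + 24) Q.
Proof.
move=> Enb EX Epw Ee u0 pw0 HX HQ.
apply: (@det_seqT _ _ _ _ 1 (nb.+1 * (7 + 3) + 3)); first lia.
apply: det_run => //=.
(* After [k] rounds the quotient is a multiple of the unit u * 2^(nb+1-k), and the remainder lies
   below that unit times [pw]. *)
pose I k s' := [/\ scr s s', (forall x, x != 8%N -> nvar s' x = nvar s x),
  (forall x, x \notin [:: 6%N; 8%N; 9%N] -> rvar s' x = rvar s x), nvar s' 8 = k &
  rvar s' 8 = u * 2 ^+ nb.+1 / 2 ^+ k.+1 /\
  exists z : nat, [/\ rvar s' 9 = u * 2 ^+ nb.+1 / 2 ^+ k * z%:R,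
     rvar s' 6 = X - rvar s' 9 * pw & 0 <= rvar s' 6 < u * 2 ^+ nb.+1 / 2 ^+ k * pw]].
have p2 k : 2 ^+ k != 0 :> R by rewrite expf_neq0 // pnatr_eq0.
apply: (@det_forT _ _ _ _ _ nb.+1 I 7) => //.
- split=> //=; rewrite /upd /=.
  + by do ![apply: scr_setN => //|apply: scr_setR => //|exact: scr_refl].
  + by move=> x /negbTE ->.
  + by move=> x; rewrite !inE !negb_or => /and3P[_ _ /negbTE ->].
  + split; first by rewrite Ee exprS; field; rewrite ?p2.
    exists 0%N; rewrite !mulr0 mul0r subr0; split=> //.
    by rewrite EX expr0 divr1 exprS; move: HX; lra.
- move=> k s' Hk [S1 S2 S3 S4 _]; split=> //=.
  by rewrite S2.
- move=> k s' Hk [S1 S2 S3 S4 [S5 [z [S6 S7 S8]]]].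
  have Epw' : rvar s' 7 = pw by rewrite S3.
  set w := u * 2 ^+ nb.+1 / 2 ^+ k.+1 in S5.
  have w0 : 0 < w by rewrite divr_gt0 ?mulr_gt0 ?exprn_gt0.
  have w2 : u * 2 ^+ nb.+1 / 2 ^+ k = 2 * w.
    by rewrite /w [2 ^+ k.+1]exprS; field; rewrite p2.
  have w3 : w / 2 = u * 2 ^+ nb.+1 / 2 ^+ k.+2.
    by rewrite /w [2 ^+ k.+2]exprS; field; rewrite p2.
  rewrite w2 in S6 S8.
  apply: det_run => //=; rewrite Epw' S5; case: ifP => Hle.
    split=> //=; rewrite /I /upd /=; split=> //=.
    + by do ![apply: scr_setN => //|apply: scr_setR => //|exact: scr_refl].
    + by move=> x Hx; rewrite /= /upd (negbTE Hx) S2.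
    + by move=> x Hx; rewrite -S3 // /= /upd; move: Hx; rewrite !inE !negb_or => /and3P[/negbTE-> /negbTE-> /negbTE->].
    + rewrite /upd /=; split; first by rewrite ?S5 w3.
      exists (z.*2.+1); rewrite /upd /= ?Epw' ?S5 ?S7 ?S6; split.
      * have -> : (z.*2.+1)%:R = 2 * z%:R + 1 :> R by rewrite -natr1 -mul2n natrM.
        by rewrite -/w; ring.
      * by ring.
      * by move: Hle S8; rewrite S7 S6 -/w; lra.
  split=> //=; rewrite /I /upd /=; split=> //=.
  + by do ![apply: scr_setN => //|apply: scr_setR => //|exact: scr_refl].
  + by move=> x Hx; rewrite /= /upd (negbTE Hx) S2.
  + by move=> x Hx; rewrite -S3 // /= /upd; move: Hx; rewrite !inE !negb_or => /and3P[_ /negbTE-> _].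
  + rewrite /upd /=; split; first by rewrite ?S5 w3.
    exists (z.*2); rewrite /upd /= -/w; split.
    * have -> : (z.*2)%:R = 2 * z%:R :> R by rewrite -mul2n natrM.
      by rewrite S6; ring.
    * by [].
    * by move/negbT: Hle; rewrite -ltNge => Hle; move: S8; lra.
- move=> s' [S1 S2 S3 S4 [_ [z [S6 S7 S8]]]].
  have E1 : u * 2 ^+ nb.+1 / 2 ^+ nb.+1 = u by rewrite mulfK.
  rewrite E1 in S6 S8; rewrite S6 in S7; rewrite S7 in S8.
  exact: (HQ s' z).
Qed.

Definition set_narr s a (f : nat -> nat) : store R :=
  Store (nvar s) (rvar s) (upd (narr s) a f) (rarr s).

Lemma same_setA L s s' x f :
  ~~ kept L x -> same L s s' -> same L s (set_narr s' x f).
Proof.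
move=> Hx H y Hy; have [E1 E2 E3 E4] := H _ Hy; split=> //=.
by rewrite /upd; case: eqP Hy Hx => // -> ->.
Qed.

Lemma fresh_setA L s x f : (x < L)%N -> fresh L s -> fresh L (set_narr s x f).
Proof.
move=> Hx H y Hy; have [E1 E2 E3 E4] := H _ Hy; split=> //=.
by rewrite /upd; case: eqP => // E; lia.
Qed.

Definition blit (f : nat -> nat) lo len v : nat -> nat :=
  fun j => if (lo <= j < lo + len)%N then v else f j.

Lemma blit1 f lo v : blit f lo 1 v = upd f lo v.
Proof.
by apply/funext => j; rewrite /blit /upd addn1 ltnS -eqn_leq eq_sym.
Qed.

Lemma blitS f lo k v : upd (blit f lo k v) (lo + k) v = blit f lo k.+1 v.
Proof.
apply/funext => j; rewrite /blit /upd addnS ltnS.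
by case: (ltngtP j (lo + k)) => //= H; case: leqP => //; lia.
Qed.

Definition filled s arr c : store R :=
  set_nvar (set_nvar (set_narr s arr
    (blit (narr s arr) (nvar s 4 + nvar s 5) c (nvar s 6))) 5 (nvar s 5 + c)) 7 c.

Lemma cfill_spec s arr c Q :
  (0 < c)%N -> rvar s 4 <= c%:R * rvar s 5 ->
  (forall c', (0 < c' < c)%N -> c'%:R * rvar s 5 < rvar s 4) ->
  Q (filled s arr c) -> det (cfill arr) s (8 * c + 6) Q.
Proof.
move=> c0 Hc Hlt HQ.
apply: (@det_seqT _ _ _ _ 1 (8 * c + 4)); first lia.
apply: det_run => //=.
apply: (@det_seqT _ _ _ _ 1 (8 * c + 2)); first lia.
apply: det_run => //=.
apply: (@det_seqT _ _ _ _ 1 (8 * c)); first lia.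
apply: det_run => //=.
set s1 := set_nvar _ _ _.
have -> : s1 = filled s arr 1.
  rewrite /s1 /filled /set_narr /put_narr /= /set_nvar /= /upd /=; congr Store.
  by apply/funext => a; case: eqP => // _; rewrite blit1 /upd.
suff H j : (j <= c)%N -> (0 < c - j)%N ->
    det (CWhile (RLt (RMul (RNat (NVar 7)) (RVar 5)) (RVar 4))
      (CPutN arr (NAdd (NVar 4) (NVar 5)) (NVar 6);; incN 5;; incN 7))
      (filled s arr (c - j)) (8 * j + 1) Q.
  have -> : filled s arr 1 = filled s arr (c - c.-1) by congr filled; lia.
  by apply: (@det_conseq _ _ _ (8 * c.-1 + 1) _ Q) => //; [lia|apply: H; lia].
elim: j => [|j IH] Hj Hcj.
  rewrite subn0; apply: det_whileF => //=; rewrite /upd /=.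
  by rewrite negbK.
apply: (@det_conseq _ _ _ (5 + (8 * j + 1)).+1 _ Q) => //; first lia.
apply: det_whileT.
  by rewrite /= /upd /= -ltNge; apply: Hlt; lia.
apply: det_run => //.
have -> : run (CPutN arr (NAdd (NVar 4) (NVar 5)) (NVar 6);; incN 5;; incN 7)
   (filled s arr (c - j.+1)) = filled s arr (c - j).
  rewrite /= /filled /set_narr /put_narr /set_nvar /= /upd /= -/(upd _ _ _).
  have E : (c - j = (c - j.+1).+1)%N by lia.
  congr Store.
    apply/funext => x; rewrite /upd; case: (x == 7%N); first by rewrite E addn1.
    by case: (x == 5%N) => //; rewrite E addn1 addnS.
  apply/funext => a; case: (a == arr) => //; rewrite ?eqxx E -blitS /upd addnA.
  by [].
by apply: IH; lia.
Qed.

(** At least 1, because [cfill] writes a slot before its first test. *)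
Definition slots (num den : R) : nat :=
  if den <= 0 then 1%N else maxn 1 `|Num.ceil (num / den)|%N.

Lemma slotsP num den : 0 <= num -> (0 < den \/ num <= 0) -> 0 <= den ->
  [/\ (0 < slots num den)%N, num <= (slots num den)%:R * den,
   (forall c', (0 < c' < slots num den)%N -> c'%:R * den < num) &
   (slots num den)%:R * den <= num + den].
Proof.
move=> n0 Hd d0; rewrite /slots; case: (leP den 0) => Hden.
  have -> : den = 0 by apply: le_anti; rewrite Hden d0.
  have -> : num = 0 by case: Hd => [|?]; [lra|apply: le_anti; rewrite n0 andbT].
  by rewrite !mulr0 addr0 lexx; split=> // c'; lia.
set q := num / den; have q0 : 0 <= q by rewrite divr_ge0 // ltW.
have E : (`|Num.ceil q|%N)%:R = (Num.ceil q)%:~R :> R.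
  by rewrite natr_absz ger0_norm // -(ler_int R) (le_trans q0) // ceil_ge.
have Hq : num = q * den by rewrite divfK // gt_eqF.
have H1 := ceil_ge q.
have H2 : (Num.ceil q)%:~R < q + 1 :> R by have := ceilB1_lt q; rewrite rmorphB /=; lra.
have mx : (maxn 1 `|Num.ceil q|)%:R = Num.max 1 (Num.ceil q)%:~R :> R.
  by rewrite natr_max E.
split.
- by rewrite leq_maxl.
- by rewrite Hq ler_pM2r // mx le_max H1 orbT.
- move=> c' /andP[c0 c1]; rewrite Hq ltr_pM2r //.
  have : (c' < `|Num.ceil q|)%N by lia.
  rewrite -(ler_nat R) E -natr1 => H3; lra.
- rewrite mx Hq -{3}[den]mul1r -mulrDl ler_pM2r // ge_max.
  by apply/andP; split; lra.
Qed.

End Macros.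

Ltac keep ::= repeat first
  [ assumption | apply: same_refl
  | apply: same_setN; [by []|] | apply: same_setR; [by []|]
  | apply: same_putN; [by []|] | apply: same_putR; [by []|] | apply: same_setA; [by []|]
  | apply: fresh_setN; [by []|] | apply: fresh_setR; [by []|]
  | apply: fresh_putN; [by []|] | apply: fresh_putR; [by []|] | apply: fresh_setA; [by []|] ].

(** * The tables of the main phase and the row sampler *)

Section MainPhase.
Variable R : realType.
Variables (n d m : nat) (er ec : nat -> nat) (ev : nat -> R).
Hypothesis er_lt : forall e, (e < m)%N -> (er e < n)%N.
Hypothesis ec_lt : forall e, (e < m)%N -> (ec e < d)%N.
Variable s0 : store R.

Definition tN := nvar s0 19.
Definition tK := narr s0 20.
Definition tWr := nvar s0 24.
Definition trow := narr s0 24.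
Definition tcr := narr s0 23.
Definition tinH := narr s0 25.
Definition tg := rvar s0 28.
Definition te0 := rvar s0 29.
Definition twe := rarr s0 28.
Definition thc := narr s0 32.
Definition tHD i k := narr s0 33 (narr s0 21 i + k)%N.
Definition tWt := narr s0 34.
Definition tTT i u := narr s0 35 (narr s0 22 i + u)%N.
Definition tce e : R := (narr s0 36 e)%:R.
Definition tkap := rarr s0 38.
Definition tsmp := narr s0 38.
Definition th := nvar s0 25.
Definition throw := narr s0 41.
Definition rcf i := (\sum_(0 <= e < m | er e == i) 1)%N.
(** Head entries are treated exactly: all entries of a short row, otherwise those with at least the
    share 1/K of the absolute row sum. There are at most K of them in a row, so the head costs no
    more than the draws. *)
Definition headf e :=
  (rcf (er e) <= tK (er e))%N || (norm1f m er ev (er e) <= (tK (er e))%:R * `|ev e|).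

Definition on_grid (x : R) := exists z : int, x = tg * z%:~R.

(** The interface between the preprocessing and the main phase. The main phase writes to no
    persistent index below 52, so these facts about [s0] stay available under [same 52]. The packing
    data are only required when there are heavy rows. *)
Record Good : Prop := MkGood {
  g_dims : [/\ nvar s0 0 = n, nvar s0 1 = d & nvar s0 2 = m];
  g_idx : [/\ narr s0 0 = er, narr s0 1 = ec & rarr s0 0 = ev];
  g_frob : rvar s0 16 = frob m ev;
  g_N : (0 < tN)%N;
  g_gam : rvar s0 19 = frob m ev / tN%:R;
  g_Wr : (0 < tWr)%N;
  g_rows : forall f : nat -> R,
    \sum_(u < tWr) f (trow u) = \sum_(0 <= i < n) (tcr i)%:R * f i;
  g_row_lt : forall u, (u < tWr)%N -> (trow u < n)%N;
  g_cr : forall i, (i < n)%N -> (0 < tcr i)%N /\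
    tWr%:R * norm2f m er ev i <= 2 * frob m ev * (tcr i)%:R;
  g_inH : forall i, (i < n)%N -> (0 < tinH i)%N =
    (tN%:R * norm2f m er ev i < norm1f m er ev i ^+ 2);
  g_we : forall e, (e < m)%N -> `|twe e| <= `|ev e|;
  g_HD : forall i, (i < n)%N -> forall f : nat -> R,
    \sum_(0 <= k < thc i) f (tHD i k) = \sum_(0 <= e < m | (er e == i) && headf e) f e;
  g_HD_lt : forall i k, (i < n)%N -> (k < thc i)%N -> (tHD i k < m)%N /\ er (tHD i k) = i;
  g_tail : forall i, (i < n)%N ->
    (tsmp i = 0%N /\ forall e, (e < m)%N -> er e = i -> headf e) \/
    tail_ok m er ev twe tN (tK i) i (tWt i) (tTT i) tce (tkap i) headf (tsmp i);
  g_cnt : forall i, (i < n)%N -> (thc i <= tK i)%N /\ (tsmp i <= tK i)%N;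
  g_hrow : forall f : nat -> R,
    \sum_(0 <= k < th) f (throw k) = \sum_(0 <= i < n | (0 < tinH i)%N) f i;
  g_pack : (0 < th)%N -> exists nb,
    [/\ nvar s0 28 = nb.+1, 0 < tg, te0 = tg ^+ 2 * 2 ^+ nb,
        (forall k, (k < th)%N -> rarr s0 41 k = (2 ^+ nb.+1) ^+ k) &
        rvar s0 42 = \sum_(0 <= k < th) te0 * rarr s0 41 k] /\
    [/\ (forall j, rarr s0 43 j = \sum_(0 <= k < th) rarr s0 41 k * wrow m er ec twe (throw k) j),
        (forall e, (e < m)%N -> on_grid (twe e)),
        (forall i, (i < n)%N -> (0 < tsmp i)%N -> on_grid (tkap i)) &
        (forall e i, (e < m)%N -> (i < n)%N ->
           `|twe e| * (norm1f m er ev i + (tsmp i)%:R * tkap i) < te0)] }.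

Hypothesis G : Good.

Definition a0f i : nat -> R := fun j =>
  \sum_(0 <= e < m | (er e == i) && headf e) twe e * delta R (ec e) j.

Definition bufv s len : nat -> R := fun j =>
  \sum_(0 <= k < len | narr s 64 k == j) rarr s 64 k.

Lemma bufv_dot s len y : (forall k, (k < len)%N -> (narr s 64 k < d)%N) ->
  dot d (bufv s len) y = \sum_(0 <= k < len) rarr s 64 k * y (narr s 64 k).
Proof.
move=> H; rewrite /dot /bufv; under eq_bigr do rewrite mulr_suml.
rewrite (exchange_big_dep_nat xpredT) //=; apply: eq_big_nat => k /andP[_ Hk].
rewrite (eq_bigl (fun j => j == narr s 64 k)); last by move=> j; rewrite eq_sym.
by rewrite big_nat1_eq /= H.
Qed.

Definition gen_post s i s' := [/\ same 64 s s', rvar s' = rvar s,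
  nvar s' 64 = (thc i + tsmp i)%N,
  (forall k, (k < thc i + tsmp i)%N -> (narr s' 64 k < d)%N) &
  (0 < th)%N -> (forall k, (k < thc i + tsmp i)%N -> on_grid (rarr s' 64 k)) /\
     \sum_(0 <= k < thc i + tsmp i) `|rarr s' 64 k| <=
       norm1f m er ev i + (tsmp i)%:R * tkap i].

Lemma eqR_le (x y : R) : x = y -> x <= y. Proof. by move=> ->. Qed.

Lemma tkap_gt0 i : (i < n)%N -> (0 < tsmp i)%N -> 0 < tkap i.
Proof.
move=> Hi Hs; case: (g_tail G Hi) => [[E _]|[_ [_ [_ [_ [H _ _]]]]]] //.
by rewrite E in Hs.
Qed.

Lemma on_grid_mulsign x (w : R) (a : nat) : (a <= 1)%N -> on_grid x ->
  on_grid (a%:R * (x * (w / `|w|))).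
Proof.
move=> a1 [z ->].
have [w0|w0|->] := ltgtP w 0; last by exists 0; rewrite !mul0r !mulr0.
- exists (- (a%:Z * z)); rewrite ltr0_norm // rmorphN rmorphM /=; field.
  by rewrite lt_eqF.
- exists (a%:Z * z); rewrite gtr0_norm // rmorphM /=; field.
  by rewrite gt_eqF.
Qed.

Lemma normr_sign_le (w : R) : `|w / `|w| | <= 1.
Proof.
have [->|w0] := eqVneq w 0; first by rewrite mul0r normr0.
by rewrite normf_div normr_id divff // normr_eq0.
Qed.

(** [gE] performs the same draws as the second loop, started from the head part [a0f] that the first
    loop has written; [h] is an arbitrary payoff of the resulting vector. *)
Lemma gen_spec s i h :
  same 52 s0 s -> nvar s 57 = i -> (i < n)%N ->
  wp cgen s (40 * tK i + 16) (gen_post s i) (fun s' => h (bufv s' (thc i + tsmp i)))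
    (gE (tWt i) (tTT i) (accept twe (tK i) (tWt i) tce (tkap i)) (svalue twe (tkap i)) ec (tsmp i) h (a0f i)).
Proof.
move=> S0 Ei Hi.
have [le1 le2] := g_cnt G Hi.
have [_ Gec _] := g_idx G.
set E := gE _ _ _ _ _.
apply: (@wp_detseqT _ _ _ _ (thc i * (9 + 3) + 3) (tsmp i * (17 + 3) + 3 + 2)); first lia.
pose I1 k s' := [/\ same 64 s s', rvar s' = rvar s, nvar s' 10 = k,
  (forall k', (k' < k)%N -> narr s' 64 k' = ec (tHD i k')) &
  (forall k', (k' < k)%N -> rarr s' 64 k' = twe (tHD i k'))].
have st x s' : (16 <= x < 52)%N || (x < 4)%N -> same 64 s s' ->
   [/\ nvar s' x = nvar s0 x, rvar s' x = rvar s0 x, narr s' x = narr s0 x & rarr s' x = rarr s0 x].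
  move=> Hx Ss'; have [|-> -> -> ->] := Ss' x; first by move: Hx; rewrite /kept; lia.
  by apply: S0; move: Hx; rewrite /kept; lia.
have si s' : same 64 s s' -> nvar s' 57 = i by move=> H; have [-> _ _ _] := H 57%N isT.
apply: (@det_forT _ _ _ _ _ (thc i) I1 9) => //.
- by split=> //; keep.
- move=> k s' Hk [S1 S2 S3 S4 S5]; split=> //=.
  by have [_ _ -> _] := st 32%N s' isT S1; rewrite (si _ S1).
- move=> k s' Hk [S1 S2 S3 S4 S5].
  have [_ _ E33 _] := st 33%N s' isT S1; have [_ _ E21 _] := st 21%N s' isT S1.
  have [_ _ E1 _] := st 1%N s' isT S1; have [_ _ _ E28] := st 28%N s' isT S1.
  apply: det_run => //; split=> //; split=> //=; first by keep.
  + move=> k'; rewrite ltnS leq_eqVlt /upd /= S3 (si _ S1) E33 E21 E1 Gec.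
    case: eqVneq => [->|ne] /= H; rewrite ?eqxx //.
    exact: S4.
  + move=> k'; rewrite ltnS leq_eqVlt /upd /= S3 (si _ S1) E33 E21 E28.
    case: eqVneq => [->|ne] /= H; rewrite ?eqxx //.
    exact: S5.
move=> s1 [S1 S2 S3 S4 S5].
have buf0 : bufv s1 (thc i) = a0f i.
  apply/funext => j; rewrite /bufv /a0f -(g_HD G Hi (fun e => twe e * delta R (ec e) j)).
  rewrite big_mkcond; apply: eq_big_nat => k /andP[_ Hk].
  by rewrite S4 // S5 // /delta eq_sym; case: eqP; rewrite ?mulr1 ?mulr0.
pose gridk s' len := (0 < th)%N -> (forall k', (k' < len)%N -> on_grid (rarr s' 64 k')) /\
     \sum_(0 <= k' < len) `|rarr s' 64 k'| <= norm1f m er ev i + (len - thc i)%:R * tkap i.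
pose I2 k s' := [/\ same 64 s s', rvar s' = rvar s, nvar s' 10 = k &
  (forall k', (k' < thc i + k)%N -> (narr s' 64 k' < d)%N) /\ gridk s' (thc i + k)%N].
(* The value function of the sampling loop: the expectation over the draws still to come. *)
pose V k s' := gE (tWt i) (tTT i) (accept twe (tK i) (tWt i) tce (tkap i)) (svalue twe (tkap i)) ec (tsmp i - k) h (bufv s' (thc i + k)).
apply: (@wp_seqT _ _ _ _ (tsmp i * (17 + 3) + 3) 1 _ _ _ _ (I2 (tsmp i)) (V (tsmp i))); first lia.
  apply: (@wp_forT _ _ _ _ _ (tsmp i) I2 V 17) => //.
  - split=> //; first by keep.
    rewrite addn0; split.
      move=> k' Hk'; rewrite /= S4 // ; have [H _] := g_HD_lt G Hi Hk'.
      exact: ec_lt.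
    move=> Hh; have [nb [_ [_ gw _ _]]] := g_pack G Hh; split.
      by move=> k' Hk'; rewrite /= S5 //; apply: gw; have [] := g_HD_lt G Hi Hk'.
    rewrite subnn mul0r addr0.
    rewrite (eq_big_nat _ _ (F2 := fun k => `|twe (tHD i k)|)); last by move=> k' /andP[_ Hk']; rewrite /= S5.
    rewrite (g_HD G Hi (fun e => `|twe e|)) /norm1f /rsum [leRHS](bigID headf) /=.
    rewrite -[leLHS]addr0 lerD ?sumr_ge0 //.
    rewrite [leLHS]big_seq_cond [leRHS]big_seq_cond; apply: ler_sum => e.
    by rewrite mem_index_iota => /andP[/andP[_ He] _]; exact: (g_we G He).
  - by rewrite /V subn0 addn0 -/E; rewrite (_ : bufv (set_nvar s1 10 0) _ = bufv s1 (thc i)) // buf0.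
  - move=> k s' Hk [Q1 Q2 Q3 _]; split=> //=.
    by have [_ _ -> _] := st 38%N s' isT Q1; rewrite (si _ Q1).
  - move=> k s' Hk [Q1 Q2 Q3 [Q4 Q5]].
    have s_gt0 : (0 < tsmp i)%N by lia.
    have kp := tkap_gt0 Hi s_gt0.
    case: (g_tail G Hi) => [[Z _]|tl]; first by rewrite Z in s_gt0.
    have [[_ K0 _ W0] [_ [te_lt [tl1 [_ kapK kapw]]]]] := tl.
    have [_ _ E34 _] := st 34%N s' isT Q1; have Eis := si _ Q1.
    have eW : neval s' (NGet 34 (NVar 57)) = tWt i by rewrite /= E34 Eis.
    rewrite /V (_ : (tsmp i - k)%N = (tsmp i - k.+1).+1); last by lia.
    rewrite [gE _ _ _ _ _ _.+1 _ _]/=.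
    set HE := gE _ _ _ _ _ (tsmp i - k.+1) h.
    pose acc := bufv s' (thc i + k).
    apply: (@wp_seqT _ _ _ _ 1 15 _ _ _ _ (fun s1' => exists2 u, (u < tWt i)%N & s1' = set_nvar s' 11 u)
      (fun s1' => let e := tTT i (nvar s1' 11) in
         accept twe (tK i) (tWt i) tce (tkap i) e * HE (add1 acc (ec e) (svalue twe (tkap i) e)) +
         (1 - accept twe (tK i) (tWt i) tce (tkap i) e) * HE (add1 acc (ec e) 0))) => //.
      by apply: wp_unif; rewrite ?eW // => u Hu; exists u.
    move=> _ [u Hu ->] /=.
    have [] := te_lt u Hu; set e := tTT i u => He Ee Hh.
    have [_ _ E35 _] := st 35%N s' isT Q1; have [_ _ E22 _] := st 22%N s' isT Q1.
    have [_ _ E36 _] := st 36%N s' isT Q1; have [_ _ E20 _] := st 20%N s' isT Q1.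
    have [_ _ E32 _] := st 32%N s' isT Q1; have [_ _ _ E38] := st 38%N s' isT Q1.
    have [_ _ E1 _] := st 1%N s' isT Q1; have [_ _ _ E28] := st 28%N s' isT Q1.
    apply: (@wp_detseqT _ _ _ _ 1 13) => //.
    apply: det_run => //; set s2 := run _ _.
    have F11 : nvar s2 11 = e by rewrite /s2 /= /upd /= E35 E22 Eis.
    have F57 : nvar s2 57 = i by [].
    have F10 : nvar s2 10 = k by [].
    have S2' : same 64 s s2 by rewrite /s2 /=; keep.
    have Fn : narr s2 = narr s' by [].
    have Fr : rarr s2 = rarr s' by [].
    have Fv : rvar s2 = rvar s by rewrite -Q2.
    clearbody s2.
    have pE : reval s2 (RDiv (RMul (RAbs (RGet 28 (NVar 11))) (RNat (NGet 34 (NVar 57))))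
       (RMul (RMul (RNat (NGet 36 (NVar 11))) (RNat (NGet 20 (NVar 57))))
         (RGet 38 (NVar 57)))) = accept twe (tK i) (tWt i) tce (tkap i) e.
      rewrite /= F11 F57 Fn Fr E28 E34 E36 E20 E38 /accept.
      by rewrite -expr2 sqrtr_sqr.
    have acc01 : 0 <= accept twe (tK i) (tWt i) tce (tkap i) e <= 1.
      apply: (@pr01 R m er ev twe (tK i) i (tWt i) (tTT i) tce (tkap i) headf) => //.
      - exact: (g_we G).
      - by move=> e' He' Ee' Hh'; have [] := tl1 e' He' Ee' Hh'.
    apply: (@wp_seqT _ _ _ _ 1 11 _ _ _ _ (fun s3 => exists2 a, (a <= 1)%N & s3 = set_nvar s2 13 a)
      (fun s3 => HE (add1 acc (ec e) ((nvar s3 13)%:R * svalue twe (tkap i) e)))) => //.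
      apply: wp_flip; rewrite ?pE //; [by exists 1%N|by exists 0%N|].
      by rewrite /= /upd /= mul1r mul0r.
    move=> _ [a a1 ->].
    have sign1 := normr_sign_le (twe e).
    set pn := CPutN _ _ _; set pr := CPutR _ _ _.
    have EN : narr (run (pn;; pr) (set_nvar s2 13 a)) 64 = upd (narr s' 64) (thc i + k) (ec e).
      by rewrite /= /upd /= Fn F11 F57 F10 E32 E1 Gec.
    have ER : rarr (run (pn;; pr) (set_nvar s2 13 a)) 64 = upd (rarr s' 64) (thc i + k) (a%:R * svalue twe (tkap i) e).
      rewrite /= /upd /= Fn Fr F11 F57 F10 E32 E38 E28 -expr2 sqrtr_sqr.
      by [].
    have S4' : same 64 s (run (pn;; pr) (set_nvar s2 13 a)) by rewrite /=; keep.
    have T10 : nvar (run (pn;; pr) (set_nvar s2 13 a)) 10 = k by [].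
    have TV : rvar (run (pn;; pr) (set_nvar s2 13 a)) = rvar s by [].
    suff : forall s4, narr s4 64 = upd (narr s' 64) (thc i + k) (ec e) ->
       rarr s4 64 = upd (rarr s' 64) (thc i + k) (a%:R * svalue twe (tkap i) e) ->
       same 64 s s4 -> nvar s4 10 = k -> rvar s4 = rvar s ->
       (nvar s4 10 = k /\ I2 k.+1 (set_nvar s4 10 k.+1)) /\
       HE (add1 acc (ec e) (a%:R * svalue twe (tkap i) e)) <= HE (bufv (set_nvar s4 10 k.+1) (thc i + k.+1)).
      by move=> H; have [H1 H2] := H _ EN ER S4' T10 TV; apply: wp_run.
    move=> {EN ER S4' T10 TV} s4 EN ER S4' T10 TV; split.
    + split=> //; split=> //; first by keep.
      rewrite addnS; split.
        move=> k'; rewrite ltnS leq_eqVlt /= => Hk'.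
        rewrite EN /upd; case: eqVneq Hk' => [_ _|_ /= Hk']; first exact: ec_lt.
        exact: Q4.
      move=> Hh0; have [q1 q2] := Q5 Hh0; have [nb [_ [_ _ gk _]]] := g_pack G Hh0.
      split.
        move=> k'; rewrite ltnS leq_eqVlt => Hk'.
        rewrite /= ER /upd; case: eqVneq Hk' => [_ _|_ /= Hk']; last exact: q1.
        by apply: on_grid_mulsign => //; exact: gk.
      rewrite big_nat_recr //= ER.
      rewrite (eq_big_nat _ _ (F2 := fun k => `|rarr s' 64 k|)); last first.
        by move=> k' /andP[_ Hk']; rewrite /upd (ltn_eqF Hk').
      rewrite /upd eqxx subSn ?leq_addr // addKn -natr1 mulrDl mul1r addrA.
      move: q2; rewrite addKn => q2; apply: lerD => //.
      rewrite /svalue !normrM (gtr0_norm kp) normr_nat.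
      have : a%:R <= 1 :> R by rewrite lern1.
      have : 0 <= a%:R :> R by rewrite ler0n.
      move: sign1 (normr_ge0 (twe e / `|twe e|)); rewrite normrM => sign1 sg0 aa0 aa1.
      set sg := _ * `|_^-1| in sign1 sg0 *.
      have : a%:R * (tkap i * sg) <= 1 * (tkap i * 1).
        apply: ler_pM => //; first by rewrite mulr_ge0 // ltW.
        by rewrite ler_pM2l.
      lra.
    + apply: eqR_le; congr HE; apply/funext => j.
      rewrite /add1 /acc /bufv addnS [RHS]big_mkcond big_nat_recr //= EN ER.
      congr (_ + _); last by rewrite /upd eqxx eq_sym.
      rewrite [LHS]big_mkcond; apply: eq_big_nat => k' /andP[_ Hk'].
      by rewrite /upd (ltn_eqF Hk').
move=> s2 [Q1 Q2 Q3 [Q4 Q5]].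
have [_ _ E32 _] := st 32%N s2 isT Q1; have [_ _ E38 _] := st 38%N s2 isT Q1.
apply: wp_run => //.
  split=> //=.
  - by keep.
  - by rewrite /upd /= E32 E38 (si _ Q1).
  - by move=> Hh; have := Q5 Hh; rewrite addKn.
by rewrite /V subnn.
Qed.
End MainPhase.

(** * Scalar products with the implicit iterate *)

Section RowStep.
Variable R : realType.
Variables (n d m : nat) (er ec : nat -> nat) (ev : nat -> R).
Hypothesis er_lt : forall e, (e < m)%N -> (er e < n)%N.
Hypothesis ec_lt : forall e, (e < m)%N -> (ec e < d)%N.
Variable s0 : store R.
Hypothesis G : Good n d m er ec ev s0.
Let we := twe s0.
Let wr := wrow m er ec we.

(** The iterate is never stored densely during a run. Array 61 takes the sparse updates of light
    rows, the drift common to all steps is a scalar multiple of the gradient in array 59, and heavy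
    rows enter through their coefficients in array 62. *)
Definition yv (s : store R) : nat -> R := fun j =>
  rarr s 61 j + rvar s 56 * rarr s 59 j + \sum_(0 <= i < n) rarr s 62 i * wr i j.

Definition ccok (s : store R) := forall i, (i < n)%N -> tinH s0 i = 0%N -> rarr s 62 i = 0.

Lemma digits_lt (zz : nat -> nat) (B : R) t : 1 <= B ->
  (forall k, (k < t)%N -> (zz k)%:R <= B - 1) ->
  0 <= \sum_(0 <= k < t) (zz k)%:R * B ^+ k <= B ^+ t - 1.
Proof.
move=> B1; elim: t => [|t IH] H; first by rewrite big_geq // expr0 subrr lexx.
rewrite big_nat_recr //=; have /andP[H1 H2] := IH (fun k Hk => H k (leqW Hk)).
have H3 := H t (ltnSn t); have H4 : 0 <= (zz t)%:R :> R by [].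
have Bt : 1 <= B ^+ t by rewrite exprn_ege1.
have : (zz t)%:R * B ^+ t <= (B - 1) * B ^+ t by rewrite ler_wpM2r //; lra.
have : 0 <= (zz t)%:R * B ^+ t by rewrite mulr_ge0 //; lra.
rewrite exprSr; lra.
Qed.

(** Uniqueness of division with remainder: two quotients that leave remainders in the same window of
    length [u * pw] coincide. *)
Lemma nat_digit_eq (u pw lo : R) (z z' : nat) : 0 < u -> 0 < pw ->
  0 <= lo < u * pw -> 0 <= u * z%:R * pw + lo - u * z'%:R * pw < u * pw -> z' = z.
Proof.
move=> u0 p0 /andP[l0 l1] /andP[h0 h1].
have up : 0 < u * pw by rewrite mulr_gt0.
apply/eqP; rewrite eqn_leq -ltnS -(ltnS z) -!(ltr_nat R) -!natr1; apply/andP; split.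
- rewrite -(ltr_pM2l up); lra.
- rewrite -(ltr_pM2l up); lra.
Qed.

(** Buffer and rounded row both have entries in [tg Z], so [tg ^+ 2] is the unit in which the packed
    digits are integers. *)
Lemma grid_dot (s : store R) len i : (i < n)%N ->
  (forall e, (e < m)%N -> on_grid s0 (we e)) ->
  (forall k, (k < len)%N -> (narr s 64 k < d)%N) ->
  (forall k, (k < len)%N -> on_grid s0 (rarr s 64 k)) ->
  exists z : int, dot d (bufv s len) (wr i) = tg s0 ^+ 2 * z%:~R.
Proof.
move=> Hi Gw Hc Hg; rewrite (bufv_dot _ Hc).
have wrg j : on_grid s0 (wr i j).
  rewrite /wr /wrow /rsum big_seq_cond; apply: (big_ind (on_grid s0)).
  - by exists 0; rewrite mulr0.
  - by move=> x y [a ->] [b ->]; exists (a + b); rewrite rmorphD /= mulrDr.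
  - move=> e; rewrite mem_index_iota => /andP[/andP[_ He] _].
    have [z ->] := Gw e He; rewrite /delta; case: (j == ec e).
      by exists z; rewrite mulr1.
    by exists 0; rewrite !mulr0.
rewrite big_seq; apply: (big_ind (fun x => exists z : int, x = tg s0 ^+ 2 * z%:~R)).
- by exists 0; rewrite mulr0.
- by move=> x y [a ->] [b ->]; exists (a + b); rewrite rmorphD /= mulrDr.
- move=> k; rewrite mem_index_iota => /andP[_ Hk].
  have [a ->] := Hg k Hk; have [b ->] := wrg (narr s 64 k).
  by exists (a * b); rewrite rmorphM /=; ring.
Qed.

Lemma wr_le i j M : (forall e, (e < m)%N -> `|we e| <= M) -> 0 <= M ->
  (forall e e', (e < m)%N -> (e' < m)%N -> er e = er e' -> ec e = ec e' -> e = e') ->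
  `|wr i j| <= M.
Proof.
move=> HM M0 inj; rewrite /wr.
have [/hasP[e]|/hasPn H] := boolP (has (fun e => (er e == i) && (ec e == j)) (index_iota 0 m)).
  rewrite mem_index_iota => /andP[_ He] /andP[/eqP <- /eqP <-].
  by rewrite wrow_ec // HM.
rewrite /wrow /rsum big_seq_cond big1 ?normr0 // => e /andP[He Ee].
by have := H e He; rewrite Ee /= => /negbTE ne; rewrite /delta eq_sym ne mulr0.
Qed.

Hypothesis erc_inj : forall e e', (e < m)%N -> (e' < m)%N ->
  er e = er e' -> ec e = ec e' -> e = e'.

Definition Tdot len := (16 * len + th s0 * (12 * nvar s0 28 + 60) + 24)%N.

(** With B = 2^(nb+1) the packed number is the sum of (Dg k + te0) * B^k over the heavy rows, [Dg k]
    being the product with the k-th of them. Each [Dg k] is a multiple of tg^2 below [te0] in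
    absolute value, so [Dg k + te0] is tg^2 times a digit in base B. Digits do not carry, and
    reading them returns the products exactly. *)
Lemma dot_spec s i Q :
  same 52 s0 s -> (i < n)%N -> ccok s ->
  let len := (thc s0 i + tsmp s0 i)%N in
  nvar s 64 = len ->
  (forall k, (k < len)%N -> (narr s 64 k < d)%N) ->
  ((0 < th s0)%N -> (forall k, (k < len)%N -> on_grid s0 (rarr s 64 k)) /\
     \sum_(0 <= k < len) `|rarr s 64 k| <= norm1f m er ev i + (tsmp s0 i)%:R * tkap s0 i) ->
  (forall s', scr s s' -> rvar s' 10 = dot d (bufv s len) (yv s) -> Q s') ->
  det cdot s (Tdot len) Q.
Proof.
move=> S0 Hi Hcc len Elen Hc Hg HQ.
have st x s' : (16 <= x < 52)%N || (x < 4)%N -> scr s s' ->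
   [/\ nvar s' x = nvar s0 x, rvar s' x = rvar s0 x, narr s' x = narr s0 x & rarr s' x = rarr s0 x].
  move=> Hx Ss'; have := scr_same Ss' S0; apply.
  by move: Hx; rewrite /kept; lia.
apply: (@det_seqT _ _ _ _ 1 (Tdot len - 2)); first by rewrite /Tdot; lia.
apply: det_run => //.
apply: (@det_seqT _ _ _ _ 1 (Tdot len - 4)); first by rewrite /Tdot; lia.
apply: det_run => //; set s1 := run _ _.
have E1 : rvar s1 10 = 0 by [].
have E2 : rvar s1 6 = rvar s0 42 by rewrite /s1 /= /upd /=; have [_ -> _ _] := st 42%N s isT (scr_refl s).
have E3 : scr s s1 by rewrite /s1; do ![apply: scr_setN => //|apply: scr_setR => //|exact: scr_refl].
clearbody s1.
apply: (@det_seqT _ _ _ _ (len * (5 + 3) + 3) (th s0 * (12 * nvar s0 28 + 60) + 3)); first by rewrite /Tdot; lia.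
set zeta := fun j => rarr s 61 j + rvar s 56 * rarr s 59 j.
pose I1 k s' := [/\ scr s s', nvar s' 10 = k,
  rvar s' 10 = \sum_(0 <= k' < k) rarr s 64 k' * zeta (narr s 64 k') &
  rvar s' 6 = rvar s0 42 + \sum_(0 <= k' < k) rarr s 64 k' * rarr s0 43 (narr s 64 k')].
apply: (@det_forT _ _ _ _ _ len I1 5) => //.
- split=> //=; rewrite /upd /=; first by apply: scr_setN.
  + by rewrite big_geq.
  + by rewrite big_geq // addr0.
- move=> k s' Hk [S1 S2 S3 S4]; split=> //=.
  by case: S1 => _ _ H; have [-> _] := H 64%N isT.
- move=> k s' Hk [S1 S2 S3 S4].
  have [_ _ _ E43] := st 43%N s' isT S1.
  have [Ena Era Eo] := S1; have [_ E56] := Eo 56%N isT.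
  apply: det_run => //; split=> //; split=> //=.
  + by do ![apply: scr_setN => //|apply: scr_setR => //].
  + rewrite /upd /= S2 S3 Ena Era E56 big_nat_recr //=.
  + rewrite /upd /= S2 S4 Ena -Era E43 big_nat_recr //= Era addrA.
    by [].
move=> s2 [S1 S2 S3 S4].
set b := bufv s len.
pose Dg k := dot d b (wr (throw s0 k)).
have cc2 s' x : scr s s' -> rarr s' x = rarr s x by case=> _ -> _.
have X0 : (0 < th s0)%N -> rvar s2 6 = \sum_(0 <= k < th s0) (Dg k + te0 s0) * rarr s0 41 k.
  move=> Hh; have [nb [[_ _ _ _ Esh] [HCp _ _ _]]] := g_pack G Hh.
  rewrite S4 Esh -(bufv_dot (rarr s0 43) Hc) -/b.
  under [RHS]eq_bigr do rewrite mulrDl.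
  rewrite big_split /= addrC; congr (_ + _).
  have -> : dot d b (rarr s0 43) = \sum_(0 <= j < d) \sum_(0 <= k < th s0) b j * (rarr s0 41 k * wr (throw s0 k) j).
    by apply: eq_bigr => j _; rewrite HCp mulr_sumr.
  rewrite exchange_big /=; apply: eq_bigr => k _; rewrite /Dg /dot mulr_suml.
  by apply: eq_bigr => j _; ring.
(* Digits are removed from the top: after [k] rounds [rvar 6] holds the [th s0 - k] lowest ones. *)
pose I2 k s' := [/\ scr s s', nvar s' 11 = k,
  rvar s' 10 = dot d b zeta + \sum_(0 <= k' < k) rarr s 62 (throw s0 (th s0 - 1 - k')) * Dg (th s0 - 1 - k')%N &
  (0 < th s0)%N -> rvar s' 6 = \sum_(0 <= k' < th s0 - k) (Dg k' + te0 s0) * rarr s0 41 k'].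
apply: (@det_forT _ _ _ _ _ (th s0) I2 (12 * nvar s0 28 + 57)) => //; first lia.
- split=> //=; first by apply: scr_setN.
  + by rewrite S3 big_geq // addr0 /b bufv_dot.
  + by rewrite subn0; exact: X0.
- move=> k s' Hk [Q1 Q2 Q3 Q4]; split=> //=.
  by have [-> _ _ _] := st 25%N s' isT Q1.
- move=> k s' Hk [Q1 Q2 Q3 Q4].
  have Hh : (0 < th s0)%N by lia.
  have [nb [[Enb g0 Ee0 Epw _] [_ Gw Gk Gbd]]] := g_pack G Hh.
  have [g1 g2] := Hg Hh.
  have Q4' := Q4 Hh.
  pose t := (th s0 - 1 - k)%N.
  have Et : (th s0 - k = t.+1)%N by rewrite /t; lia.
  have [E25 _ _ _] := st 25%N s' isT Q1; have [_ _ _ E41] := st 41%N s' isT Q1.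
  have [_ _ N41 _] := st 41%N s' isT Q1; have [_ E29 _ _] := st 29%N s' isT Q1.
  pose pfx := CSetN 10 (NSub (NSub (NVar 25) (NConst 1)) (NVar 11));;
     (CSetR 7 (RGet 41 (NVar 10));; CSetR 8 (RVar 29)).
  set u := tg s0 ^+ 2; have u0 : 0 < u by rewrite exprn_gt0.
  have B0 : 0 < 2 ^+ nb.+1 :> R by rewrite exprn_gt0.
  have B1 : 1 <= 2 ^+ nb.+1 :> R by rewrite exprn_ege1 // ler1n.
  have e0E : te0 s0 * 2 = u * 2 ^+ nb.+1 by rewrite Ee0 [2 ^+ nb.+1]exprS -/u; ring.
  have [zz Hzz] : {zz : nat -> nat | forall k', (k' < th s0)%N ->
      Dg k' + te0 s0 = u * (zz k')%:R /\ (zz k')%:R <= 2 ^+ nb.+1 - 1 :> R}.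
    have P k' : exists z : nat, (k' < th s0)%N -> Dg k' + te0 s0 = u * z%:R /\ z%:R <= 2 ^+ nb.+1 - 1 :> R.
      have [Hk'|] := boolP (k' < th s0)%N; last by exists 0%N.
      (* Testing [g_hrow] on the indicator of the listed row shows that it is a row of the
         matrix. *)
      have Hr : (throw s0 k' < n)%N.
        rewrite ltnNge; apply/negP => Hge.
        have := g_hrow G (fun i => (i == throw s0 k')%:R).
        rewrite [X in _ = X]big_nat_cond [X in _ = X]big1; last first.
          by move=> i2 /andP[/andP[_ Hin] _]; case: eqP => // E; lia.
        rewrite (bigD1_seq k') ?mem_index_iota ?iota_uniq //= eqxx => /eqP.
        by rewrite gt_eqF // ltr_pwDl // ?sumr_ge0 // => *; rewrite ler0n.
      have [z Ez] := grid_dot Hr Gw Hc g1.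
      have M0 : 0 < norm1f m er ev i + (tsmp s0 i)%:R * tkap s0 i \/
                norm1f m er ev i + (tsmp s0 i)%:R * tkap s0 i <= 0 by case: (ltP 0 (norm1f m er ev i + (tsmp s0 i)%:R * tkap s0 i)); [left|right].
      (* The product is at most the largest rounded entry times the absolute sum of the buffer;
         [g_pack] keeps this below [te0]. *)
      have HD : `|Dg k'| < te0 s0.
        rewrite /Dg /b bufv_dot //; apply: le_lt_trans (ler_norm_sum _ _ _) _.
        set SS := norm1f m er ev i + _ in g2 M0 *.
        have e0p : 0 < te0 s0 by rewrite Ee0 mulr_gt0 ?exprn_gt0.
        have [m0|mp] := posnP m.
          rewrite big1 // => k2 _; rewrite /wr /wrow /rsum m0 big_geq // mulr0 normr0 //.
        have [M [HM M0' HMS]] : exists M, [/\ forall e, (e < m)%N -> `|we e| <= M, 0 <= M & M * SS < te0 s0].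
          have [e He Hmax] : exists2 e, (e < m)%N & forall e', (e' < m)%N -> `|we e'| <= `|we e|.
            elim: m mp => // m' IH _; have [->|mp'] := posnP m'.
              by exists 0%N => // e'; rewrite ltnS leqn0 => /eqP ->.
            have [e He H] := IH mp'.
            have [le|/ltW le] := leP `|we e| `|we m'|.
              exists m' => // e'; rewrite ltnS leq_eqVlt => /orP[/eqP-> //|/H H'].
              exact: le_trans H' le.
            exists e; first exact: ltnW.
            by move=> e'; rewrite ltnS leq_eqVlt => /orP[/eqP->//|/H].
          by exists `|we e|; split=> //; exact: Gbd.
        apply: (@le_lt_trans _ _ (M * \sum_(0 <= k2 < len) `|rarr s 64 k2|)).
          rewrite mulr_sumr; apply: ler_sum => k2 _; rewrite normrM mulrC ler_wpM2r //.
          exact: wr_le.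
        by apply: le_lt_trans HMS; rewrite ler_wpM2l.
      have Ez' : Dg k' = u * z%:~R by [].
      have E2n : Dg k' + te0 s0 = u * (z + 2 ^+ nb)%:~R.
        by rewrite Ez' Ee0 rmorphD /= rmorphXn /= -/u; ring.
      have zp : 0 <= z + 2 ^+ nb.
        rewrite -(ler_int R) -(ler_pM2l u0) mulr0 -E2n.
        by move: HD; rewrite ltr_norml; lra.
      exists (absz (z + 2 ^+ nb)) => _; split.
        by rewrite E2n natr_absz ger0_norm.
      rewrite natr_absz ger0_norm //.
      have : z + 2 ^+ nb < 2 ^+ nb.+1.
        rewrite -(ltr_int R) -(ltr_pM2l u0) -E2n [X in _ < u * X]rmorphXn /=.
        by rewrite -e0E; move: HD; rewrite ltr_norml; lra.
      rewrite -lezD1 -(ler_int R) rmorphD /= [X in _ <= X]rmorphXn /=.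
      by move=> H; rewrite lerBrDr.
    by have [zz Hz] := choice P; exists zz.
  pose lo := \sum_(0 <= k' < t) (Dg k' + te0 s0) * rarr s0 41 k'.
  have lo_b : 0 <= lo < u * (2 ^+ nb.+1) ^+ t.
    have Elo : lo = u * \sum_(0 <= k' < t) (zz k')%:R * (2 ^+ nb.+1) ^+ k'.
      rewrite /lo mulr_sumr; apply: eq_big_nat => k' /andP[_ Hk'].
      have Hk2 : (k' < th s0)%N by move: Hk'; rewrite /t; lia.
      by have [-> _] := Hzz k' Hk2; rewrite Epw // mulrA.
    have /andP[l0 l1] : 0 <= \sum_(0 <= k' < t) (zz k')%:R * (2 ^+ nb.+1 : R) ^+ k' <= (2 ^+ nb.+1) ^+ t - 1.
      apply: digits_lt => // k' Hk'.
      by have [|_ ->] // := Hzz k'; move: Hk'; rewrite /t; lia.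
    by rewrite Elo mulr_ge0 ?(ltW u0) //= ltr_pM2l //; lra.
  have tth : (t < th s0)%N by rewrite /t; lia.
  have XE : rvar s' 6 = u * (zz t)%:R * (2 ^+ nb.+1) ^+ t + lo.
    rewrite Q4' Et big_nat_recr //= -/lo addrC; congr (_ + _).
    by have [-> _] := Hzz t tth; rewrite Epw.
  have pw0 : 0 < (2 ^+ nb.+1) ^+ t :> R by rewrite exprn_gt0.
  have [_ zz1] := Hzz t tth.
  apply: (@det_seqT _ _ _ _ 1 (12 * nvar s0 28 + 55)); first by clear; lia.
  apply: det_run => //.
  apply: (@det_seqT _ _ _ _ 1 (12 * nvar s0 28 + 53)); first by clear; lia.
  apply: det_run => //.
  apply: (@det_seqT _ _ _ _ 1 (12 * nvar s0 28 + 51)); first by clear; lia.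
  apply: det_run => //; set s3 := run _ _.
  have R1 : scr s s3 by rewrite /s3 /=; do ![apply: scr_setN => //|apply: scr_setR => //].
  have R2 : nvar s3 10 = t by rewrite /s3 /= /upd /= E25 Q2.
  have R3 : nvar s3 11 = k by [].
  have R4 : rvar s3 7 = (2 ^+ nb.+1) ^+ t by rewrite /s3 /= /upd /= E25 Q2 E41 -/t Epw.
  have R5 : rvar s3 8 = u * 2 ^+ nb by rewrite /s3 /= /upd /= E29 -Ee0.
  have R6 : rvar s3 6 = rvar s' 6 by [].
  have R7 : rvar s3 10 = rvar s' 10 by [].
  clearbody s3.
  have [N28 _ _ _] := st 28%N s3 isT R1.
  apply: (@det_seqT _ _ _ _ (12 * nb + 24) 1); first by rewrite Enb; clear; lia.
  apply: (@cbits_spec _ _ u (rvar s' 6) ((2 ^+ nb.+1) ^+ t) nb) => //.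
  - by rewrite N28.
  - rewrite XE; have : u * (zz t)%:R * (2 ^+ nb.+1) ^+ t <= u * (2 ^+ nb.+1 - 1) * (2 ^+ nb.+1) ^+ t.
      by rewrite ler_pM2r // ler_pM2l.
    have : 0 <= u * (zz t)%:R * (2 ^+ nb.+1) ^+ t by rewrite !mulr_ge0 ?(ltW u0) // ltW.
    have -> : 2 * (u * 2 ^+ nb) * (2 ^+ nb.+1) ^+ t = u * 2 ^+ nb.+1 * (2 ^+ nb.+1) ^+ t.
      by rewrite [2 ^+ nb.+1]exprS; ring.
    by move: lo_b; lra.
  move=> s4 z T1 T2 T3 T4 T6 T5.
  have Ez : z = zz t.
    apply: (nat_digit_eq u0 pw0 lo_b); move: T5; rewrite XE; lra.
  have T1' : scr s s4.
    case: R1 T1 => a1 a2 a3 [b1 b2 b3]; split; rewrite ?b1 ?b2 // => x Hx.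
    by have [-> ->] := b3 x Hx; exact: a3.
  have [_ U29 _ _] := st 29%N s4 isT T1'; have [_ _ U41 _] := st 41%N s4 isT T1'.
  have [Dt _] := Hzz t tth.
  apply: det_run => //; split; first by rewrite /= T2.
  split=> //=.
  + by do ![apply: scr_setN => //|apply: scr_setR => //].
  + rewrite /upd /= T2 // R2 T3 // R7 Q3 U29 U41 T4 (cc2 _ _ T1') big_nat_recr //= addrA.
    congr (_ + _); rewrite Ez -/t -Dt /te0; ring.
  + move=> _; have Et2 : (th s0 - k.+1 = t)%N by rewrite /t -subnDA add1n.
    by rewrite /upd /= Et2 -/lo T6 XE Ez; ring.
- move=> s' [Q1 Q2 Q3 _]; apply: HQ => //.
  rewrite Q3 -/b.
  have -> : \sum_(0 <= k' < th s0) rarr s 62 (throw s0 (th s0 - 1 - k')) * Dg (th s0 - 1 - k')%N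
     = \sum_(0 <= k' < th s0) rarr s 62 (throw s0 k') * Dg k'.
    rewrite [RHS]big_nat_rev /=; apply: eq_big_nat => k' _.
    by rewrite add0n (_ : (th s0 - 1 - k' = th s0 - k'.+1)%N) //; lia.
  rewrite /Dg (g_hrow G (fun i => rarr s 62 i * dot d b (wr i))) big_mkcond /=.
  rewrite /yv /dot; under [RHS]eq_bigr do rewrite mulrDr mulr_sumr.
  rewrite [RHS]big_split /=; congr (_ + _).
  rewrite exchange_big /=; apply: eq_big_nat => i' /andP[_ Hi'].
  case: ifP => [_|]; first by rewrite mulr_sumr; apply: eq_bigr => j _; ring.
  move/negbT; rewrite -eqn0Ngt => /eqP Hz; rewrite big1 // => j _.
  by rewrite (Hcc _ Hi' Hz) mul0r mulr0.
Qed.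

End RowStep.

(** * A complete row step *)

Section CRow.
Variable R : realType.
Variables (n d m : nat) (er ec : nat -> nat) (ev : nat -> R).
Hypothesis er_lt : forall e, (e < m)%N -> (er e < n)%N.
Hypothesis ec_lt : forall e, (e < m)%N -> (ec e < d)%N.
Variable s0 : store R.
Hypothesis G : Good n d m er ec ev s0.
Hypothesis erc_inj : forall e e', (e < m)%N -> (e' < m)%N ->
  er e = er e' -> ec e = ec e' -> e = e'.
Let wr := wrow m er ec (twe s0).
Local Notation yvs := (yv n m er ec s0).
Local Notation ccs := (ccok n s0).

Definition Trow K := (160 * K + th s0 * (12 * nvar s0 28 + 60) + 80)%N.

Definition row_post (s s' : store R) := [/\ same 56 s s',
  (forall x, (56 <= x < 61)%N -> rarr s' x = rarr s x), nvar s' 56 = nvar s 56 & ccs s'].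

(** The step adds eta times the gradient and subtracts kk (b . y) times a second copy of the row,
    exact or sampled, in time of order [tK s0 i] plus the cost of reading the digits. The drift
    costs one scalar addition. *)
Lemma crow_spec s i (eta : R) Psi :
  same 52 s0 s -> nvar s 57 = i -> (i < n)%N -> ccs s -> rvar s0 48 = eta ->
  wp crow s (Trow (tK s0 i)) (row_post s) (fun s' => Psi (yvs s'))
    (row_expect d m er ec (twe s0) (tK s0 i) i (tWt s0 i) (tTT s0 i) (tce s0) (tkap s0 i)
       (a0f m er ec ev s0 i) (tsmp s0 i) (0 < tinH s0 i)%N Psi (yvs s)
       (lc 1 (yvs s) eta (rarr s 59)) (eta * (tWr s0)%:R / (tcr s0 i)%:R)).
Proof.
move=> S0 Ei Hi Hcc Eeta.
have [le1 le2] := g_cnt G Hi.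
set y := yvs s; set kk := _ / _; set y1 := lc 1 y _ _.
set len := (thc s0 i + tsmp s0 i)%N.
have st x s' : (16 <= x < 52)%N || (x < 4)%N -> same 56 s s' ->
   [/\ nvar s' x = nvar s0 x, rvar s' x = rvar s0 x, narr s' x = narr s0 x & rarr s' x = rarr s0 x].
  move=> Hx Ss'; have [|-> -> -> ->] := Ss' x; first by move: Hx; rewrite /kept; lia.
  by apply: S0; move: Hx; rewrite /kept; lia.
rewrite /row_expect; set h1 := fun b : nat -> R => _.
have HG := gen_spec (h := h1) ec_lt G S0 Ei Hi.
apply: (wp_seqT (T2 := Trow (tK s0 i) - (40 * tK s0 i + 17)) _ HG); first by rewrite /Trow; lia.
move=> s1 [S1 S2 S3 S4 S5].
have S1' : same 56 s s1 by apply: same_le S1.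
have S01 : same 52 s0 s1 by apply: same_trans S0 (same_le _ S1').
have k1 x : (56 <= x < 64)%N -> [/\ nvar s1 x = nvar s x, rvar s1 x = rvar s x & rarr s1 x = rarr s x].
  by move=> Hx; have [|-> -> _ ->] := S1 x; first by rewrite /kept; lia.
have yE s' : rarr s' 61 = rarr s 61 -> rvar s' 56 = rvar s 56 -> rarr s' 59 = rarr s 59 ->
    rarr s' 62 = rarr s 62 -> yvs s' = y.
  by rewrite /y /yv => -> -> -> ->.
have y_1 : yvs s1 = y.
  by apply: yE; [have [_ _ ->] := k1 61%N isT|have [_ -> _] := k1 56%N isT|have [_ _ ->] := k1 59%N isT|have [_ _ ->] := k1 62%N isT].
have cc1 : ccs s1 by move=> i' Hi' Hz; have [_ _ ->] := k1 62%N isT; exact: Hcc.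
apply: (@wp_detseqT _ _ _ _ (Tdot s0 len) (80 * tK s0 i + 35)); first by rewrite /Tdot /Trow /len; lia.
apply: (dot_spec G erc_inj S01 Hi cc1 S3 S4 S5) => s2 U1 U2.
have U1' : same 56 s s2 by apply: scr_same U1 S1'.
have [_ _ UN] := st 23%N s2 isT U1'; have [UW _ _ _] := st 24%N s2 isT U1' => _.
have [_ U48 _ _] := st 48%N s2 isT U1'.
have [Una Ura Uo] := U1.
have U57 : nvar s2 57 = i by have [-> _] := Uo 57%N isT; have [-> _ _] := k1 57%N isT.
have U56 : rvar s2 56 = rvar s 56 by have [_ ->] := Uo 56%N isT; have [_ -> _] := k1 56%N isT.
have V56 : nvar s2 56 = nvar s 56 by have [-> _] := Uo 56%N isT; have [-> _ _] := k1 56%N isT.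
have Ur x : (56 <= x < 64)%N -> rarr s2 x = rarr s x by move=> Hx; rewrite Ura; have [_ _ ->] := k1 x Hx.
apply: (@wp_detseqT _ _ _ _ 1 (80 * tK s0 i + 33)); first lia.
apply: det_run => //; set s3 := run _ _.
pose q := kk * dot d (bufv s1 len) y.
have W12 : rvar s3 12 = q.
  by rewrite /s3 /= /upd /= U48 Eeta UW U57 UN U2 y_1.
have Q3 : scr s2 s3 by rewrite /s3; apply: scr_setR => //; exact: scr_refl.
have S3' : same 56 s s3 by apply: scr_same Q3 U1'.
have E57 : nvar s3 57 = i by [].
have E56 : rvar s3 56 = rvar s 56 by [].
have F56 : nvar s3 56 = nvar s 56 by [].
have Er x : (56 <= x < 64)%N -> rarr s3 x = rarr s x by move=> Hx; rewrite -Ur.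
have [_ E48 _ _] := st 48%N s3 isT S3'; have [_ _ E25 _] := st 25%N s3 isT S3'.
clearbody s3; clear s2 U1 U2 U1' UN UW U48 Una Ura Uo U57 U56 V56 Ur Q3.
pose fin s4 := [/\ same 56 s s4, (forall x, (56 <= x < 61)%N -> rarr s4 x = rarr s x),
  nvar s4 56 = nvar s 56, ccs s4 & rvar s4 56 = rvar s 56].
(* The iterate including the drift, which the last command of [crow] still has to add to variable
   56. *)
pose y4 (s4 : store R) := lc 1 (yvs s4) eta (rarr s 59).
apply: (@wp_seqT _ _ _ _ (80 * tK s0 i + 30) 1 _ _ _ _ fin (fun s4 => Psi (y4 s4))); first lia; last first.
  move=> s4 [G1 G2 G3 G4 G5].
  have [_ H48 _ _] := st 48%N s4 isT G1.
  apply: wp_run => //.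
    by split=> //; keep.
  apply: eqR_le; congr Psi; apply/funext => j.
  rewrite /y4 /lc /yv  /= /upd /= G5 H48 Eeta (G2 59%N isT); ring.
apply: (@wp_conseq _ _ _ (80 * tK s0 i + 29).+1 _ fin fin (fun s4 => Psi (y4 s4)) (fun s4 => Psi (y4 s4)) (h1 (bufv s1 len))) => //; first lia.
apply: wp_if.
  rewrite /= E57 E25 => Hin.
  apply: wp_run => //; first by rewrite /=; lia.
    split=> //=; [by keep|by move=> x Hx; rewrite /upd (_ : (x == 62%N) = false); [apply: Er; lia|apply/eqP; lia]|].
    move=> i' Hi' Hz; rewrite /= /upd /= E57; case: eqP => [E|_].
      by rewrite -/(tinH s0) -E Hz in Hin.
    by rewrite Er //; exact: Hcc.
  rewrite /h1 [X in if X then _ else _]Hin; apply: eqR_le; congr Psi; apply/funext => j.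
  rewrite /y4 /y1 /lc /y /yv  /= /upd /= E57 W12 E56 -/q !Er //.
  have -> : \sum_(0 <= i0 < n) (if i0 == i then rarr s 62 i - q else rarr s 62 i0) * wr i0 j
     = \sum_(0 <= i0 < n) rarr s 62 i0 * wr i0 j - q * wr i j.
    rewrite (bigD1_seq i) ?mem_index_iota ?iota_uniq //= [in RHS](bigD1_seq i) ?mem_index_iota ?iota_uniq //= eqxx.
    have -> : \sum_(0 <= i0 < n | i0 != i) (if i0 == i then rarr s 62 i - q else rarr s 62 i0) * wr i0 j = \sum_(0 <= i0 < n | i0 != i) rarr s 62 i0 * wr i0 j.
      by apply: eq_bigr => i0 /negbTE ->.
    ring.
  rewrite /wr; ring.
rewrite /= E57 E25 -leqNgt leqn0 => /eqP Hin.
have Hin' : (0 < tinH s0 i)%N = false by rewrite /tinH Hin.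
rewrite {1}/h1 Hin' -/q.
have S03 : same 52 s0 s3 by apply: same_trans S0 (same_le _ S3').
set h2 := fun b' => Psi (lc 1 y1 (- q) b').
have HG2 := gen_spec (h := h2) ec_lt G S03 E57 Hi.
apply: (wp_seqT (T2 := 2 * tK s0 i * (5 + 3) + 3) _ HG2); first lia.
move=> s5 [V1 V2 V3 V4 V5].
have V1' : same 56 s s5 by apply: same_trans S3' (same_le _ V1).
have k5 x : (56 <= x < 64)%N -> nvar s5 x = nvar s3 x /\ rarr s5 x = rarr s3 x.
  by move=> Hx; have [|-> _ _ ->] := V1 x; first by rewrite /kept; lia.
rewrite -/len in V3 *.
pose I k s' := [/\ same 56 s s', nvar s' 10 = k,
   (forall x, x != 61%N -> rarr s' x = rarr s5 x),
   (forall j, rarr s' 61 j = rarr s 61 j - q * bufv s5 k j) &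
   [/\ narr s' = narr s5, nvar s' 56 = nvar s 56, nvar s' 64 = len, rvar s' 12 = q & rvar s' 56 = rvar s 56]].
apply: (det_wp (Q := I len)); last first.
  move=> s' [J1 J2 J3 J4 [J5 J6 J7 J8 J9]]; split.
    split=> //.
      by move=> x Hx; rewrite J3; [have [|_ ->] := k5 x; [lia|apply: Er; lia]|lia].
    by move=> i' Hi' Hz; rewrite J3 //; have [|_ ->] // := k5 62%N; rewrite Er //; exact: Hcc.
  rewrite /h2; apply: eqR_le; congr Psi; apply/funext => j.
  rewrite /y4 /y1 /lc /y /yv  J4 J9 !J3 //.
  have [|_ ->] // := k5 62%N; have [|_ ->] // := k5 59%N; rewrite !Er //; ring.
apply: (@det_forT _ _ _ _ _ len I 5) => //.
- by rewrite /len; lia.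
- split=> //=; first by keep.
  + by move=> j; have [|_ ->] // := k5 61%N; rewrite Er // /bufv big_geq // mulr0 subr0.
  + rewrite /upd /= V2 W12 V3; split=> //.
    by have [|-> _] // := k5 56%N.
- by move=> k s' Hk [J1 J2 J3 J4 [J5 J6 J7 J8 J9]].
- move=> k s' Hk [J1 J2 J3 J4 [J5 J6 J7 J8 J9]].
  apply: det_run => //; split=> //; split=> //=; first by keep.
  + by move=> x /negbTE Hx; rewrite /upd Hx J3 // Hx.
  + move=> j; rewrite /upd /= J2 J5 (J3 64%N) // J8 J4.
    rewrite [bufv s5 k.+1 j]big_mkcond big_nat_recr //= -big_mkcond /= -/(bufv s5 k j) eq_sym.
    by case: eqP => [->|_]; rewrite ?J4; ring.
Qed.
End CRow.

(** * Amortised running time *)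

Section Credit.
Variable R : realType.
Implicit Types (c : cmd) (s : store R) (T t : nat).
Implicit Types (Q : store R -> Prop) (psi : store R -> R) (C : store R -> nat).

(* [wp] with amortised running time: a final memory [s'] still owns the unspent
   credit [C s']. *)
Definition wpt c s T C Q psi (v : R) : Prop :=
  forall k t P, (forall s', Q s' -> psi s' <= halt_prob (C s' + t) P (k, s')) ->
  v <= halt_prob (T + t) P (c :: k, s).

Lemma wpt_wp c s T T' C Q psi v : (T <= T')%N -> wp c s T Q psi v ->
  (forall s', Q s' -> (C s' + T <= T')%N) -> wpt c s T' C Q psi v.
Proof.
move=> leT H HT k t P Hk.
have -> : (T' + t = T + (T' - T + t))%N by lia.
apply: H => s' Qs'; apply: le_trans (Hk _ Qs') _; apply: halt_prob_mono.
by have := HT _ Qs'; lia.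
Qed.

Lemma wp_wpt c s T Q psi v : wpt c s T (fun=> 0%N) Q psi v -> wp c s T Q psi v.
Proof. by move=> H k t P Hk; apply: H. Qed.

Lemma wpt_conseq c s T T' C C' Q Q' psi psi' v v' :
  (T <= T')%N -> v' <= v ->
  (forall s', Q s' -> [/\ Q' s', psi s' <= psi' s' & (C' s' <= C s')%N]) ->
  wpt c s T C Q psi v -> wpt c s T' C' Q' psi' v'.
Proof.
move=> leT lev HQ H k t P Hk; apply: le_trans lev _.
apply: (le_trans (H k t P _)); last by apply: halt_prob_mono; rewrite leq_add2r.
move=> s' /HQ [Qs' le' leC]; apply: le_trans le' (le_trans (Hk _ Qs') _).
by apply: halt_prob_mono; rewrite leq_add2r.
Qed.

Lemma wpt_seq c1 c2 s T T1 C1 C Q psi v Q1 psi1 : (T1 < T)%N ->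
  wpt c1 s T1 C1 Q1 psi1 v ->
  (forall s1, Q1 s1 -> wpt c2 s1 (C1 s1) C Q psi (psi1 s1)) ->
  wpt (CSeq c1 c2) s T C Q psi v.
Proof.
move=> leT H1 H2 k t P Hk.
apply: (@le_trans _ _ (halt_prob (T1.+1 + t) P ((c1;; c2) :: k, s))); last first.
  by apply: halt_prob_mono; rewrite leq_add2r.
by rewrite addSn /= big_seq1 mul1r; apply: H1 => s1 Qs1; apply: H2.
Qed.

Lemma wpt_detseq c1 c2 s T T1 T2 C Q psi v : (T1 + T2 < T)%N ->
  det c1 s T1 (fun s1 => wpt c2 s1 T2 C Q psi v) ->
  wpt (CSeq c1 c2) s T C Q psi v.
Proof.
move=> leT [s1 H2 H1] k t P Hk.
apply: (@le_trans _ _ (halt_prob ((T1 + T2).+1 + t) P ((c1;; c2) :: k, s))); last first.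
  by apply: halt_prob_mono; rewrite leq_add2r.
rewrite addSn /= big_seq1 mul1r -addnA; apply: le_trans (H1 _ _ _).
exact: H2.
Qed.

Lemma wpt_run c s T C Q psi v : simple c -> Q (run c s) ->
  (cost c + C (run c s) <= T)%N -> v <= psi (run c s) -> wpt c s T C Q psi v.
Proof.
move=> Sc HQ leT Hv.
apply: (@wpt_conseq c s T T C C (fun s' => s' = run c s /\ Q s') Q psi psi v v) => //.
  by move=> s' [_ ?].
apply: (@wpt_wp c s (cost c)); first lia.
  exact: wp_run.
by move=> s' [-> _]; lia.
Qed.

Lemma wpt_if b c1 c2 s T T1 C Q psi v : (T1 < T)%N ->
  (beval s b -> wpt c1 s T1 C Q psi v) -> (~~ beval s b -> wpt c2 s T1 C Q psi v) ->
  wpt (CIf b c1 c2) s T C Q psi v.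
Proof.
move=> leT H1 H2 k t P Hk.
apply: (@le_trans _ _ (halt_prob (T1.+1 + t) P (CIf b c1 c2 :: k, s))); last first.
  by apply: halt_prob_mono; rewrite leq_add2r.
rewrite addSn /= big_seq1 mul1r.
by case: ifP => E; [apply: H1|apply: H2; rewrite ?E].
Qed.

Lemma wpt_whileF b c s T C Q psi v : (C s < T)%N ->
  ~~ beval s b -> Q s -> v <= psi s -> wpt (CWhile b c) s T C Q psi v.
Proof.
move=> leT E Qs Hv k t P Hk; apply: le_trans Hv (le_trans (Hk _ Qs) _).
apply: (@le_trans _ _ (halt_prob ((C s).+1 + t) P (CWhile b c :: k, s))); last first.
  by apply: halt_prob_mono; rewrite leq_add2r.
by rewrite addSn /= big_seq1 mul1r (negbTE E).
Qed.

Lemma wpt_whileT b c s T T1 C1 C Q psi v Q1 psi1 : (T1 < T)%N ->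
  beval s b -> wpt c s T1 C1 Q1 psi1 v ->
  (forall s1, Q1 s1 -> wpt (CWhile b c) s1 (C1 s1) C Q psi (psi1 s1)) ->
  wpt (CWhile b c) s T C Q psi v.
Proof.
move=> leT E H1 H2 k t P Hk.
apply: (@le_trans _ _ (halt_prob (T1.+1 + t) P (CWhile b c :: k, s))); last first.
  by apply: halt_prob_mono; rewrite leq_add2r.
by rewrite addSn [leRHS]/= big_seq1 mul1r E; apply: H1 => s1 Qs1; apply: H2.
Qed.

End Credit.

(** * Elementary loops over arrays *)

Section Loops.
Variable R : realType.
Implicit Types (s : store R).

Definition set_rarr s a (f : nat -> R) : store R :=
  Store (nvar s) (rvar s) (narr s) (upd (rarr s) a f).

Lemma same_setRA L s s' x f :
  ~~ kept L x -> same L s s' -> same L s (set_rarr s' x f).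
Proof.
move=> Hx H y Hy; have [E1 E2 E3 E4] := H _ Hy; split=> //=.
by rewrite /upd; case: eqP Hy Hx => // -> ->.
Qed.

Lemma fresh_setRA L s x f : (x < L)%N -> fresh L s -> fresh L (set_rarr s x f).
Proof.
move=> Hx H y Hy; have [E1 E2 E3 E4] := H _ Hy; split=> //=.
by rewrite /upd; case: eqP => // E; lia.
Qed.

Lemma upd_id (T : Type) (f : nat -> T) a : upd f a (f a) = f.
Proof. by apply/funext => x; rewrite /upd; case: eqP => // ->. Qed.

Lemma upd_upd (T : Type) (f : nat -> T) a u v : upd (upd f a u) a v = upd f a v.
Proof. by apply/funext => x; rewrite /upd; case: eqP. Qed.

Definition cmap a x E := CFor 4 (NVar x) (CPutR a (NVar 4) E).

(** When cell [j] is computed it still has its old value, so [E] may refer to the cell that it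
    overwrites. *)
Lemma cmap_spec s a x E f k T Q : x != 4%N -> nvar s x = k -> (4 * k + 3 <= T)%N ->
  (forall j A, (j < k)%N -> A j = rarr s a j ->
     reval (set_nvar (set_rarr s a A) 4 j) E = f j) ->
  Q (set_nvar (set_rarr s a (fun j => if (j < k)%N then f j else rarr s a j)) 4 k) ->
  det (cmap a x E) s T Q.
Proof.
move=> Hx Ek leT HE HQ.
pose A j j' := if (j' < j)%N then f j' else rarr s a j'.
pose I j s' := s' = set_nvar (set_rarr s a (A j)) 4 j.
apply: (@det_forT _ _ _ _ _ k I 1) => //.
- lia.
- rewrite /I /set_nvar /set_rarr /= /A /=; congr Store.
  by rewrite (_ : (fun j' => _) = rarr s a) ?upd_id //; apply/funext.
- by move=> j s' Hj ->; rewrite /= /upd eqxx (negbTE Hx).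
- move=> j s' Hj ->; have Ev : reval (set_nvar (set_rarr s a (A j)) 4 j) E = f j.
    by apply: HE => //; rewrite /A ltnn.
  apply: det_run => //=; split; first by rewrite /upd eqxx.
  rewrite Ev /I /set_nvar /put_rarr /set_rarr /= !upd_upd; congr Store.
  congr upd; apply/funext => j'; rewrite /upd !eqxx /A.
  by case: (ltngtP j' j) => [H|H|->]; rewrite ?ltnSn // ltnS; [rewrite ltnW|rewrite leqNgt H].
- by move=> s' ->.
Qed.

Definition cscatter a x I E := CFor 4 (NVar x) (CPutR a I (RAdd (RGet a I) E)).

Lemma cscatter_spec s a x I E ix vl k T Q :
  x != 4%N -> nvar s x = k -> (4 * k + 3 <= T)%N ->
  (forall e A, (e < k)%N -> let t := set_nvar (set_rarr s a A) 4 e in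
     neval t I = ix e /\ reval t E = vl e) ->
  Q (set_nvar (set_rarr s a
      (fun j => rarr s a j + \sum_(0 <= e < k | ix e == j) vl e)) 4 k) ->
  det (cscatter a x I E) s T Q.
Proof.
move=> Hx Ek leT HE HQ.
pose A e j := rarr s a j + \sum_(0 <= e' < e | ix e' == j) vl e'.
pose J j s' := s' = set_nvar (set_rarr s a (A j)) 4 j.
apply: (@det_forT _ _ _ _ _ k J 1) => //.
- lia.
- rewrite /J /set_nvar /set_rarr /= /A /=; congr Store.
  rewrite (_ : (fun j' => _) = rarr s a) ?upd_id //; apply/funext => j.
  by rewrite big_geq // addr0.
- by move=> j s' Hj ->; rewrite /= /upd eqxx (negbTE Hx).
- move=> e s' He ->; have [E1 E2] := HE e (A e) He.
  apply: det_run => //=; split; first by rewrite /upd eqxx.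
  rewrite E1 E2 /J /set_nvar /put_rarr /set_rarr /= !upd_upd; congr Store.
  congr upd; apply/funext => j; rewrite /upd !eqxx /A.
  rewrite [in RHS]big_mkcond big_nat_recr //= -big_mkcond /= addrA [ix e == j]eq_sym.
  by case: eqP => [->|_]; rewrite ?addr0.
- by move=> s' ->.
Qed.

Definition cnscatter a x I := CFor 4 (NVar x) (CPutN a I (NAdd (NGet a I) (NConst 1))).

Lemma cnscatter_spec s a x I ix k T Q :
  x != 4%N -> nvar s x = k -> (4 * k + 3 <= T)%N ->
  (forall e A, (e < k)%N -> neval (set_nvar (set_narr s a A) 4 e) I = ix e) ->
  Q (set_nvar (set_narr s a
      (fun j => narr s a j + \sum_(0 <= e < k | ix e == j) 1)%N) 4 k) ->
  det (cnscatter a x I) s T Q.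
Proof.
move=> Hx Ek leT HE HQ.
pose A e j := (narr s a j + \sum_(0 <= e' < e | ix e' == j) 1)%N.
pose J j s' := s' = set_nvar (set_narr s a (A j)) 4 j.
apply: (@det_forT _ _ _ _ _ k J 1) => //.
- lia.
- rewrite /J /set_nvar /set_narr /= /A /=; congr Store.
  rewrite (_ : (fun j' => _) = narr s a) ?upd_id //; apply/funext => j.
  by rewrite big_geq // addn0.
- by move=> j s' Hj ->; rewrite /= /upd eqxx (negbTE Hx).
- move=> e s' He ->; have E1 := HE e (A e) He.
  apply: det_run => //=; split; first by rewrite /upd eqxx.
  rewrite E1 /J /set_nvar /put_narr /set_narr /= !upd_upd; congr Store.
  congr upd; apply/funext => j; rewrite /upd !eqxx /A.
  rewrite [in RHS]big_mkcond big_nat_recr //= -big_mkcond /= addnA [ix e == j]eq_sym.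
  by case: eqP => [->|_]; rewrite ?addn0.
- by move=> s' ->.
Qed.

Definition csum x y E := CFor 4 (NVar x) (CSetR y (RAdd (RVar y) E)).

Lemma csum_spec s x y E vl k T Q : x != 4%N -> nvar s x = k -> (4 * k + 3 <= T)%N ->
  (forall e V, (e < k)%N -> reval (set_nvar (set_rvar s y V) 4 e) E = vl e) ->
  Q (set_nvar (set_rvar s y (rvar s y + \sum_(0 <= e < k) vl e)) 4 k) ->
  det (csum x y E) s T Q.
Proof.
move=> Hx Ek leT HE HQ.
pose A e := rvar s y + \sum_(0 <= e' < e) vl e'.
pose J j s' := s' = set_nvar (set_rvar s y (A j)) 4 j.
apply: (@det_forT _ _ _ _ _ k J 1) => //.
- lia.
- by rewrite /J /set_nvar /set_rvar /= /A big_geq // addr0 upd_id.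
- by move=> j s' Hj ->; rewrite /= /upd eqxx (negbTE Hx).
- move=> e s' He ->; have E1 := HE e (A e) He.
  apply: det_run => //=; split; first by rewrite /upd eqxx.
  rewrite E1 /J /set_nvar /set_rvar /= !upd_upd; congr Store.
  by congr upd; rewrite /upd eqxx /A big_nat_recr //= addrA.
- by move=> s' ->.
Qed.

(** Naturals have no product in the language; multiplication by a constant is a repeated sum. *)
Fixpoint nmul k e := if k is k'.+1 then NAdd e (nmul k' e) else NConst 0.

Lemma neval_nmul s k e : neval s (nmul k e) = (k * neval s e)%N.
Proof. by elim: k => //= k ->; rewrite mulSn. Qed.

End Loops.
Arguments nmul : simpl never.

Ltac keep ::= repeat first
  [ assumption | apply: same_refl
  | apply: same_setN; [by []|] | apply: same_setR; [by []|]
  | apply: same_putN; [by []|] | apply: same_putR; [by []|] | apply: same_setA; [by []|]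
  | apply: same_setRA; [by []|]
  | apply: fresh_setN; [by []|] | apply: fresh_setR; [by []|]
  | apply: fresh_putN; [by []|] | apply: fresh_putR; [by []|] | apply: fresh_setA; [by []|]
  | apply: fresh_setRA; [by []|] ].

(** * The inner loop: budgets, stopping and expected value *)

Definition cstep := CUnif 57 (NVar 24);; CSetN 57 (NGet 24 (NVar 57));;
  CSetN 53 (NSub (NVar 53) (NGet 20 (NVar 57)));; crow.
(** Variables 52 and 53 are the budgets for steps and for samples, and 56 is the running flag. One
    of the [nvar 48] outcomes stops the run, which gives the geometric time with p = 1 / (1 + 768
    N). *)
Definition cloop := CSetN 52 (NSub (NVar 52) (NConst 1));; CUnif 10 (NVar 48);;
  CIf (BLeN (NVar 10) (NConst 0)) (CSetN 56 (NConst 0)) cstep.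
Definition cinner :=
  CWhile (BAnd (BLeN (NConst 1) (NVar 56))
    (BAnd (BLeN (NConst 1) (NVar 52)) (BLeN (NConst 1) (NVar 53)))) cloop.

Section InnerValue.
Variable R : realType.
Variables (dd ad : (nat -> R) -> (nat -> R) -> R) (gam : R).
Hypotheses (Bd : bilin dd) (Ba : bilin ad).
Hypotheses (d0 : forall u, 0 <= dd u u) (a0 : forall u, 0 <= ad u u) (g0 : 0 < gam).
Variables (yh lam : nat -> R) (c0 th : R).
Hypothesis th0 : 0 <= th.
Local Notation h := (hform dd ad gam).

Lemma bilin0 B u : bilin B -> B u (fun=> 0) = 0 :> R.
Proof.
move=> HB; rewrite (_ : (fun=> 0) = lc 0 u 0 u); first by rewrite bilinr // !mul0r addr0.
by apply/funext => j; rewrite /lc !mul0r addr0.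
Qed.

Lemma gam_dd_le u : gam * dd u u <= h u u.
Proof. by rewrite /hform lerDr. Qed.

(** [yh + gam v] is the mean of the stopped iterate of a run from [y]. Its payoff has the same
    linear part as [inner_value y] and no larger quadratic part, so nonnegativity carries over. *)
Lemma inner_value_ge0 y v : (forall u, h v u = dd y u) ->
  (forall u, 0 <= c0 + h lam u + th * h u u) -> 0 <= inner_value dd ad gam yh lam c0 th y.
Proof.
move=> vE Hp; have g0' := g0; have HB := bilin_hform gam Bd Ba.
have h0 u := hform_ge0 d0 a0 g0 u.
have H := Hp (lc 1 yh gam v); rewrite /inner_value.
have E1 : h lam (lc 1 yh gam v) = h lam yh + gam * dd lam y.
  by rewrite bilinr // (bilinC lam v HB) vE (bilinC y lam Bd) mul1r.
rewrite E1 in H.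
set Y := h yh yh; set ee := dd (lc 1 y (-1) yh) _.
have H1 : h (lc 1 yh gam v) (lc 1 yh gam v) <= 2 * Y + 2 * (gam * (gam * dd y v)).
  have := h0 (lc 1 yh (- gam) v).
  rewrite !(bilinl _ _ _ _ _ HB, bilinr _ _ _ _ _ HB) !vE (bilinC yh v HB) vE -/Y; lra.
have H2 : gam * dd y v <= dd y y.
  have := d0 (lc 1 y (- gam) v).
  rewrite !(bilinl _ _ _ _ _ Bd, bilinr _ _ _ _ _ Bd) (bilinC v y Bd).
  have : gam * (gam * dd v v) <= gam * dd y v by rewrite ler_pM2l // -(vE v); exact: gam_dd_le.
  lra.
have H3 : dd y y <= 2 * ee + 2 * dd yh yh.
  have := d0 (lc 1 y (-2) yh).
  rewrite /ee !(bilinl _ _ _ _ _ Bd, bilinr _ _ _ _ _ Bd) (bilinC yh y Bd); lra.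
have H4 : gam * (gam * dd y v) <= gam * dd y y by rewrite ler_pM2l.
have H5 : gam * dd y y <= gam * (2 * ee + 2 * dd yh yh) by rewrite ler_pM2l.
have H6 := gam_dd_le yh; rewrite -/Y in H6.
have ee0 : 0 <= gam * ee by rewrite mulr_ge0 ?d0 // ltW.
have Y0 : 0 <= Y := h0 yh.
have H7 : th * h (lc 1 yh gam v) (lc 1 yh gam v) <= th * (8 * gam * ee + 21 * Y).
  by apply: ler_wpM2l => //; lra.
lra.
Qed.

Lemma inner_value0_le :
  inner_value dd ad gam yh lam c0 th (fun=> 0) <= c0 + h lam yh + th * (32 * h yh yh).
Proof.
have HB := bilin_hform gam Bd Ba.
rewrite /inner_value (bilin0 lam Bd) !(bilinl _ _ _ _ _ Bd, bilinr _ _ _ _ _ Bd).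
rewrite (bilin0 _ Bd) (bilinC (fun=> 0) yh Bd) !(bilin0 _ Bd).
have H1 := gam_dd_le yh; have H0 := hform_ge0 d0 a0 g0 yh.
have : th * (8 * (gam * dd yh yh) + 21 * h yh yh) <= th * (32 * h yh yh) by apply: ler_wpM2l => //; lra.
lra.
Qed.
End InnerValue.

Section InnerLoop.
Variable R : realType.
Variables (n d m : nat) (er ec : nat -> nat) (ev : nat -> R).
Hypothesis er_lt : forall e, (e < m)%N -> (er e < n)%N.
Hypothesis ec_lt : forall e, (e < m)%N -> (ec e < d)%N.
Hypothesis erc_inj : forall e e', (e < m)%N -> (e' < m)%N ->
  er e = er e' -> ec e = ec e' -> e = e'.
Variable s0 : store R.
Hypothesis G : Good n d m er ec ev s0.
Hypothesis F0 : 0 < frob m ev.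
Hypothesis etaE : rvar s0 48 * (768 * frob m ev) = 1.
Hypothesis q1E : nvar s0 48 = (1 + 768 * tN s0)%N.
Hypothesis aF : forall u, gram n d m er ec (twe s0) u u <= frob m ev * dot d u u.
Hypothesis Kd : forall i, (i < n)%N -> (tK s0 i <= d)%N.
Local Notation gam := (rvar s0 19).
Local Notation eta := (rvar s0 48).
Local Notation gr := (gram n d m er ec (twe s0)).
Local Notation hf := (hform (dot d) gr gam).
Hypothesis solv : forall w, exists v, forall u, hf v u = dot d w u.
Local Notation yvs := (yv n m er ec s0).
Local Notation ccs := (ccok n s0).
Variables (cS cK dv : R) (FS FK : nat).
Hypotheses (cS0 : 0 <= cS) (cK0 : 0 <= cK).
Hypotheses (cSE : 1 <= dv + cS * FS%:R) (cKE : 1 <= dv + cK * FK%:R).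

(** The price of what has been spent so far, in units of probability. By [cSE] and [cKE] an
    exhausted budget is so expensive that the value left is at most [dv]. *)
Definition fuel (s : store R) : R :=
  cS * (FS%:R - (nvar s 52)%:R) + cK * (FK%:R - (nvar s 53)%:R).
Definition alive (s : store R) := (0 < nvar s 52)%N && (0 < nvar s 53)%N.
Definition meanK : R := (\sum_(0 <= i < n) (tcr s0 i)%:R * (tK s0 i)%:R) / (tWr s0)%:R.
(** The expected number of samples in the rest of a run: there are (1 - p) / p = 768 N further row
    steps in the mean, with [meanK] samples each. *)
Definition rk : R := 768 * (tN s0)%:R * meanK.
Definition Astep := (th s0 * (12 * nvar s0 28 + 60))%N.
(** The time that the remaining budgets pay for. Subtraction from counter 53 is truncated, so the
    last row step may use up to [d] samples more than the counter had left; the term with [160 * d]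
    covers this. *)
Definition cred (s : store R) := ((Astep + 110) * nvar s 52 + 160 * nvar s 53 +
  160 * d * (0 < nvar s 53))%N.
Local Notation q1 := ((1 + 768 * tN s0)%:R : R).
Local Notation p := (1 / q1 : R).

Lemma N_gt0 : 0 < (tN s0)%:R :> R. Proof. by rewrite ltr0n (g_N G). Qed.
Lemma gam_gt0 : 0 < gam.
Proof. by rewrite (g_gam G) divr_gt0 ?N_gt0. Qed.
Lemma gam_leF : gam <= frob m ev.
Proof.
rewrite (g_gam G) ler_pdivrMr ?N_gt0 // ler_peMr ?(ltW F0) //.
by rewrite ler1n (g_N G).
Qed.
Lemma q1_eq : q1 = 1 + 768 * (tN s0)%:R. Proof. by rewrite natrD natrM. Qed.
Lemma pE : (1 - p) * (eta * gam) = p.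
Proof.
have N0 := N_gt0; have F0' := F0; have etaE' := etaE.
have e1 : eta = 1 / (768 * frob m ev).
  apply: (mulIf (x := 768 * frob m ev)); first by rewrite gt_eqF // mulr_gt0.
  by rewrite etaE' mul1r mulVf // gt_eqF // mulr_gt0.
rewrite e1 (g_gam G) q1_eq; field.
rewrite (gt_eqF F0) (gt_eqF N0) gt_eqF //; lra.
Qed.

Section Payoff.
Variables (g c0 thc' : R) (lam yh r : nat -> R).
Hypotheses (g1 : g <= 1) (th0 : 0 <= thc').
Hypothesis rE : forall u, dot d r u = hf yh u.
Definition payoff y := c0 + hf lam y + thc' * hf y y.
Hypothesis pay0 : forall y, 0 <= payoff y.
Local Notation IV := (inner_value (dot d) gr gam yh lam c0 thc').
Definition rowx Q y i := row_expect d m er ec (twe s0) (tK s0 i) i (tWt s0 i)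
  (tTT s0 i) (tce s0) (tkap s0 i) (a0f m er ec ev s0 i) (tsmp s0 i)
  (0 < tinH s0 i)%N Q y (lc 1 y eta r) (eta * (tWr s0)%:R / (tcr s0 i)%:R).

Lemma IV_ge0 y : 0 <= IV y.
Proof.
have [v Hv] := solv y.
apply: (inner_value_ge0 (bilin_dot R d) (bilin_gram _ _ _ _ _ _)) Hv pay0 => //.
- exact: dot_ge0.
- exact: gram_ge0.
- exact: gam_gt0.
Qed.

Lemma rowx_opp Q a y i : (i < n)%N -> rowx (fun u => a - Q u) y i = a - rowx Q y i.
Proof.
move=> Hi.
have HW : tsmp s0 i = 0%N \/ (0 < tWt s0 i)%N.
  by case: (g_tail G Hi) => [[-> _]|[[_ _ _ HW] _]]; [left|right].
have gop k (h : (nat -> R) -> R) acc : k = 0%N \/ (0 < tWt s0 i)%N ->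
   gE (tWt s0 i) (tTT s0 i) (accept (twe s0) (tK s0 i) (tWt s0 i) (tce s0) (tkap s0 i))
     (svalue (twe s0) (tkap s0 i)) ec k (fun u => a - h u) acc =
   a - gE (tWt s0 i) (tTT s0 i) (accept (twe s0) (tK s0 i) (tWt s0 i) (tce s0) (tkap s0 i))
     (svalue (twe s0) (tkap s0 i)) ec k h acc.
  by case=> [->|W0] //; apply: gE_opp.
rewrite /rowx /row_expect -gop //; congr gE; apply/funext => b.
by case: ifP => _ //; rewrite gop.
Qed.

Lemma sum_cr : \sum_(0 <= i < n) (tcr s0 i)%:R = (tWr s0)%:R :> R.
Proof.
have := g_rows G (fun=> 1); rewrite sumr_const card_ord => ->.
by apply: eq_bigr => i _; rewrite mulr1.
Qed.

(** [inner_value] is a supermartingale for the stopped process: with probability p the payoff is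
    collected, otherwise one random row step is made. [row_bound] supplies the estimate for each
    row, [step_bound] averages it and [inner_step] closes the recursion. *)
Lemma inner_expect y :
  p * payoff y + (1 - p) * ((\sum_(0 <= i < n) (tcr s0 i)%:R * rowx IV y i) / (tWr s0)%:R)
  <= IV y.
Proof.
have q0 : 0 < q1 by rewrite ltr0n.
have q11 : 1 < q1 by rewrite ltr1n -[X in (X < _)%N]addn0 ltn_add2l muln_gt0 (g_N G).
have p0 : 0 < p by rewrite divr_gt0.
have p1 : p < 1 by rewrite ltr_pdivrMr // mul1r.
have eta0 : 0 < eta by have := etaE; have := F0; nra.
have c20 : 0 <= 8 * thc' * gam by rewrite !mulr_ge0 // ltW // gam_gt0.
have IVE : IV = fun u => ic0 (dot d) gr gam yh lam c0 thc' + dot d (iw gam yh lam thc') u + 8 * thc' * gam * dot d u u.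
  by apply/funext => u; rewrite (inner_valueE _ _ (bilin_dot R d)).
apply: le_trans (inner_step (bilin_dot R d) (bilin_gram _ _ _ _ _ _) (@dot_ge0 R d)
  (@gram_ge0 _ _ _ _ _ _ _) aF F0 gam_gt0 gam_leF etaE p0 p1 pE lam c0 rE th0 y).
rewrite lerD2l; apply: ler_wpM2l; first by lra.
have crP i : (i < n)%N -> (0 < tcr s0 i)%N /\
    (tWr s0)%:R * norm2f m er ev i <= 2 * frob m ev * (tcr s0 i)%:R by exact: (g_cr G).
apply: le_trans (step_bound er_lt (RE := rowx IV y) (g_Wr G) (g_N G) c20 eta0 F0 (g_gam G) sum_cr crP
  (w := iw gam yh lam thc') (y := y) (r := r) (c0 := ic0 (dot d) gr gam yh lam c0 thc') _) _.
  move=> i Hi; rewrite /rowx IVE.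
  apply: (row_bound ec_lt erc_inj (N := tN s0) (head := headf m er ev s0)) => //.
  - exact: (g_we G).
  - exact: (g_N G).
  - move=> E; case: (g_tail G Hi) => [[_ H]|[[E2 K0 _ _] _]] //.
    by rewrite -E2 E in K0.
  - by case: (g_tail G Hi) => [[-> _]|H]; [left|right].
  - by rewrite (g_inH G Hi) -leNgt.
have Bg := bilin_gram n d m er ec (twe s0).
rewrite (bilinl _ _ _ _ _ Bg) /hform; move: (iw _ _ _ _) (ic0 _ _ _ _ _ _ _) => w c.
by apply: eqR_le; ring.
Qed.

Definition guarded s X := if alive s then g - X - fuel s else dv.
Definition Inv sI s := [/\ same 52 s0 s, ccs s,
  (forall x, (56 <= x < 61)%N -> rarr s x = rarr sI x), nvar s 54 = nvar sI 54 &
  (nvar s 52 <= FS)%N /\ (nvar s 53 <= FK)%N].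

(** If a budget is exhausted, its price alone pushes the left side below [dv]. This uses that the
    loss [X] is nonnegative, which is why [IV_ge0] is proved. *)
Lemma val_ge s X : (nvar s 52 <= FS)%N -> (nvar s 53 <= FK)%N -> 0 <= X ->
  g - X - fuel s <= guarded s X.
Proof.
move=> H1 H2 X0; rewrite /guarded; case: ifP => // /negbT; rewrite negb_and -!eqn0Ngt.
have g1' := g1; have := cSE; have := cKE; rewrite /fuel => k1 k2.
have A1 : 0 <= cS * (FS%:R - (nvar s 52)%:R) by rewrite mulr_ge0 // subr_ge0 ler_nat.
have A2 : 0 <= cK * (FK%:R - (nvar s 53)%:R) by rewrite mulr_ge0 // subr_ge0 ler_nat.
by case/orP => /eqP E; move: A1 A2; rewrite E !subr0; lra.
Qed.

Definition Vend s := guarded s (payoff (yvs s)).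
(** A running state is charged in advance for the expected rest of the run: 1/p = q1 passes of the
    loop and [rk] samples. *)
Definition Vin s := if nvar s 56 == 0%N then Vend s
  else guarded s (IV (yvs s) + cS * q1 + cK * rk).

Lemma rk_ge0 : 0 <= rk.
Proof.
rewrite /rk /meanK !mulr_ge0 ?invr_ge0 ?ler0n //.
by apply: sumr_ge0 => i _; rewrite mulr_ge0 ?ler0n.
Qed.

Lemma inner_loop sI s : rarr sI 59 = r -> Inv sI s ->
  wpt cinner s (cred s + 1) cred (Inv sI) Vend (Vin s).
Proof.
move=> Er; have [N leN] := ubnP (nvar s 52); elim: N s leN => // N IH s leN Is.
have [S0 Hcc Hr H54 [HfS HfK]] := Is.
have [|C] := boolP (beval s (BAnd (BLeN (NConst 1) (NVar 56))
    (BAnd (BLeN (NConst 1) (NVar 52)) (BLeN (NConst 1) (NVar 53))))); last first.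
  apply: wpt_whileF => //; first lia.
  rewrite /Vin; case: eqP => // go; move: C; rewrite /=.
  have -> : (0 < nvar s 56)%N by lia.
  by move=> /= /negbTE dead; rewrite /Vend /guarded /alive dead.
move=> C; have /and3P[go fs0 fk0] := C; rewrite /= in go fs0 fk0.
apply: (@wpt_whileT _ _ _ _ _ (cred s) (fun s1 => cred s1 + 1)%N cred _ _ _
   (fun s1 => Inv sI s1 /\ (nvar s1 52 < nvar s 52)%N) Vin) => //; first lia.
  2: by move=> s1 [I1 lt1]; apply: IH => //; lia.
have [f Ef] : exists f, nvar s 52 = f.+1 by exists (nvar s 52).-1; rewrite prednK.
set y := yvs s.
(* [PA] is the value after the stopping draw, [RV i] the value once row [i] has been chosen, and
   [PB] the mean of [RV] over the row table. *)
pose RV i := g - rowx IV y i - fuel s - cS - cS * q1 - cK * ((tK s0 i)%:R + rk).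
pose PB := g - (\sum_(0 <= i < n) (tcr s0 i)%:R * rowx IV y i) / (tWr s0)%:R
   - fuel s - cS - cS * q1 - cK * (meanK + rk).
pose PA := g - payoff y - fuel s - cS.
have crE : cred s = ((Astep + 110) * f + (Astep + 110) + 160 * nvar s 53 + 160 * d)%N.
  by rewrite /cred Ef fk0 mulnS muln1; lia.
have VE : Vin s <= p * PA + (1 - p) * PB.
  rewrite /Vin gtn_eqF // /guarded /alive fs0 fk0 /= -/y.
  have := inner_expect y; rewrite /PA /PB.
  have pq : p * q1 = 1 by rewrite mul1r mulVf // pnatr_eq0.
  set Bb := _ / (tWr s0)%:R; set ff := fuel s => HB.
  have E1 : (1 - p) * (meanK + rk) = rk.
    have E2 : meanK + rk = q1 * meanK by rewrite q1_eq /rk; ring.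
    have gen (a b e : R) : (1 - a) * (b * e) = b * e - a * b * e by ring.
    by rewrite E2 gen pq q1_eq /rk; ring.
  have E3 : (1 - p) * (cS * q1) = cS * q1 - cS.
    have gen (a b e : R) : (1 - a) * (b * e) = b * e - b * (a * e) by ring.
    by rewrite gen pq mulr1.
  have E4 : (1 - p) * (cK * (meanK + rk)) = cK * rk by rewrite mulrCA E1.
  lra.
have st x : (16 <= x < 52)%N || (x < 4)%N ->
   [/\ nvar s x = nvar s0 x, rvar s x = rvar s0 x, narr s x = narr s0 x & rarr s x = rarr s0 x].
  by move=> Hx; apply: S0; move: Hx; rewrite /kept; clear; lia.
apply: (@wpt_detseq _ _ _ _ _ 1 (cred s - 2)); first by clear -crE; rewrite crE; lia.
apply: det_run => //; set s1 := run _ _.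
have k1 : nvar s1 52 = f by rewrite /s1 /= /upd /= Ef subn1.
have k2 : same 52 s0 s1 by rewrite /s1; keep.
have k3 : nvar s1 53 = nvar s 53 /\ nvar s1 54 = nvar s 54 by [].
have k4 : rarr s1 = rarr s /\ yvs s1 = y by [].
have k5 : nvar s1 56 = nvar s 56 by [].
clearbody s1; case: k3 => k3 k3'; case: k4 => k4 k4'.
have fu1 : fuel s1 = fuel s + cS by rewrite /fuel k1 k3 Ef -natr1; ring.
have cr1 : (cred s1 + Astep + 110 <= cred s)%N by clear -crE k1 k3 fk0; rewrite crE /cred k1 k3 fk0; lia.
have q48 : nvar s1 48 = (1 + 768 * tN s0)%N by have [-> _ _ _] := k2 48%N isT.
apply: (@wpt_seq _ _ _ _ _ (cred s - 4) (fun=> cred s - 6)%N _ _ _ _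
   (fun s2 => exists u, s2 = set_nvar s1 10 u) (fun s2 => if nvar s2 10 == 0%N then PA else PB)).
- by clear -crE; rewrite crE; lia.
- apply: (@wpt_wp _ _ _ 1); [by clear -crE; rewrite crE; lia| |by move=> *; clear -crE; rewrite crE; lia].
  apply: wp_unif; rewrite /= q48 //; first by move=> u _; exists u.
  apply: le_trans VE _; rewrite big_ord_recl /= /upd /=.
  rewrite (eq_bigr (fun=> PB)) // sumr_const card_ord -[PB *+ _]mulr_natr.
  apply: eqR_le; rewrite q1_eq natrM; field.
  by rewrite gt_eqF //; have := N_gt0; lra.
move=> s2 [u ->{s2}].
apply: (@wpt_if _ _ _ _ _ _ (cred s - 7)); first by clear -crE; rewrite crE; lia.
  rewrite /= /upd /= leqn0 => u0; rewrite u0.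
  apply: wpt_run => //.
  - split; last by rewrite /= /upd /= k1 Ef.
    split=> //=; rewrite /upd /=; [by keep|by rewrite /ccok /= k4|by rewrite k4|by rewrite k3'|].
    by clear -HfS HfK Ef k1 k3; rewrite k1 k3; lia.
  - have -> : cred (run (CSetN 56 (NConst 0)) (set_nvar s1 10 u)) = cred s1 by [].
    by clear -cr1; rewrite [cost _]/=; lia.
  - rewrite /Vin /= /upd /= /Vend.
    set s3 := set_nvar _ 56 0.
    have -> : yvs s3 = y by [].
    have := @val_ge s3 (payoff y); rewrite /PA.
    have -> : fuel s3 = fuel s + cS by rewrite -fu1.
    rewrite /s3 /= /upd /= k1 k3 => H.
    have : g - payoff y - (fuel s + cS) <= guarded s3 (payoff y) by apply: H => //; clear -HfS HfK Ef; lia.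
    lra.
rewrite /= /upd /= leqn0 => u0; rewrite (negbTE u0).
set s2 := set_nvar s1 10 u.
have l1 : nvar s2 52 = f /\ nvar s2 53 = nvar s 53 by [].
have l2 : same 52 s0 s2 by rewrite /s2; keep.
have l3 : nvar s2 54 = nvar s 54 /\ nvar s2 56 = nvar s 56 by [].
have l4 : rarr s2 = rarr s /\ yvs s2 = y by [].
clearbody s2; clear dependent s1; case: l1 => l1 l1'; case: l3 => l3 l3'; case: l4 => l4 l4'.
have q24 : nvar s2 24 = tWr s0 by have [-> _ _ _] := l2 24%N isT.
apply: (@wpt_seq _ _ _ _ _ (cred s - 9) (fun=> cred s - 11)%N _ _ _ _
   (fun s3 => exists2 u, (u < tWr s0)%N & s3 = set_nvar s2 57 u) (fun s3 => RV (trow s0 (nvar s3 57)))).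
- by clear -crE; rewrite crE; lia.
- apply: (@wpt_wp _ _ _ 1); [by clear -crE; rewrite crE; lia| |by move=> *; clear -crE; rewrite crE; lia].
  have W0 := g_Wr G; have Wn : (tWr s0)%:R != 0 :> R by rewrite pnatr_eq0 -lt0n.
  apply: wp_unif; rewrite /= q24 //; first by move=> w Hw; exists w.
  rewrite /upd /= (g_rows G RV); apply: eqR_le.
  have sc := sum_cr.
  have -> : \sum_(0 <= i < n) (tcr s0 i)%:R * RV i =
     (tWr s0)%:R * (g - fuel s - cS - cS * q1 - cK * rk)
     - \sum_(0 <= i < n) (tcr s0 i)%:R * rowx IV y i
     - cK * \sum_(0 <= i < n) (tcr s0 i)%:R * (tK s0 i)%:R.
    rewrite -sc mulr_suml mulr_sumr -!sumrB; apply: eq_bigr => i _.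
    by rewrite /RV; ring.
  rewrite /PB /meanK; move: (fuel s) (rk) ((1 + 768 * tN s0)%:R : R) Wn (\sum_(0 <= i < n) _) (\sum_(0 <= i < n) _) => ff rr qq Wn A1 A2.
  by field.
move=> s3 [w Hw ->{s3}]; rewrite [nvar _ 57]/= /upd /=.
pose i := trow s0 w; have Hi : (i < n)%N by exact: (g_row_lt G).
rewrite -/i.
have [_ _ n24 _] := l2 24%N isT; have [_ _ n20 _] := l2 20%N isT.
apply: (@wpt_detseq _ _ _ _ _ 1 (cred s - 13)); first by clear -crE; rewrite crE; lia.
apply: det_run => //.
apply: (@wpt_detseq _ _ _ _ _ 1 (cred s - 15)); first by clear -crE; rewrite crE; lia.
apply: det_run => //; set s5 := run _ _.
have j57 : nvar s5 57 = i by rewrite /s5 /= /upd /= n24.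
have j53 : nvar s5 53 = (nvar s 53 - tK s0 i)%N by rewrite /s5 /= /upd /= n24 l1' n20.
have j52 : nvar s5 52 = f by [].
have j54 : nvar s5 54 = nvar s 54 by [].
have j56 : nvar s5 56 = nvar s 56 by [].
have jr : rarr s5 = rarr s by [].
have jy : yvs s5 = y by [].
have js : same 52 s0 s5 by rewrite /s5; keep.
clearbody s5; clear s2 l1 l1' l2 l3 l3' l4 l4' q24 n24 n20 u u0.
have jcc : ccs s5 by rewrite /ccok jr.
pose g5 := g - fuel s5 - cS * q1 - cK * rk.
have HC := crow_spec (Psi := fun u => g5 - IV u) ec_lt G erc_inj js j57 Hi jcc (erefl _).
have j59 : rarr s5 59 = r by rewrite jr -Er Hr.
rewrite jy j59 -/(rowx _ y i) (rowx_opp _ _ _ Hi) in HC.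
(* Truncated subtraction can only lower the price charged. *)
have fu5 : fuel s5 <= fuel s + cS + cK * (tK s0 i)%:R.
  rewrite /fuel j52 j53 Ef.
  have : (nvar s 53)%:R - (tK s0 i)%:R <= (nvar s 53 - tK s0 i)%:R :> R.
    by rewrite lerBlDr -natrD ler_nat; clear; lia.
  move=> H; have := ler_wpM2l cK0 H; rewrite -natr1; lra.
apply: (@wpt_conseq _ _ _ (cred s - 15) _ (fun s1 => cred s1 + 1)%N _ (row_post n s0 s5) _
   (fun s' => g5 - IV (yvs s')) _ (g5 - rowx IV y i)) => //.
- by rewrite /RV /g5; lra.
- move=> s' [P1 P2 P3 P4].
  have [e52 _ _ _] := P1 52%N isT; have [e53 _ _ _] := P1 53%N isT; have [e54 _ _ _] := P1 54%N isT.
  split=> //.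
    split; last by rewrite e52 j52 Ef.
    split=> //; [by apply: same_trans js (same_le _ P1)| |by rewrite e54 j54|by clear -HfS HfK Ef e52 e53 j52 j53; rewrite e52 e53 j52 j53; lia].
    by move=> x Hx; rewrite P2 // jr Hr.
  rewrite /Vin P3 j56 gtn_eqF //.
  have -> : g5 - IV (yvs s') = g - (IV (yvs s') + cS * q1 + cK * rk) - fuel s'.
    by rewrite /g5 /fuel e52 e53; ring.
  apply: val_ge; rewrite ?e52 ?e53 ?j52 ?j53; [by clear -HfS Ef; lia|by clear -HfK; lia|].
  by apply: addr_ge0; [apply: addr_ge0; [exact: IV_ge0|exact: mulr_ge0]|apply: mulr_ge0 => //; exact: rk_ge0].
apply: (wpt_wp _ HC).
  by have := Kd Hi; clear -crE fk0; rewrite crE /Trow /Astep; lia.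
move=> s' [P1 _ _ _].
have [e52 _ _ _] := P1 52%N isT; have [e53 _ _ _] := P1 53%N isT.
have := Kd Hi; clear -crE fk0 e52 e53 j52 j53; rewrite crE /cred e52 e53 j52 j53 /Trow -/Astep.
by case: (posnP (nvar s 53 - tK s0 i)) => [->|H]; lia.
Qed.

End Payoff.
End InnerLoop.

(** * Quadratic forms *)

Section Forms2.
Variable R : realType.
Variables (n d m : nat) (er ec : nat -> nat).
Hypothesis er_lt : forall e, (e < m)%N -> (er e < n)%N.
Hypothesis ec_lt : forall e, (e < m)%N -> (ec e < d)%N.
Hypothesis erc_inj : forall e e', (e < m)%N -> (e' < m)%N ->
  er e = er e' -> ec e = ec e' -> e = e'.
Implicit Types (u v w : nat -> R) (B : (nat -> R) -> (nat -> R) -> R).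

Lemma form_cauchy B u v : bilin B -> (forall w, 0 <= B w w) ->
  B u v ^+ 2 <= B u u * B v v.
Proof.
move=> HB B0; have H t : 0 <= B u u - 2 * t * B u v + t ^+ 2 * B v v.
  have := B0 (lc 1 u (- t) v); rewrite !(bilinl _ _ _ _ _ HB, bilinr _ _ _ _ _ HB).
  rewrite (bilinC v u HB); lra.
have [v0|v0] := eqVneq (B v v) 0.
  have [->|uv] := eqVneq (B u v) 0; first by rewrite v0 mulr0 expr0n.
  (* At this point the form would have the value -1. *)
  have := H ((B u u + 1) / (2 * B u v)); rewrite v0 mulr0 addr0.
  have -> : B u u - 2 * ((B u u + 1) / (2 * B u v)) * B u v = -1 by field.
  lra.
have vp : 0 < B v v by rewrite lt_def v0 B0.
have := H (B u v / B v v).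
have -> : B u u - 2 * (B u v / B v v) * B u v + (B u v / B v v) ^+ 2 * B v v =
  (B u u * B v v - B u v ^+ 2) / B v v by field.
by rewrite pmulr_lge0 ?invr_gt0 // subr_ge0.
Qed.

Lemma gram_le w u : gram n d m er ec w u u <= (\sum_(0 <= e < m) w e ^+ 2) * dot d u u.
Proof.
rewrite -(sum_rsum er_lt) mulr_suml; apply: ler_sum => i _.
rewrite -(dot_wrow_self ec_lt erc_inj) -expr2.
by apply: form_cauchy; [exact: bilin_dot|exact: dot_ge0].
Qed.

Lemma gram_perturb v w u (c : R) : \sum_(0 <= e < m) (v e - w e) ^+ 2 <= c ->
  gram n d m er ec v u u <= 2 * gram n d m er ec w u u + 2 * c * dot d u u.
Proof.
move=> Hc; apply: (@le_trans _ _ (2 * gram n d m er ec w u u +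
    2 * gram n d m er ec (fun e => v e - w e) u u)).
  rewrite /gram !mulr_sumr -big_split; apply: ler_sum => i _ /=.
  rewrite !(dot_wrow er ec_lt) /rsum.
  have -> : \sum_(0 <= e < m | er e == i) (v e - w e) * u (ec e) =
    \sum_(0 <= e < m | er e == i) v e * u (ec e) - \sum_(0 <= e < m | er e == i) w e * u (ec e).
    by rewrite -sumrB; apply: eq_bigr => e _; rewrite mulrBl.
  set a := \sum_(_ <= _ < _ | _) v _ * _; set b := \sum_(_ <= _ < _ | _) _.
  have := sqr_ge0 (a - 2 * b); rewrite expr2; lra.
rewrite lerD2l -mulrA; apply: ler_wpM2l => //.
by apply: le_trans (gram_le _ _) _; apply: ler_wpM2r => //; exact: dot_ge0.
Qed.

(** Only the first [d] coordinates count. This is what allows a form on functions to be read as a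
    [d] by [d] matrix. *)
Definition local_form B := forall u u' v, (forall j, (j < d)%N -> u j = u' j) -> B u v = B u' v.

Lemma local_dot : local_form (dot d).
Proof. by move=> u u' v H; apply: eq_dot. Qed.

Lemma local_gram w : local_form (gram n d m er ec w).
Proof.
by move=> u u' v H; apply: eq_bigr => i _; congr (_ * _); apply: eq_dot.
Qed.

Lemma form_expand B u v : bilin B -> local_form B ->
  B u v = \sum_(j < d) u j * B (delta R j) v.
Proof.
move=> HB LB.
have L : linear_fun (fun u => B u v) by move=> a u1 b u2; rewrite bilinl.
rewrite -(linear_sum (fun i : 'I_d => u i) (fun i : 'I_d => delta R i) L).
apply: LB => j Hj; rewrite (bigD1 (Ordinal Hj)) //= big1 ?addr0.
  by rewrite /delta eqxx mulr1.
move=> i ne; rewrite /delta; case: eqP => [E|_]; last by rewrite mulr0.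
by move: ne; rewrite -val_eqE /= -E eqxx.
Qed.

Definition form_mx B : 'M[R]_d := \matrix_(i, j) B (delta R i) (delta R j).
Definition fun_of_row (x : 'rV[R]_d) : nat -> R := fun j => \sum_(i < d) x 0 i * delta R i j.
Lemma fun_of_rowE x (j : 'I_d) : fun_of_row x j = x 0 j.
Proof.
rewrite /fun_of_row (bigD1 j) //= big1 ?addr0; first by rewrite /delta eqxx mulr1.
move=> i ne; rewrite /delta; case: eqP => [E|_]; last by rewrite mulr0.
by move: ne; rewrite -val_eqE /= E eqxx.
Qed.

Lemma form_row B x u : bilin B -> local_form B ->
  B (fun_of_row x) u = \sum_(j < d) (x *m form_mx B) 0 j * u j.
Proof.
move=> HB LB; rewrite form_expand //.
transitivity (\sum_(i < d) \sum_(j < d) x 0 i * (u j * B (delta R j) (delta R i))).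
  apply: eq_bigr => i _; rewrite fun_of_rowE (bilinC _ u HB) (form_expand u _ HB LB).
  by rewrite mulr_sumr.
rewrite exchange_big; apply: eq_bigr => j _; rewrite mxE mulr_suml.
by apply: eq_bigr => i _; rewrite mxE (bilinC (delta R j) _ HB); ring.
Qed.

Lemma form_solve_unit B w : bilin B -> local_form B -> form_mx B \in unitmx ->
  exists v, (forall u, B v u = dot d w u) /\
   v = fun_of_row ((\row_j w j) *m invmx (form_mx B)).
Proof.
move=> HB LB U; exists (fun_of_row ((\row_j w j) *m invmx (form_mx B))); split=> // u.
rewrite form_row // mulmxKV // /dot big_mkord.
by apply: eq_bigr => j _; rewrite mxE.
Qed.

Lemma form_solve B (c : R) : bilin B -> local_form B -> 0 < c ->
  (forall u, c * dot d u u <= B u u) -> forall w, exists v, forall u, B v u = dot d w u.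
Proof.
move=> HB LB c0 Hc w.
have U : form_mx B \in unitmx.
  rewrite -row_free_unit; apply: inj_row_free => x Hx.
  have H : B (fun_of_row x) (fun_of_row x) = 0.
    by rewrite form_row // Hx big1 // => j _; rewrite mxE mul0r.
  have := Hc (fun_of_row x); rewrite H => H2.
  have D0 : dot d (fun_of_row x) (fun_of_row x) = 0.
    apply: le_anti; rewrite dot_ge0 andbT; move: H2.
    by rewrite pmulr_rle0.
  apply/rowP => j; rewrite mxE; apply/eqP.
  move/eqP: D0; rewrite /dot big_mkord psumr_eq0; last by move=> i _; rewrite -expr2 sqr_ge0.
  by move/allP/(_ j (mem_index_enum _)); rewrite /= fun_of_rowE -expr2 sqrf_eq0.
by have [v [Hv _]] := form_solve_unit w HB LB U; exists v.
Qed.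

(** Let v solve B v = u. Cauchy-Schwarz gives |u|^4 = B(v,u)^2 <= B(v,v) B(u,u), and B(v,v) = u . v
    <= K |u|^2, where K bounds the entries of the inverse matrix. *)
Lemma form_coercive B : bilin B -> local_form B -> (forall u, 0 <= B u u) ->
  form_mx B \in unitmx -> exists2 c : R, 0 < c & forall u, c * dot d u u <= B u u.
Proof.
move=> HB LB B0 U; set X := invmx (form_mx B).
pose K : R := 1 + \sum_(i < d) \sum_(j < d) `|X i j|.
have S0 : 0 <= \sum_(i < d) \sum_(j < d) `|X i j| :> R by do 2![apply: sumr_ge0 => ? _].
have K0 : 0 < K by rewrite /K; lra.
exists K^-1; first by rewrite invr_gt0.
move=> u; have [v [Hv Ev]] := form_solve_unit u HB LB U.
have uu0 := dot_ge0 d u.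
have uc (i : 'I_d) : u i ^+ 2 <= dot d u u.
  rewrite /dot big_mkord (bigD1 i) //= -expr2 lerDl; apply: sumr_ge0 => j _.
  by rewrite -expr2 sqr_ge0.
have vb : dot d u v <= K * dot d u u.
  rewrite /dot big_mkord Ev.
  apply: (@le_trans _ _ (\sum_(j < d) \sum_(i < d) `|X i j| * dot d u u)).
    apply: ler_sum => j _; rewrite fun_of_rowE mxE mulr_sumr; apply: ler_sum => i _.
    rewrite mxE; apply: le_trans (ler_norm _) _.
    have -> : u j * (u i * X i j) = X i j * (u j * u i) by ring.
    rewrite normrM; apply: ler_wpM2l => //.
    have := uc i; have := uc j; have := sqr_ge0 (`|u i| - `|u j|).
    rewrite normrM -[u i ^+ 2]real_normK ?num_real // -[u j ^+ 2]real_normK ?num_real //.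
    rewrite !expr2; lra.
  rewrite exchange_big /=; under eq_bigr do rewrite -mulr_suml.
  by rewrite -mulr_suml; apply: ler_wpM2r => //; rewrite /K; lra.
have := form_cauchy v u HB B0; rewrite !Hv => H.
have [z|nz] := eqVneq (dot d u u) 0; first by rewrite z mulr0.
have up : 0 < dot d u u by rewrite lt_def nz.
rewrite mulrC ler_pdivrMr //.
have H2 : dot d u u ^+ 2 <= K * dot d u u * B u u.
  by apply: le_trans H _; apply: ler_wpM2r.
rewrite -(ler_pM2l up); move: H2; rewrite expr2; lra.
Qed.

Lemma rayleigh (M : (nat -> R) -> (nat -> R) -> R) (mu : R) :
  bilin M -> local_form M -> (forall u, 0 <= M u u) -> (0 < d)%N ->
  smallest_eigenvalue (form_mx M) mu -> forall u, mu * dot d u u <= M u u.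
Proof.
move=> HM LM M0 dp [_ mumin].
pose S : set R := [set c | forall u, c * dot d u u <= M u u]%classic.
have S0 : S 0 by move=> u; rewrite mul0r.
have Sb c : S c -> c <= M (delta R 0) (delta R 0).
  move=> /(_ (delta R 0)); rewrite dot_delta // /delta eqxx mulr1; exact.
have hs : has_sup S.
  by split; [exists 0|exists (M (delta R 0) (delta R 0)) => c; exact: Sb].
pose rho := sup S.
have Hrho u : rho * dot d u u <= M u u.
  have [->|nz] := eqVneq (dot d u u) 0; first by rewrite mulr0.
  have up : 0 < dot d u u by rewrite lt_def nz dot_ge0.
  rewrite -ler_pdivlMr //; apply: ge_sup; first by exists 0.
  by move=> c Sc; rewrite ler_pdivlMr.
pose B u v := M u v - rho * dot d u v.
have HB : bilin B.
  split=> [u v|a u b v w]; rewrite /B; first by rewrite (bilinC u v HM) (bilinC u v (bilin_dot R d)).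
  by rewrite (bilinl _ _ _ _ _ HM) (bilinl _ _ _ _ _ (bilin_dot R d)); ring.
have LB : local_form B by move=> u u' v H; rewrite /B (LM _ _ _ H) (local_dot v H).
have B0 u : 0 <= B u u by rewrite subr_ge0.
have mxB : form_mx B = form_mx M - rho%:M.
  apply/matrixP => i j; rewrite !mxE /B dot_delta // /delta -val_eqE eq_sym /=.
  by rewrite mulr_natr.
have ev : eigenvalue (form_mx M) rho.
  rewrite /eigenvalue /eigenspace kermx_eq0 row_free_unit -mxB.
  apply/negP => U; have [c c0 Hc] := form_coercive HB LB B0 U.
  have : S (rho + c) by move=> u; have := Hc u; rewrite /B mulrDl; lra.
  by move/(ub_le_sup (proj2 hs)); rewrite -/rho; lra.
move=> u; apply: le_trans (Hrho u); apply: ler_wpM2r; first exact: dot_ge0.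
exact: mumin.
Qed.

End Forms2.

(** * One outer round and the outer loop *)

Definition cgrad :=
  cmap 58 1 (RDiv (RAdd (RGet 56 (NVar 4)) (RMul (RVar 49) (RGet 57 (NVar 4))))
                  (RAdd (RC 1) (RVar 49)));;
  cmap 59 1 (RC 0);;
  cmap 60 0 (RSub (RC 0) (RGet 1 (NVar 4)));;
  cscatter 60 2 (NGet 0 (NVar 4)) (RMul (RGet 0 (NVar 4)) (RGet 58 (NGet 1 (NVar 4))));;
  cscatter 59 2 (NGet 1 (NVar 4)) (RMul (RGet 0 (NVar 4)) (RGet 60 (NGet 0 (NVar 4)))).

(** Makes the implicit iterate dense in array 61, which is affordable once per round, and applies
    the updates of x and z with step sizes 1/64 and [be]. *)
Definition cfinish :=
  cscatter 61 2 (NGet 1 (NVar 4)) (RMul (RGet 28 (NVar 4)) (RGet 62 (NGet 0 (NVar 4))));;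
  cmap 61 1 (RAdd (RGet 61 (NVar 4)) (RMul (RVar 56) (RGet 59 (NVar 4))));;
  cmap 56 1 (RSub (RGet 58 (NVar 4)) (RDiv (RGet 61 (NVar 4)) (RC 64)));;
  cmap 57 1 (RSub (RAdd (RMul (RSub (RC 1) (RVar 49)) (RGet 57 (NVar 4)))
                        (RMul (RVar 49) (RGet 58 (NVar 4))))
                  (RMul (RVar 50) (RGet 61 (NVar 4)))).

Definition cbody :=
  cgrad;; cmap 61 1 (RC 0);; cmap 62 0 (RC 0);; CSetR 56 (RC 0);; CSetN 56 (NConst 1);;
  cinner;; cfinish.

Definition cmain := CWhile (BLeN (NConst 1) (NVar 54))
  (CSetN 54 (NSub (NVar 54) (NConst 1));; cbody).

Lemma wpt_frame (R : realType) c (s : store R) T C X Q psi v :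
  wpt c s T C Q psi v -> wpt c s (T + X) (fun s' => C s' + X)%N Q psi v.
Proof.
move=> H k t P Hk; rewrite -addnA; apply: H => s' Qs'; rewrite addnA; exact: Hk.
Qed.

Section Gradient.
Variable R : realType.
Variables (n d m : nat) (er ec : nat -> nat) (ev : nat -> R).
Hypothesis er_lt : forall e, (e < m)%N -> (er e < n)%N.
Hypothesis ec_lt : forall e, (e < m)%N -> (ec e < d)%N.

Lemma scatter_dot (f u : nat -> R) :
  dot d (fun j => \sum_(0 <= e < m | ec e == j) f e) u = \sum_(0 <= e < m) f e * u (ec e).
Proof.
rewrite /dot; under eq_bigr do rewrite mulr_suml.
rewrite (exchange_big_dep_nat xpredT) //=; apply: eq_big_nat => k /andP[_ Hk].
rewrite (eq_bigl (fun j => j == ec k)); last by move=> j; rewrite eq_sym.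
by rewrite big_nat1_eq /= ec_lt.
Qed.

Lemma grad_spec s Q : [/\ nvar s 0 = n, nvar s 1 = d & nvar s 2 = m] ->
  [/\ narr s 0 = er, narr s 1 = ec & rarr s 0 = ev] ->
  (forall s', same 56 s s' ->
    (forall x, (60 < x)%N || (x < 58)%N -> rarr s' x = rarr s x) ->
    (forall x, x != 4%N -> nvar s' x = nvar s x) -> rvar s' = rvar s ->
    (forall j, (j < d)%N -> rarr s' 58 j = (rarr s 56 j + rvar s 49 * rarr s 57 j) / (1 + rvar s 49)) ->
    (forall u, dot d (rarr s' 59) u = gram n d m er ec ev (rarr s' 58) u
       - \sum_(0 <= i < n) rarr s 1 i * dot d (wrow m er ec ev i) u) -> Q s') ->
  det cgrad s (8 * d + 4 * n + 8 * m + 24) Q.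
Proof.
move=> [Dn Dd Dm] [Ie Ic Iv] HQ.
apply: (@det_seqT _ _ _ _ (4 * d + 3) (4 * d + 4 * n + 8 * m + 20)); first by clear; lia.
pose v j := (rarr s 56 j + rvar s 49 * rarr s 57 j) / (1 + rvar s 49).
apply: (@cmap_spec _ _ _ _ _ v d) => //.
apply: (@det_seqT _ _ _ _ (4 * d + 3) (4 * n + 8 * m + 16)); first by clear; lia.
apply: (@cmap_spec _ _ _ _ _ (fun=> 0) d) => //.
apply: (@det_seqT _ _ _ _ (4 * n + 3) (8 * m + 12)); first by clear; lia.
apply: (@cmap_spec _ _ _ _ _ (fun i => 0 - rarr s 1 i) n) => //.
apply: (@det_seqT _ _ _ _ (4 * m + 3) (4 * m + 8)); first by clear; lia.
pose v' j := if (j < d)%N then v j else rarr s 58 j.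
apply: (@cscatter_spec _ _ _ _ _ _ er (fun e => ev e * v' (ec e)) m) => //.
  by move=> e A He; rewrite /= /upd /= Ie Ic Iv.
pose res i := (if (i < n)%N then 0 - rarr s 1 i else rarr s 60 i)
   + \sum_(0 <= e < m | er e == i) ev e * v' (ec e).
apply: (@cscatter_spec _ _ _ _ _ _ ec (fun e => ev e * res (er e)) m) => //; first by clear; lia.
  by move=> e A He; rewrite /= /upd /= Ie Ic Iv.
apply: HQ.
- by keep.
- move=> x Hx; rewrite /= /upd /=.
  have -> : (x == 58%N) = false by apply/eqP; lia.
  have -> : (x == 59%N) = false by apply/eqP; lia.
  by have -> : (x == 60%N) = false by apply/eqP; lia.
- by move=> x /negbTE Hx; rewrite /= /upd Hx.
- by [].
- by move=> j Hj; rewrite /= /upd /= Hj.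
- move=> u; rewrite /= /upd /= -/v'.
  have -> : dot d (fun j => (if (j < d)%N then 0 else rarr s 59 j)
      + \sum_(0 <= e < m | ec e == j) ev e * res (er e)) u =
     dot d (fun j => \sum_(0 <= e < m | ec e == j) ev e * res (er e)) u.
    by apply: eq_dot => // j Hj; rewrite Hj add0r.
  rewrite scatter_dot -(sum_rsum er_lt) /gram -sumrB; apply: eq_big_nat => i /andP[_ Hi].
  rewrite !(dot_wrow er ec_lt).
  transitivity (res i * rsum m er i (fun e => ev e * u (ec e))).
    by rewrite /rsum mulr_sumr; apply: eq_bigr => e /eqP ->; ring.
  by rewrite /res Hi -/(rsum m er i (fun e => ev e * v' (ec e))); ring.
Qed.
End Gradient.

Section Outer.
Variable R : realType.
Variables (n d m : nat) (er ec : nat -> nat) (ev : nat -> R).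
Hypothesis er_lt : forall e, (e < m)%N -> (er e < n)%N.
Hypothesis ec_lt : forall e, (e < m)%N -> (ec e < d)%N.
Hypothesis erc_inj : forall e e', (e < m)%N -> (e' < m)%N ->
  er e = er e' -> ec e = ec e' -> e = e'.
Variable s0 : store R.
Hypothesis G : Good n d m er ec ev s0.
Hypothesis F0 : 0 < frob m ev.
Hypothesis etaE : rvar s0 48 * (768 * frob m ev) = 1.
Hypothesis q1E : nvar s0 48 = (1 + 768 * tN s0)%N.
Hypothesis aF : forall u, gram n d m er ec (twe s0) u u <= frob m ev * dot d u u.
Hypothesis Kd : forall i, (i < n)%N -> (tK s0 i <= d)%N.
Local Notation gam := (rvar s0 19).
Local Notation gr := (gram n d m er ec (twe s0)).
Local Notation hd := (hform (dot d) gr gam).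
Local Notation md := (gram n d m er ec ev).
Hypothesis solv : forall w, exists v, forall u, hd v u = dot d w u.
Local Notation yvs := (yv n m er ec s0).
Variables (cS cK dv : R) (FS FK : nat).
Hypotheses (cS0 : 0 <= cS) (cK0 : 0 <= cK).
Hypotheses (cSE : 1 <= dv + cS * FS%:R) (cKE : 1 <= dv + cK * FK%:R).
Local Notation al := (rvar s0 49).
Local Notation be := (rvar s0 50).
Variables (nu c : R) (xs : nat -> R).
Hypotheses (mh : forall u, md u u <= 2 * hd u u) (hm : forall u, nu * hd u u <= md u u).
Hypotheses (al0 : 0 < al) (al1 : al <= 1) (nu0 : 0 < nu) (beE : be * nu = al).
Hypotheses (alE : al ^+ 2 * 2048 = nu) (cge0 : 0 <= c).
Hypothesis xsE : forall u, md xs u =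
  \sum_(0 <= i < n) rarr s0 1 i * dot d (wrow m er ec ev i) u.
Local Notation q1 := ((1 + 768 * tN s0)%:R : R).
Local Notation fuels := (fuel cS cK FS FK).
Local Notation creds := (cred d s0).

Definition dx (s : store R) j := rarr s 56 j - xs j.
Definition dz (s : store R) j := rarr s 57 j - xs j.
Definition iter_cost := cS * q1 + cK * rk n s0.
(** The value with [k] rounds to go: each of them is charged its expected price, and the present
    potential is already multiplied by the contraction that these rounds will bring. *)
Definition Vout k s := if alive s then 1 - k%:R * iter_cost
  - c * (1 - al) ^+ k * potential md hd nu (dx s) (dz s) - fuels s else dv.
Definition OInv (s : store R) := [/\ same 52 s0 s, (nvar s 52 <= FS)%N & (nvar s 53 <= FK)%N].
Definition Tbody := (24 * d + 8 * n + 12 * m + 80)%N.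

Lemma local_hd : local_form d hd.
Proof. by move=> u u' v H; rewrite /hform (local_gram n m er ec _ v H) (local_dot v H). Qed.

Lemma local2 B u u' : bilin B -> local_form d B -> (forall j, (j < d)%N -> u j = u' j) ->
  B u u = B u' u' :> R.
Proof. by move=> HB LB H; rewrite (LB _ _ _ H) (bilinC u' u HB) (LB _ _ _ H). Qed.

Lemma potential_local x x' z z' : (forall j, (j < d)%N -> x j = x' j) ->
  (forall j, (j < d)%N -> z j = z' j) ->
  potential md hd nu x z = potential md hd nu x' z'.
Proof.
move=> Hx Hz; rewrite /potential (local2 (bilin_gram _ _ _ _ _ _) (local_gram _ _ _ _ _) Hx).
by rewrite (local2 (bilin_hform _ (bilin_dot R d) (bilin_gram _ _ _ _ _ _)) local_hd Hz).
Qed.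

(** The payoff of the inner run is the quadratic bound of [outer_value_le], weighted by the
    contraction of the later rounds. The run starts at 0, where [inner_value0_le] bounds its loss by
    the left side of [outer_contract]. *)
Lemma body_spec k s : OInv s ->
  wpt cbody s (creds s + Tbody) creds (fun s' => OInv s' /\ nvar s' 54 = nvar s 54)
    (Vout k) (Vout k.+1 s).
Proof.
move=> [S0 HfS HfK].
have Bm := bilin_gram n d m er ec ev.
have Bh : bilin hd := bilin_hform _ (bilin_dot R d) (bilin_gram _ _ _ _ _ _).
have m0 : forall u, 0 <= md u u by move=> u; exact: gram_ge0.
have g0 := gam_gt0 G F0.
have [Dn Dd Dm] := g_dims G; have [Ie Ic Iv] := g_idx G.
have [a0 _ b0 c0] := S0 0%N isT; have [a1 _ b1 c1] := S0 1%N isT; have [a2 _ _ _] := S0 2%N isT.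
have [_ E49 _ _] := S0 49%N isT.
apply: (@wpt_detseq _ _ _ _ _ (8 * d + 4 * n + 8 * m + 24) (creds s + 16 * d + 4 * n + 4 * m + 54)); first by clear; rewrite /Tbody; lia.
apply: (grad_spec (ev := ev) er_lt ec_lt); [by rewrite a0 a1 a2|by rewrite b0 b1 c0|].
move=> s1 G1 G2 G3 G4 G5 G6.
rewrite E49 in G5; rewrite c1 in G6.
set x := dx s; set z := dz s.
have Vloc j : (j < d)%N -> rarr s1 58 j - xs j = Vv al x z j.
  move=> Hj; rewrite G5 // /Vv /lc /x /z /dx /dz; field.
  by rewrite gt_eqF //; have := al0; lra.
have [yh Hyh] := solv (rarr s1 59).
have yhE u : hd yh u = md (Vv al x z) u.
  rewrite Hyh G6 -xsE -(local_gram n m er ec ev u Vloc).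
  have -> : (fun j => rarr s1 58 j - xs j) = lc 1 (rarr s1 58) (-1) xs.
    by apply/funext => j; rewrite /lc; ring.
  by rewrite (bilinl _ _ _ _ _ Bm); ring.
have [nd _ _ _] := G1 1%N isT; have [nn _ _ _] := G1 0%N isT.
rewrite a1 Dd in nd; rewrite a0 Dn in nn.
apply: (@wpt_detseq _ _ _ _ _ (4 * d + 3) (creds s + 12 * d + 4 * n + 4 * m + 50)); first by clear; lia.
apply: (@cmap_spec _ _ _ _ _ (fun=> 0) d) => //.
apply: (@wpt_detseq _ _ _ _ _ (4 * n + 3) (creds s + 12 * d + 4 * m + 46)); first by clear; lia.
apply: (@cmap_spec _ _ _ _ _ (fun=> 0) n) => //.
apply: (@wpt_detseq _ _ _ _ _ 1 (creds s + 12 * d + 4 * m + 44)); first by clear; lia.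
apply: det_run => //.
apply: (@wpt_detseq _ _ _ _ _ 1 (creds s + 12 * d + 4 * m + 42)); first by clear; lia.
apply: det_run => //; set s2 := run _ _.
have h1 : same 52 s0 s2.
  by rewrite /s2; keep; apply: same_trans S0 (same_le _ G1).
have h2 : nvar s2 52 = nvar s 52 by rewrite /s2 /= /upd /= G3.
have h3 : nvar s2 53 = nvar s 53 by rewrite /s2 /= /upd /= G3.
have h4 : nvar s2 54 = nvar s 54 by rewrite /s2 /= /upd /= G3.
have h5 : nvar s2 56 = 1%N by [].
have h6 : rarr s2 57 = rarr s 57 by rewrite /s2 /= /upd /= G2.
have h7 : rarr s2 58 = rarr s1 58 by [].
have h8 : rarr s2 59 = rarr s1 59 by [].
have h9 i : (i < n)%N -> rarr s2 62 i = 0 by move=> Hi; rewrite /s2 /= /upd /= Hi.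
have h10 j : (j < d)%N -> rarr s2 61 j = 0 by move=> Hj; rewrite /s2 /= /upd /= Hj.
have h11 : rvar s2 56 = 0 by [].
clearbody s2.
pose cc := c * (1 - al) ^+ k.
have al1' : 0 <= 1 - al by rewrite subr_ge0.
have cc0 : 0 <= cc by rewrite mulr_ge0 // exprn_ge0.
pose L := lam nu al be x z yh.
pose L' := lc cc L 0 L.
pose v0 := cc * value0 md hd nu al x z.
pose th' := cc * theta nu be.
pose g := 1 - k%:R * iter_cost.
have it0 : 0 <= iter_cost by rewrite /iter_cost addr_ge0 // mulr_ge0 ?ler0n // rk_ge0.
have g1 : g <= 1 by rewrite /g gerBl mulr_ge0 ?ler0n.
have th0 : 0 <= th' by rewrite mulr_ge0 //; apply: theta_ge0.
have payE y : payoff n d m er ec s0 v0 th' L' y =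
   cc * (value0 md hd nu al x z + hd L y + theta nu be * hd y y).
  by rewrite /payoff /L' (bilinl _ _ _ _ _ Bh) /v0 /th'; ring.
have pot0 u w : 0 <= potential md hd nu u w.
  rewrite /potential addr_ge0 ?divr_ge0 // mulr_ge0 ?(ltW nu0) //.
  by apply: hform_ge0 => // ?; [exact: dot_ge0|exact: gram_ge0].
have payO y : cc * outer_value md hd nu al be x z y <= payoff n d m er ec s0 v0 th' L' y.
  by rewrite payE; apply: ler_wpM2l => //; apply: outer_value_le.
have pay0 y : 0 <= payoff n d m er ec s0 v0 th' L' y.
  by apply: le_trans (payO y); rewrite mulr_ge0 // pot0.
have rE u : dot d (rarr s1 59) u = hd yh u by rewrite Hyh.
have I2 : Inv n s0 FS FK s2 s2.
  by split=> //; [move=> i Hi _; exact: h9|rewrite h2 h3].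
have HL := inner_loop er_lt ec_lt erc_inj G F0 etaE q1E aF Kd solv cS0 cK0 cSE cKE g1 th0 rE pay0 h8 I2.
have crd : creds s2 = creds s by rewrite /cred h2 h3.
rewrite crd in HL.
apply: (@wpt_seq _ _ _ _ _ (creds s + 1 + (12 * d + 4 * m + 40)) (fun s3 => creds s3 + (12 * d + 4 * m + 40))%N _ _ _ _
   (Inv n s0 FS FK s2) (Vend n d m er ec s0 cS cK dv FS FK g v0 th' L')); first by clear; lia.
  apply: wpt_frame; apply: wpt_conseq HL => //.
  rewrite /Vin h5 /= /guarded /Vout /alive h2 h3; case: ifP => // _.
  have -> : fuel cS cK FS FK s2 = fuels s by rewrite /fuel h2 h3.
  have HIV : inner_value (dot d) gr gam yh L' v0 th' (yvs s2) <= cc * (1 - al) * potential md hd nu x z.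
    have -> : inner_value (dot d) gr gam yh L' v0 th' (yvs s2) =
              inner_value (dot d) gr gam yh L' v0 th' (fun=> 0).
      rewrite !(inner_valueE _ _ (bilin_dot R d)).
      have z0 j : (j < d)%N -> yvs s2 j = 0.
        move=> Hj; rewrite /yv h10 // h11 mul0r !add0r big_nat_cond big1 // => i /andP[/andP[_ Hi] _].
        by rewrite h9 // mul0r.
      by rewrite (local2 (bilin_dot R d) (@local_dot R d) z0) (eq_dot (v' := fun=> 0) (fun _ _ => erefl) z0).
    apply: le_trans (inner_value0_le (bilin_dot R d) (bilin_gram _ _ _ _ _ _) (@dot_ge0 R d)
       (@gram_ge0 _ _ _ _ _ _ _) g0 yh L' v0 th0) _.
    have -> : v0 + hd L' yh + th' * (32 * hd yh yh) =
       cc * (value0 md hd nu al x z + hd L yh + theta nu be * (32 * hd yh yh)).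
      by rewrite /L' (bilinl _ _ _ _ _ Bh) /v0 /th'; ring.
    by rewrite -mulrA; apply: ler_wpM2l => //; apply: outer_contract.
  rewrite exprSr -natr1 /g /iter_cost mulrDl mul1r; move: HIV; rewrite /cc -/x -/z; lra.
move=> s3 [I1 I2' I3 I4 [I5 I6]].
have [n1 _ m1 _] := I1 1%N isT; have [n2 _ m0' _] := I1 2%N isT; have [_ _ mm0 _] := I1 0%N isT.
have [_ _ _ r28] := I1 28%N isT; have [_ v49 _ _] := I1 49%N isT; have [_ v50 _ _] := I1 50%N isT.
apply: (@wpt_detseq _ _ _ _ _ (4 * m + 3) (creds s3 + (12 * d + 30))); first by clear; lia.
apply: (@cscatter_spec _ _ _ _ _ _ ec (fun e => twe s0 e * rarr s3 62 (er e)) m) => //; first by rewrite n2.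
  by move=> e A He; rewrite /= /upd /= m1 mm0 r28 Ie Ic.
apply: (@wpt_detseq _ _ _ _ _ (4 * d + 3) (creds s3 + (8 * d + 20))); first by clear; lia.
set y := yvs s3.
apply: (@cmap_spec _ _ _ _ _ y d) => //; first by rewrite /= /upd /= n1.
  move=> j A Hj HA; rewrite /= /upd /= HA /= /upd /= /y /yv.
  rewrite [RHS]addrAC; congr (_ + _ + _).
  transitivity (\sum_(0 <= e < m) (ec e == j)%:R * (twe s0 e * rarr s3 62 (er e))).
    by rewrite big_mkcond; apply: eq_bigr => e _; case: eqP; rewrite ?mul1r ?mul0r.
  rewrite -(sum_rsum er_lt); apply: eq_bigr => i _; rewrite /wrow /rsum mulr_sumr.
  apply: eq_bigr => e /eqP ->; rewrite /delta eq_sym; ring.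
pose x' j := rarr s3 58 j - y j / 64.
pose z' j := (1 - al) * rarr s3 57 j + al * rarr s3 58 j - be * y j.
apply: (@wpt_detseq _ _ _ _ _ (4 * d + 3) (creds s3 + (4 * d + 10))); first by clear; lia.
apply: (@cmap_spec _ _ _ _ _ x' d) => //; first by rewrite /= /upd /= n1.
  by move=> j A Hj HA; rewrite /= /upd /= Hj.
pose Q3 := (fun s' => [/\ OInv s', nvar s' 54 = nvar s 54, creds s' = creds s3 & Vend n d m er ec s0 cS cK dv FS FK g v0 th' L' s3 <= Vout k s']) : store R -> Prop.
apply: (@wpt_conseq _ _ _ (creds s3 + (4 * d + 10)) _ creds _ Q3 _ (Vout k) _ (Vend n d m er ec s0 cS cK dv FS FK g v0 th' L' s3)) => //.
  by move=> s' [? ? _ _].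
apply: (@wpt_wp _ _ _ (4 * d + 3)); first by clear; lia.
  apply: (@det_wp _ _ _ _ Q3); last by move=> s' H; split=> //; case: H.
  apply: (@cmap_spec _ _ _ _ _ z' d) => //; first by rewrite /= /upd /= n1.
    by move=> j A Hj HA; rewrite /= /upd /= Hj HA /= /upd /= v49 v50.
  split=> //.
  - by split=> //; keep.
  - by rewrite /= /upd /= I4 h4.
  - set s4 := set_nvar _ _ _.
    rewrite /Vend /guarded /Vout; have -> : alive s4 = alive s3 by [].
    case: ifP => // _; have -> : fuels s4 = fuels s3 by [].
    rewrite -/g -/cc lerD2r lerD2l lerN2.
    apply: le_trans (payO y); apply: eqR_le; congr (_ * _).
    rewrite /outer_value; apply: potential_local => j Hj.
      rewrite /dx /s4 /= /upd /= Hj /x' /lc -Vloc // -h7 -(I3 58%N) //; by field.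
    rewrite /dz /s4 /= /upd /= Hj /z' /lc /Wv /lc -Vloc // -h7 -(I3 58%N) //.
    by rewrite /z /dz (I3 57%N) // h6; ring.
by move=> s' [_ _ -> _]; clear; lia.
Qed.

Lemma main_loop s : OInv s ->
  wpt cmain s (creds s + nvar s 54 * (Tbody + 4) + 1) creds OInv (Vout 0) (Vout (nvar s 54) s).
Proof.
move Ek: (nvar s 54) => k; elim: k s Ek => [|k IH] s Ek Is.
  by apply: wpt_whileF => //; [by clear; lia|rewrite /= Ek].
have [S0 HfS HfK] := Is.
apply: (@wpt_whileT _ _ _ _ _ (creds s + Tbody + k * (Tbody + 4) + 4)
  (fun s1 => creds s1 + k * (Tbody + 4) + 1)%N creds _ _ _ (fun s1 => OInv s1 /\ nvar s1 54 = k) (Vout k)).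
- by clear; rewrite mulSn; lia.
- by rewrite /= Ek.
- apply: (@wpt_detseq _ _ _ _ _ 1 (creds s + Tbody + (k * (Tbody + 4) + 1))); first by clear; lia.
  apply: det_run => //; set s1 := run _ _.
  have I1 : OInv s1 by split=> //; rewrite /s1; keep.
  have := wpt_frame (X := (k * (Tbody + 4) + 1)%N) (body_spec (k := k) I1).
  have -> : creds s1 = creds s by [].
  apply: wpt_conseq => //; move=> s' [O1 O2]; split=> //; last by clear; lia.
  by split=> //; rewrite O2 /s1 /= /upd /= Ek subn1.
- by move=> s1 [I1 E1]; apply: IH.
Qed.
End Outer.

(** * Preprocessing *)

Definition eN x := RNat (NVar x).
Definition pA :=
  cscatter 16 2 (NGet 0 (NVar 4)) (RAbs (RGet 0 (NVar 4)));;
  cscatter 17 2 (NGet 0 (NVar 4)) (RMul (RGet 0 (NVar 4)) (RGet 0 (NVar 4)));;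
  cnscatter 16 2 (NGet 0 (NVar 4));;
  csum 2 16 (RMul (RGet 0 (NVar 4)) (RGet 0 (NVar 4)));;
  csum 0 18 (RMul (RSqrt (RGet 17 (NVar 4))) (RGet 16 (NVar 4))).
Definition pNcond :=
  BAnd (BLeR (RMul (RMul (RMul (eN 19) (RMul (eN 19) (eN 19))) (RVar 18)) (RVar 18))
          (RMul (RMul (RMul (eN 2) (eN 2)) (RVar 16)) (RVar 16)))
       (BLeR (RMul (eN 19) (RVar 1)) (RVar 16)).
Definition pNloop := CWhile pNcond (CSetN 19 (NAdd (NVar 19) (NVar 19))).
Definition pN := CSetN 19 (NConst 1);; pNloop;; CSetR 19 (RDiv (RVar 16) (eN 19)).
Definition sq e := RMul e e.
(** Finds the least k that equals the row count or satisfies k^2 |a|_2^2 >= N |a|_1^2. The search is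
    linear, but the row counts bound it, so all searches together take time O(m + n). *)
Definition pKloop := CWhile (BAnd (NLt (NVar 5) (NGet 16 (NVar 14)))
  (RLt (RMul (sq (eN 5)) (RGet 17 (NVar 14))) (RMul (eN 19) (sq (RGet 16 (NVar 14))))))
  (incN 5).
(** Besides K, each row receives the offsets of its segments of length [d] and [2 * d] in the entry
    tables, accumulated by addition, and its flag for being heavy. *)
Definition pK := CFor 14 (NVar 0)
  (CSetN 5 (NConst 0);; pKloop;;
   CPutN 20 (NVar 14) (NVar 5);;
   CPutN 21 (NVar 14) (NVar 20);; CSetN 20 (NAdd (NVar 20) (NVar 1));;
   CPutN 22 (NVar 14) (NVar 22);; CSetN 22 (NAdd (NVar 22) (NAdd (NVar 1) (NVar 1)));;
   CIf (RLt (RMul (eN 19) (RGet 17 (NVar 14))) (sq (RGet 16 (NVar 14))))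
     (CPutN 25 (NVar 14) (NConst 1);; incN 25) CSkip).
Definition pR := CFor 14 (NVar 0)
  (CSetN 4 (NConst 0);; CSetN 5 (NVar 24);; CSetN 6 (NVar 14);;
   CSetR 4 (RMul (RGet 17 (NVar 14)) (eN 2));; CSetR 5 (RVar 16);;
   cfill 24;; CPutN 23 (NVar 14) (NVar 7);; CSetN 24 (NVar 5)).
Definition pGloop := CWhile (RLt (RVar 29) (RMul (RC 8) (RMul (eN 2) (RVar 16))))
  (CSetR 29 (RAdd (RVar 29) (RVar 29));; incN 28).
(** With grid size sqrt(g / (4 m)) the m rounding errors have a square sum of at most g / 4, which
    the regularization g absorbs. Variable 29 doubles from the squared grid size until it reaches 8
    m F, a safe bound for the products that are packed. *)
Definition pG := CIf (BLeN (NConst 1) (NVar 25))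
  (CSetR 28 (RSqrt (RDiv (RVar 19) (RMul (RC 4) (eN 2))));;
   CSetR 29 (sq (RVar 28));; CSetN 28 (NConst 1);; pGloop) CSkip.
(** Without heavy rows nothing is packed, and values are left unrounded. *)
Definition cquant := CIf (BLeN (NConst 1) (NVar 25))
  (CSetR 6 (RVar 10);; CSetR 7 (RC 1);; CSetR 8 (RDiv (RVar 29) (RVar 28));; cbits)
  (CSetR 9 (RVar 10)).
Definition pW := CFor 14 (NVar 2)
  (CSetR 10 (RAbs (RGet 0 (NVar 14)));; cquant;;
   CPutR 28 (NVar 14) (RMul (RVar 9) (RDiv (RGet 0 (NVar 14)) (RAbs (RGet 0 (NVar 14)))))).
Definition pHcond := BNot (BAnd (BNot (BLeN (NGet 16 (NVar 13)) (NGet 20 (NVar 13))))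
  (BNot (BLeR (RGet 16 (NVar 13))
     (RMul (RNat (NGet 20 (NVar 13))) (RAbs (RGet 0 (NVar 14))))))).
Definition pH := CFor 14 (NVar 2)
  (CSetN 13 (NGet 0 (NVar 14));;
   CIf pHcond
     (CPutN 33 (NAdd (NGet 21 (NVar 13)) (NGet 32 (NVar 13))) (NVar 14);;
      CPutN 32 (NVar 13) (NAdd (NGet 32 (NVar 13)) (NConst 1)))
     (CSetN 4 (NGet 22 (NVar 13));; CSetN 5 (NGet 34 (NVar 13));; CSetN 6 (NVar 14);;
      CSetR 4 (RMul (RAbs (RGet 0 (NVar 14))) (RNat (NGet 16 (NVar 13))));;
      CSetR 5 (RGet 16 (NVar 13));;
      cfill 35;; CPutN 34 (NVar 13) (NVar 5);; CPutN 36 (NVar 14) (NVar 7))).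
(** [kap] is 2 |a|_1 / K rounded down plus one grid unit. It is then on the grid and still at least
    2 |a|_1 / K, as the acceptance probabilities require. *)
Definition pS := CFor 14 (NVar 0)
  (CIf (BLeN (NGet 16 (NVar 14)) (NGet 20 (NVar 14))) CSkip
     (CPutN 38 (NVar 14) (NGet 20 (NVar 14));;
      CSetR 10 (RDiv (RMul (RC 2) (RGet 16 (NVar 14))) (RNat (NGet 20 (NVar 14))));;
      cquant;; CPutR 38 (NVar 14) (RAdd (RVar 9) (RVar 28)))).
(** The k-th heavy row gets the weight B^k with B = 2 * te0 / g^2, a power of 2 by construction of
    [te0]; [rvar 42] is the packed shift by [te0] in every digit. *)
Definition pP :=
  CSetR 40 (RC 1);; CSetR 30 (RDiv (RMul (RC 2) (RVar 29)) (sq (RVar 28)));;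
  CFor 14 (NVar 0) (CIf (BLeN (NConst 1) (NGet 25 (NVar 14)))
    (CPutN 41 (NVar 41) (NVar 14);; CPutR 41 (NVar 41) (RVar 40);;
     CPutR 42 (NVar 14) (RVar 40);; CSetR 42 (RAdd (RVar 42) (RMul (RVar 29) (RVar 40)));;
     CSetR 40 (RMul (RVar 40) (RVar 30));; incN 41) CSkip);;
  cscatter 43 2 (NGet 1 (NVar 4)) (RMul (RGet 28 (NVar 4)) (RGet 42 (NGet 0 (NVar 4)))).

(** * Frame conditions for the preprocessing *)

Section SameX.
Variable R : realType.
Implicit Types (s : store R) (l : seq nat).
Definition off l x := ((16 <= x) || (x < 4))%N && (x \notin l).
Definition sameX l s s' := forall x, off l x ->
  [/\ nvar s' x = nvar s x, rvar s' x = rvar s x,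
      narr s' x = narr s x & rarr s' x = rarr s x].
Lemma sameX_refl l s : sameX l s s. Proof. by []. Qed.
Lemma sameX_trans l s1 s2 s3 : sameX l s1 s2 -> sameX l s2 s3 -> sameX l s1 s3.
Proof. by move=> H1 H2 x Hx; have [-> -> -> ->] := H2 _ Hx; exact: H1. Qed.
Lemma sameX_setN l s s' x v : ~~ off l x -> sameX l s s' -> sameX l s (set_nvar s' x v).
Proof.
move=> Hx H y Hy; have [E1 E2 E3 E4] := H _ Hy; split=> //=.
by rewrite /upd; case: eqP Hy Hx => // -> ->.
Qed.
Lemma sameX_setR l s s' x v : ~~ off l x -> sameX l s s' -> sameX l s (set_rvar s' x v).
Proof.
move=> Hx H y Hy; have [E1 E2 E3 E4] := H _ Hy; split=> //=.
by rewrite /upd; case: eqP Hy Hx => // -> ->.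
Qed.
Lemma sameX_putN l s s' x i v : ~~ off l x -> sameX l s s' -> sameX l s (put_narr s' x i v).
Proof.
move=> Hx H y Hy; have [E1 E2 E3 E4] := H _ Hy; split=> //=.
by rewrite /upd; case: eqP Hy Hx => // -> ->.
Qed.
Lemma sameX_putR l s s' x i v : ~~ off l x -> sameX l s s' -> sameX l s (put_rarr s' x i v).
Proof.
move=> Hx H y Hy; have [E1 E2 E3 E4] := H _ Hy; split=> //=.
by rewrite /upd; case: eqP Hy Hx => // -> ->.
Qed.
Lemma sameX_setA l s s' x f : ~~ off l x -> sameX l s s' -> sameX l s (set_narr s' x f).
Proof.
move=> Hx H y Hy; have [E1 E2 E3 E4] := H _ Hy; split=> //=.
by rewrite /upd; case: eqP Hy Hx => // -> ->.
Qed.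
Lemma sameX_setRA l s s' x f : ~~ off l x -> sameX l s s' -> sameX l s (set_rarr s' x f).
Proof.
move=> Hx H y Hy; have [E1 E2 E3 E4] := H _ Hy; split=> //=.
by rewrite /upd; case: eqP Hy Hx => // -> ->.
Qed.
Lemma scr_sameX l s s0 s' : scr s s' -> sameX l s0 s -> sameX l s0 s'.
Proof.
move=> [E1 E2 E3] H x Hx; have [a b c e] := H x Hx.
have Hx' : ~~ (4 <= x < 16)%N by move: Hx; rewrite /off => /andP[H1 _]; lia.
by have [-> ->] := E3 x Hx'; rewrite E1 E2.
Qed.
End SameX.

Ltac keepX := repeat first
  [ assumption | apply: sameX_refl
  | apply: sameX_setN; [by []|] | apply: sameX_setR; [by []|]
  | apply: sameX_putN; [by []|] | apply: sameX_putR; [by []|] | apply: sameX_setA; [by []|]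
  | apply: sameX_setRA; [by []|] ].

(** * Row statistics, the parameter N, sample counts and the row table *)

Section Pre.
Variable R : realType.
Variables (n d m : nat) (er ec : nat -> nat) (ev : nat -> R).
Hypothesis er_lt : forall e, (e < m)%N -> (er e < n)%N.
Hypothesis ec_lt : forall e, (e < m)%N -> (ec e < d)%N.
Implicit Types (s : store R).
Local Notation n1 := (norm1f m er ev).
Local Notation n2 := (norm2f m er ev).
Local Notation F := (frob m ev).
Local Notation rc := (rcf m er).

Definition P0 s := [/\ nvar s 0 = n, nvar s 1 = d & nvar s 2 = m] /\
  [/\ narr s 0 = er, narr s 1 = ec & rarr s 0 = ev].

Lemma P0_sameX l s s' : all (fun x => (3 < x)%N) l -> P0 s -> sameX l s s' -> P0 s'.
Proof.
move=> /allP Hl [[D0 D1 D2] [I0 I1 J0]] S.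
have o x : (x < 4)%N -> off l x.
  by move=> Hx; rewrite /off Hx orbT /=; apply/negP => /Hl; lia.
rewrite /P0; have [-> _ -> ->] := S 0%N (o 0%N isT); have [-> _ -> _] := S 1%N (o 1%N isT).
by have [-> _ _ _] := S 2%N (o 2%N isT).
Qed.

Definition sumS := \sum_(0 <= i < n) Num.sqrt (n2 i) * n1 i.

Lemma pA_spec s : P0 s -> fresh 16 s ->
  det pA s (16 * m + 4 * n + 24) (fun s' => [/\ sameX [:: 16; 17; 18]%N s s',
    [/\ rarr s' 16 = n1, rarr s' 17 = n2 & narr s' 16 = rc] &
    rvar s' 16 = F /\ rvar s' 18 = sumS]).
Proof.
move=> [[D0 D1 D2] [I0 I1 J0]] fr.
have [_ w16 a16 z16] := fr 16%N isT; have [_ _ _ z17] := fr 17%N isT; have [_ z18 _ _] := fr 18%N isT.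
have ab (x : R) : Num.sqrt (x * x) = `|x| by rewrite -expr2 sqrtr_sqr.
apply: (@det_seqT _ _ _ _ (4 * m + 3) (12 * m + 4 * n + 18)); first lia.
apply: (@cscatter_spec _ _ _ _ _ _ er (fun e => `|ev e|) m) => //.
  by move=> e A He; rewrite /= /upd /= I0 J0 ab.
apply: (@det_seqT _ _ _ _ (4 * m + 3) (8 * m + 4 * n + 14)); first lia.
apply: (@cscatter_spec _ _ _ _ _ _ er (fun e => ev e ^+ 2) m) => //.
  by move=> e A He; rewrite /= /upd /= I0 J0 expr2.
apply: (@det_seqT _ _ _ _ (4 * m + 3) (4 * m + 4 * n + 10)); first lia.
apply: (@cnscatter_spec _ _ _ _ _ er m) => //.
  by move=> e A He; rewrite /= /upd /= I0.
apply: (@det_seqT _ _ _ _ (4 * m + 3) (4 * n + 6)); first lia.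
apply: (@csum_spec _ _ _ _ _ (fun e => ev e ^+ 2) m) => //.
  by move=> e A He; rewrite /= /upd /= J0 expr2.
have e1 : (fun j => rarr s 16 j + \sum_(0 <= e < m | er e == j) `|ev e|) = n1.
  by apply/funext => j; rewrite z16 add0r.
have e2 : (fun j => rarr s 17 j + \sum_(0 <= e < m | er e == j) ev e ^+ 2) = n2.
  by apply/funext => j; rewrite z17 add0r.
have e3 : (fun j => narr s 16 j + \sum_(0 <= e < m | er e == j) 1)%N = rc.
  by apply/funext => j; rewrite a16 add0n.
apply: (@csum_spec _ _ _ _ _ (fun i => Num.sqrt (n2 i) * n1 i) n) => //; first lia.
  by move=> e A He; rewrite /= /upd /= -e1 -e2.
split.
- by keepX.
- by rewrite /= /upd /=.
- by rewrite /= /upd /= w16 z18 !add0r.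
Qed.

Definition Ncond (mu : R) (N : nat) :=
  (N%:R * (N%:R * N%:R) * sumS * sumS <= m%:R * m%:R * F * F) && (N%:R * mu <= F).

Lemma pN_spec s mu : (forall N, Ncond mu N -> (N <= m)%N) -> (0 < m)%N ->
  P0 s -> rvar s 1 = mu -> rvar s 16 = F -> rvar s 18 = sumS ->
  det pN s (4 * m + 12) (fun s' => [/\ sameX [:: 19]%N s s',
    rvar s' 19 = F / (nvar s' 19)%:R, (0 < nvar s' 19)%N, ~~ Ncond mu (nvar s' 19) &
    nvar s' 19 = 1%N \/ exists2 M, nvar s' 19 = (M + M)%N & Ncond mu M]).
Proof.
move=> Nm mp Ps Emu E16 E18.
apply: (@det_seqT _ _ _ _ 1 (4 * m + 8)); first lia.
apply: det_run => //; set s1 := run _ _.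
apply: (@det_seqT _ _ _ _ (4 * m + 1) 2); first lia.
pose I s' := [/\ sameX [:: 19]%N s s', (0 < nvar s' 19 <= 2 * m)%N &
   nvar s' 19 = 1%N \/ exists2 M, nvar s' 19 = (M + M)%N & Ncond mu M].
have I1 : I s1 by split=> //=; [rewrite /s1; keepX|rewrite /upd /=; lia|left].
suff H k s2 : I s2 -> (2 * m - nvar s2 19 <= k)%N ->
  det pNloop s2 (2 * k + 1) (fun s' => I s' /\ ~~ Ncond mu (nvar s' 19)).
  have := H (2 * m)%N s1 I1 (leq_subr _ _).
  apply: det_conseq; first lia.
  move=> s' [[A1 A2 A3] A4]; apply: det_run => //.
  have [_ B16 _ _] := A1 16%N isT.
  split=> //=; rewrite ?/upd /=; first by keepX.
    by rewrite B16 E16.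
  by lia.
have cE t : I t -> beval t pNcond = Ncond mu (nvar t 19).
  move=> [A1 _ _]; have [_ B16 _ _] := A1 16%N isT; have [_ B18 _ _] := A1 18%N isT.
  have [_ B1 _ _] := A1 1%N isT; have [B2 _ _ _] := A1 2%N isT.
  by rewrite /= B16 B18 B1 B2 E16 E18 Emu; case: Ps => [[_ _ ->] _].
elim: k s2 {I1} => [|k IH] s2 I2 Hk.
  apply: det_whileF; rewrite ?(cE _ I2); last split=> //.
    apply/negP => /Nm; case: I2 => _; lia.
  apply/negP => /Nm; case: I2 => _; lia.
case C: (Ncond mu (nvar s2 19)); last first.
  apply: (@det_conseq _ _ _ 1 _ (fun s' => I s' /\ ~~ Ncond mu (nvar s' 19))); [by clear; lia|by []|].
  by apply: det_whileF; rewrite ?(cE _ I2) ?C //; split=> //; rewrite C.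
have Nle := Nm _ C; have [A1 A2 A3] := I2.
apply: (@det_conseq _ _ _ (1 + (2 * k + 1)).+1 _ (fun s' => I s' /\ ~~ Ncond mu (nvar s' 19))); [by clear; lia|by []|].
apply: det_whileT; first by rewrite (cE _ I2).
apply: det_run => //; apply: IH; last by rewrite /= /upd /=; lia.
split=> //=; rewrite /upd /=; [by keepX|by lia|right; by exists (nvar s2 19)].
Qed.

Variable N : nat.
Definition Kspec i K := [/\ (K <= rc i)%N,
   K = rc i \/ N%:R * (n1 i * n1 i) <= K%:R * K%:R * n2 i &
   forall k, (k < K)%N -> k%:R * k%:R * n2 i < N%:R * (n1 i * n1 i)].
Definition inHf i := N%:R * n2 i < n1 i * n1 i.

Lemma pK_spec s : P0 s -> [/\ rarr s 16 = n1, rarr s 17 = n2 & narr s 16 = rc] ->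
  nvar s 19 = N -> fresh 20 s ->
  det pK s (4 * m + 40 * n + 3) (fun s' => [/\ sameX [:: 20; 21; 22; 25]%N s s',
    (forall i, (i < n)%N -> Kspec i (narr s' 20 i)),
    (forall i, (i < n)%N -> narr s' 21 i = i * d /\ narr s' 22 i = i * (2 * d))%N,
    (forall i, narr s' 25 i = ((i < n)%N && inHf i) :> nat) &
    nvar s' 25 = (\sum_(0 <= i < n) inHf i)%N]).
Proof.
move=> Ps [E16 E17 F16] E19 fr; have [[D0 D1 D2] _] := Ps.
pose I k s' := [/\ sameX [:: 20; 21; 22; 25]%N s s', nvar s' 14 = k,
    (forall i, (i < k)%N -> [/\ Kspec i (narr s' 20 i), narr s' 21 i = (i * d)%N & narr s' 22 i = (i * (2 * d))%N]),
    (forall i, narr s' 25 i = ((i < k)%N && inHf i) :> nat) &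
    [/\ nvar s' 25 = (\sum_(0 <= i < k) inHf i)%N, nvar s' 20 = (k * d)%N & nvar s' 22 = (k * (2 * d))%N]].
(* The time is summed row by row: the search in row [i] takes at most [rc i] rounds, and the row
   counts add up to [m]. *)
have -> : (4 * m + 40 * n + 3 = \sum_(0 <= i < n) ((4 * rc i + 37) + 3) + 3)%N.
  rewrite (eq_bigr (fun i => 4 * rc i + 40)%N); last by move=> i _; lia.
  rewrite big_split /= sum_nat_const_nat subn0 -big_distrr /=; congr (_ + _ + _)%N; last lia.
  congr (4 * _)%N; rewrite /rcf (exchange_big_dep_nat xpredT) //=.
  rewrite (eq_big_nat _ _ (F2 := fun=> 1%N)); last first.
    move=> e /andP[_ He]; rewrite (eq_bigl (fun i => i == er e)); last by move=> i; rewrite eq_sym.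
    by rewrite big_nat1_eq leq0n /= er_lt.
  by rewrite sum_nat_const_nat subn0 muln1.
apply: (@det_for _ _ _ _ _ n I (fun i => 4 * rc i + 37)%N).
- have [z20 _ _ _] := fr 20%N isT; have [z22 _ _ _] := fr 22%N isT; have [z25 _ y25 _] := fr 25%N isT.
  split=> //=; first by keepX.
  + by move=> i; rewrite y25.
  + by rewrite /upd /= z20 z22 z25 big_geq.
- move=> k s' Hk [S1 S2 _ _ _]; split=> //=.
  by have [-> _ _ _] := S1 0%N isT.
- move=> k s' Hk [S1 S2 S3 S4 [S5 S6 S7]].
  have st x s'' : off [:: 20; 21; 22; 25]%N x -> sameX [:: 20; 21; 22; 25]%N s s'' ->
    [/\ nvar s'' x = nvar s x, rvar s'' x = rvar s x, narr s'' x = narr s x & rarr s'' x = rarr s x].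
    by move=> Hx; apply.
  apply: (@det_seqT _ _ _ _ 1 (4 * rc k + 35)); first lia.
  apply: det_run => //; set s1 := run _ _.
  pose J s2 := [/\ sameX [:: 20; 21; 22; 25]%N s s2, (forall x, x != 5%N -> nvar s2 x = nvar s' x),
     narr s2 = narr s', (nvar s2 5 <= rc k)%N &
     forall j, (j < nvar s2 5)%N -> j%:R * j%:R * n2 k < N%:R * (n1 k * n1 k)].
  have J1 : J s1.
    split=> //=; rewrite /s1; [by keepX|by move=> x /negbTE Hx; rewrite /= /upd Hx].
  have cE s2 : J s2 -> beval s2 (BAnd (NLt (NVar 5) (NGet 16 (NVar 14)))
      (RLt (RMul (sq (eN 5)) (RGet 17 (NVar 14))) (RMul (eN 19) (sq (RGet 16 (NVar 14)))))) =
      ((nvar s2 5 < rc k)%N && ((nvar s2 5)%:R * (nvar s2 5)%:R * n2 k < N%:R * (n1 k * n1 k))).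
    move=> [A1 A2 A3 _ _]; have [_ _ B16 C16] := st 16%N s2 isT A1; have [_ _ _ C17] := st 17%N s2 isT A1.
    have [B19 _ _ _] := st 19%N s2 isT A1.
    by rewrite /= -!ltNge -ltnNge (A2 14%N isT) S2 B16 C16 C17 B19 E16 E17 F16 E19.
  apply: (@det_seqT _ _ _ _ (4 * rc k + 1) 22); first lia.
  have H j s2 : J s2 -> (rc k - nvar s2 5 <= j)%N ->
     det pKloop s2 (4 * j + 1) (fun s3 => J s3 /\ Kspec k (nvar s3 5)).
    elim: j s2 => [|j IH] s2 J2 Hj.
      have [A1 A2 A3 A4 A5] := J2.
      apply: det_whileF; first by rewrite (cE _ J2); apply/negP => /andP[]; lia.
      by split=> //; split=> //; left; lia.
    case C: ((nvar s2 5 < rc k)%N && ((nvar s2 5)%:R * (nvar s2 5)%:R * n2 k < N%:R * (n1 k * n1 k))); last first.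
      have [A1 A2 A3 A4 A5] := J2.
      apply: (@det_conseq _ _ _ 1 _ (fun s3 => J s3 /\ Kspec k (nvar s3 5))); [by clear; lia|by []|].
      apply: det_whileF; first by rewrite (cE _ J2) C.
      split=> //; split=> //; move/negbT: C; rewrite negb_and -leqNgt -leNgt => /orP[C|C]; [left; lia|by right].
    have /andP[C1 C2] := C; have [A1 A2 A3 A4 A5] := J2.
    apply: (@det_conseq _ _ _ (1 + (4 * j + 1)).+1 _ (fun s3 => J s3 /\ Kspec k (nvar s3 5))); [by clear; lia|by []|].
    apply: det_whileT; first by rewrite (cE _ J2).
    apply: det_run => //; apply: IH; last by rewrite /= /upd /=; lia.
    split=> //=; rewrite ?/upd /=; [by keepX|by move=> x Hx; rewrite (negbTE Hx) A2|by lia|].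
    move=> j'; rewrite addn1 ltnS leq_eqVlt => /orP[/eqP -> //|]; exact: A5.
  apply: det_conseq (H (rc k) s1 J1 (leq_subr _ _)); first lia.
  move=> s2 [[A1 A2 A3 A4 A5] KK].
  have [B1 _ _ _] := st 1%N s2 isT A1; have [B19 _ _ _] := st 19%N s2 isT A1.
  have [_ _ _ C16] := st 16%N s2 isT A1; have [_ _ _ C17] := st 17%N s2 isT A1.
  have bE : beval s2 (RLt (RMul (eN 19) (RGet 17 (NVar 14))) (sq (RGet 16 (NVar 14)))) = inHf k.
    by rewrite /= -ltNge (A2 14%N isT) S2 B19 C16 C17 E16 E17 E19.
  apply: det_run => //; rewrite /=.
  set b := (X in if X then _ else _).
  have -> : b = inHf k by rewrite -bE /b /= /upd /=.
  have comm s3 : sameX [:: 20; 21; 22; 25]%N s s3 -> nvar s3 14 = k ->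
     narr s3 20 = upd (narr s2 20) k (nvar s2 5) -> narr s3 21 = upd (narr s2 21) k (nvar s2 20) ->
     narr s3 22 = upd (narr s2 22) k (nvar s2 22) ->
     (forall i, narr s3 25 i = ((i < k.+1)%N && inHf i) :> nat) ->
     nvar s3 25 = (nvar s2 25 + inHf k)%N -> nvar s3 20 = (nvar s2 20 + d)%N ->
     nvar s3 22 = (nvar s2 22 + (d + d))%N ->
     nvar s3 14 = k /\ I k.+1 (set_nvar s3 14 k.+1).
    move=> G1 G2 G3 G4 G5 G6 G7 G8 G9; split=> //; split=> //=; first by keepX.
    + move=> i; rewrite ltnS leq_eqVlt G3 G4 G5 /upd A3; case: eqVneq => [-> _|ne] /=.
        by rewrite (A2 20%N isT) (A2 22%N isT) S6 S7.
      by move=> Hi; exact: S3.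
    + rewrite /upd /= G7 G8 G9 (A2 25%N isT) (A2 20%N isT) (A2 22%N isT) S5 S6 S7 big_nat_recr //=; split=> //; lia.
  have e14 : nvar s2 14 = k by rewrite (A2 14%N isT).
  case Hb: (inHf k).
    apply: comm; rewrite /= ?/upd /= ?e14 ?B1 ?D1.
    + by keepX.
    + by [].
    + by [].
    + by [].
    + by [].
    + move=> i; rewrite ltnS leq_eqVlt A3 ?S4; case: eqVneq => [->|ne] //=.
      by rewrite Hb.
    + by rewrite Hb.
    + by [].
    + by [].
  apply: comm; rewrite /= ?/upd /= ?e14 ?B1 ?D1.
  + by keepX.
  + by [].
  + by [].
  + by [].
  + by [].
  + move=> i; rewrite ltnS leq_eqVlt A3 ?S4; case: eqVneq => [->|ne] //=.
    by rewrite ltnn Hb.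
  + by rewrite Hb addn0.
  + by [].
  + by [].
- by move=> s' [S1 S2 S3 S4 [S5 _ _]]; split=> // i Hi; have [] := S3 i Hi.
Qed.

Lemma blit_sum (A : nat -> nat) b w c v (f : nat -> R) :
  \sum_(0 <= u < w + c) f (blit A (b + w) c v (b + u)%N) =
  \sum_(0 <= u < w) f (A (b + u)%N) + c%:R * f v.
Proof.
rewrite (big_cat_nat _ (n := w)) ?leq_addr //=; congr (_ + _).
  by apply: eq_big_nat => u /andP[_ Hu]; rewrite /blit leq_add2l leqNgt Hu.
rewrite (eq_big_nat _ _ (F2 := fun=> f v)); last first.
  by move=> u /andP[H1 H2]; rewrite /blit leq_add2l H1 -addnA ltn_add2l H2.
by rewrite sumr_const_nat addKn -[RHS]mulrC mulr_natr.
Qed.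

(** The share of row [i] in [m] slots, rounded up. The table then has between [m] and [m + n] slots,
    and the draw probabilities are accurate up to a factor 2. *)
Definition crf i := slots (n2 i * m%:R) F.
Hypothesis F0 : 0 < F.

Lemma pR_spec s : P0 s -> rarr s 17 = n2 -> rvar s 16 = F -> nvar s 24 = 0%N ->
  det pR s (\sum_(0 <= i < n) (8 * crf i + 28) + 3) (fun s' => [/\ sameX [:: 23; 24]%N s s',
    (forall i, (i < n)%N -> narr s' 23 i = crf i), nvar s' 24 = (\sum_(0 <= i < n) crf i)%N,
    (forall f : nat -> R, \sum_(0 <= u < nvar s' 24) f (narr s' 24 u) = \sum_(0 <= i < n) (crf i)%:R * f i) &
    forall u, (u < nvar s' 24)%N -> (narr s' 24 u < n)%N]).
Proof.
move=> Ps E17 E16 E24; have [[D0 D1 D2] _] := Ps.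
pose I k s' := [/\ sameX [:: 23; 24]%N s s', nvar s' 14 = k,
    (forall i, (i < k)%N -> narr s' 23 i = crf i), nvar s' 24 = (\sum_(0 <= i < k) crf i)%N &
    (forall f : nat -> R, \sum_(0 <= u < nvar s' 24) f (narr s' 24 u) = \sum_(0 <= i < k) (crf i)%:R * f i) /\
    forall u, (u < nvar s' 24)%N -> (narr s' 24 u < n)%N].
rewrite (eq_bigr (fun i => (8 * crf i + 25) + 3)%N); last by move=> i _; lia.
apply: (@det_for _ _ _ _ _ n I (fun i => 8 * crf i + 25)%N).
- split=> //=; rewrite ?/upd /= ?E24 //; first by keepX.
  + by rewrite big_geq.
  + by split=> // f; rewrite !big_geq.
- by move=> k s' Hk [S1 S2 _ _ _]; split=> //=; have [-> _ _ _] := S1 0%N isT.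
- move=> k s' Hk [S1 S2 S3 S4 [S5 S6]].
  have [_ _ _ B17] := S1 17%N isT; have [_ B16 _ _] := S1 16%N isT; have [B2 _ _ _] := S1 2%N isT.
  apply: (@det_seqT _ _ _ _ 1 (8 * crf k + 23)); first lia; apply: det_run => //.
  apply: (@det_seqT _ _ _ _ 1 (8 * crf k + 21)); first lia; apply: det_run => //.
  apply: (@det_seqT _ _ _ _ 1 (8 * crf k + 19)); first lia; apply: det_run => //.
  apply: (@det_seqT _ _ _ _ 1 (8 * crf k + 17)); first lia; apply: det_run => //.
  apply: (@det_seqT _ _ _ _ 1 (8 * crf k + 15)); first lia; apply: det_run => //; set s1 := run _ _.
  have r4 : rvar s1 4 = n2 k * m%:R by rewrite /s1 /= /upd /= S2 B17 E17 B2 D2.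
  have r5 : rvar s1 5 = F by rewrite /s1 /= /upd /= B16 E16.
  have q4 : nvar s1 4 = 0%N by [].
  have q5 : nvar s1 5 = nvar s' 24 by [].
  have q6 : nvar s1 6 = k by rewrite /s1 /= /upd /= S2.
  have q14 : nvar s1 14 = k by rewrite /s1 /= /upd /= S2.
  have q23 : narr s1 = narr s' by [].
  have qs : sameX [:: 23; 24]%N s s1 by rewrite /s1; keepX.
  clearbody s1.
  have [c0 c1 c2 c3] : [/\ (0 < crf k)%N, n2 k * m%:R <= (crf k)%:R * F,
     (forall c', (0 < c' < crf k)%N -> c'%:R * F < n2 k * m%:R) & (crf k)%:R * F <= n2 k * m%:R + F].
    by apply: slotsP; rewrite ?mulr_ge0 ?norm2f_ge0 ?ler0n ?(ltW F0) //; left.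
  apply: (@det_seqT _ _ _ _ (8 * crf k + 6) 4); first lia.
  apply: (@cfill_spec _ _ _ (crf k)) => //; rewrite ?r4 ?r5 //.
  apply: det_run => //; set s3 := run _ _.
  have t14 : nvar s3 14 = k by rewrite /s3 /filled /= /upd /= q14.
  have t24 : nvar s3 24 = (nvar s' 24 + crf k)%N by rewrite /s3 /filled /= /upd /= q5.
  have a24 : narr s3 24 = blit (narr s' 24) (nvar s' 24) (crf k) k.
    by rewrite /s3 /filled /= /upd /= q4 q5 q6 q23 add0n.
  have a23 : narr s3 23 = upd (narr s' 23) k (crf k) by rewrite /s3 /filled /= /upd /= q14 q23.
  have ts : sameX [:: 23; 24]%N s s3 by rewrite /s3 /filled; keepX.
  clearbody s3; split=> //; split=> //=; first by keepX.
  + move=> i; rewrite ltnS leq_eqVlt a23 /upd; case: eqVneq => [->|ne] //= Hi; exact: S3.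
  + by rewrite big_nat_recr //= /upd /= t24 S4.
  + rewrite /upd /= t24 a24; split=> [f|u].
      have := blit_sum (narr s' 24) 0 (nvar s' 24) (crf k) k f; rewrite add0n => ->.
      by rewrite big_nat_recr //= -S5.
    by rewrite /blit; case: ifP => // H Hu; apply: S6; lia.
- by move=> s' [S1 S2 S3 S4 [S5 S6]].
Qed.
End Pre.

(** * Grid rounding, entry tables and packing of the heavy rows *)

Section Pre2.
Variable R : realType.
Variables (n d m : nat) (er ec : nat -> nat) (ev : nat -> R).
Hypothesis er_lt : forall e, (e < m)%N -> (er e < n)%N.
Hypothesis ec_lt : forall e, (e < m)%N -> (ec e < d)%N.
Hypothesis erc_inj : forall e e', (e < m)%N -> (e' < m)%N ->
  er e = er e' -> ec e = ec e' -> e = e'.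
Hypothesis ev_nz : forall e, (e < m)%N -> ev e != 0.
Implicit Types (s : store R).
Local Notation n1 := (norm1f m er ev).
Local Notation n2 := (norm2f m er ev).
Local Notation F := (frob m ev).
Local Notation rc := (rcf m er).
Local Notation P0s := (P0 n d m er ec ev).

Lemma abs_sqrt (x : R) : Num.sqrt (x * x) = `|x|.
Proof. by rewrite -expr2 sqrtr_sqr. Qed.

Lemma pG_spec s (g : R) nb : P0s s -> rvar s 16 = F -> nvar s 25 != 0%N ->
  g = Num.sqrt (rvar s 19 / (4 * m%:R)) ->
  8 * (m%:R * F) <= g ^+ 2 * 2 ^+ nb -> (forall k, (k < nb)%N -> g ^+ 2 * 2 ^+ k < 8 * (m%:R * F)) ->
  det pG s (5 * nb + 10) (fun s' => [/\ sameX [:: 28; 29]%N s s', rarr s' = rarr s /\ narr s' = narr s, nvar s' 28 = nb.+1,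
    rvar s' 28 = g & rvar s' 29 = g ^+ 2 * 2 ^+ nb]).
Proof.
move=> Ps E16 h0 Eg Hnb Hlt; have [[_ _ D2] _] := Ps.
apply: (@det_conseq _ _ _ (5 * nb + 8).+1 _ (fun s' => [/\ sameX [:: 28; 29]%N s s', rarr s' = rarr s /\ narr s' = narr s, nvar s' 28 = nb.+1,
    rvar s' 28 = g & rvar s' 29 = g ^+ 2 * 2 ^+ nb])); [by clear; lia|by []|].
apply: det_if => /=; last by rewrite -eqn0Ngt (negbTE h0).
move=> _.
apply: (@det_seqT _ _ _ _ 1 (5 * nb + 6)); first by clear; lia.
apply: det_run => //.
apply: (@det_seqT _ _ _ _ 1 (5 * nb + 4)); first by clear; lia.
apply: det_run => //.
apply: (@det_seqT _ _ _ _ 1 (5 * nb + 2)); first by clear; lia.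
apply: det_run => //; set s1 := run _ _.
pose I k s' := [/\ sameX [:: 28; 29]%N s s', rarr s' = rarr s /\ narr s' = narr s, nvar s' 28 = k.+1,
    rvar s' 28 = g & rvar s' 29 = g ^+ 2 * 2 ^+ k].
have I0 : I 0%N s1.
  split=> //; first by rewrite /s1; keepX.
    by rewrite /s1 /= /upd /= D2 Eg.
  by rewrite /s1 /= /upd /= D2 -Eg expr0 mulr1 expr2.
suff H j k s2 : (j + k = nb)%N -> I k s2 -> det pGloop s2 (5 * j + 1) (I nb).
  apply: det_conseq (H nb 0%N s1 (addn0 _) I0) => //; by clear; lia.
elim: j k s2 => [|j IH] k s2 Hk [A1 A2 A3 A4 A5].
  rewrite add0n in Hk; subst k.
  have [_ B16 _ _] := A1 16%N isT; have [B2 _ _ _] := A1 2%N isT.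
  by apply: det_whileF => //=; rewrite negbK A5 B16 B2 E16 D2.
have [_ B16 _ _] := A1 16%N isT; have [B2 _ _ _] := A1 2%N isT.
apply: (@det_conseq _ _ _ (3 + (5 * j + 1)).+1 _ (I nb)); [by clear; lia|by []|].
apply: det_whileT.
  by rewrite /= -ltNge A5 B16 B2 E16 D2; apply: Hlt; move: Hk; clear; lia.
apply: det_run => //; apply: (IH k.+1); first by move: Hk; clear; lia.
split=> //=; rewrite ?/upd /=; [by keepX|by rewrite A3 addn1|].
by rewrite A5 [2 ^+ k.+1]exprS; ring.
Qed.

Section Quant.
Variables (h nb : nat) (g : R).
Hypothesis gpos : (0 < h)%N -> 0 < g.
Hypothesis g0 : h = 0%N -> g = 0.

Definition Qst s := [/\ nvar s 25 = h, rvar s 28 = g &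
  (0 < h)%N -> nvar s 28 = nb.+1 /\ rvar s 29 = g ^+ 2 * 2 ^+ nb].
Definition qspec (X q : R) := [/\ 0 <= q, q <= X, X <= q + g &
  (0 < h)%N -> exists z : nat, q = g * z%:R].
Definition Tq := (if (0 < h)%N then 12 * nb + 34 else 4)%N.

Lemma cquant_spec s X Q : Qst s -> rvar s 10 = X -> 0 <= X ->
  ((0 < h)%N -> X < 2 * (g * 2 ^+ nb)) ->
  (forall s' q, scr s s' -> (forall x, x != 8%N -> nvar s' x = nvar s x) ->
     rvar s' 9 = q -> qspec X q -> Q s') -> det cquant s Tq Q.
Proof.
move=> [E25 E28 Hq] EX X0 HX HQ; rewrite /Tq; case: (posnP h) => [h0|hp]; last first.
  have gp := gpos hp; have [N28 E29] := Hq hp.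
  apply: (@det_conseq _ _ _ (12 * nb + 33).+1 _ Q); [by clear; lia|by []|].
  apply: det_if => /=; rewrite E25; last by rewrite -ltnNge ltnS leqn0 gtn_eqF.
  move=> _.
  apply: (@det_seqT _ _ _ _ 1 (12 * nb + 31)); first by clear; lia.
  apply: det_run => //.
  apply: (@det_seqT _ _ _ _ 1 (12 * nb + 29)); first by clear; lia.
  apply: det_run => //.
  apply: (@det_seqT _ _ _ _ 1 (12 * nb + 27)); first by clear; lia.
  apply: det_run => //; set s1 := run _ _.
  apply: (@det_conseq _ _ _ (12 * nb + 24) _ Q); [by clear; lia|by []|].
  apply: (@cbits_spec _ s1 g X 1 nb) => //; rewrite ?/s1 /= ?/upd /= ?EX //.
  - by rewrite E28 E29; field; rewrite gt_eqF.
  - by rewrite mulr1 X0 HX.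
  move=> s' z S1 S2 S3 S4 S5; rewrite !mulr1 => /andP[S6 S7].
  apply: (HQ s' (g * z%:R)) => //.
  + case: S1 => a b c; split=> // x Hx; have [-> ->] := c x Hx.
    have [h6 h7 h8] : [/\ x != 6%N, x != 7%N & x != 8%N] by split; apply/eqP => E; subst x.
    by rewrite /= /upd (negbTE h6) (negbTE h7) (negbTE h8).
  + by split; [rewrite mulr_ge0 // ltW|lra|lra|move=> _; exists z].
apply: (@det_conseq _ _ _ 3.+1 _ Q); [by []|by []|].
apply: det_if => /=; rewrite E25 h0 //.
move=> _; apply: det_run => //; apply: (HQ _ X) => //=.
- by apply: scr_setR => //; exact: scr_refl.
- by split=> //; rewrite ?g0 ?addr0 // h0.
Qed.

Definition Wspec e w := exists2 q, w = q * (ev e / `|ev e|) & qspec `|ev e| q.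

Lemma pW_spec s : P0s s -> Qst s ->
  (forall e, (e < m)%N -> (0 < h)%N -> `|ev e| < 2 * (g * 2 ^+ nb)) ->
  det pW s (m * (Tq + 8) + 3) (fun s' => [/\ sameX [:: 28]%N s s',
    [/\ nvar s' 28 = nvar s 28, rvar s' 28 = rvar s 28 & narr s' 28 = narr s 28] &
    forall e, (e < m)%N -> Wspec e (rarr s' 28 e)]).
Proof.
move=> Ps Qs Hb; have [[_ _ D2] [_ _ J0]] := Ps.
pose I k s' := [/\ sameX [:: 28]%N s s', nvar s' 14 = k,
    [/\ nvar s' 28 = nvar s 28, rvar s' 28 = rvar s 28 & narr s' 28 = narr s 28] &
    forall e, (e < k)%N -> Wspec e (rarr s' 28 e)].
apply: (@det_forT _ _ _ _ _ m I (Tq + 5)).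
- by clear; lia.
- by split=> //; keepX.
- by move=> k s' Hk [S1 S2 _ _]; split=> //=; have [-> _ _ _] := S1 2%N isT.
- move=> k s' Hk [S1 S2 [N28 R28 A28] S4].
  have [_ _ _ B0] := S1 0%N isT; have [B25 _ _ _] := S1 25%N isT; have [_ B29 _ _] := S1 29%N isT.
  apply: (@det_seqT _ _ _ _ 1 (Tq + 3)); first by clear; lia.
  apply: det_run => //; set s1 := run _ _.
  have q1 : Qst s1.
    case: Qs => a b c; split; rewrite /s1 /= /upd /= ?B25 ?R28 //.
    by rewrite N28 B29.
  have q2 : rvar s1 10 = `|ev k| by rewrite /s1 /= /upd /= S2 B0 J0 abs_sqrt.
  have q3 : scr s' s1 by rewrite /s1; apply: scr_setR => //; exact: scr_refl.
  have q4 : nvar s1 = nvar s' by [].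
  clearbody s1.
  apply: (@det_seqT _ _ _ _ Tq 1); first by clear; lia.
  apply: (cquant_spec q1 q2) => //; first by move=> hp; exact: Hb.
  move=> s2 q U1 U2 U3 U4.
  have V : scr s' s2.
    case: q3 U1 => a1 a2 a3 [b1 b2 b3]; split; rewrite ?b1 ?b2 // => x Hx.
    by have [-> ->] := b3 x Hx; exact: a3.
  have [Va Vr Vo] := V.
  have e14 : nvar s2 14 = k by rewrite U2 // q4.
  apply: det_run => //; set s3 := run _ _.
  have X : sameX [:: 28]%N s s3 by rewrite /s3; apply: sameX_putR => //; apply: scr_sameX V S1.
  have r28 : rarr s3 28 = upd (rarr s' 28) k (q * (ev k / `|ev k|)).
    by rewrite /s3 /= /upd /= e14 U3 Vr B0 J0 abs_sqrt.
  have n28 : nvar s3 28 = nvar s' 28 /\ rvar s3 28 = rvar s' 28 by exact: (Vo 28%N isT).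
  have a28 : narr s3 28 = narr s' 28 by rewrite /s3 /= Va.
  have n14 : nvar s3 14 = k by [].
  clearbody s3; case: n28 => n28 m28; split=> //; split=> //=; first by keepX.
  + by rewrite /upd /= n28 m28 a28.
  + move=> e; rewrite ltnS leq_eqVlt r28 /upd; case: eqVneq => [-> _|ne] /=; last exact: S4.
    by exists q.
- by move=> s' [S1 S2 S3 S4].
Qed.

Variable K : nat -> nat.

Lemma pS_spec s : P0s s -> Qst s -> narr s 16 = rc -> rarr s 16 = n1 ->
  (forall i, (i < n)%N -> narr s 20 i = K i) -> narr s 38 = (fun=> 0%N) ->
  (forall i, (i < n)%N -> (0 < h)%N -> 2 * n1 i / (K i)%:R < 2 * (g * 2 ^+ nb)) ->
  det pS s (n * (Tq + 13) + 3) (fun s' => [/\ sameX [:: 38]%N s s',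
    (forall i, (i < n)%N -> narr s' 38 i = if (rc i <= K i)%N then 0%N else K i) &
    forall i, (i < n)%N -> (K i < rc i)%N ->
      exists2 q, rarr s' 38 i = q + g & qspec (2 * n1 i / (K i)%:R) q]).
Proof.
move=> Ps Qs E16 F16 EK E38 Hb; have [[D0 _ D2] [_ _ J0]] := Ps.
pose I k s' := [/\ sameX [:: 38]%N s s', nvar s' 14 = k,
    (forall i, (i < n)%N -> narr s' 38 i = if (k <= i)%N || (rc i <= K i)%N then 0%N else K i) &
    forall i, (i < k)%N -> (K i < rc i)%N ->
      exists2 q, rarr s' 38 i = q + g & qspec (2 * n1 i / (K i)%:R) q].
apply: (@det_forT _ _ _ _ _ n I (Tq + 10)).
- by clear; lia.
- by split=> //=; [keepX|move=> i _; rewrite E38].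
- by move=> k s' Hk [S1 S2 _ _]; split=> //=; have [-> _ _ _] := S1 0%N isT.
- move=> k s' Hk [S1 S2 S3 S4].
  have [_ _ B16 C16] := S1 16%N isT; have [_ _ B20 _] := S1 20%N isT.
  have [B25 _ _ _] := S1 25%N isT; have [B28 C28 _ _] := S1 28%N isT; have [_ B29 _ _] := S1 29%N isT.
  apply: (@det_conseq _ _ _ (Tq + 9).+1 _ (fun s2 => nvar s2 14 = k /\ I k.+1 (set_nvar s2 14 k.+1))); [by clear; lia|by []|].
  apply: det_if => /=; rewrite S2 B16 B20 E16 EK //.
    move=> Hle; apply: det_run; [by []|by clear; rewrite /=; lia|].
    split=> //; split=> //=; first by keepX.
      move=> i Hi; rewrite S3 //; case: (ltngtP i k) => [H|H|->] //=.
      by rewrite Hle.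
    move=> i; rewrite ltnS leq_eqVlt => /orP[/eqP->|/S4 //]; by rewrite ltnNge Hle.
  rewrite -ltnNge => Hlt.
  apply: (@det_seqT _ _ _ _ 1 (Tq + 7)); first by clear; lia.
  apply: det_run => //.
  apply: (@det_seqT _ _ _ _ 1 (Tq + 5)); first by clear; lia.
  apply: det_run => //; set s1 := run _ _.
  have q1 : Qst s1.
    case: Qs => a b c; split; rewrite /s1 /= /upd /= ?B25 ?C28 //.
    by rewrite B28 B29.
  have q2 : rvar s1 10 = 2 * n1 k / (K k)%:R by rewrite /s1 /= /upd /= S2 C16 F16 B20 EK.
  have q3 : sameX [:: 38]%N s s1 by rewrite /s1; keepX.
  have q4 : nvar s1 = nvar s' by [].
  have q5 : narr s1 38 = upd (narr s' 38) k (K k) by rewrite /s1 /= /upd /= S2 B20 EK.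
  have q6 : rarr s1 = rarr s' by [].
  have q7 : rvar s1 28 = g by case: q1.
  clearbody s1.
  apply: (@det_seqT _ _ _ _ Tq 1); first by clear; lia.
  apply: (cquant_spec q1 q2).
  - by rewrite mulr_ge0 ?mulr_ge0 ?norm1f_ge0 ?invr_ge0 ?ler0n.
  - by move=> hp; exact: Hb.
  move=> s2 q U1 U2 U3 U4; have [Va Vr Vo] := U1.
  have e14 : nvar s2 14 = k by rewrite U2 // q4.
  apply: det_run => //; set s3 := run _ _.
  have X : sameX [:: 38]%N s s3 by rewrite /s3; apply: sameX_putR => //; apply: scr_sameX U1 q3.
  have r38 : rarr s3 38 = upd (rarr s' 38) k (q + g).
    rewrite /s3 /= /upd /= e14 U3 Vr q6; have [_ ->] := Vo 28%N isT; by rewrite q7.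
  have a38 : narr s3 38 = upd (narr s' 38) k (K k) by rewrite /s3 /= Va q5.
  have n14 : nvar s3 14 = k by [].
  clearbody s3; split=> //; split=> //=; first by keepX.
  + move=> i Hi; rewrite a38 /upd; case: (ltngtP i k) => [H|H|->] //=; rewrite ?S3 //.
    * by rewrite (leqNgt k i) H /=.
    * by rewrite (ltnW H).
    * by rewrite leqNgt Hlt.
  + move=> i; rewrite ltnS leq_eqVlt r38 /upd; case: eqVneq => [-> _ _|ne] /=; last exact: S4.
    by exists q.
- move=> s' [S1 S2 S3 S4]; split=> // i Hi.
  by rewrite S3 // leqNgt Hi.
Qed.
End Quant.

Variable K : nat -> nat.
Definition hd' e := (rc (er e) <= K (er e))%N || (n1 (er e) <= (K (er e))%:R * `|ev e|).
(** The share of an entry in [rc] slots of its row, rounded up. A row needs at most twice its entry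
    count, which is why its segment has length [2 * d]. *)
Definition cef e := slots (`|ev e| * (rc (er e))%:R) (n1 (er e)).

Definition segT (D : nat) (T w : nat -> nat) i (f : nat -> R) := \sum_(0 <= k < w i) f (T (i * D + k)%N).

Lemma seg_ne D i i0 k k0 : i != i0 -> (k < D)%N -> (k0 < D)%N -> (i * D + k)%N != (i0 * D + k0)%N.
Proof.
move=> ne Hk Hk0; apply: contraNneq ne => E.
have D0 : (0 < D)%N by apply: leq_ltn_trans Hk.
by rewrite -(divnMDl i k D0 : _ = _) divn_small // addn0 in E || idtac;
   have := congr1 (divn^~ D) E; rewrite !divnMDl // !divn_small // !addn0 => ->.
Qed.

(** No segment exceeds its length [D], so appending to one of them cannot reach into another. *)
Lemma seg_blit D T w i0 c v : (w i0 + c <= D)%N -> (forall i, (w i <= D)%N) ->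
  let T' := blit T (i0 * D + w i0) c v in let w' := upd w i0 (w i0 + c)%N in
  (forall i f, segT D T' w' i f = segT D T w i f + (if i == i0 then c%:R * f v else 0)) /\
  (forall (P : nat -> nat -> Prop), (forall i k, (k < w i)%N -> P i (T (i * D + k)%N)) -> P i0 v ->
     forall i k, (k < w' i)%N -> P i (T' (i * D + k)%N)).
Proof.
move=> Hc Hw T' w'.
have Tne i k : i != i0 -> (k < w i)%N -> T' (i * D + k)%N = T (i * D + k)%N.
  move=> ne Hk; rewrite /T' /blit; case: ifP => // /andP[h1 h2].
  have kD : (k < D)%N := leq_trans Hk (Hw i).
  have h3 : (i0 * D + (i * D + k - i0 * D) = i * D + k)%N by rewrite subnKC //; lia.
  have h4 : (i * D + k - i0 * D < D)%N by lia.
  by have := seg_ne ne kD h4; rewrite h3 eqxx.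
split=> [i f|P HP Pv i k].
  rewrite /segT /w' /upd; case: eqVneq => [->|ne]; first exact: blit_sum.
  by rewrite addr0; apply: eq_big_nat => k /andP[_ Hk]; rewrite Tne.
rewrite /w' /upd; case: eqVneq => [->|ne] Hk; last by rewrite Tne //; exact: HP.
rewrite /T' /blit; case: ifP => // /negbT H; apply: HP.
by move: H Hk; lia.
Qed.

Lemma pH_spec s : P0s s -> narr s 16 = rc -> rarr s 16 = n1 ->
  (forall i, (i < n)%N -> narr s 20 i = K i) ->
  (forall i, (i < n)%N -> narr s 21 i = i * d /\ narr s 22 i = i * (2 * d))%N ->
  [/\ narr s 32 = (fun=> 0%N) & narr s 34 = (fun=> 0%N)] ->
  (forall i, (\sum_(0 <= e < m | (er e == i) && hd' e) 1 <= d)%N) ->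
  (forall i, (\sum_(0 <= e < m | (er e == i) && ~~ hd' e) cef e <= 2 * d)%N) ->
  (forall i, (i < n)%N -> 0 < n1 i) ->
  det pH s (\sum_(0 <= e < m) (8 * cef e + 32) + 3) (fun s' => [/\ sameX [:: 32; 33; 34; 35; 36]%N s s',
    (forall i, narr s' 32 i = \sum_(0 <= e < m | (er e == i) && hd' e) 1)%N,
    (forall i, narr s' 34 i = \sum_(0 <= e < m | (er e == i) && ~~ hd' e) cef e)%N,
    (forall e, (e < m)%N -> ~~ hd' e -> narr s' 36 e = cef e) &
    [/\ forall i f, segT d (narr s' 33) (narr s' 32) i f = \sum_(0 <= e < m | (er e == i) && hd' e) f e,
        forall i f, segT (2 * d) (narr s' 35) (narr s' 34) i f =
          \sum_(0 <= e < m | (er e == i) && ~~ hd' e) (cef e)%:R * f e,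
        (forall i k, (k < narr s' 32 i)%N -> (narr s' 33 (i * d + k) < m)%N /\ er (narr s' 33 (i * d + k)) = i) &
        (forall i k, (k < narr s' 34 i)%N -> [/\ (narr s' 35 (i * (2 * d) + k) < m)%N,
           er (narr s' 35 (i * (2 * d) + k)) = i & ~~ hd' (narr s' 35 (i * (2 * d) + k))])]]).
Proof.
move=> Ps E16 F16 EK Eb [z32 z34] Hhd Htl n1p; have [[D0 D1 D2] [I0 _ J0]] := Ps.
pose I k s' := [/\ sameX [:: 32; 33; 34; 35; 36]%N s s', nvar s' 14 = k,
    (forall i, narr s' 32 i = \sum_(0 <= e < k | (er e == i) && hd' e) 1)%N,
    (forall i, narr s' 34 i = \sum_(0 <= e < k | (er e == i) && ~~ hd' e) cef e)%N &
    (forall e, (e < k)%N -> ~~ hd' e -> narr s' 36 e = cef e) /\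
    [/\ forall i f, segT d (narr s' 33) (narr s' 32) i f = \sum_(0 <= e < k | (er e == i) && hd' e) f e,
        forall i f, segT (2 * d) (narr s' 35) (narr s' 34) i f =
          \sum_(0 <= e < k | (er e == i) && ~~ hd' e) (cef e)%:R * f e,
        (forall i k, (k < narr s' 32 i)%N -> (narr s' 33 (i * d + k) < m)%N /\ er (narr s' 33 (i * d + k)) = i) &
        (forall i k, (k < narr s' 34 i)%N -> [/\ (narr s' 35 (i * (2 * d) + k) < m)%N,
           er (narr s' 35 (i * (2 * d) + k)) = i & ~~ hd' (narr s' 35 (i * (2 * d) + k))])]].
rewrite (eq_bigr (fun e => (8 * cef e + 29) + 3)%N); last by move=> i _; lia.
have recN (P : pred nat) (f : nat -> nat) k : (\sum_(0 <= e < k.+1 | P e) f e = \sum_(0 <= e < k | P e) f e + (if P k then f k else 0))%N.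
  by rewrite [LHS]big_mkcond big_nat_recr //= -big_mkcond.
have recR (P : pred nat) (f : nat -> R) k : \sum_(0 <= e < k.+1 | P e) f e = \sum_(0 <= e < k | P e) f e + (if P k then f k else 0).
  by rewrite [LHS]big_mkcond big_nat_recr //= -big_mkcond.
have mono (P : pred nat) (f : nat -> nat) k : (k <= m)%N -> (\sum_(0 <= e < k | P e) f e <= \sum_(0 <= e < m | P e) f e)%N.
  by move=> Hk; rewrite [X in (_ <= X)%N](big_cat_nat _ (n := k)) //= leq_addr.
apply: (@det_for _ _ _ _ _ m I (fun e => 8 * cef e + 29)%N).
- split=> //=; first by keepX.
  + by move=> i; rewrite big_geq // z32.
  + by move=> i; rewrite big_geq // z34.
  + split=> //; split=> [i f|i f|i k|i k]; rewrite /segT /= ?z32 ?z34 //.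
      by rewrite !big_geq.
    by rewrite !big_geq.
- by move=> k s' Hk [S1 S2 _ _ _]; split=> //=; have [-> _ _ _] := S1 2%N isT.
- move=> k s' Hk [S1 S2 S3 S4 [S5 [S6 S7 S8 S9]]].
  have [_ _ A0 B0] := S1 0%N isT; have [_ _ A16 B16] := S1 16%N isT; have [_ _ A20 _] := S1 20%N isT.
  have [_ _ A21 _] := S1 21%N isT; have [_ _ A22 _] := S1 22%N isT.
  have Hi := er_lt Hk; set i0 := er k in Hi *.
  have [b1 b2] := Eb i0 Hi.
  have w32 i : (narr s' 32 i <= d)%N by rewrite S3; apply: leq_trans (Hhd i); apply: mono; exact: ltnW.
  have w34 i : (narr s' 34 i <= 2 * d)%N by rewrite S4; apply: leq_trans (Htl i); apply: mono; exact: ltnW.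
  apply: (@det_seqT _ _ _ _ 1 (8 * cef k + 27)); first by clear; lia.
  apply: det_run => //; set s1 := run _ _.
  have e13 : nvar s1 13 = i0 by rewrite /s1 /= /upd /= S2 A0 I0.
  have e14 : nvar s1 14 = k by [].
  have X1 : sameX [:: 32; 33; 34; 35; 36]%N s s1 by rewrite /s1; keepX.
  have na1 : narr s1 = narr s' by [].
  have ra1 : rarr s1 = rarr s' by [].
  clearbody s1.
  have bE : beval s1 pHcond = hd' k.
    rewrite /pHcond /= e13 e14 na1 ra1 A16 A20 B16 B0 abs_sqrt E16 F16 J0 EK // /hd' -/i0.
    by rewrite negb_and !negbK.
  apply: (@det_conseq _ _ _ (8 * cef k + 26).+1 _ (fun s2 => nvar s2 14 = k /\ I k.+1 (set_nvar s2 14 k.+1))); [by clear; lia|by []|].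
  apply: det_if; rewrite bE => Hh.
    apply: det_run; [by []|by rewrite /=; clear; lia|]; set s3 := run _ _.
    have t32 : narr s3 32 = upd (narr s' 32) i0 (narr s' 32 i0 + 1)%N by rewrite /s3 /= /upd /= e13 na1.
    have t33 : narr s3 33 = blit (narr s' 33) (i0 * d + narr s' 32 i0) 1 k.
      by rewrite blit1 /s3 /= /upd /= e13 e14 na1 A21 b1.
    have t34 : narr s3 34 = narr s' 34 by rewrite /s3 /= /upd /= na1.
    have t35 : narr s3 35 = narr s' 35 by rewrite /s3 /= /upd /= na1.
    have t36 : narr s3 36 = narr s' 36 by rewrite /s3 /= /upd /= na1.
    have t14 : nvar s3 14 = k by [].
    have X3 : sameX [:: 32; 33; 34; 35; 36]%N s s3 by rewrite /s3; keepX.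
    clearbody s3.
    have le1 : (narr s' 32 i0 + 1 <= d)%N.
      apply: leq_trans (Hhd i0); rewrite S3; apply: leq_trans (mono _ _ _ Hk).
      by rewrite recN eqxx Hh.
    have [Z1 Z2] := seg_blit (narr s' 33) k le1 w32.
    split=> //; split=> //=; first by keepX.
    + by move=> i; rewrite recN t32 /upd Hh andbT eq_sym; case: eqVneq => [->|ne]; rewrite S3 ?addn0.
    + by move=> i; rewrite recN t34 Hh andbF addn0.
    + split=> [e|]; first by rewrite ltnS leq_eqVlt t36 => /orP[/eqP->|/S5//]; rewrite Hh.
      rewrite t32 t33 t34 t35; split=> //.
      * by move=> i f; rewrite Z1 S6 recR Hh andbT eq_sym; case: eqP; rewrite ?mul1r.
      * by move=> i f; rewrite recR Hh andbF addr0 S7.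
      * by apply: (Z2 (fun i t => (t < m)%N /\ er t = i)).
  have np : 0 < n1 i0 := n1p i0 Hi.
  have [c0 c1 c2 c3] : [/\ (0 < cef k)%N, `|ev k| * (rc i0)%:R <= (cef k)%:R * n1 i0,
     (forall c', (0 < c' < cef k)%N -> c'%:R * n1 i0 < `|ev k| * (rc i0)%:R) & (cef k)%:R * n1 i0 <= `|ev k| * (rc i0)%:R + n1 i0].
    by apply: slotsP; rewrite ?mulr_ge0 ?ler0n ?(ltW np) //; left.
  apply: (@det_seqT _ _ _ _ 1 (8 * cef k + 24)); first by clear; lia.
  apply: det_run => //.
  apply: (@det_seqT _ _ _ _ 1 (8 * cef k + 22)); first by clear; lia.
  apply: det_run => //.
  apply: (@det_seqT _ _ _ _ 1 (8 * cef k + 20)); first by clear; lia.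
  apply: det_run => //.
  apply: (@det_seqT _ _ _ _ 1 (8 * cef k + 18)); first by clear; lia.
  apply: det_run => //.
  apply: (@det_seqT _ _ _ _ 1 (8 * cef k + 16)); first by clear; lia.
  apply: det_run => //; set s2 := run _ _.
  have r4 : rvar s2 4 = `|ev k| * (rc i0)%:R by rewrite /s2 /= /upd /= e14 e13 na1 ra1 A16 B0 abs_sqrt J0 E16.
  have r5 : rvar s2 5 = n1 i0 by rewrite /s2 /= /upd /= e13 ra1 B16 F16.
  have q4 : nvar s2 4 = (i0 * (2 * d))%N by rewrite /s2 /= /upd /= e13 na1 A22 b2.
  have q5 : nvar s2 5 = narr s' 34 i0 by rewrite /s2 /= /upd /= e13 na1.
  have q6 : nvar s2 6 = k by rewrite /s2 /= /upd /= e14.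
  have q13 : nvar s2 13 = i0 by rewrite /s2 /= /upd /= e13.
  have q14 : nvar s2 14 = k by rewrite /s2 /= /upd /= e14.
  have qa : narr s2 = narr s' by rewrite /s2 /= na1.
  have X2 : sameX [:: 32; 33; 34; 35; 36]%N s s2 by rewrite /s2; keepX.
  clearbody s2; clear s1 e13 e14 X1 na1 ra1 bE.
  apply: (@det_seqT _ _ _ _ (8 * cef k + 6) 3); first by clear; lia.
  apply: (@cfill_spec _ _ _ (cef k)) => //; rewrite ?r4 ?r5 //.
  apply: det_run => //; set s3 := run _ _.
  have t34 : narr s3 34 = upd (narr s' 34) i0 (narr s' 34 i0 + cef k)%N by rewrite /s3 /filled /= /upd /= q13 q5 qa.
  have t35 : narr s3 35 = blit (narr s' 35) (i0 * (2 * d) + narr s' 34 i0) (cef k) k.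
    by rewrite /s3 /filled /= /upd /= q4 q5 q6 qa.
  have t36 : narr s3 36 = upd (narr s' 36) k (cef k) by rewrite /s3 /filled /= /upd /= q14 qa.
  have t32 : narr s3 32 = narr s' 32 by rewrite /s3 /filled /= /upd /= qa.
  have t33 : narr s3 33 = narr s' 33 by rewrite /s3 /filled /= /upd /= qa.
  have t14 : nvar s3 14 = k by rewrite /s3 /filled /= /upd /= q14.
  have X3 : sameX [:: 32; 33; 34; 35; 36]%N s s3 by rewrite /s3 /filled; keepX.
  clearbody s3.
  have le1 : (narr s' 34 i0 + cef k <= 2 * d)%N.
    apply: leq_trans (Htl i0); rewrite S4; apply: leq_trans (mono _ _ _ Hk).
    by rewrite recN eqxx Hh.
  have [Z1 Z2] := seg_blit (narr s' 35) k le1 w34.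
  split=> //; split=> //=; first by keepX.
  + by move=> i; rewrite recN t32 (negbTE Hh) andbF addn0.
  + by move=> i; rewrite recN t34 /upd Hh andbT eq_sym; case: eqVneq => [->|ne]; rewrite S4 ?addn0.
  + split=> [e|].
      by rewrite ltnS leq_eqVlt t36 /upd; case: eqVneq => [->|ne] //=; exact: S5.
    rewrite t32 t33 t34 t35; split=> //.
    * by move=> i f; rewrite recR (negbTE Hh) andbF addr0 S6.
    * by move=> i f; rewrite Z1 S7 recR Hh andbT eq_sym.
    * by apply: (Z2 (fun i t => [/\ (t < m)%N, er t = i & ~~ hd' t])).
- by move=> s' [S1 S2 S3 S4 [S5 S6]].
Qed.

(** Array 42 holds the weight of every heavy row and 0 for the others. With it the packed columns
    arise from a single scatter over all entries. *)
Lemma pP_spec s (inH : nat -> bool) g nb : P0s s -> (forall i, (i < n)%N -> narr s 25 i = inH i :> nat) ->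
  fresh 40 s ->
  det pP s (n * 17 + 4 * m + 14) (fun s' => [/\ sameX [:: 30; 40; 41; 42; 43]%N s s',
    nvar s' 41 = (\sum_(0 <= i < n) inH i)%N,
    (forall f : nat -> R, \sum_(0 <= k < nvar s' 41) f (narr s' 41 k) = \sum_(0 <= i < n | inH i) f i) &
    0 < g -> rvar s 28 = g -> rvar s 29 = g ^+ 2 * 2 ^+ nb ->
    [/\ (forall k, (k < nvar s' 41)%N -> rarr s' 41 k = (2 ^+ nb.+1) ^+ k),
        rvar s' 42 = \sum_(0 <= k < nvar s' 41) rvar s 29 * rarr s' 41 k &
        forall j, rarr s' 43 j = \sum_(0 <= k < nvar s' 41) rarr s' 41 k * wrow m er ec (rarr s 28) (narr s' 41 k) j]]).
Proof.
move=> Ps EH fr; have [[D0 D1 D2] [I0 I1 J0]] := Ps.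
have [_ z42 _ y42] := fr 42%N isT; have [z41 _ _ _] := fr 41%N isT; have [_ _ _ z43] := fr 43%N isT.
apply: (@det_seqT _ _ _ _ 1 (n * 17 + 4 * m + 12)); first by clear; lia.
apply: det_run => //.
apply: (@det_seqT _ _ _ _ 1 (n * 17 + 4 * m + 10)); first by clear; lia.
apply: det_run => //; set s1 := run _ _.
pose B := 2 * rvar s 29 / (rvar s 28 * rvar s 28).
pose I k s' := [/\ sameX [:: 30; 40; 41; 42; 43]%N s s', nvar s' 14 = k,
   nvar s' 41 = (\sum_(0 <= i < k) inH i)%N,
   (forall f : nat -> R, \sum_(0 <= k' < nvar s' 41) f (narr s' 41 k') = \sum_(0 <= i < k | inH i) f i) &
   [/\ rvar s' 40 = B ^+ nvar s' 41, rvar s' 30 = B, (forall k', (k' < nvar s' 41)%N -> rarr s' 41 k' = B ^+ k'),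
     rvar s' 42 = \sum_(0 <= k' < nvar s' 41) rvar s 29 * rarr s' 41 k' &
     [/\ (forall f : nat -> R, \sum_(0 <= k' < nvar s' 41) rarr s' 41 k' * f (narr s' 41 k') =
         \sum_(0 <= i < k) rarr s' 42 i * f i), (forall i, (k <= i)%N -> rarr s' 42 i = 0) &
       rarr s' 43 = fun=> 0]]].
apply: (@det_seqT _ _ _ _ (n * (14 + 3) + 3) (4 * m + 3)); first by clear; lia.
apply: (@det_forT _ _ _ _ _ n I 14) => //.
- have u41 : nvar (set_nvar s1 14 0) 41 = 0%N by rewrite /s1 /= /upd /= z41.
  split; rewrite ?u41.
  + by rewrite /s1; keepX.
  + by [].
  + by rewrite big_geq.
  + by move=> f; rewrite !big_geq.
  + split; rewrite ?u41 //.
    * by rewrite /s1 /= /upd /= z42 big_geq.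
    * split=> [f|i _|]; rewrite ?u41 /s1 /= /upd /= ?y42 ?z43 //; by rewrite !big_geq.
- by move=> k s' Hk [S1 S2 _ _ _]; split=> //=; have [-> _ _ _] := S1 0%N isT.
- move=> k s' Hk [S1 S2 S3 S4 [S5 S6 S7 S8 [S9 S10 S11]]].
  have [_ _ A25 _] := S1 25%N isT; have [_ A29 _ _] := S1 29%N isT.
  have recR (f : nat -> R) : \sum_(0 <= e < k.+1 | inH e) f e = \sum_(0 <= e < k | inH e) f e + (if inH k then f k else 0).
    by rewrite [LHS]big_mkcond big_nat_recr //= -big_mkcond.
  apply: (@det_conseq _ _ _ 13.+1 _ (fun s2 => nvar s2 14 = k /\ I k.+1 (set_nvar s2 14 k.+1))); [by []|by []|].
  apply: det_if; rewrite /= S2 A25 EH // => Hin; last first.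
    apply: det_run => //; split=> //; move: Hin; rewrite lt0b => Hin; split=> //=; first by keepX.
    + by rewrite /upd /= big_nat_recr //= S3 (negbTE Hin) addn0.
    + by move=> f; rewrite recR (negbTE Hin) addr0 -S4.
    + rewrite /upd /=; split=> //; split=> // [f|i Hi]; last by rewrite S10 // ltnW.
      by rewrite big_nat_recr //= S10 // mul0r addr0 -S9.
  move: Hin; rewrite lt0b => Hin.
  apply: det_run => //; set s3 := run _ _; set c := nvar s' 41 in S3 S4 S5 S7 S8 S9.
  have t14 : nvar s3 14 = k by [].
  have t41 : nvar s3 41 = c.+1 by rewrite /s3 /= /upd /= addn1.
  have a41 : narr s3 41 = upd (narr s' 41) c k by rewrite /s3 /= /upd /= S2.
  have r41 : rarr s3 41 = upd (rarr s' 41) c (B ^+ c) by rewrite /s3 /= /upd /= S5.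
  have r42 : rarr s3 42 = upd (rarr s' 42) k (B ^+ c) by rewrite /s3 /= /upd /= S2 S5.
  have v42 : rvar s3 42 = rvar s' 42 + rvar s 29 * B ^+ c by rewrite /s3 /= /upd /= A29 S5.
  have v40 : rvar s3 40 = B ^+ c * B by rewrite /s3 /= /upd /= S5 S6.
  have v30 : rvar s3 30 = B by rewrite /s3 /= /upd /= S6.
  have r43 : rarr s3 43 = fun=> 0 by rewrite /s3 /= /upd /= S11.
  have X3 : sameX [:: 30; 40; 41; 42; 43]%N s s3 by rewrite /s3; keepX.
  clearbody s3.
  have updl (T : Type) (f : nat -> T) v k' : (k' < c)%N -> upd f c v k' = f k' by move=> H; rewrite /upd (ltn_eqF H).
  split=> //; split=> //=; rewrite ?/upd /= ?t41; first by keepX.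
  + by rewrite big_nat_recr //= -S3 Hin addn1.
  + move=> f; rewrite big_nat_recr //= recR Hin a41 /upd eqxx -S4; congr (_ + _).
    by apply: eq_big_nat => k' /andP[_ Hk']; rewrite (ltn_eqF Hk').
  + rewrite v40 v30 v42; split=> //.
    * by rewrite exprSr.
    * move=> k'; rewrite ltnS leq_eqVlt r41 /upd; case: eqVneq => [->|ne] //=; exact: S7.
    * rewrite big_nat_recr //= r41 /upd eqxx S8; congr (_ + _).
      by apply: eq_big_nat => k' /andP[_ Hk']; rewrite (ltn_eqF Hk').
    * split=> [f|i Hi|//]; last by rewrite r42 /upd gtn_eqF // S10 // ltnW.
      rewrite big_nat_recr //= [RHS]big_nat_recr //= r41 a41 r42 /upd !eqxx; congr (_ + _).
      rewrite (eq_big_nat _ _ (F2 := fun k' => rarr s' 41 k' * f (narr s' 41 k'))); last first.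
        by move=> k' /andP[_ Hk']; rewrite (ltn_eqF Hk').
      rewrite S9; apply: eq_big_nat => i /andP[_ Hi].
      by rewrite (ltn_eqF Hi).
move=> s2 [S1 S2 S3 S4 [S5 S6 S7 S8 [S9 S10 S11]]].
have [A2 _ _ _] := S1 2%N isT; have [_ _ A0 _] := S1 0%N isT; have [_ _ A1 _] := S1 1%N isT.
have [_ _ _ R28] := S1 28%N isT.
apply: (@cscatter_spec _ _ _ _ _ _ ec (fun e => rarr s 28 e * rarr s2 42 (er e)) m) => //; first by rewrite A2.
  by move=> e A He; rewrite /= /upd /= A0 A1 R28 I0 I1.
split=> //=; first by keepX.
move=> gp Eg Ee0.
have BE : B = 2 ^+ nb.+1.
  by rewrite /B Eg Ee0 [2 ^+ nb.+1]exprS; field; rewrite gt_eqF.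
rewrite /upd /= -BE; split=> // j.
rewrite S11 add0r (S9 (fun i => wrow m er ec (rarr s 28) i j)).
transitivity (\sum_(0 <= e < m) (ec e == j)%:R * (rarr s 28 e * rarr s2 42 (er e))).
  by rewrite big_mkcond; apply: eq_bigr => e _; case: eqP; rewrite ?mul1r ?mul0r.
rewrite -(sum_rsum er_lt); apply: eq_bigr => i _; rewrite /wrow /rsum mulr_sumr.
by apply: eq_bigr => e /eqP ->; rewrite /delta eq_sym; ring.
Qed.
End Pre2.

(** * Real inequalities kept apart from large contexts *)

Lemma mul_le_sqrD (R : realType) (a b : R) : a * b <= (a ^+ 2 + b ^+ 2) / 2.
Proof. by have := sqr_ge0 (a - b); rewrite !expr2; lra. Qed.
Lemma mid_le (R : realType) (a b c : R) : a <= c -> b <= c -> (a + b) / 2 <= c.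
Proof. by lra. Qed.
Lemma pack_lt (R : realType) (w a b c f : R) : w * a <= f -> w * b <= w * (2 * a + c) ->
  w * c <= f -> 0 < f -> w * a + w * b < 8 * f.
Proof. by lra. Qed.
Lemma perturb_upper (R : realType) (M G g q : R) :
  M <= 2 * G + 2 * (g / 4) * q -> 0 <= g * q -> M <= 2 * (G + g * q).
Proof. by lra. Qed.
Lemma perturb_lower (R : realType) (M G g q X : R) :
  G <= 2 * M + 2 * (g / 4) * q -> g * q <= X -> 0 <= g * q -> G + g * q <= 2 * M + 2 * X.
Proof. by lra. Qed.
Lemma half_sum_le (R : realType) (a b : R) : b <= a -> a / 2 + b / 2 <= a.
Proof. by lra. Qed.
Lemma sub2_le1 (R : realType) (x y : R) : 0 <= x -> 0 <= y -> 1 - x - y <= 1.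
Proof. by lra. Qed.
Lemma sub_mono2 (R : realType) (a b f : R) : b <= a -> 0 <= f -> 1 - a - f <= 1 - b.
Proof. by lra. Qed.

(** * Sizes of the tables and norm inequalities for rows *)

Section Counting.
Variable R : realType.
Variables (n d m : nat) (er ec : nat -> nat) (ev : nat -> R).
Hypothesis er_lt : forall e, (e < m)%N -> (er e < n)%N.
Hypothesis ec_lt : forall e, (e < m)%N -> (ec e < d)%N.
Hypothesis erc_inj : forall e e', (e < m)%N -> (e' < m)%N ->
  er e = er e' -> ec e = ec e' -> e = e'.
Hypothesis ev_nz : forall e, (e < m)%N -> ev e != 0.
Hypothesis rowne : forall i, (i < n)%N -> exists2 e, (e < m)%N & er e = i.
Local Notation n1 := (norm1f m er ev).
Local Notation n2 := (norm2f m er ev).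
Local Notation F := (frob m ev).
Local Notation rc := (rcf m er).

Lemma rc_le_d i : (rc i <= d)%N.
Proof.
pose s := [seq ec e | e <- index_iota 0 m & er e == i].
have sz : size s = rc i by rewrite /rcf sum1_count size_map size_filter.
rewrite -sz -[d](size_iota 0); apply: uniq_leq_size.
  rewrite map_inj_in_uniq ?filter_uniq ?iota_uniq // => e e'.
  rewrite !mem_filter !mem_index_iota => /andP[/eqP h1 /andP[_ h2]] /andP[/eqP h3 /andP[_ h4]].
  by apply: erc_inj => //; rewrite h1.
move=> j /mapP[e]; rewrite mem_filter mem_index_iota => /andP[_ /andP[_ He]] ->.
by rewrite mem_iota /= add0n ec_lt.
Qed.

Lemma sum_rc : (\sum_(0 <= i < n) rc i = m)%N.
Proof.
rewrite /rcf (exchange_big_dep_nat xpredT) //=.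
rewrite (eq_big_nat _ _ (F2 := fun=> 1%N)); last first.
  move=> e /andP[_ He]; rewrite (eq_bigl (fun i => i == er e)); last by move=> i; rewrite eq_sym.
  by rewrite big_nat1_eq leq0n /= er_lt.
by rewrite sum_nat_const_nat subn0 muln1.
Qed.

Lemma rc_rsum i (a : R) : rsum m er i (fun=> a) = (rc i)%:R * a.
Proof. by rewrite /rsum /rcf natr_sum mulr_suml; apply: eq_bigr => e _; rewrite mul1r. Qed.

Lemma rsum_ge i f e : (forall e, 0 <= f e) -> (e < m)%N -> er e = i -> f e <= rsum m er i f :> R.
Proof.
move=> f0 He Ee; rewrite /rsum big_mkcond (bigD1_seq e) ?mem_index_iota ?iota_uniq //= Ee eqxx lerDl.
by apply: sumr_ge0 => e' _; case: ifP.
Qed.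

Lemma rc_gt0 i : (i < n)%N -> (0 < rc i)%N.
Proof.
move=> /rowne[e He Ee]; rewrite /rcf big_mkcond (bigD1_seq e) ?mem_index_iota ?iota_uniq //=.
by rewrite Ee eqxx.
Qed.

Lemma n_le_m : (n <= m)%N.
Proof.
rewrite -[X in (_ <= X)%N]sum_rc; apply: (@leq_trans (\sum_(0 <= i < n) 1)).
  by rewrite sum_nat_const_nat subn0 muln1.
rewrite big_nat_cond [X in (_ <= X)%N]big_nat_cond; apply: leq_sum => i /andP[/andP[_ Hi] _].
exact: rc_gt0.
Qed.

Lemma n1_gt0 i : (i < n)%N -> 0 < n1 i.
Proof.
move=> /rowne[e He Ee]; apply: lt_le_trans (rsum_ge (f := fun e => `|ev e|) _ He Ee) => //.
by rewrite normr_gt0 ev_nz.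
Qed.

Lemma n2_gt0 i : (i < n)%N -> 0 < n2 i.
Proof.
move=> /rowne[e He Ee]; apply: lt_le_trans (rsum_ge (f := fun e => ev e ^+ 2) _ He Ee).
  by rewrite lt_def sqr_ge0 andbT expf_neq0 // ev_nz.
by move=> ?; rewrite sqr_ge0.
Qed.

Lemma rsumD i (f g : nat -> R) : rsum m er i (fun e => f e + g e) = rsum m er i f + rsum m er i g.
Proof. by rewrite /rsum big_split. Qed.
Lemma rsumZ i c (f : nat -> R) : rsum m er i (fun e => c * f e) = c * rsum m er i f.
Proof. by rewrite /rsum mulr_sumr. Qed.

(** The nonnegative variance of [|ev e|] about its mean [t] over the row. *)
Lemma n1_sqr_le i : (i < n)%N -> n1 i ^+ 2 <= (rc i)%:R * n2 i.
Proof.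
move=> Hi; have r0 : 0 < (rc i)%:R :> R by rewrite ltr0n rc_gt0.
pose t := n1 i / (rc i)%:R.
have : 0 <= rsum m er i (fun e => (`|ev e| - t) ^+ 2) by apply: rsum_ge0 => e _; rewrite sqr_ge0.
have -> : rsum m er i (fun e => (`|ev e| - t) ^+ 2) = n2 i + (- (2 * t)) * n1 i + (rc i)%:R * t ^+ 2.
  rewrite -rc_rsum -rsumZ -!rsumD; apply: eq_rsum => e _ _.
  by rewrite -[ev e ^+ 2]real_normK ?num_real //; ring.
have -> : n2 i + - (2 * t) * n1 i + (rc i)%:R * t ^+ 2 = n2 i - n1 i ^+ 2 / (rc i)%:R.
  by rewrite /t; field; rewrite gt_eqF.
by rewrite subr_ge0 ler_pdivrMr // mulrC.
Qed.

Lemma n2_le_sqr i : n2 i <= n1 i ^+ 2.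
Proof.
rewrite expr2 -rsumZ; apply: rsum_le => e He Ee.
rewrite -[ev e ^+ 2]real_normK ?num_real // expr2; apply: ler_wpM2r => //.
by apply: (rsum_ge (f := fun e => `|ev e|)).
Qed.

Lemma F_le_sumS : F <= sumS n m er ev.
Proof.
rewrite -(sum_norm2f ev er_lt) /sumS; apply: ler_sum => i _.
have n20 := norm2f_ge0 m er ev i.
rewrite -{1}[n2 i]sqr_sqrtr // expr2; apply: ler_wpM2l; first by rewrite sqrtr_ge0.
by rewrite -[leRHS]ger0_norm ?norm1f_ge0 // -sqrtr_sqr ler_sqrt ?n2_le_sqr // sqr_ge0.
Qed.

Lemma F_gt0 : (0 < n)%N -> 0 < F.
Proof.
move=> Hn; rewrite -(sum_norm2f ev er_lt) (bigD1_seq 0%N) ?mem_index_iota ?iota_uniq //=.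
by apply: ltr_pwDl; [exact: n2_gt0|apply: sumr_ge0 => i _; exact: norm2f_ge0].
Qed.

Hypothesis np : (0 < n)%N.
Let F0 := F_gt0 np.

(** Since F <= S, the condition implies N^3 <= m^2, which fails for N > m. *)
Lemma Ncond_le mu N : Ncond n m er ev mu N -> (N <= m)%N.
Proof.
move=> /andP[H _]; rewrite leqNgt; apply/negP => Hlt.
have SF := F_le_sumS; have F0' := F0; set S := sumS n m er ev in H SF.
have N3 : m%:R * m%:R + 1 <= N%:R * (N%:R * N%:R) :> R.
  by rewrite -!natrM natr1 ler_nat; nia.
have FS : F * F <= S * S by apply: ler_pM => //; exact: ltW.
have FF : 0 < F * F by exact: mulr_gt0.
have mm : 0 <= m%:R * m%:R :> R by rewrite mulr_ge0.
have : (m%:R * m%:R + 1) * (F * F) <= N%:R * (N%:R * N%:R) * (S * S).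
  by apply: ler_pM => //; [lra|exact: ltW].
lra.
Qed.

Local Notation crf := (crf m er ev).
Lemma crfP i : [/\ (0 < crf i)%N, n2 i * m%:R <= (crf i)%:R * F & (crf i)%:R * F <= n2 i * m%:R + F].
Proof.
by have [h1 h2 _ h4] := slotsP (mulr_ge0 (norm2f_ge0 m er ev i) (ler0n R m)) (or_introl F0) (ltW F0); split.
Qed.

Lemma sum_crf_le : (\sum_(0 <= i < n) crf i <= m + n)%N.
Proof.
rewrite -(ler_nat R) natr_sum natrD -(ler_pM2r F0) mulr_suml.
apply: (@le_trans _ _ (\sum_(0 <= i < n) (n2 i * m%:R + F))).
  by apply: ler_sum => i _; have [] := crfP i.
rewrite big_split /= -mulr_suml (sum_norm2f ev er_lt) sumr_const_nat subn0 mulrDl [F * _]mulrC lerD2l.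
by rewrite mulr_natl.
Qed.

Lemma sum_crf_ge : (m <= \sum_(0 <= i < n) crf i)%N.
Proof.
rewrite -(ler_nat R) natr_sum -(ler_pM2r F0) mulr_suml -{1}(sum_norm2f ev er_lt) mulr_sumr.
by apply: ler_sum => i _; rewrite mulrC; have [] := crfP i.
Qed.

Local Notation cef := (cef m er ev).
Lemma cefP e : (e < m)%N -> [/\ (0 < cef e)%N, `|ev e| * (rc (er e))%:R <= (cef e)%:R * n1 (er e) &
  (cef e)%:R * n1 (er e) <= `|ev e| * (rc (er e))%:R + n1 (er e)].
Proof.
move=> He; have p := n1_gt0 (er_lt He).
by have [h1 h2 _ h4] := slotsP (mulr_ge0 (normr_ge0 (ev e)) (ler0n R (rc (er e)))) (or_introl p) (ltW p); split.
Qed.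

Lemma sum_cef_row i : (i < n)%N -> (\sum_(0 <= e < m | er e == i) cef e <= 2 * rc i)%N.
Proof.
move=> Hi; have p := n1_gt0 Hi.
rewrite -(ler_nat R) natr_sum natrM -(ler_pM2r p) mulr_suml -/(rsum m er i (fun e => (cef e)%:R * n1 i)).
apply: (@le_trans _ _ (rsum m er i (fun e => (rc i)%:R * `|ev e| + n1 i))).
  by apply: rsum_le => e He Ee; have [_ _] := cefP He; rewrite Ee [_ * (rc i)%:R]mulrC.
rewrite rsumD rsumZ rc_rsum -/(n1 i); lra.
Qed.

Lemma sum_cef : (\sum_(0 <= e < m) cef e <= 2 * m)%N.
Proof.
have -> : (\sum_(0 <= e < m) cef e = \sum_(0 <= i < n) \sum_(0 <= e < m | er e == i) cef e)%N.
  rewrite (exchange_big_dep_nat xpredT) //=; apply: eq_big_nat => e /andP[_ He].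
  rewrite (eq_bigl (fun i => i == er e)); last by move=> i; rewrite eq_sym.
  by rewrite big_nat1_eq leq0n /= er_lt.
rewrite -{3}sum_rc big_distrr /= big_nat_cond [X in (_ <= X)%N]big_nat_cond.
by apply: leq_sum => i /andP[/andP[_ Hi] _]; exact: sum_cef_row.
Qed.

Lemma ev_sqr_leF e : (e < m)%N -> ev e ^+ 2 <= F.
Proof.
move=> He; rewrite /frob (bigD1_seq e) ?mem_index_iota ?iota_uniq //= lerDl.
by apply: sumr_ge0 => ? _; rewrite sqr_ge0.
Qed.

Lemma n1_sqr_leF i : (i < n)%N -> n1 i ^+ 2 <= m%:R * F.
Proof.
move=> Hi; apply: le_trans (n1_sqr_le Hi) _; apply: ler_pM => //; first exact: norm2f_ge0.
  rewrite ler_nat -{2}sum_rc (bigD1_seq i) ?mem_index_iota ?iota_uniq //=; exact: leq_addr.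
rewrite -(sum_norm2f ev er_lt) (bigD1_seq i) ?mem_index_iota ?iota_uniq //= lerDl.
by apply: sumr_ge0 => ? _; exact: norm2f_ge0.
Qed.

End Counting.

(** [det] with the final memory named. Chaining the phases in this form keeps all facts about the
    intermediate memories available. *)
Definition goes (R : realType) c (s : store R) T s' :=
  forall k t P, halt_prob t P (k, s') <= halt_prob (T + t) P (c :: k, s).

Lemma goes_seq (R : realType) c1 c2 (s s1 s2 : store R) T1 T2 :
  goes c1 s T1 s1 -> goes c2 s1 T2 s2 -> goes (c1;; c2) s (T1 + T2).+1 s2.
Proof.
move=> H1 H2 k t P; rewrite addSn /= big_seq1 mul1r -addnA.
exact: le_trans (H2 _ _ _) (H1 _ _ _).
Qed.

Lemma goes_det (R : realType) c (s s' : store R) T (Q : store R -> Prop) :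
  goes c s T s' -> Q s' -> det c s T Q.
Proof. by move=> H Qs; exists s'. Qed.

Lemma fresh_sameX (R : realType) L l (s s' : store R) : (16 <= L)%N -> all (fun x => (x < L)%N) l ->
  fresh L s -> sameX l s s' -> fresh L s'.
Proof.
move=> L16 /allP Hl Hf S x Hx; have [] := Hf x Hx.
have o : off l x by rewrite /off (leq_trans L16 Hx) /=; apply/negP => /Hl; lia.
by have [-> -> -> ->] := S x o.
Qed.

Lemma sameX_sub (R : realType) (l l' : seq nat) (s s' : store R) : {subset l <= l'} -> sameX l s s' -> sameX l' s s'.
Proof.
move=> sub S x /andP[h1 h2]; apply: S; rewrite /off h1 /=.
by apply: contra h2; exact: sub.
Qed.

Lemma archi2 (R : realType) (x : R) : exists k, x <= 2 ^+ k.
Proof.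
have [x0|x0] := leP x 0; first by exists 0%N; rewrite expr0 (le_trans x0).
exists (Num.bound x); apply: le_trans (ltW (archi_boundP (ltW x0))) _.
by rewrite -natrX ler_nat ltnW // ltn_expl.
Qed.

Definition pPre := pA;; pN;; pK;; pR;; pG;; pW;; pH;; pS;; pP.
Definition ids := [:: 16; 17; 18; 19; 20; 21; 22; 23; 24; 25; 28; 29; 30; 32; 33; 34; 35; 36; 38; 40; 41; 42; 43]%N.

Lemma sameX_cat (R : realType) l l' (s1 s2 s3 : store R) :
  sameX l s1 s2 -> sameX l' s2 s3 -> sameX (l ++ l') s1 s3.
Proof.
move=> H1 H2; apply: (@sameX_trans _ _ _ s2).
  by apply: sameX_sub H1 => x Hx; rewrite mem_cat Hx.
by apply: sameX_sub H2 => x Hx; rewrite mem_cat Hx orbT.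
Qed.

Lemma sum_affine k (f : nat -> nat) a c :
  (\sum_(0 <= i < k) (a * f i + c) = a * (\sum_(0 <= i < k) f i) + c * k)%N.
Proof. by rewrite big_split /= big_distrr /= sum_nat_const_nat subn0 mulnC. Qed.

(** * The preprocessing as a whole *)

Section Assembly.
Variable R : realType.
Variables (n d m : nat) (er ec : nat -> nat) (ev : nat -> R) (mu : R).
Hypothesis er_lt : forall e, (e < m)%N -> (er e < n)%N.
Hypothesis ec_lt : forall e, (e < m)%N -> (ec e < d)%N.
Hypothesis erc_inj : forall e e', (e < m)%N -> (e' < m)%N ->
  er e = er e' -> ec e = ec e' -> e = e'.
Hypothesis ev_nz : forall e, (e < m)%N -> ev e != 0.
Hypothesis rowne : forall i, (i < n)%N -> exists2 e, (e < m)%N & er e = i.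
Hypothesis np : (0 < n)%N.
Hypothesis mu0 : 0 < mu.
Local Notation n1 := (norm1f m er ev).
Local Notation n2 := (norm2f m er ev).
Local Notation F := (frob m ev).
Local Notation rc := (rcf m er).
Hypothesis dF : d%:R * mu <= F.

(** [p_half] bounds N from above and so the cost of a round; [p_N] bounds it from below and so the
    number of rounds. [p_h0] and [p_nb0] say that no bits are needed once N mu > F, and [p_hN]
    balances the number of heavy rows against the N steps of a round. *)
Record PreOK (s s' : store R) (T : nat) : Prop := MkPreOK {
  p_good : Good n d m er ec ev s';
  p_same : sameX ids s s';
  p_N : ~~ Ncond n m er ev mu (tN s');
  p_half : tN s' = 1%N \/ exists2 M, tN s' = (M + M)%N & Ncond n m er ev mu M;
  p_K : forall i, (i < n)%N -> Kspec m er ev (tN s') i (tK s' i);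
  p_cr : forall i, (i < n)%N -> tcr s' i = crf m er ev i;
  p_Wr : tWr s' = (\sum_(0 <= i < n) crf m er ev i)%N;
  p_hN : (th s' * tN s' <= m)%N;
  p_h0 : F < (tN s')%:R * mu -> th s' = 0%N;
  p_nb0 : th s' = 0%N -> nvar s' 28 = 0%N;
  p_nb : (0 < th s')%N -> exists2 nb, nvar s' 28 = nb.+1 &
    forall k, (k < nb)%N -> rvar s' 19 / (4 * m%:R) * 2 ^+ k < 8 * (m%:R * F);
  p_err : \sum_(0 <= e < m) (ev e - twe s' e) ^+ 2 <= rvar s' 19 / 4;
  p_T : (T <= 500 * m * (1 + nvar s' 28))%N }.

(** By Cauchy-Schwarz |a|_1^2 is at most the row count times |a|_2^2, so a heavy row has more than N
    entries, and there are at most m / N such rows. *)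
Lemma inHf_rc N i : (i < n)%N -> inHf m er ev N i -> (N < rc i)%N.
Proof.
move=> Hi; rewrite /inHf -expr2 => H.
have H2 := lt_le_trans H (n1_sqr_le ev rowne Hi).
by rewrite -(ltr_nat R) -(ltr_pM2r (n2_gt0 ev_nz rowne Hi)).
Qed.

Lemma Wspec_facts h g e w : 0 <= g -> (e < m)%N -> Wspec ev h g e w ->
  [/\ `|w| <= `|ev e|, `|ev e - w| <= g & (0 < h)%N -> exists2 z : nat, `|w| = g * z%:R & exists z' : int, w = g * z'%:~R].
Proof.
move=> g0 He [q -> [q0 q1 q2 q3]]; have ne := ev_nz He.
have np' : 0 < `|ev e| by rewrite normr_gt0.
have sg : `|ev e / `|ev e| | = 1 by rewrite normf_div normr_id divff // gt_eqF.
have nw : `|q * (ev e / `|ev e|)| = q by rewrite normrM sg mulr1 ger0_norm.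
split; first by rewrite nw.
  have -> : ev e - q * (ev e / `|ev e|) = (`|ev e| - q) * (ev e / `|ev e|) by field; rewrite gt_eqF.
  by rewrite normrM sg mulr1 ger0_norm; lra.
move=> hp; have [z Ez] := q3 hp; exists z; first by rewrite nw.
have [ep|en|e0] := ltgtP 0 (ev e); last by rewrite -e0 eqxx in ne.
  by exists z%:Z; rewrite gtr0_norm // divff ?mulr1 // gt_eqF.
exists (- z%:Z); rewrite ltr0_norm // rmorphN /= invrN mulrN divff ?mulrN1 ?lt_eqF // Ez; ring.
Qed.

Lemma preprocess s : P0 n d m er ec ev s -> fresh 16 s -> rvar s 1 = mu ->
  exists s' T, goes pPre s T s' /\ PreOK s s' T.
Proof.
move=> Ps fr Emu.
have F0 := F_gt0 er_lt ev_nz rowne np.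
have nm := n_le_m er_lt rowne.
have mp : (0 < m)%N := leq_trans np nm.
have mR : 0 < m%:R :> R by rewrite ltr0n.
have [s1 [A1 [A2 A3 A4] [A5 A6]] G1] := pA_spec Ps fr.
have P1 : P0 n d m er ec ev s1 by apply: P0_sameX Ps A1.
have f1 : fresh 19 s1 by apply: fresh_sameX (fresh_le _ fr) A1.
have E1 : rvar s1 1 = mu by have [_ -> _ _] := A1 1%N isT.
have [s2 [B1 B2 B3 B4 B5] G2] := pN_spec (@Ncond_le _ _ _ _ _ er_lt ev_nz rowne np mu) mp P1 E1 A5 A6.
have P2 : P0 n d m er ec ev s2 by apply: P0_sameX P1 B1.
have f2 : fresh 20 s2 by apply: fresh_sameX (fresh_le _ f1) B1.
move EN : (nvar s2 19) => N; rewrite EN in B2 B3 B4 B5.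
have NR : 0 < N%:R :> R by rewrite ltr0n.
have in2 : [/\ rarr s2 16 = n1, rarr s2 17 = n2 & narr s2 16 = rc].
  have [_ _ -> ->] := B1 16%N isT; by have [_ _ _ ->] := B1 17%N isT.
have [s3 [C1 C2 C3 C4 C5] G3] := pK_spec er_lt P2 in2 EN f2.
have P3 : P0 n d m er ec ev s3 by apply: P0_sameX P2 C1.
have f3 : fresh 26 s3 by apply: fresh_sameX (fresh_le _ f2) C1.
have [in2a in2b in2c] := in2.
have r17 : rarr s3 17 = n2 by have [_ _ _ ->] := C1 17%N isT.
have r16 : rvar s3 16 = F by have [_ -> _ _] := C1 16%N isT; have [_ -> _ _] := B1 16%N isT.
have n24 : nvar s3 24 = 0%N by have [-> _ _ _] := C1 24%N isT; have [-> _ _ _] := f2 24%N isT.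
have [s4 [D1 D2 D3 D4 D5] G4] := pR_spec F0 P3 r17 r16 n24.
have P4 : P0 n d m er ec ev s4 by apply: P0_sameX P3 D1.
have f4 : fresh 26 s4 by apply: fresh_sameX f3 D1.
move Eh : (nvar s4 25) => h.
have h3 : h = (\sum_(0 <= i < n) inHf m er ev N i)%N.
  by rewrite -Eh; have [-> _ _ _] := D1 25%N isT.
have g19 : rvar s4 19 = F / N%:R.
  by have [_ -> _ _] := D1 19%N isT; have [_ -> _ _] := C1 19%N isT.
have r16' : rvar s4 16 = F by have [_ -> _ _] := D1 16%N isT.
have gam0 : 0 < F / N%:R by rewrite divr_gt0.
have gamF : F / N%:R <= F by rewrite ler_pdivrMr // ler_peMr ?(ltW F0) // ler1n.
have [s5 [nb [g [Tg [G5 X5 [Q5 ga5 gb5] [gp g0 gsq] [h05 hp5 e05]]]]]] : exists s5 nb g Tg,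
  [/\ goes pG s4 Tg s5, sameX [:: 28; 29]%N s4 s5,
   [/\ Qst h nb g s5, rarr s5 = rarr s4 & narr s5 = narr s4],
   [/\ (0 < h)%N -> 0 < g, h = 0%N -> g = 0 & m%:R * g ^+ 2 <= F / N%:R / 4] &
   [/\ h = 0%N -> nvar s5 28 = 0%N /\ Tg = 3%N,
     (0 < h)%N -> Tg = (5 * nb + 10)%N /\ (forall k, (k < nb)%N -> F / N%:R / (4 * m%:R) * 2 ^+ k < 8 * (m%:R * F)) &
     (0 < h)%N -> 8 * (m%:R * F) <= g ^+ 2 * 2 ^+ nb]].
  have [h0|hp] := posnP h.
    have [z1 z2 _ _] := f4 28%N isT.
    have [s' -> Hg] : det pG s4 3 (fun s' => s' = s4).
      by apply: det_if => /=; rewrite Eh h0 // => _; apply: det_run.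
    (* Without heavy rows the grid size 0 stands for exact values. *)
    exists s4, 0%N, 0, 3%N; split.
    - exact: Hg.
    - by [].
    - by split=> //; split=> //; rewrite h0.
    - by split=> //; rewrite expr0n /= mulr0 divr_ge0 // ltW.
    - by split.
  pose g := Num.sqrt (F / N%:R / (4 * m%:R)).
  have q0 : 0 < F / N%:R / (4 * m%:R) by rewrite divr_gt0 // mulr_gt0.
  have gE : g ^+ 2 = F / N%:R / (4 * m%:R) by rewrite sqr_sqrtr // ltW.
  have gp : 0 < g by rewrite sqrtr_gt0.
  have ex : exists k, 8 * (m%:R * F) <= g ^+ 2 * 2 ^+ k.
    have [k Hk] := archi2 (8 * (m%:R * F) / g ^+ 2); exists k.
    by rewrite [leRHS]mulrC -ler_pdivrMr ?exprn_gt0.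
  case: (ex_minnP ex) => nb Hnb Hmin.
  have Hlt k : (k < nb)%N -> g ^+ 2 * 2 ^+ k < 8 * (m%:R * F).
    by move=> Hk; rewrite ltNge; apply/negP => /Hmin; rewrite leqNgt Hk.
  have hne : nvar s4 25 != 0%N by rewrite Eh -lt0n.
  have gdef : g = Num.sqrt (rvar s4 19 / (4 * m%:R)) by rewrite g19.
  have [s5 [X5 [Xr Xa] N5 R5 R5'] G5] := pG_spec P4 r16' hne gdef Hnb Hlt.
  exists s5, nb, g, (5 * nb + 10)%N; split=> //.
  - split=> //; split=> //; first by have [-> _ _ _] := X5 25%N isT.
  - split=> //; first by move=> h0; rewrite h0 in hp.
    rewrite gE; apply: eqR_le; field.
    by rewrite (gt_eqF mR) (gt_eqF NR).
  - split=> //; first by move=> h0; rewrite h0 in hp.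
    by move=> _; split=> // k Hk; rewrite -gE; exact: Hlt.
have gge0 : 0 <= g by case: (posnP h) => [/g0 ->|/gp/ltW].
have gF : g ^+ 2 <= F.
  have : 1 * g ^+ 2 <= m%:R * g ^+ 2 by apply: ler_wpM2r; rewrite ?sqr_ge0 // ler1n.
  lra.
have mF : F <= m%:R * F by rewrite ler_peMl ?(ltW F0) // ler1n.
(* Everything to be quantized has a square of at most m F, and then g X <= (g^2 + X^2) / 2 <= m F
   lies below g^2 * 2^nb. *)
have bnd X : 0 <= X -> X ^+ 2 <= m%:R * F -> (0 < h)%N -> X < g * 2 ^+ nb.
  move=> X0 X2 hp; rewrite -(ltr_pM2l (gp hp)) mulrA -expr2.
  have := e05 hp; have : g * X <= (g ^+ 2 + X ^+ 2) / 2.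
    by have := sqr_ge0 (g - X); rewrite !expr2; lra.
  have : 0 < m%:R * F by exact: mulr_gt0.
  lra.
have P5 : P0 n d m er ec ev s5 by apply: P0_sameX P4 X5.
have evb e : (e < m)%N -> (0 < h)%N -> `|ev e| < 2 * (g * 2 ^+ nb).
  move=> He hp; have : `|ev e| < g * 2 ^+ nb.
    apply: bnd => //; rewrite real_normK ?num_real //.
    exact: le_trans (ev_sqr_leF _ He) mF.
  have : 0 < g * 2 ^+ nb by rewrite mulr_gt0 ?exprn_gt0 ?gp.
  lra.
have [s6 [X6 [N6 R6 A6'] W6] G6] := pW_spec gp g0 P5 Q5 evb.
have P6 : P0 n d m er ec ev s6 by apply: P0_sameX P5 X6.
pose K := narr s3 20.
have X46 : sameX [:: 28; 29; 28]%N s4 s6 by exact: (sameX_cat X5 X6).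
have X36 : sameX [:: 23; 24; 28; 29; 28]%N s3 s6 by exact: (sameX_cat D1 X46).
have X26 : sameX [:: 20; 21; 22; 25; 23; 24; 28; 29; 28]%N s2 s6 by exact: (sameX_cat C1 X36).
have f6 : fresh 30 s6 by apply: fresh_sameX (fresh_le _ f2) X26.
have i6 : narr s6 16 = rc /\ rarr s6 16 = n1 by have [_ _ -> ->] := X26 16%N isT.
have K6 i : (i < n)%N -> narr s6 20 i = K i by have [_ _ -> _] := X36 20%N isT.
have b6 i : (i < n)%N -> narr s6 21 i = (i * d)%N /\ narr s6 22 i = (i * (2 * d))%N.
  by have [_ _ -> _] := X36 21%N isT; have [_ _ -> _] := X36 22%N isT; exact: C3.
have z6 : [/\ narr s6 32 = (fun=> 0%N) & narr s6 34 = (fun=> 0%N)].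
  by have [_ _ -> _] := f6 32%N isT; have [_ _ -> _] := f6 34%N isT.
have ltsub (P Q : pred nat) (f : nat -> nat) : (\sum_(0 <= e < m | P e && Q e) f e <= \sum_(0 <= e < m | P e) f e)%N.
  rewrite [X in (_ <= X)%N](bigID Q) /=; exact: leq_addr.
have rcn i : ~~ (i < n)%N -> forall (P : pred nat) (f : nat -> nat), (\sum_(0 <= e < m | (er e == i) && P e) f e = 0)%N.
  move=> Hi P f; rewrite big_nat_cond big1 // => e /andP[/andP[_ He] /andP[/eqP Ee _]].
  by move: Hi; rewrite -Ee er_lt.
have hh6 i : (\sum_(0 <= e < m | (er e == i) && hd' m er ev K e) 1 <= d)%N.
  by apply: leq_trans (ltsub _ _ _) _; exact: (rc_le_d ec_lt erc_inj).
have tt6 i : (\sum_(0 <= e < m | (er e == i) && ~~ hd' m er ev K e) cef m er ev e <= 2 * d)%N.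
  have [Hi|Hi] := boolP (i < n)%N; last by rewrite rcn.
  apply: leq_trans (ltsub _ _ _) _; apply: leq_trans (sum_cef_row er_lt ev_nz rowne Hi) _.
  by rewrite leq_mul2l /= (rc_le_d ec_lt erc_inj).
have n1p := fun i => @n1_gt0 _ _ _ _ _ ev_nz rowne i.
have [s7 [X7 H32 H34 H36 [HS1 HS2 HP1 HP2]] G7] := pH_spec er_lt P6 (proj1 i6) (proj2 i6) K6 b6 z6 hh6 tt6 n1p.
have P7 : P0 n d m er ec ev s7 by apply: P0_sameX P6 X7.
have X57 : sameX [:: 28; 32; 33; 34; 35; 36]%N s5 s7 by exact: (sameX_cat X6 X7).
have X27 : sameX [:: 20; 21; 22; 25; 23; 24; 28; 29; 28; 32; 33; 34; 35; 36]%N s2 s7 by exact: (sameX_cat X26 X7).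
have f7 : fresh 37 s7 by apply: fresh_sameX (fresh_le _ f2) X27.
have Q7 : Qst h nb g s7.
  case: Q5 => a b c; have [e1 e2 _ _] := X7 28%N isT.
  split; [by have [-> _ _ _] := X57 25%N isT|by rewrite e2 R6|].
  by rewrite e1 N6; have [_ -> _ _] := X57 29%N isT.
have i7 : narr s7 16 = rc /\ rarr s7 16 = n1 by have [_ _ -> ->] := X27 16%N isT.
have K7 i : (i < n)%N -> narr s7 20 i = K i by have [_ _ -> _] := X7 20%N isT; exact: K6.
have z7 : narr s7 38 = (fun=> 0%N) by have [_ _ -> _] := f7 38%N isT.
have kb i : (i < n)%N -> (0 < h)%N -> 2 * n1 i / (K i)%:R < 2 * (g * 2 ^+ nb).
  move=> Hi hp; have n10 := ltW (n1p i Hi).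
  have H : n1 i < g * 2 ^+ nb by apply: bnd => //; exact: (n1_sqr_leF ev er_lt rowne Hi).
  rewrite -mulrA ltr_pM2l //; case: (posnP (K i)) => [->|Kp]; first by rewrite invr0 mulr0; lra.
  apply: le_lt_trans H; rewrite ler_pdivrMr ?ltr0n // ler_peMr // ler1n.
  by [].
have [s8 [X8 S38 S38'] G8] := pS_spec gp g0 P7 Q7 (proj1 i7) (proj2 i7) K7 z7 kb.
have P8 : P0 n d m er ec ev s8 by apply: P0_sameX P7 X8.
have X28 := sameX_cat X27 X8.
have f8 : fresh 40 s8 by apply: fresh_sameX (fresh_le _ f2) X28.
have X48 : sameX [:: 28; 29; 28; 32; 33; 34; 35; 36; 38]%N s4 s8.
  exact: (sameX_cat (sameX_cat X46 X7) X8).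
have X38 := sameX_cat D1 X48.
have i25 i : (i < n)%N -> narr s8 25 i = inHf m er ev N i :> nat.
  by move=> Hi; have [_ _ -> _] := X38 25%N isT; rewrite C4 Hi.
have [s9 [X9 c41 c41' c9] G9] := pP_spec er_lt g nb P8 i25 f8.
have P9 : P0 n d m er ec ev s9 by apply: P0_sameX P8 X9.
have X89 := X9; have X79 := sameX_cat X8 X9; have X69 := sameX_cat X7 X79.
have X59 := sameX_cat X6 X69; have X49 := sameX_cat X5 X59; have X39 := sameX_cat D1 X49.
have X29 := sameX_cat C1 X39; have X19 := sameX_cat B1 X29.
have hN : (h * N <= m)%N.
  rewrite h3 -[X in (_ <= X)%N](sum_rc er_lt) big_distrl /= big_nat_cond [X in (_ <= X)%N]big_nat_cond.
  apply: leq_sum => i /andP[/andP[_ Hi] _].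
  by case E: (inHf m er ev N i); rewrite ?mul0n // mul1n ltnW // inHf_rc.
have t9N : tN s9 = N by rewrite /tN; have [-> _ _ _] := X29 19%N isT.
have t9h : th s9 = h by rewrite /th; have [-> _ _ _] := X49 25%N isT.
have t9K : tK s9 = K by rewrite /tK; have [_ _ -> _] := X39 20%N isT.
have t9g : rvar s9 19 = F / N%:R by have [_ -> _ _] := X49 19%N isT.
have t928 : nvar s9 28 = nvar s5 28.
  by have [-> _ _ _] := X69 28%N isT; rewrite N6.
have t9we : twe s9 = rarr s6 28 by rewrite /twe; have [_ _ _ ->] := X69 28%N isT.
have t9tg : tg s9 = g.
  by rewrite /tg; have [_ -> _ _] := X69 28%N isT; rewrite R6; case: Q5.
have WF e : (e < m)%N -> _ := fun He => Wspec_facts gge0 He (W6 e He).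
have t921 i : (i < n)%N -> narr s9 21 i = (i * d)%N by have [_ _ -> _] := X69 21%N isT => Hi; case: (b6 i Hi).
have t922 i : (i < n)%N -> narr s9 22 i = (i * (2 * d))%N by have [_ _ -> _] := X69 22%N isT => Hi; case: (b6 i Hi).
have hdE e : headf m er ev s9 e = hd' m er ev K e by rewrite /headf /hd' t9K.
have crE i : (i < n)%N -> tcr s9 i = crf m er ev i.
  by rewrite /tcr; have [_ _ -> _] := X49 23%N isT; exact: D2.
have WrE : tWr s9 = (\sum_(0 <= i < n) crf m er ev i)%N.
  by rewrite /tWr; have [-> _ _ _] := X49 24%N isT.
have Wrm : (m <= tWr s9)%N by rewrite WrE; exact: (sum_crf_ge er_lt ev_nz rowne np).
have Wr2 : (tWr s9 <= 2 * m)%N.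
  by rewrite WrE; apply: leq_trans (sum_crf_le er_lt ev_nz rowne np) _; rewrite mul2n -addnn leq_add2l.
have smpE i : (i < n)%N -> tsmp s9 i = if (rc i <= K i)%N then 0%N else K i.
  by rewrite /tsmp; have [_ _ -> _] := X89 38%N isT; exact: S38.
have kapE i : (i < n)%N -> (K i < rc i)%N -> exists2 q, tkap s9 i = q + g & qspec h g (2 * n1 i / (K i)%:R) q.
  by rewrite /tkap; have [_ _ _ ->] := X89 38%N isT; exact: S38'.
have KP i : (i < n)%N -> (K i < rc i)%N -> (0 < K i)%N /\ N%:R * n1 i ^+ 2 <= (K i)%:R ^+ 2 * n2 i.
  move=> Hi Hk; have [_ [E|H] _] := C2 i Hi; first by move: Hk; rewrite /K E ltnn.
  split; last by rewrite !expr2.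
  rewrite lt0n; apply/eqP => K0; move: H; rewrite -/K -/(K i) K0 !mul0r.
  by rewrite leNgt mulr_gt0 // mulr_gt0 // n1p.
have thcE i : thc s9 i = (\sum_(0 <= e < m | (er e == i) && hd' m er ev K e) 1)%N.
  by rewrite /thc; have [_ _ -> _] := X79 32%N isT; exact: H32.
have hck i : (i < n)%N -> (thc s9 i <= K i)%N.
  move=> Hi; rewrite thcE; have [Hle|Hlt] := leqP (rc i) (K i).
    by apply: leq_trans (ltsub _ _ _) _.
  rewrite -(ler_nat R) natr_sum -(ler_pM2r (n1p i Hi)) mulr_suml.
  apply: (@le_trans _ _ (\sum_(0 <= e < m | (er e == i) && hd' m er ev K e) (K i)%:R * `|ev e|)).
    apply: ler_sum => e /andP[/eqP Ee]; rewrite /hd' Ee leqNgt Hlt /= mul1r; exact.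
  rewrite -mulr_sumr; apply: ler_wpM2l => //; rewrite /norm1f /rsum [leRHS](bigID (hd' m er ev K)) /= lerDl.
  by apply: sumr_ge0.
exists s9; eexists; split.
  exact: (goes_seq G1 (goes_seq G2 (goes_seq G3 (goes_seq G4 (goes_seq G5 (goes_seq G6 (goes_seq G7 (goes_seq G8 G9)))))))).
have [[d0 d1 d2] [i0 i1 j0]] := P9.
split.
- split=> //.
  + by have [_ -> _ _] := X19 16%N isT.
  + by rewrite t9N.
  + by rewrite t9N.
  + exact: leq_trans mp Wrm.
  + move=> f; rewrite /tWr /trow; have [-> _ -> _] := X49 24%N isT.
    rewrite -(big_mkord xpredT (fun u => f (narr s4 24 u))) D4.
    by apply: eq_big_nat => i /andP[_ Hi]; rewrite crE.
  + by rewrite /tWr /trow; have [-> _ -> _] := X49 24%N isT; exact: D5.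
  + move=> i Hi; rewrite crE //; have [c0 c1 _] := crfP er_lt ev_nz rowne np i; split=> //.
    have : (tWr s9)%:R * n2 i <= (2 * m)%:R * n2 i by apply: ler_wpM2r; rewrite ?norm2f_ge0 // ler_nat.
    by move/le_trans; apply; rewrite natrM -!mulrA ler_pM2l // [m%:R * _]mulrC [F * _]mulrC.
  + move=> i Hi; rewrite /tinH; have [_ _ -> _] := X89 25%N isT; rewrite i25 // lt0b t9N.
    by rewrite /inHf expr2.
  + by move=> e He; rewrite t9we; have [] := WF e He.
  + move=> i Hi f; have := HS1 i f; rewrite /segT /thc /tHD.
    have [_ _ -> _] := X79 32%N isT; have [_ _ -> _] := X79 33%N isT => H.
    rewrite (eq_bigl _ _ (fun e => f_equal (andb _) (hdE e))) -H; apply: eq_bigr => k _; by rewrite t921.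
  + move=> i k Hi; rewrite /thc /tHD; have [_ _ -> _] := X79 32%N isT; have [_ _ -> _] := X79 33%N isT.
    by rewrite t921 //; exact: HP1.
  + move=> i Hi; rewrite smpE // t9K t9N; have [Hle|Hlt] := leqP (rc i) (K i).
      by left; split=> // e He Ee; rewrite hdE /hd' Ee Hle.
    right; have [K0 KN] := KP i Hi Hlt.
    have WtE : tWt s9 i = (\sum_(0 <= e < m | (er e == i) && ~~ hd' m er ev K e) cef m er ev e)%N.
      by rewrite /tWt; have [_ _ -> _] := X79 34%N isT; exact: H34.
    have ceE e : (e < m)%N -> ~~ hd' m er ev K e -> tce s9 e = (cef m er ev e)%:R.
      by move=> He Hh; rewrite /tce; have [_ _ -> _] := X79 36%N isT; rewrite H36.
    have [q kE [q0 q1 q2 q3]] := kapE i Hi Hlt.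
    have n1i := n1p i Hi; have KR : 0 < (K i)%:R :> R by rewrite ltr0n.
    have Xp : 0 < 2 * n1 i / (K i)%:R by rewrite divr_gt0 // mulr_gt0.
    split; first split=> //.
      rewrite WtE lt0n; apply/eqP => W0.
      (* An empty tail would give [n1 i <= K i * |ev e|] for the whole row; summing over its entries
         yields [rc i <= K i], contrary to [Hlt]. *)
      have allh e : (e < m)%N -> er e = i -> n1 i <= (K i)%:R * `|ev e|.
        move=> He Ee; have : hd' m er ev K e.
          apply: contraT => Hh; have [c0 _ _] := cefP er_lt ev_nz rowne He.
          move: W0; rewrite big_mkcond (bigD1_seq e) ?mem_index_iota ?iota_uniq //= Ee eqxx Hh /=.
          by move/eqP; rewrite addn_eq0 => /andP[]; rewrite eqn0Ngt c0.
        by rewrite /hd' Ee leqNgt Hlt.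
      have : rsum m er i (fun=> n1 i) <= rsum m er i (fun e => (K i)%:R * `|ev e|) by apply: rsum_le.
      rewrite rc_rsum rsumZ -/(n1 i) ler_pM2r // ler_nat => H.
      by move: Hlt; rewrite ltnNge H.
    split; [|split; [|split]].
    * move=> f; rewrite /tTT; have := HS2 i f; rewrite /segT.
      rewrite /tWt; have [_ _ -> _] := X79 34%N isT; have [_ _ -> _] := X79 35%N isT => H.
      rewrite -(big_mkord xpredT (fun u => f (narr s7 35 (narr s9 22 i + u)%N))) t922 // H.
      rewrite [LHS]big_nat_cond [RHS]big_nat_cond.
      rewrite [RHS](eq_bigl (fun e => (0 <= e < m)%N && ((er e == i) && ~~ hd' m er ev K e))).
        by apply: eq_bigr => e /andP[/andP[_ He] /andP[_ Hh]]; rewrite ceE.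
      by move=> e; rewrite hdE.
    * move=> u; rewrite /tTT /tWt; have [_ _ -> _] := X79 34%N isT; have [_ _ -> _] := X79 35%N isT => Hu.
      by rewrite t922 // hdE; exact: HP2.
    * move=> e He Ee; rewrite hdE => Hh; rewrite ceE //.
      have [c0 c1 _] := cefP er_lt ev_nz rowne He; rewrite Ee in c1.
      split; [by rewrite ltr0n| |].
        have : (tWt s9 i)%:R <= 2 * (rc i)%:R :> R.
          rewrite -natrM ler_nat WtE; apply: leq_trans (ltsub _ _ _) _.
          exact: (sum_cef_row er_lt ev_nz rowne Hi).
        move=> H; apply: le_trans (ler_wpM2l (normr_ge0 (ev e)) H) _.
        by rewrite mulrCA -mulrA ler_pM2l // [n1 i * _]mulrC.
      by move: Hh; rewrite /hd' Ee negb_or -ltNge => /andP[_ /ltW].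
    * rewrite kE; split; [exact: lt_le_trans Xp q2| |].
        have := ler_wpM2l (ltW KR) q2.
        by have -> : (K i)%:R * (2 * n1 i / (K i)%:R) = 2 * n1 i by field; rewrite gt_eqF.
      move=> e He Ee; rewrite t9we; have [w1 w2 w3] := WF e He.
      have e1 : (q + g) * `|rarr s6 28 e| <= (2 * n1 i / (K i)%:R) * `|ev e| + g * `|rarr s6 28 e|.
        rewrite mulrDl lerD2r; apply: ler_pM => //.
      apply: le_trans e1 _; rewrite lerD2l.
      (* A nonzero grid value is at least [g] in absolute value. *)
      have e2 : g * `|rarr s6 28 e| <= `|rarr s6 28 e| ^+ 2.
        case: (posnP h) => [/g0 ->|hp]; first by rewrite mul0r sqr_ge0.
        have [[|z] Ez _] := w3 hp; first by rewrite Ez mulr0n mulr0 expr0n /= mulr0.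
        rewrite expr2; apply: ler_wpM2r => //; rewrite Ez ler_peMr // ler1n.
        by [].
      apply: le_trans e2 _; rewrite -[ev e ^+ 2]real_normK ?num_real //.
      by rewrite lerXn2r ?nnegrE.
  + move=> i Hi; rewrite t9K smpE //; split; first exact: hck.
    by case: ifP.
  + move=> f; rewrite t9h /throw.
    have -> : h = nvar s9 41 by rewrite c41 h3.
    rewrite c41' [LHS]big_nat_cond [RHS]big_nat_cond; apply: eq_bigl => i; rewrite /tinH.
    case Hi: (0 <= i < n)%N => //=; have [_ _ -> _] := X89 25%N isT.
    by rewrite (i25 i Hi) lt0b.
  + rewrite t9h => hp; have gp' := gp hp; have [_ q28 /(_ hp) [m28 q29]] := Q7.
    have h41 : h = nvar s9 41 by rewrite c41 h3.
    have e28 : rvar s8 28 = g by have [_ -> _ _] := X8 28%N isT.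
    have e29 : rvar s8 29 = g ^+ 2 * 2 ^+ nb by have [_ -> _ _] := X8 29%N isT.
    have [c1 c2 c3] := c9 gp' e28 e29.
    have te0E : te0 s9 = g ^+ 2 * 2 ^+ nb by rewrite /te0; have [_ -> _ _] := X89 29%N isT.
    have we8 : rarr s8 28 = twe s9 by rewrite /twe; have [_ _ _ ->] := X89 28%N isT.
    have og x (z : int) : x = g * z%:~R -> on_grid s9 x by move=> ->; exists z; rewrite t9tg.
    exists nb; split.
      split; rewrite ?t9tg //.
      * by have [-> _ _ _] := X79 28%N isT.
      * by rewrite h41.
      * by rewrite h41 te0E -e29.
    split.
    * by move=> j; rewrite h41 c3 we8.
    * move=> e He; rewrite t9we; have [_ _ /(_ hp) [_ _ [z Ez]]] := WF e He; exact: og Ez.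
    * move=> i Hi; rewrite smpE //; case: (leqP (rc i) (K i)) => // Hlt _.
      have [q -> [_ _ _ /(_ hp) [z Ez]]] := kapE i Hi Hlt.
      by apply: (og _ (z%:Z + 1)); rewrite rmorphD /= Ez; ring.
    * move=> e i He Hi; rewrite te0E; apply: lt_le_trans (e05 hp).
      rewrite t9we; have [w1 _ _] := WF e He; have n10 := ltW (n1p i Hi).
      have w2 : `|rarr s6 28 e| ^+ 2 <= F.
        apply: le_trans (ev_sqr_leF _ He); rewrite -[leRHS]real_normK ?num_real //.
        by rewrite lerXn2r ?nnegrE.
      (* The three parts, [n1 i], then 2 n1 i and m g from the draws, contribute at most m F, 2 m F
         and m F: together 4 m F, below the 8 m F reached by [te0]. *)
      have H1 : `|rarr s6 28 e| * n1 i <= m%:R * F.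
        exact: le_trans (mul_le_sqrD _ _) (mid_le (le_trans w2 mF) (n1_sqr_leF ev er_lt rowne Hi)).
      have H2 : `|rarr s6 28 e| * (m%:R * g) <= m%:R * F.
        rewrite mulrCA; apply: ler_wpM2l; first exact: ltW.
        exact: le_trans (mul_le_sqrD _ _) (mid_le w2 gF).
      have H3 : (tsmp s9 i)%:R * tkap s9 i <= 2 * n1 i + m%:R * g.
        rewrite smpE //; case: leqP => [_|Hlt].
          by rewrite mul0r addr_ge0 ?mulr_ge0 // ltW.
        have [K0 _] := KP i Hi Hlt; have KR : 0 < (K i)%:R :> R by rewrite ltr0n.
        have [q -> [q0 q1 _ _]] := kapE i Hi Hlt.
        rewrite mulrDr lerD //.
          have := ler_wpM2l (ltW KR) q1.
          by have -> : (K i)%:R * (2 * n1 i / (K i)%:R) = 2 * n1 i by field; rewrite gt_eqF.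
        apply: ler_wpM2r => //; rewrite ler_nat; apply: leq_trans (ltnW Hlt) _.
        by rewrite -{2}(sum_rc er_lt) (bigD1_seq i) ?mem_index_iota ?iota_uniq //= leq_addr.
      have H4 := ler_wpM2l (normr_ge0 (rarr s6 28 e)) H3.
      have mFp : 0 < m%:R * F by exact: mulr_gt0.
      by rewrite mulrDr; exact: (pack_lt H1 H4 H2 mFp).
- have X09 := sameX_cat A1 X19.
  by apply: sameX_sub X09; apply/allP.
- by rewrite t9N.
- by rewrite t9N.
- by move=> i Hi; rewrite t9N t9K; exact: C2.
- exact: crE.
- exact: WrE.
- by rewrite t9h t9N.
(* A heavy row has more than N entries, hence N < d; but d mu <= F < N mu. *)
- rewrite t9N t9h h3 => H; rewrite big_nat_cond big1 // => i /andP[/andP[_ Hi] _].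
  case E: (inHf m er ev N i) => //.
  have := inHf_rc Hi E; move: (rc_le_d ec_lt erc_inj i) => h1 h2.
  have : N%:R * mu <= d%:R * mu by rewrite ler_pM2r // ler_nat; exact: ltnW (leq_trans h2 h1).
  by move=> h4; have := le_lt_trans (le_trans h4 dF) H; rewrite ltxx.
- by rewrite t9h t928 => /h05[].
- rewrite t9h t928 t9g => hp; have [_ Hlt] := hp5 hp; exists nb => //.
  by case: Q5 => _ _ /(_ hp)[].
- rewrite t9we t9g; apply: le_trans gsq.
  apply: (@le_trans _ _ (\sum_(0 <= e < m) g ^+ 2)); last first.
    by rewrite sumr_const_nat subn0 -[_ *+ m]mulr_natl.
  rewrite big_nat_cond [leRHS]big_nat_cond; apply: ler_sum => e /andP[/andP[_ He] _].
  have [_ w _] := WF e He; rewrite -[leLHS]real_normK ?num_real //.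
  by rewrite lerXn2r ?nnegrE.
- rewrite t928 !sum_affine.
  have := sum_crf_le er_lt ev_nz rowne np => S1.
  have := sum_cef er_lt ev_nz rowne => S2.
  rewrite /Tq; case: (posnP h) => [h0|hp].
    by have [-> ->] := h05 h0; rewrite ?h0 /=; clear -S1 S2 nm mp; lia.
  have [-> _] := hp5 hp; have -> : nvar s5 28 = nb.+1 by case: Q5 => _ _ /(_ hp)[].
  have S3 : (n * nb <= m * nb)%N by rewrite leq_mul2r nm orbT.
  have S4 : (nb <= m * nb)%N by rewrite leq_pmull.
  move: S3 S4; clear -S1 S2 nm mp.
  by move: (\sum_(0 <= i < n) crf m er ev i)%N (\sum_(0 <= e < m) cef m er ev e)%N S1 S2 => x y; lia.
Qed.
End Assembly.

(** * The program *)

(** With nu = mu / (2 (mu + g)) these are al = sqrt(mu / (mu + g)) / 64, which makes al^2 * 2048 =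
    nu, and be = al / nu, as required by the outer step. *)
Definition cparams :=
  CSetR 48 (RDiv (RC 1) (RMul (RC 768) (RVar 16)));;
  CSetN 48 (NAdd (NConst 1) (nmul 768 (NVar 19)));;
  CSetR 49 (RDiv (RSqrt (RDiv (RVar 1) (RAdd (RVar 1) (RVar 19)))) (RC 64));;
  CSetR 50 (RDiv (RMul (RVar 49) (RMul (RC 2) (RAdd (RVar 1) (RVar 19)))) (RVar 1)).
(** Without logarithms, the number of rounds is found by multiplying up the contraction factor. Each
    round raises the budgets to [D] times its expected consumption: [nvar 48] steps and at most 5400
    m samples, see [rk_le]. *)
Definition cJbody D := CSetR 4 (RMul (RVar 4) (RSub (RC 1) (RVar 49)));; incN 54;;
    CSetN 52 (NAdd (NVar 52) (nmul D (NVar 48)));;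
    CSetN 53 (NAdd (NVar 53) (nmul D (nmul 60 (nmul 90 (NVar 2))))).
Definition cJloop D := CWhile (RLt (RMul (RVar 0) (RVar 0)) (RMul (RC D) (RVar 4))) (cJbody D).
Definition cinit := cmap 56 1 (RGet 2 (NVar 4));; cmap 57 1 (RGet 2 (NVar 4)).
(** An optimal starting point leaves no room for a relative error and must be returned as it is. The
    gradient at the starting point, which vanishes only there, decides. *)
Definition czero := CSetR 4 (RC 0);; csum 1 4 (RMul (RGet 59 (NVar 4)) (RGet 59 (NVar 4)));;
  CIf (BLeR (RVar 4) (RC 0)) (CSetN 54 (NConst 0)) CSkip.
Definition cout := cmap 3 1 (RGet 56 (NVar 4)).
Definition prog D := pPre;; cparams;; CSetR 4 (RC 1);; cJloop D;; cinit;; cgrad;; czero;; cmain;; cout.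

Lemma geom_steps (R : realType) (al eps : R) (D : nat) : 0 < al -> al <= 1 -> 0 < eps < 1 -> (0 < D)%N ->
  exists J : nat, D%:R * (1 - al) ^+ J <= eps * eps /\ J%:R <= 1 + ln (D%:R / (eps * eps)) / al.
Proof.
move=> a0 a1 /andP[e0 e1] D0; have DR : 1 <= D%:R :> R by rewrite ler1n.
have ee : 0 < eps * eps by rewrite mulr_gt0.
have ee1 : eps * eps <= 1 by rewrite -[1]mulr1 ler_pM // ltW.
have q1 : 1 <= D%:R / (eps * eps) by rewrite ler_pdivlMr // mul1r; lra.
have l0 : 0 <= ln (D%:R / (eps * eps)) by exact: ln_ge0.
set x := ln (D%:R / (eps * eps)) / al; have x0 : 0 <= x by rewrite divr_ge0 // ltW.
exists (absz (Num.ceil x)).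
have E : (absz (Num.ceil x))%:R = (Num.ceil x)%:~R :> R.
  by rewrite natr_absz ger0_norm // -(ler_int R) (le_trans x0) // ceil_ge.
have H1 := ceil_ge x.
have H2 : (Num.ceil x)%:~R < x + 1 :> R by have := ceilB1_lt x; rewrite rmorphB /=; lra.
split; last by rewrite E; lra.
have H3 : (1 - al) ^+ absz (Num.ceil x) <= eps * eps / D%:R.
  apply: (@le_trans _ _ (expR (- al) ^+ absz (Num.ceil x))).
    apply: lerXn2r; rewrite ?nnegrE ?expR_ge0 ?subr_ge0 //; exact: expR_ge1Dx.
  rewrite -expRM_natl.
  have -> : eps * eps / D%:R = expR (- ln (D%:R / (eps * eps))).
    by rewrite expRN lnK ?posrE ?invf_div //; apply: lt_le_trans q1.
  rewrite ler_expR E mulrN lerN2.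
  have : x * al <= (Num.ceil x)%:~R * al by rewrite ler_pM2r.
  by rewrite /x divfK // gt_eqF.
have Dp : 0 < D%:R :> R by rewrite ltr0n.
by have := ler_wpM2l (ltW Dp) H3; rewrite mulrCA divff ?mulr1 // gt_eqF.
Qed.

(** * The whole program: samples per round and expected outcome *)

Section Algorithm.
Variable R : realType.
Variables (n d m : nat) (er ec : nat -> nat) (ev : nat -> R) (mu : R).
Hypothesis er_lt : forall e, (e < m)%N -> (er e < n)%N.
Hypothesis ec_lt : forall e, (e < m)%N -> (ec e < d)%N.
Hypothesis erc_inj : forall e e', (e < m)%N -> (e' < m)%N ->
  er e = er e' -> ec e = ec e' -> e = e'.
Hypothesis ev_nz : forall e, (e < m)%N -> ev e != 0.
Hypothesis rowne : forall i, (i < n)%N -> exists2 e, (e < m)%N & er e = i.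
Hypothesis np : (0 < n)%N.
Hypothesis mu0 : 0 < mu.
Local Notation n1 := (norm1f m er ev).
Local Notation n2 := (norm2f m er ev).
Local Notation F := (frob m ev).
Local Notation rc := (rcf m er).
Local Notation md := (gram n d m er ec ev).
Hypothesis dF : d%:R * mu <= F.
Hypothesis ray : forall u, mu * dot d u u <= md u u.
Let F0 := F_gt0 er_lt ev_nz rowne np.
Let S := sumS n m er ev.

(** Each row satisfies |a|_1 <= sqrt(m) |a|_2. *)
Lemma sumS_le : S ^+ 2 <= m%:R * F ^+ 2.
Proof.
have m0 : 0 <= Num.sqrt m%:R :> R by rewrite sqrtr_ge0.
have : S <= Num.sqrt m%:R * F.
  rewrite /S /sumS -(sum_norm2f ev er_lt) mulr_sumr.
  apply: ler_sum_nat => i /andP[_ Hi].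
  have n20 := norm2f_ge0 m er ev i; have n10 := norm1f_ge0 m er ev i.
  rewrite -{2}[n2 i]sqr_sqrtr // expr2 mulrA [Num.sqrt m%:R * _]mulrC -mulrA.
  apply: ler_wpM2l; first by rewrite sqrtr_ge0.
  rewrite -sqrtrM ?ler0n // -[leLHS]ger0_norm // -sqrtr_sqr ler_sqrt ?mulr_ge0 //.
  apply: le_trans (n1_sqr_le ev rowne Hi) _; apply: ler_wpM2r => //.
  by rewrite ler_nat -{2}(sum_rc er_lt) (bigD1_seq i) ?mem_index_iota ?iota_uniq //= leq_addr.
have S0 : 0 <= S by have := F_le_sumS ev er_lt; have := F0; rewrite -/S; lra.
move=> H; have : S ^+ 2 <= (Num.sqrt m%:R * F) ^+ 2 by rewrite lerXn2r ?nnegrE // mulr_ge0 // ltW.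
by rewrite exprMn sqr_sqrtr.
Qed.

(** Minimality of K gives n2 K <= n2 + sqrt(N) sqrt(n2) n1, so row sampling makes [meanK] at most 2
    + sqrt(N) S / F. Since N = 1 or N / 2 met the doubling condition, N^(3/2) S <= 3 m F and N <= 2
    m. Hence N * meanK <= 7 m, and 768 * 7 < 5400. *)
Lemma rk_le (s s' : store R) T : PreOK n d m er ec ev mu s s' T ->
  (tN s' <= 2 * m)%N /\ rk n s' <= 5400 * m%:R.
Proof.
move=> P; set N := tN s'; have G := p_good P.
have mp : 0 < m%:R :> R by rewrite ltr0n; apply: leq_trans np (n_le_m er_lt rowne).
have m1 : 1 <= m%:R :> R by rewrite ler1n -(ltr0n R).
have F0' := F0.
have S0 : 0 <= S by have := F_le_sumS ev er_lt; rewrite -/S; lra.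
have N2m : (N <= 2 * m)%N.
  have := p_half P; rewrite -/N => -[->|[M -> C]]; first by move: mp; rewrite ltr0n; lia.
  by have := Ncond_le er_lt ev_nz rowne np C; lia.
split=> //.
have N0 : 0 < N%:R :> R by rewrite ltr0n (g_N G).
have NS : Num.sqrt N%:R * N%:R * S <= 3 * (m%:R * F).
  have s0 : 0 <= Num.sqrt N%:R :> R by rewrite sqrtr_ge0.
  have mF0 : 0 <= m%:R * F by rewrite mulr_ge0 // ltW.
  rewrite -(ler_pXn2r (n := 2)) ?nnegrE ?mulr_ge0 //; last by rewrite ltW.
  rewrite !exprMn sqr_sqrtr //; case: (p_half P) => [E|[M E C]].
    rewrite -/N in E; rewrite E expr1n !mul1r; apply: le_trans sumS_le _.
    have : m%:R * F ^+ 2 <= m%:R ^+ 2 * F ^+ 2.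
      by apply: ler_wpM2r; rewrite ?sqr_ge0 // expr2 ler_peMl // ltW.
    have : 0 <= m%:R ^+ 2 * F ^+ 2 by rewrite mulr_ge0 ?sqr_ge0.
    by lra.
  case/andP: C => C _; rewrite -/N in E.
  have -> : N%:R = 2 * M%:R :> R by rewrite E natrD; ring.
  have : 0 <= m%:R ^+ 2 * F ^+ 2 by rewrite mulr_ge0 ?sqr_ge0.
  move: C; rewrite -/S !expr2; lra.
have KB i : (i < n)%N -> n2 i * (tK s' i)%:R <= n2 i + Num.sqrt N%:R * (Num.sqrt (n2 i) * n1 i).
  move=> Hi; have [_ _ H] := p_K P Hi; rewrite -/N in H.
  have n20 := norm2f_ge0 m er ev i; have n10 := norm1f_ge0 m er ev i.
  case E: (tK s' i) H => [|k] H.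
    by rewrite mulr0 addr_ge0 // !mulr_ge0 // sqrtr_ge0.
  have := H k (ltnSn k); rewrite -natr1 mulrDr mulr1 addrC lerD2l => H1.
  have H2 : Num.sqrt (n2 i) * k%:R <= Num.sqrt N%:R * n1 i.
    rewrite -[leLHS]ger0_norm ?mulr_ge0 ?sqrtr_ge0 // -[leRHS]ger0_norm ?mulr_ge0 ?sqrtr_ge0 //.
    rewrite -!sqrtr_sqr ler_sqrt ?sqr_ge0 // !exprMn !sqr_sqrtr // !expr2; move: H1; lra.
  have -> : n2 i * k%:R = Num.sqrt (n2 i) * (Num.sqrt (n2 i) * k%:R) by rewrite mulrA -expr2 sqr_sqrtr.
  by rewrite [leRHS]mulrCA; apply: ler_wpM2l; rewrite ?sqrtr_ge0.
have SK : \sum_(0 <= i < n) n2 i * (tK s' i)%:R <= F + Num.sqrt N%:R * S.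
  rewrite /S /sumS mulr_sumr -(sum_norm2f ev er_lt) -big_split /=.
  by apply: ler_sum_nat => i /andP[_ Hi]; exact: KB.
have SK2 : \sum_(0 <= i < n) (tK s' i)%:R <= m%:R :> R.
  rewrite -(sum_rc er_lt) natr_sum.
  by apply: ler_sum_nat => i /andP[_ Hi]; have [h _ _] := p_K P Hi; rewrite ler_nat.
have Wr0 : m%:R <= (tWr s')%:R :> R.
  by rewrite ler_nat (p_Wr P); exact: (sum_crf_ge er_lt ev_nz rowne np).
pose Q : R := \sum_(0 <= i < n) (tcr s' i)%:R * (tK s' i)%:R.
have SQ : Q * F <= m%:R * (F + Num.sqrt N%:R * S) + F * m%:R.
  apply: (@le_trans _ _ (m%:R * (\sum_(0 <= i < n) n2 i * (tK s' i)%:R) + F * \sum_(0 <= i < n) (tK s' i)%:R)).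
    rewrite /Q mulr_suml !mulr_sumr -big_split /=.
    apply: ler_sum_nat => i /andP[_ Hi]; rewrite (p_cr P Hi).
    have [_ _ h] := crfP er_lt ev_nz rowne np i.
    have := ler_wpM2r (ler0n R (tK s' i)) h; lra.
  by apply: lerD; apply: ler_wpM2l => //; exact: ltW.
have Q0 : 0 <= Q by apply: sumr_ge0 => i _; rewrite mulr_ge0.
have MK : meanK n s' * (m%:R * F) <= Q * F.
  rewrite mulrA ler_pM2r // /meanK -/Q mulrAC ler_pdivrMr; last by apply: lt_le_trans Wr0.
  by apply: ler_wpM2l.
have mF : 0 < m%:R * F by exact: mulr_gt0.
have N2 : N%:R <= 2 * m%:R :> R by rewrite -natrM ler_nat.
have : N%:R * meanK n s' * (m%:R * F) <= 7 * m%:R * (m%:R * F).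
  rewrite -mulrA; apply: (@le_trans _ _ (N%:R * (m%:R * (F + Num.sqrt N%:R * S) + F * m%:R))).
    by apply: ler_wpM2l; [exact: ltW|lra].
  have -> : N%:R * (m%:R * (F + Num.sqrt N%:R * S) + F * m%:R) =
     2 * (m%:R * F) * N%:R + m%:R * (Num.sqrt N%:R * N%:R * S) by ring.
  have h1 : 2 * (m%:R * F) * N%:R <= 2 * (m%:R * F) * (2 * m%:R) by apply: ler_wpM2l => //; lra.
  have h2 := ler_wpM2l (ltW mp) NS.
  lra.
rewrite ler_pM2r // /rk -/N => H; rewrite -mulrA; lra.
Qed.

Lemma goes_run (s : store R) c : simple c -> goes c s (cost c) (run c s).
Proof.
move=> Sc; have [s' -> //] : det c s (cost c) (fun s' => s' = run c s).
by apply: det_run.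
Qed.

Variables (D : nat) (eps : R) (s : store R) (xs : nat -> R).
Hypothesis D0 : (0 < D)%N.
Hypothesis eps01 : 0 < eps < 1.
Hypothesis Ps : P0 n d m er ec ev s.
Hypothesis fr : fresh 4 s.
Hypothesis Eeps : rvar s 0 = eps.
Hypothesis Emu : rvar s 1 = mu.
Hypothesis xsE : forall u, md xs u = \sum_(0 <= i < n) rarr s 1 i * dot d (wrow m er ec ev i) u.

Definition err0 j := rarr s 2 j - xs j.
Definition errout (s' : store R) j := rarr s' 3 j - xs j.

Record RunOK (s9 : store R) (Tp J T : nat) : Prop := MkRunOK {
  r_pre : PreOK n d m er ec ev mu s s9 Tp;
  r_J : D%:R * (1 - Num.sqrt (mu / (mu + rvar s9 19)) / 64) ^+ J <= eps * eps;
  r_Jle : J%:R <= 1 + ln (D%:R / (eps * eps)) / (Num.sqrt (mu / (mu + rvar s9 19)) / 64);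
  r_T : (T <= Tp + (th s9 * (12 * nvar s9 28 + 60) + 110) * (J * (D * (1 + 768 * tN s9)))
     + 160 * (J * (D * (60 * (90 * m)))) + 160 * d + J * (24 * d + 8 * n + 12 * m + 100)
     + 24 * d + 4 * n + 8 * m + 120)%N }.

(** The prices stay free because the statement is used twice, for termination and for success. The
    optimal starting point has its own clause, as Markov's inequality for the relative error says
    nothing there. *)
Lemma algorithm : exists s9 Tp J T, [/\ RunOK s9 Tp J T,
  md err0 err0 = 0 -> forall psi, (forall s', md (errout s') (errout s') = 0 -> 1 <= psi s') ->
    wp (prog D) s T (fun=> True) psi 1 &
  forall (cS cK dv c : R) psi, 0 <= cS -> 0 <= cK -> 0 <= c ->
    1 <= dv + cS * (J * (D * (1 + 768 * tN s9)))%:R ->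
    1 <= dv + cK * (J * (D * (60 * (90 * m))))%:R ->
    (forall s', dv <= psi s') ->
    (forall s', 1 - c * (md (errout s') (errout s') / 2) <= psi s') ->
    wp (prog D) s T (fun=> True) psi
      (1 - J%:R * (cS * (1 + 768 * tN s9)%:R + cK * rk n s9)
       - c * (1 - Num.sqrt (mu / (mu + rvar s9 19)) / 64) ^+ J * md err0 err0)].
Proof.
have F0' := F0; have mu0' := mu0.
have fr16 : fresh 16 s by apply: fresh_le fr.
have [s9 [Tp [G9 P]]] := preprocess er_lt ec_lt erc_inj ev_nz rowne np mu0 dF Ps fr16 Emu.
have Gd := p_good P; have Sm := p_same P.
have gam0 := gam_gt0 Gd F0; set gam := rvar s9 19 in gam0 *.
set al := Num.sqrt (mu / (mu + gam)) / 64.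
have mg : 0 < mu + gam by lra.
have rt : 0 < mu / (mu + gam) by rewrite divr_gt0.
have rt1 : mu / (mu + gam) <= 1 by rewrite ler_pdivrMr // mul1r; lra.
have al0 : 0 < al by rewrite divr_gt0 // sqrtr_gt0.
have al1 : al <= 1.
  have : Num.sqrt (mu / (mu + gam)) <= Num.sqrt 1 by rewrite ler_sqrt.
  by rewrite sqrtr1 /al; lra.
have al2 : al ^+ 2 * 2048 = mu / (2 * (mu + gam)).
  by rewrite /al expr_div_n sqr_sqrtr ?(ltW rt) //; field; rewrite gt_eqF.
have [s9e _ _ _] := Sm 2%N isT; have [_ e0 _ _] := Sm 0%N isT; have [_ e1 _ b1] := Sm 1%N isT.
have [_ _ _ r2] := Sm 2%N isT.
have P9 : P0 n d m er ec ev s9 by apply: P0_sameX Ps Sm.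
have f9 : fresh 44 s9 by apply: fresh_sameX (fresh_le _ fr) Sm.
have [J0 [J1 J2]] := geom_steps al0 al1 eps01 D0.
have exJ : exists J, D%:R * (1 - al) ^+ J <= eps * eps by exists J0.
case: (ex_minnP exJ) => J HJ Jmin.
have Jle : J%:R <= 1 + ln (D%:R / (eps * eps)) / al.
  by apply: le_trans J2; rewrite ler_nat Jmin.
have Jlt k : (k < J)%N -> eps * eps < D%:R * (1 - al) ^+ k.
  by move=> Hk; rewrite ltNge; apply/negP => /Jmin; rewrite leqNgt Hk.
pose s0 := run cparams s9.
have G0 : goes cparams s9 7 s0 by exact: (@goes_run s9 cparams isT).
have GG : Good n d m er ec ev s0 by case: Gd => *; split.
have v48 : rvar s0 48 = 1 / (768 * F) by rewrite /s0 /= /upd /= (g_frob Gd).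
have n48 : nvar s0 48 = (1 + 768 * tN s9)%N.
  transitivity (1 + neval (run (CSetR 48 (RDiv (RC 1) (RMul (RC 768) (RVar 16)))) s9) (nmul 768 (NVar 19)))%N; first by [].
  by rewrite neval_nmul.
have v49 : rvar s0 49 = al by rewrite /s0 /= /upd /= e1 Emu.
have v50 : rvar s0 50 = al * (2 * (mu + gam)) / mu by rewrite /s0 /= /upd /= e1 Emu.
have v19 : rvar s0 19 = gam by [].
have tN0 : tN s0 = tN s9 by [].
have n48' : nvar s0 48 = (1 + 768 * tN s0)%N by rewrite tN0.
have [tK0 th0 tw0] : [/\ tK s0 = tK s9, th s0 = th s9 & twe s0 = twe s9] by [].
have n28 : nvar s0 28 = nvar s9 28 by [].
have rk0 : rk n s0 = rk n s9 by [].
have r10 : rarr s0 1 = rarr s 1 by rewrite -b1.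
have r20 : rarr s0 2 = rarr s 2 by rewrite -r2.
have ev0 : rvar s0 0 = eps by rewrite -Eeps -e0.
have D0' : [/\ nvar s0 0 = n, nvar s0 1 = d & nvar s0 2 = m] := g_dims GG.
have [q1 q2 q3] := D0'.
have z5 : [/\ nvar s0 52 = 0%N, nvar s0 53 = 0%N & nvar s0 54 = 0%N].
  have [a1 _ _ _] := f9 52%N isT; have [a2 _ _ _] := f9 53%N isT; have [a3 _ _ _] := f9 54%N isT.
  by split.
clearbody s0.
pose s1 := set_rvar s0 4 (1%N%:R : R).
have G1 : goes (CSetR 4 (RC 1)) s0 1 s1 by exact: (@goes_run s0 (CSetR 4 (RC 1)) isT).
pose I k s' := [/\ same 52 s0 s', rvar s' 4 = (1 - al) ^+ k, nvar s' 54 = k,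
   nvar s' 52 = (k * (D * (1 + 768 * tN s9)))%N & nvar s' 53 = (k * (D * (60 * (90 * m))))%N].
have [s2 I2 G2] : det (cJloop D) s1 (9 * J + 1) (I J).
  have I1 : I 0%N s1 by case: z5 => a1 a2 a3; split=> //; rewrite /s1; keep.
  suff H j k s' : (j + k = J)%N -> I k s' -> det (cJloop D) s' (9 * j + 1) (I J).
    exact: (H J 0%N s1 (addn0 _) I1).
  elim: j k s' => [|j IH] k s' Hk [A1 A2 A3 A4 A5].
    rewrite add0n in Hk; rewrite Hk in A2 A3 A4 A5; have [_ c0 _ _] := A1 0%N isT.
    apply: det_whileF.
      rewrite /= negbK A2 c0 ev0.
      exact: HJ.
    by split.
  have [_ c0 _ _] := A1 0%N isT; have [_ c49 _ _] := A1 49%N isT; have [c48 _ _ _] := A1 48%N isT.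
  have [c2 _ _ _] := A1 2%N isT.
  apply: (@det_conseq _ _ _ (7 + (9 * j + 1)).+1 _ (I J)); [by clear; lia|by []|].
  apply: det_whileT.
    by rewrite /= -ltNge A2 c0 ev0; apply: Jlt; move: Hk; clear; lia.
  apply: det_run => //; apply: (IH k.+1); first by move: Hk; clear; lia.
  split; rewrite /= ?/upd /= ?neval_nmul /= ?/upd /=.
  - by keep.
  - by rewrite A2 c49 v49 exprSr.
  - by rewrite A3 addn1.
  - by rewrite A4 c48 n48 mulSn addnC.
  - by rewrite A5 c2 q3 mulSn addnC.
case: I2 => L1 _ L3 L4 L5.
have [d2 _ _ rr2] := L1 2%N isT; have [d1 _ _ rr1] := L1 1%N isT.
pose x0 := rarr s 2.
pose x56 j := if (j < d)%N then x0 j else rarr s2 56 j.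
pose x57 j := if (j < d)%N then x0 j else rarr s2 57 j.
pose s3 := set_nvar (set_rarr (set_nvar (set_rarr s2 56 x56) 4 d) 57 x57) 4 d.
have [s3' E3 G3] : det cinit s2 (8 * d + 8) (fun s' => s' = s3).
  apply: (@det_seqT _ _ _ _ (4 * d + 3) (4 * d + 4)); first by clear; lia.
  apply: (@cmap_spec _ _ _ _ _ x0 d) => //; first by rewrite d1.
    by move=> j A Hj HA; rewrite /= /upd /= rr2 r20.
  apply: (@cmap_spec _ _ _ _ _ x0 d) => //; first by rewrite /= /upd /= d1.
    by clear; lia.
  by move=> j A Hj HA; rewrite /= /upd /= rr2 r20.
rewrite E3 in G3; clear E3 s3'.
have L13 : same 52 s0 s3 by rewrite /s3; keep.
have [k52 k53 k54] : [/\ nvar s3 52 = nvar s2 52, nvar s3 53 = nvar s2 53 & nvar s3 54 = nvar s2 54] by [].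
have [k56 k57] : rarr s3 56 = x56 /\ rarr s3 57 = x57 by [].
clearbody s3.
have [g0' _ h0' j0'] := L13 0%N isT; have [g1' _ h1' j1'] := L13 1%N isT; have [g2' _ _ _] := L13 2%N isT.
have [_ l49 _ _] := L13 49%N isT.
have dims3 : [/\ nvar s3 0 = n, nvar s3 1 = d & nvar s3 2 = m] by rewrite g0' g1' g2'.
have idx3 : [/\ narr s3 0 = er, narr s3 1 = ec & rarr s3 0 = ev] by rewrite h0' h1' j0'; exact: (g_idx GG).
pose Q4 s' := [/\ same 56 s3 s', rarr s' 56 = x56 /\ rarr s' 57 = x57,
   (forall x, x != 4%N -> nvar s' x = nvar s3 x) &
   forall u, dot d (rarr s' 59) u = md err0 u].
have [s4 [U1 [U2 U2'] U3 U4] G4] : det cgrad s3 (8 * d + 4 * n + 8 * m + 24) Q4.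
  apply: (grad_spec er_lt ec_lt dims3 idx3) => s' V1 V2 V3 V4 V5 V6; split=> //.
    by rewrite !V2.
  move=> u; rewrite V6 j1' r10 -xsE.
  have Bm := bilin_gram n d m er ec ev.
  have loc j : (j < d)%N -> rarr s' 58 j = x0 j.
    move=> Hj; rewrite V5 // k56 k57 /x56 /x57 Hj l49 v49; field.
    by rewrite gt_eqF //; lra.
  rewrite (local_gram n m er ec ev u loc).
  have -> : err0 = lc 1 x0 (-1) xs by apply/funext => j; rewrite /err0 /lc /x0; ring.
  by rewrite (bilinl _ _ _ _ _ Bm); ring.
pose Q5 s' := [/\ same 54 s3 s', rarr s' 56 = x56, rarr s' 57 = x57 &
   (md err0 err0 = 0 -> nvar s' 54 = 0%N) /\
   (nvar s' 54 = J \/ nvar s' 54 = 0%N /\ forall j, (j < d)%N -> err0 j = 0)].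
have [s5 [W1 W2 W3 [W0 W4]] G5] : det czero s4 (4 * d + 12) Q5.
  have [u1 _ _ _] := U1 1%N isT.
  apply: (@det_seqT _ _ _ _ 1 (4 * d + 10)); first by clear; lia.
  apply: det_run => //.
  apply: (@det_seqT _ _ _ _ (4 * d + 3) 4); first by clear; lia.
  apply: (@csum_spec _ _ _ _ _ (fun j => rarr s4 59 j * rarr s4 59 j) d) => //.
    by rewrite /= u1 g1' q2.
  rewrite /= /upd /= add0r -/(dot d (rarr s4 59) (rarr s4 59)).
  have U54 : same 54 s3 s4 by apply: same_le U1.
  have E54 : nvar s4 54 = J by rewrite U3 // k54.
  apply: det_run => //=; rewrite /upd /=; case: ifP => Hz.
    split=> //=; first by keep.
    split=> //; right; split=> // j Hj.
    have z j' : (j' < d)%N -> rarr s4 59 j' = 0.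
      move=> Hj'; have : dot d (rarr s4 59) (rarr s4 59) == 0.
        by rewrite eq_le Hz dot_ge0.
      rewrite /dot big_mkord psumr_eq0; last by move=> i _; rewrite -expr2 sqr_ge0.
      by move/allP/(_ (Ordinal Hj') (mem_index_enum _)); rewrite /= -expr2 sqrf_eq0 => /eqP.
    have : md err0 err0 = 0 by rewrite -U4 /dot big_nat_cond big1 // => i /andP[/andP[_ Hi] _]; rewrite z // mul0r.
    move=> E; have := ray err0; rewrite E => H.
    have : dot d err0 err0 == 0 by rewrite eq_le dot_ge0 andbT; move: H; rewrite pmulr_rle0.
    rewrite /dot big_mkord psumr_eq0; last by move=> i _; rewrite -expr2 sqr_ge0.
    by move/allP/(_ (Ordinal Hj) (mem_index_enum _)); rewrite /= -expr2 sqrf_eq0 => /eqP.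
  split=> //=; first by keep.
  split; last by left.
  move=> E; move/negP: Hz; case.
  have := form_cauchy err0 (rarr s4 59) (bilin_gram n d m er ec ev) (@gram_ge0 _ n d m er ec ev).
  by rewrite E mul0r -U4 => h; rewrite (_ : dot d (rarr s4 59) (rarr s4 59) = 0) //; apply/eqP; rewrite -sqrf_eq0 eq_le h sqr_ge0.
have S5 : same 52 s0 s5 by apply: same_trans L13 (same_le _ W1).
have [w52 _ _ _] := W1 52%N isT; have [w53 _ _ _] := W1 53%N isT.
rewrite k52 L4 in w52; rewrite k53 L5 in w53.
pose Tm := (cred d s0 s5 + nvar s5 54 * (Tbody n d m + 4) + 1)%N.
pose T := (Tp + (7 + (1 + (9 * J + 1 + (8 * d + 8 + (8 * d + 4 * n + 8 * m + 24 + (4 * d + 12 + (Tm + (4 * d + 3)).+1).+1).+1).+1).+1).+1).+1).+1%N.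
have pre psi v : wp (cmain;; cout) s5 (Tm + (4 * d + 3)).+1 (fun=> True) psi v ->
    wp (prog D) s T (fun=> True) psi v.
  move=> main; rewrite /T.
  apply: (wp_detseq (goes_det G9 _)); apply: (wp_detseq (goes_det G0 _)).
  apply: (wp_detseq (goes_det G1 _)); apply: (wp_detseq (goes_det G2 _)).
  apply: (wp_detseq (goes_det G3 _)); apply: (wp_detseq (goes_det G4 _)).
  exact: (wp_detseq (goes_det G5 _)).
have cout_spec s6 : same 52 s0 s6 ->
    det cout s6 (4 * d + 3) (fun s' => forall j, (j < d)%N -> rarr s' 3 j = rarr s6 56 j).
  move=> Z1; have [a1 _ _ _] := Z1 1%N isT.
  apply: (@cmap_spec _ _ _ _ _ (rarr s6 56) d) => //; first by rewrite a1.
  by move=> j Hj; rewrite /= /upd /= Hj.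
exists s9, Tp, J, T; split.
- split=> //; rewrite /T /Tm /cred /Astep w52 w53 th0 n28 /Tbody.
  have : (nvar s5 54 <= J)%N by case: W4 => [->|[-> _]].
  move=> h; have h2 := leq_mul2r (24 * d + 8 * n + 12 * m + 84)%N (nvar s5 54) J.
  rewrite h orbT in h2; move: h2.
  have -> : (24 * d + 8 * n + 12 * m + 80 + 4 = 24 * d + 8 * n + 12 * m + 84)%N by clear; lia.
  have -> : (24 * d + 8 * n + 12 * m + 100 = 24 * d + 8 * n + 12 * m + 84 + 16)%N by clear; lia.
  rewrite [(J * (_ + 16))%N]mulnDr.
  have : (160 * d * (0 < J * (D * (60 * (90 * m)))) <= 160 * d)%N.
    by rewrite -[X in (_ <= X)%N]muln1 leq_mul2l leq_b1 orbT.
  move: (160 * d * (0 < J * (D * (60 * (90 * m)))))%N => z.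
  move: ((th s9 * (12 * nvar s9 28 + 60) + 110) * (J * (D * (1 + 768 * tN s9))))%N => a1.
  move: (J * (D * (60 * (90 * m))))%N => a2.
  move: (nvar s5 54 * (24 * d + 8 * n + 12 * m + 84))%N => a3.
  move: (J * (24 * d + 8 * n + 12 * m + 84))%N => a4.
  by clear; lia.
- move=> E0 psi Hpsi; apply: pre.
  apply: (@wp_detseqT _ _ _ _ 1 (4 * d + 3)); first by rewrite /Tm; clear; lia.
  apply: det_whileF; first by rewrite /= W0.
  apply: det_wp (cout_spec s5 S5) _ => s' Hs'; split=> //; apply: Hpsi; rewrite -E0.
  apply: (local2 (bilin_gram _ _ _ _ _ _) (local_gram n m er ec ev)) => j Hj.
  by rewrite /errout /err0 Hs' // W2 /x56 Hj.
move=> cS cK dv c psi cS0 cK0 c0 HS HK Hdv Hpsi.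
pose FS := (J * (D * (1 + 768 * tN s9)))%N; pose FK := (J * (D * (60 * (90 * m))))%N.
pose nu := mu / (2 * (mu + gam)).
have nu0 : 0 < nu by rewrite divr_gt0 // mulr_gt0.
have err := p_err P; rewrite -/gam in err.
have errC : \sum_(0 <= e < m) (twe s9 e - ev e) ^+ 2 <= gam / 4.
  by apply: le_trans err; apply: eqR_le; apply: eq_bigr => e _; rewrite -sqrrN opprB.
pose hd := hform (dot d) (gram n d m er ec (twe s0)) (rvar s0 19).
(* Rounding changes the matrix by at most gam / 4 in squared Frobenius norm, so both comparisons
   between [md] and [hd] lose only constants besides the ratio mu / (mu + gam). *)
have mh u : md u u <= 2 * hd u u.
  rewrite /hd /hform v19 tw0; have := gram_perturb er_lt ec_lt erc_inj u err.
  by move/perturb_upper; apply; rewrite mulr_ge0 ?dot_ge0 // ltW.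
have hm u : nu * hd u u <= md u u.
  rewrite /hd /hform v19 tw0; have h1 := gram_perturb er_lt ec_lt erc_inj u errC.
  have h2 : gam * dot d u u <= gam / mu * md u u.
    by rewrite -mulrA ler_pM2l // mulrC ler_pdivlMr // mulrC; exact: ray.
  have h3 : nu * (gram n d m er ec (twe s9) u u + gam * dot d u u) <= nu * (2 * md u u + 2 * (gam / mu * md u u)).
    apply: ler_wpM2l; first exact: ltW.
    by apply: (perturb_lower h1 h2); rewrite mulr_ge0 ?dot_ge0 // ltW.
  apply: le_trans h3 _; apply: eqR_le; rewrite /nu; field.
  by rewrite (gt_eqF mu0) gt_eqF.
have aF u : gram n d m er ec (twe s0) u u <= F * dot d u u.
  apply: le_trans (gram_le er_lt ec_lt erc_inj _ _) _; apply: ler_wpM2r; first exact: dot_ge0.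
  rewrite /frob; apply: ler_sum_nat => e /andP[_ He].
  rewrite -[leLHS]real_normK ?num_real // -[leRHS]real_normK ?num_real // lerXn2r ?nnegrE //.
  exact: (g_we GG).
have Kd i : (i < n)%N -> (tK s0 i <= d)%N.
  by move=> Hi; rewrite tK0; have [h _ _] := p_K P Hi; apply: leq_trans h (rc_le_d ec_lt erc_inj i).
have solv w : exists v, forall u, hd v u = dot d w u.
  apply: (form_solve (c := gam)) => //.
  - exact: bilin_hform (bilin_dot R d) (bilin_gram _ _ _ _ _ _).
  - by move=> u u' v H; rewrite /hd /hform (local_gram n m er ec _ v H) (local_dot v H).
  - by move=> u; rewrite /hd /hform v19 lerDr gram_ge0.
have etaE : rvar s0 48 * (768 * frob m ev) = 1.
  by rewrite v48 mul1r mulVf // gt_eqF // mulr_gt0.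
have beE : rvar s0 50 * nu = rvar s0 49.
  by rewrite v50 v49 /nu; field; rewrite (gt_eqF mu0) gt_eqF.
have alE : rvar s0 49 ^+ 2 * 2048 = nu by rewrite v49.
have xsE' u : md xs u = \sum_(0 <= i < n) rarr s0 1 i * dot d (wrow m er ec ev i) u by rewrite r10.
have al0' : 0 < rvar s0 49 by rewrite v49.
have al1' : rvar s0 49 <= 1 by rewrite v49.
have O5 : OInv s0 FS FK s5 by split=> //; rewrite ?w52 ?w53.
have ML := main_loop er_lt ec_lt erc_inj GG F0 etaE n48' aF Kd solv cS0 cK0 HS HK mh hm al0' al1' nu0 beE alE c0 xsE' O5.
have e56 j : (j < d)%N -> dx xs s5 j = err0 j by move=> Hj; rewrite /dx W2 /x56 Hj.
have e57 j : (j < d)%N -> dz xs s5 j = err0 j by move=> Hj; rewrite /dz W3 /x57 Hj.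
have m00 := gram_ge0 n d m er ec ev err0.
have rkp : 0 <= rk n s9 by exact: rk_ge0.
have it0 : 0 <= cS * (1 + 768 * tN s9)%:R + cK * rk n s9 by rewrite addr_ge0 // mulr_ge0.
have om : 0 <= 1 - al by rewrite subr_ge0.
have v5 : 1 - J%:R * (cS * (1 + 768 * tN s9)%:R + cK * rk n s9) - c * (1 - al) ^+ J * md err0 err0
   <= Vout n d m er ec ev s0 cS cK dv FS FK nu c xs (nvar s5 54) s5.
  have fl : fuel cS cK FS FK s5 = 0 by rewrite /fuel w52 w53 !subrr !mulr0 addr0.
  rewrite /Vout /alive w52 w53 fl subr0.
  have cJ0 : 0 <= c * (1 - al) ^+ J * md err0 err0 by rewrite !mulr_ge0 // exprn_ge0.
  have jt0 : 0 <= J%:R * (cS * (1 + 768 * tN s9)%:R + cK * rk n s9) by rewrite mulr_ge0.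
  case: ifP => [_|dead].
    rewrite /iter_cost rk0 tN0 v49; case: W4 => [->|[-> z]].
      rewrite lerD2l lerN2; apply: ler_wpM2l; first by rewrite mulr_ge0 // exprn_ge0.
      rewrite (@potential_local R n d m er ec ev s0 nu _ _ _ _ e56 e57) /potential.
      exact: (half_sum_le (hm err0)).
    rewrite mul0r expr0 mulr1 subr0.
    have zz j : (j < d)%N -> err0 j = (fun=> 0) j by exact: z.
    have -> : potential md hd nu (dx xs s5) (dz xs s5) = 0.
      rewrite (@potential_local R n d m er ec ev s0 nu _ (fun=> 0) _ (fun=> 0)); last 2 first.
      - by move=> j Hj; rewrite e56 // z.
      - by move=> j Hj; rewrite e57 // z.
      rewrite /potential (bilin0 _ (bilin_gram _ _ _ _ _ _)) (bilin0 _ (bilin_hform _ (bilin_dot R d) (bilin_gram _ _ _ _ _ _))).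
      by rewrite mulr0 !mul0r addr0.
    by rewrite mulr0 subr0; exact: sub2_le1.
  (* A state can start without fuel only if a budget is 0, and then [HS] or [HK] reads [1 <= dv]. *)
  have : FS = 0%N \/ FK = 0%N.
    by rewrite /FS /FK; move/negbT: dead; rewrite negb_and -!eqn0Ngt => /orP[/eqP ->|/eqP ->]; [left|right].
  by case=> E; [move: HS; rewrite -/FS E|move: HK; rewrite -/FK E]; rewrite mulr0 addr0; exact: le_trans (sub2_le1 jt0 cJ0).
have main : wp (cmain;; cout) s5 (Tm + (4 * d + 3)).+1 (fun=> True) psi
    (Vout n d m er ec ev s0 cS cK dv FS FK nu c xs (nvar s5 54) s5).
  apply: wp_wpt; apply: (wpt_seq (T1 := (Tm + (4 * d + 3))%N) _ (wpt_frame (X := (4 * d + 3)%N) ML)); first by clear; lia.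
  move=> s6 [Z1 Z2 Z3].
  apply: (@wpt_wp _ _ _ (4 * d + 3)); [by clear; lia| |by clear => *; lia].
  apply: det_wp (cout_spec s6 Z1) _.
  move=> s' Hs'; split=> //.
  rewrite /Vout; case: ifP => [al6|_]; last exact: Hdv.
  apply: le_trans (Hpsi s'); rewrite mul0r expr0 mulr1 subr0.
  have fl : 0 <= fuel cS cK FS FK s6.
    by rewrite /fuel addr_ge0 // mulr_ge0 // subr_ge0 ler_nat.
  have -> : md (errout s') (errout s') = md (dx xs s6) (dx xs s6).
    apply: (local2 (bilin_gram _ _ _ _ _ _) (local_gram n m er ec ev)) => j Hj.
    by rewrite /errout /dx Hs'.
  have : c * (md (dx xs s6) (dx xs s6) / 2) <= c * potential md (hform (dot d) (gram n d m er ec (twe s0)) (rvar s0 19)) nu (dx xs s6) (dz xs s6).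
    apply: ler_wpM2l => //; rewrite /potential lerDl divr_ge0 // mulr_ge0 ?(ltW nu0) //.
    by apply: hform_ge0; [exact: dot_ge0|exact: gram_ge0|rewrite v19].
  by move=> h; exact: sub_mono2.
by apply: pre; apply: wp_conseq v5 _ main.
Qed.
End Algorithm.

(** * The sparse input *)

Section Bridge.
Variables (R : realType) (n d : nat) (A : 'M[R]_(n, d)).
Local Notation l := (nonzeros A).
Definition erA := load_seq 0%N [seq val p.1 | p <- l].
Definition ecA := load_seq 0%N [seq val p.2 | p <- l].
Definition evA := load_seq 0 [seq A p.1 p.2 | p <- l].
Local Notation m := (size l).

Lemma nonzeros_uniq : uniq l.
Proof.
apply: filter_uniq; apply: allpairs_uniq; rewrite ?enum_uniq //.
by move=> [a b] [c e] _ _ /= [-> ->].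
Qed.

Lemma mem_nonzeros p : (p \in l) = (A p.1 p.2 != 0).
Proof.
rewrite mem_filter; case: p => i j; rewrite andb_idr // => _.
by apply/allpairsP; exists (i, j); rewrite !mem_enum.
Qed.

Lemma size_nonzeros : m = nnz A.
Proof.
rewrite /nnz -(card_uniqP nonzeros_uniq); apply: eq_card => p.
by rewrite [LHS]mem_nonzeros inE.
Qed.

Variable p0 : 'I_n * 'I_d.

Lemma erE e : (e < m)%N -> erA e = (nth p0 l e).1 :> nat.
Proof. by move=> He; rewrite /erA /load_seq (nth_map p0). Qed.
Lemma ecE e : (e < m)%N -> ecA e = (nth p0 l e).2 :> nat.
Proof. by move=> He; rewrite /ecA /load_seq (nth_map p0). Qed.
Lemma evE e : (e < m)%N -> evA e = A (nth p0 l e).1 (nth p0 l e).2.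
Proof. by move=> He; rewrite /evA /load_seq (nth_map p0). Qed.

Lemma erA_lt e : (e < m)%N -> (erA e < n)%N.
Proof. by move=> He; rewrite erE. Qed.
Lemma ecA_lt e : (e < m)%N -> (ecA e < d)%N.
Proof. by move=> He; rewrite ecE. Qed.

Lemma ercA_inj e e' : (e < m)%N -> (e' < m)%N -> erA e = erA e' -> ecA e = ecA e' -> e = e'.
Proof.
move=> He He'; rewrite !erE // !ecE // => /val_inj h1 /val_inj h2.
apply/eqP; rewrite -(nth_uniq p0 He He' nonzeros_uniq).
by rewrite [nth p0 l e]surjective_pairing h1 h2 -surjective_pairing.
Qed.

Lemma evA_nz e : (e < m)%N -> evA e != 0.
Proof. by move=> He; rewrite evE // -mem_nonzeros mem_nth. Qed.

Lemma rowneA : (forall i, row i A != 0) ->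
  forall i, (i < n)%N -> exists2 e, (e < m)%N & erA e = i.
Proof.
move=> Hr i Hi; have := Hr (Ordinal Hi) => /rV0Pn[j]; rewrite mxE => nz.
have pin : (Ordinal Hi, j) \in l by rewrite mem_nonzeros.
exists (index (Ordinal Hi, j) l); first by rewrite index_mem.
by rewrite erE ?index_mem // nth_index.
Qed.

Lemma rsum_nz (i : 'I_n) (f : 'I_n -> 'I_d -> R) (g : nat -> R) :
  (forall i j, A i j = 0 -> f i j = 0) ->
  (forall e, (e < m)%N -> g e = f (nth p0 l e).1 (nth p0 l e).2) ->
  rsum m erA i g = \sum_j f i j.
Proof.
move=> f0 gE; rewrite /rsum.
transitivity (\sum_(p <- l | p.1 == i) f p.1 p.2).
  rewrite [RHS](big_nth p0) [LHS]big_nat_cond [RHS]big_nat_cond.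
  apply: eq_big => [e|e /andP[/andP[_ He] _]]; last exact: gE.
  case He: (0 <= e < m)%N => //=; by rewrite erE // -val_eqE.
rewrite big_mkcond big_uniq ?nonzeros_uniq //=.
transitivity (\sum_(p : 'I_n * 'I_d | p.1 == i) f p.1 p.2).
  rewrite big_mkcond [RHS]big_mkcond; apply: eq_bigr => p _ /=.
  case: ifP => // /negbT; rewrite mem_nonzeros negbK => /eqP /f0 ->.
  by case: ifP.
rewrite (eq_bigl (fun p => (p.1 == i) && xpredT p.2)); last by move=> p; rewrite andbT.
by rewrite -(pair_big (fun k => k == i) xpredT f) /= big_pred1_eq.
Qed.

Lemma norm1A (i : 'I_n) : norm1f m erA evA i = norm1 (row i A).
Proof.
rewrite /norm1f (rsum_nz i (f := fun i j => `|A i j|)).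
- by rewrite /norm1; apply: eq_bigr => j _; rewrite mxE.
- by move=> i' j ->; rewrite normr0.
- by move=> e He; rewrite evE.
Qed.

Lemma norm2A (i : 'I_n) : norm2f m erA evA i = norm2 (row i A) ^+ 2.
Proof.
rewrite /norm2f (rsum_nz i (f := fun i j => A i j ^+ 2)).
- rewrite /norm2 sqr_sqrtr; last by apply: sumr_ge0 => j _; rewrite sqr_ge0.
  by apply: eq_bigr => j _; rewrite mxE.
- by move=> i' j ->; rewrite expr0n.
- by move=> e He; rewrite evE.
Qed.

Lemma frobA : frob m evA = frobenius A ^+ 2.
Proof.
rewrite -(sum_norm2f evA erA_lt) /frobenius sqr_sqrtr; last first.
  by do 2![apply: sumr_ge0 => ? _]; rewrite sqr_ge0.
rewrite big_mkord; apply: eq_bigr => i _; rewrite norm2A /norm2 sqr_sqrtr; last first.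
  by apply: sumr_ge0 => j _; rewrite sqr_ge0.
by apply: eq_bigr => j _; rewrite mxE.
Qed.

Lemma wrowA (i : 'I_n) (j : 'I_d) : wrow m erA ecA evA i j = A i j.
Proof.
rewrite /wrow (rsum_nz i (f := fun i j' => A i j' * delta R j' j)).
- rewrite (bigD1 j) //= big1 ?addr0; first by rewrite /delta eqxx mulr1.
  by move=> k ne; rewrite /delta val_eqE eq_sym (negbTE ne) mulr0.
- by move=> i' j' ->; rewrite mul0r.
- by move=> e He; rewrite evE // ecE.
Qed.

Lemma dotA (i : 'I_n) u : dot d (wrow m erA ecA evA i) u = \sum_(j < d) A i j * u j.
Proof. by rewrite /dot big_mkord; apply: eq_bigr => j _; rewrite wrowA. Qed.

Definition fun_of_col (x : 'cV[R]_d) := fun_of_row x^T.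
Lemma fun_of_colE x (j : 'I_d) : fun_of_col x j = x j 0.
Proof. by rewrite /fun_of_col fun_of_rowE mxE. Qed.

Lemma dotAx (i : 'I_n) x : dot d (wrow m erA ecA evA i) (fun_of_col x) = (A *m x) i 0.
Proof. by rewrite dotA mxE; apply: eq_bigr => j _; rewrite fun_of_colE. Qed.

Lemma gramA u v : gram n d m erA ecA evA u v =
  \sum_(i < n) dot d (wrow m erA ecA evA i) u * dot d (wrow m erA ecA evA i) v.
Proof. by rewrite /gram big_mkord. Qed.

Lemma form_mxA : form_mx d (gram n d m erA ecA evA) = A^T *m A.
Proof.
apply/matrixP => j k; rewrite !mxE gramA; apply: eq_bigr => i _.
by rewrite !dot_delta // !wrowA mxE.
Qed.

Lemma mxnormA y : mxnorm_by (A^T *m A) y ^+ 2 = gram n d m erA ecA evA (fun_of_col y) (fun_of_col y).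
Proof.
rewrite /mxnorm_by mulmxA -trmx_mul -mulmxA.
have -> : ((A *m y)^T *m (A *m y)) 0 0 = gram n d m erA ecA evA (fun_of_col y) (fun_of_col y).
  by rewrite mxE gramA; apply: eq_bigr => i _; rewrite mxE dotAx.
by rewrite sqr_sqrtr // gram_ge0.
Qed.

(** The hypothesis is the system of normal equations; it makes the cross term vanish when the
    residual of [y] is expanded around the solution. *)
Lemma argminA (b : 'cV[R]_n) (xs : nat -> R) :
  (forall u, gram n d m erA ecA evA xs u =
     \sum_(0 <= i < n) load_seq 0 [seq b i 0 | i <- enum 'I_n] i * dot d (wrow m erA ecA evA i) u) ->
  regression_argmin A b (\col_j xs j).
Proof.
move=> H y; rewrite /residual_sq.
set X := \col_j xs j.
have bE (i : 'I_n) : load_seq 0 [seq b i 0 | i <- enum 'I_n] i = b i 0.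
  by rewrite /load_seq (nth_map i) ?size_enum_ord // nth_ord_enum.
have XE : forall j, (j < d)%N -> xs j = fun_of_col X j.
  by move=> j Hj; rewrite (fun_of_colE X (Ordinal Hj)) mxE.
pose e := fun_of_col (y - X).
have cross : \sum_(i < n) (A *m X - b) i 0 * (A *m (y - X)) i 0 = 0.
  have := H e; rewrite big_mkord (local_gram n _ _ _ _ e XE) gramA => E.
  transitivity (\sum_(i < n) dot d (wrow m erA ecA evA i) (fun_of_col X) * dot d (wrow m erA ecA evA i) e -
     \sum_(i < n) load_seq 0 [seq b i0 0 | i0 <- enum 'I_n] i * dot d (wrow m erA ecA evA i) e).
    rewrite -sumrB; apply: eq_bigr => i _.
    by rewrite !dotAx bE -mulrBl; congr (_ * _); rewrite !mxE.
  by rewrite E subrr.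
have -> : \sum_i (A *m y - b) i 0 ^+ 2 = \sum_i (A *m X - b) i 0 ^+ 2 +
   2 * (\sum_i (A *m X - b) i 0 * (A *m (y - X)) i 0) + \sum_i (A *m (y - X)) i 0 ^+ 2.
  rewrite mulr_sumr -!big_split /=; apply: eq_bigr => i _.
  have -> : (A *m y - b) i 0 = (A *m X - b) i 0 + (A *m (y - X)) i 0.
    by rewrite mulmxBr !mxE; ring.
  by ring.
rewrite cross mulr0 addr0 lerDl; apply: sumr_ge0 => i _; exact: sqr_ge0.
Qed.

End Bridge.

(** * Running time *)

Section Cost.
Variable R : realType.
Implicit Types (F S mu : R) (m N b : nat).

Lemma ln_ge_subV (x : R) : 0 < x -> 1 - x^-1 <= ln x.
Proof.
by move=> x0; have := expR_ge1Dx (- ln x); rewrite expRN lnK ?posrE // => H; lra.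
Qed.

(** The exponents 2/3, 1/6 and 1/3 have the common denominator 6, so comparisons are made between
    sixth powers, where no real exponent is left. *)
Lemma exprn6_powR (a q : R) (k : nat) : 0 <= a -> q * 6 = k%:R -> (a `^ q) ^+ 6 = a ^+ k.
Proof. by move=> a0 H; rewrite -powR_mulrn ?powR_ge0 // -powRrM H powR_mulrn. Qed.

Definition workX m F S mu := m%:R `^ (2 / 3) * (F / mu) `^ (1 / 6) * (S / mu) `^ (1 / 3).

Lemma workX_ge0 m F S mu : 0 <= workX m F S mu.
Proof. by rewrite !mulr_ge0 ?powR_ge0. Qed.

Lemma workX6 m F S mu : 0 < mu -> 0 <= F -> 0 <= S ->
  workX m F S mu ^+ 6 = m%:R ^+ 4 * (F / mu) * (S / mu) ^+ 2.
Proof.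
move=> mu0 F0 S0; have k0 : 0 <= F / mu by rewrite divr_ge0 // ltW.
have t0 : 0 <= S / mu by rewrite divr_ge0 // ltW.
have E1 : (m%:R `^ (2 / 3)) ^+ 6 = m%:R ^+ 4 :> R by apply: exprn6_powR => //; lra.
have E2 : ((F / mu) `^ (1 / 6)) ^+ 6 = (F / mu) ^+ 1 by apply: exprn6_powR => //; lra.
have E3 : ((S / mu) `^ (1 / 3)) ^+ 6 = (S / mu) ^+ 2 by apply: exprn6_powR => //; lra.
by rewrite /workX exprMn exprMn E1 E2 E3 expr1.
Qed.

(* The sixth power of the claim is m^6 (k/N)^3 <= m^4 k (S/mu)^2, with k = F/mu. *)
Lemma sqrt_le_workX m N F S mu : 0 < mu -> 0 < F -> 0 <= S -> (0 < N)%N ->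
  m%:R ^+ 2 * F ^+ 2 <= N%:R ^+ 3 * S ^+ 2 ->
  m%:R * Num.sqrt (F / mu / N%:R) <= workX m F S mu.
Proof.
move=> mu0 F0 S0 Np H.
have N0 : 0 < N%:R :> R by rewrite ltr0n.
have k0 : 0 < F / mu by rewrite divr_gt0.
have kN : 0 <= F / mu / N%:R by rewrite divr_ge0 // ltW.
rewrite -(@ler_pXn2r _ 6) ?nnegrE ?workX_ge0 ?mulr_ge0 ?sqrtr_ge0 ?ler0n //.
rewrite workX6 ?(ltW F0) // exprMn -[Num.sqrt _ ^+ 6]/(Num.sqrt _ ^+ (2 * 3)) exprM sqr_sqrtr //.
have -> : m%:R ^+ 6 * (F / mu / N%:R) ^+ 3 =
   m%:R ^+ 4 * (F / mu) * (m%:R ^+ 2 * F ^+ 2 / N%:R ^+ 3 / mu ^+ 2).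
  by field; rewrite !gt_eqF.
apply: ler_wpM2l; first by rewrite mulr_ge0 ?exprn_ge0 ?ler0n // ltW.
rewrite expr_div_n ler_pM2r ?invr_gt0 ?exprn_gt0 //.
by rewrite ler_pdivrMr ?exprn_gt0 // [leRHS]mulrC.
Qed.

(** From m <= N^3 <= k^3 the bound 32 m^2 N becomes k^12, using 32 <= k^5. Taking logarithms with ln
    2 >= 1/2 doubles 12 to 24. *)
Lemma bits_le_ln (k : R) m N nb : 2 <= k -> (m < N ^ 3)%N -> N%:R <= k ->
  2 ^+ nb <= 32 * m%:R ^+ 2 * N%:R :> R -> nb%:R <= 24 * ln k.
Proof.
move=> k2 mN Nk H; have k0 : 0 < k by lra.
have N0 : 0 <= N%:R :> R by rewrite ler0n.
have h1 : m%:R <= k ^+ 3.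
  apply: (@le_trans _ _ (N%:R ^+ 3)); first by rewrite -natrX ler_nat ltnW.
  by rewrite lerXn2r // nnegrE ltW.
have h2 : 2 ^+ nb <= k ^+ 12.
  apply: le_trans H _.
  have -> : k ^+ 12 = k ^+ 5 * (k ^+ 3) ^+ 2 * k by ring.
  have h3 : 32 <= k ^+ 5.
    have -> : 32 = 2 ^+ 5 :> R by ring.
    by rewrite lerXn2r // nnegrE ltW.
  apply: ler_pM => //; first by rewrite mulr_ge0 // exprn_ge0.
  apply: ler_pM => //; first by rewrite exprn_ge0.
  by rewrite lerXn2r // ?nnegrE // exprn_ge0 // ltW.
have : ln (2 ^+ nb) <= ln (k ^+ 12) by rewrite ler_ln // posrE exprn_gt0.
have lnE (x : R) j : 0 < x -> ln (x ^+ j) = j%:R * ln x by move=> x0; rewrite lnXn // mulr_natl.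
rewrite !lnE // => h4.
have l2 : 1 / 2 <= ln 2 :> R by have := ln_ge_subV (ltr0n R 2); lra.
have : nb%:R * (1 / 2) <= nb%:R * ln 2 :> R by apply: ler_wpM2l.
lra.
Qed.

(** There are two reasons for the doubling to have stopped. If N mu > F, then no bits are needed and
    the square root is at most 2, so the cost is of order m. Otherwise N^3 S^2 > m^2 F^2, which
    turns m sqrt(k / N) into [workX]; as S^2 <= m F^2 it also gives m < N^3, so the number of bits
    is O(ln k). *)
Lemma work_le m N b F S mu : 0 < mu -> mu <= F -> F <= S -> S ^+ 2 <= m%:R * F ^+ 2 ->
  (0 < m)%N -> (0 < N)%N ->
  ~~ ((N%:R * (N%:R * N%:R) * S * S <= m%:R * m%:R * F * F) && (N%:R * mu <= F)) ->
  (F < N%:R * mu -> b = 0%N) ->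
  ((0 < b)%N -> exists2 nb, b = nb.+1 &
     forall k, (k < nb)%N -> F / N%:R / (4 * m%:R) * 2 ^+ k < 8 * (m%:R * F)) ->
  (1 + b%:R) * m%:R * Num.sqrt ((mu + F / N%:R) / mu) <=
    60 * (m%:R + workX m F S mu * ln (F / mu)).
Proof.
move=> mu0 muF FS S2 mp Np HN b0 Hb.
have F0 : 0 < F by apply: lt_le_trans muF.
have S0 : 0 < S by apply: lt_le_trans FS.
have N0 : 0 < N%:R :> R by rewrite ltr0n.
have m0 : 0 < m%:R :> R by rewrite ltr0n.
set k := F / mu; have k1 : 1 <= k by rewrite ler_pdivlMr // mul1r.
have lnk : 0 <= ln k by apply: ln_ge0.
have X0 := workX_ge0 m F S mu.
have rE : (mu + F / N%:R) / mu = 1 + k / N%:R by rewrite /k; field; rewrite !gt_eqF.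
rewrite rE; have [lt|ge] := ltP F (N%:R * mu).
  rewrite b0 // addr0 mul1r.
  have kN : k / N%:R <= 1 by rewrite ler_pdivrMr // mul1r /k ler_pdivrMr // ltW.
  have h : Num.sqrt (1 + k / N%:R) <= 2.
    have -> : 2 = Num.sqrt (2 ^+ 2) :> R by rewrite sqrtr_sqr ger0_norm.
    by rewrite ler_sqrt; lra.
  have := ler_wpM2l (ltW m0) h; have := mulr_ge0 X0 lnk; lra.
have Nk : N%:R <= k by rewrite ler_pdivlMr.
move: HN; rewrite ge andbT -ltNge => HN.
have HN' : m%:R ^+ 2 * F ^+ 2 < N%:R ^+ 3 * S ^+ 2.
  have -> : m%:R ^+ 2 * F ^+ 2 = m%:R * m%:R * F * F by ring.
  by have -> : N%:R ^+ 3 * S ^+ 2 = N%:R * (N%:R * N%:R) * S * S by ring.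
have mN : (m < N ^ 3)%N.
  rewrite -(ltr_nat R) natrX -(ltr_pM2r (mulr_gt0 m0 (exprn_gt0 2 F0))).
  apply: (@lt_le_trans _ _ (N%:R ^+ 3 * S ^+ 2)); first by rewrite mulrA -expr2.
  by apply: ler_wpM2l => //; rewrite exprn_ge0 // ltW.
have N2 : (2 <= N)%N.
  by case: (N) Np mN => [|[|?]] // _; rewrite exp1n ltnNge mp.
have k2 : 2 <= k by apply: le_trans Nk; rewrite ler_nat.
have lk : 1 / 2 <= ln k.
  have := @ln_ge_subV k; have : k^-1 <= 2^-1 by rewrite lef_pV2 // posrE; lra.
  by move=> h1 /(_ ltac:(lra)); lra.
have bl : 1 + b%:R <= 30 * ln k.
  case: (posnP b) Hb => [-> _|bp /(_ isT)[nb -> Hnb]]; first by lra.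
  case: nb Hnb => [_|nb /(_ nb (ltnSn nb)) Hnb]; first by lra.
  suff : nb%:R <= 24 * ln k by have -> : nb.+2%:R = nb%:R + 2 :> R by [rewrite -addn2 natrD]; lra.
  apply: (@bits_le_ln k m N) => //.
  have c0 : 0 < F / N%:R / (4 * m%:R) by rewrite !divr_gt0 ?mulr_gt0.
  rewrite -(ler_pM2l c0); apply: le_trans (ltW Hnb) _.
  rewrite le_eqVlt; apply/orP; left; apply/eqP; field; by rewrite !gt_eqF.
have kN1 : 1 <= k / N%:R by rewrite ler_pdivlMr // mul1r.
have h2 : Num.sqrt (1 + k / N%:R) <= 2 * Num.sqrt (k / N%:R).
  have -> : 2 = Num.sqrt (2 ^+ 2) :> R by rewrite sqrtr_sqr ger0_norm.
  rewrite -sqrtrM ?exprn_ge0 // ler_sqrt; lra.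
have h3 := @sqrt_le_workX m N F S mu mu0 F0 (ltW S0) Np (ltW HN').
rewrite -/k in h3.
rewrite -mulrA; apply: (@le_trans _ _ (30 * ln k * (m%:R * (2 * Num.sqrt (k / N%:R))))).
  apply: ler_pM => //.
  - by rewrite addr_ge0 ?ler0n.
  - by rewrite mulr_ge0 ?sqrtr_ge0 // ltW.
  - by apply: ler_wpM2l => //; exact: ltW.
have h4 := ler_wpM2l lnk h3; lra.
Qed.

End Cost.

(** The dominant terms are the steps, of order N per round, each with the bits of [h] heavy rows;
    [h * N <= m] turns their product into m (1 + b). *)
Lemma nat_time_le Tp h b J D N m d n T : (0 < D)%N -> (0 < m)%N -> (0 < N)%N ->
  (n <= m)%N -> (d <= m)%N -> (N <= 2 * m)%N -> (h * N <= m)%N ->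
  (Tp <= 500 * m * (1 + b))%N ->
  (T <= Tp + (h * (12 * b + 60) + 110) * (J * (D * (1 + 768 * N)))
     + 160 * (J * (D * (60 * (90 * m)))) + 160 * d + J * (24 * d + 8 * n + 12 * m + 100)
     + 24 * d + 4 * n + 8 * m + 120)%N ->
  (T <= 1100 * 1000 * (D * ((J + 1) * (m * (1 + b)))))%N.
Proof.
move=> Dp mp Np nm dm N2 hN HTp HT; apply: leq_trans HT _.
set q := (m * (1 + b))%N.
have mq : (m <= q)%N by rewrite leq_pmulr.
have hm : (h <= m)%N by apply: leq_trans hN; rewrite leq_pmulr.
have a1 : (h * (12 * b + 60) * (1 + 768 * N) <= 60 * 769 * q)%N.
  have e1 : (12 * b + 60 <= 60 * (1 + b))%N by lia.
  have e2 : (h * (1 + 768 * N) <= 769 * m)%N by rewrite mulnDr muln1 mulnCA; lia.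
  by have := leq_mul e1 e2; rewrite /q; lia.
have a2 : (110 * (1 + 768 * N) <= 110 * 1537 * q)%N by lia.
have b1 : ((h * (12 * b + 60) + 110) * (J * (D * (1 + 768 * N))) <=
    (60 * 769 + 110 * 1537) * (J * D * q))%N.
  have -> : ((h * (12 * b + 60) + 110) * (J * (D * (1 + 768 * N))) =
    (h * (12 * b + 60) * (1 + 768 * N) + 110 * (1 + 768 * N)) * (J * D))%N.
    by rewrite -mulnDl -[RHS]mulnA; congr (_ * _)%N; rewrite [RHS]mulnC mulnA.
  have -> : ((60 * 769 + 110 * 1537) * (J * D * q) = (60 * 769 * q + 110 * 1537 * q) * (J * D))%N.
    by rewrite -mulnDl [(J * D * q)%N]mulnC mulnA.
  by apply: leq_mul => //; exact: leq_add.
have b2 : (J * (D * (60 * (90 * m))) <= 60 * 90 * (J * D * q))%N.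
  have -> : (J * (D * (60 * (90 * m))) = 60 * 90 * (J * D * m))%N by lia.
  by rewrite leq_mul2l leq_mul2l mq !orbT.
have b3 : (J * (24 * d + 8 * n + 12 * m + 100) <= 144 * (J * D * q))%N.
  have e1 : (24 * d + 8 * n + 12 * m + 100 <= 144 * q)%N by lia.
  have e2 : (J * (144 * q) <= 144 * (J * D * q))%N.
    by rewrite mulnCA leq_mul2l /= leq_mul2r leq_pmulr // orbT.
  by apply: leq_trans e2; rewrite leq_mul2l e1 orbT.
have b4 : (q <= D * q)%N by rewrite leq_pmull.
have b5 : (D * ((J + 1) * q) = J * D * q + D * q)%N by lia.
rewrite b5; move: HTp; rewrite -mulnA -/q.
move: a1 a2 b1 b2 b3 b4 mq nm dm mp.
move: ((h * (12 * b + 60) + 110) * (J * (D * (1 + 768 * N))))%N (J * (D * (60 * (90 * m))))%N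
  (J * (24 * d + 8 * n + 12 * m + 100))%N (J * D * q)%N (D * q)%N => x1 x2 x3 u v _ _.
by clear; lia.
Qed.

(** Additive constants in the number of rounds are absorbed into ln(1 / eps), which is at least
    [l0]. This is how the constant comes to depend on [l0], and through it on the upper bound for
    eps. *)
Lemma time_le (R : realType) (D J m b T : nat) (mu g eps l0 Y : R) :
  (0 < D)%N -> 0 < mu -> 0 < g -> 0 < eps -> 0 < l0 -> l0 <= ln (1 / eps) ->
  (T <= 1100 * 1000 * (D * ((J + 1) * (m * (1 + b)))))%N ->
  J%:R <= 1 + ln (D%:R / (eps * eps)) / (Num.sqrt (mu / (mu + g)) / 64) ->
  (1 + b%:R) * m%:R * Num.sqrt ((mu + g) / mu) <= 60 * Y ->
  T%:R <= 1100 * 1000 * D%:R * 60 * ((2 + 64 * ln D%:R) / l0 + 128) * (Y * ln (1 / eps)).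
Proof.
move=> Dp mu0 g0 e0 l00 lL HT HJ HY.
have D1 : 1 <= D%:R :> R by rewrite ler1n.
have D0 : 0 < D%:R :> R by rewrite ltr0n.
have lD : 0 <= ln D%:R :> R by apply: ln_ge0.
set L := ln (1 / eps) in lL *.
set r := Num.sqrt ((mu + g) / mu) in HY *.
have r1 : 1 <= r.
  have -> : 1 = Num.sqrt 1 :> R by rewrite sqrtr1.
  by rewrite ler_sqrt ?ler_pdivlMr ?mul1r //; lra.
have rE : Num.sqrt (mu / (mu + g)) = r^-1 by rewrite -sqrtrV ?divr_ge0 ?invf_div //; lra.
have LE : ln (D%:R / (eps * eps)) = ln D%:R + 2 * L.
  have -> : D%:R / (eps * eps) = D%:R * ((1 / eps) * (1 / eps)) by field; rewrite gt_eqF.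
  have ie : 0 < 1 / eps by rewrite divr_gt0.
  have lnE (x y : R) : 0 < x -> 0 < y -> ln (x * y) = ln x + ln y by move=> ? ?; exact: lnM.
  have E1 : ln (D%:R * ((1 / eps) * (1 / eps))) = ln D%:R + ln ((1 / eps) * (1 / eps)).
    by apply: lnE => //; exact: mulr_gt0.
  have E2 : ln ((1 / eps) * (1 / eps)) = L + L by apply: lnE.
  by rewrite E1 E2; lra.
rewrite LE rE in HJ.
have L0 : 0 < L by apply: lt_le_trans lL.
set B := (2 + 64 * ln D%:R) / l0 + 128.
have B0 : 0 <= B by rewrite addr_ge0 // divr_ge0 ?(ltW l00) // addr_ge0 // mulr_ge0.
have JB : J%:R + 1 <= r * (B * L).
  have h1 : J%:R + 1 <= 2 + 64 * r * (ln D%:R + 2 * L).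
    have -> : 64 * r * (ln D%:R + 2 * L) = (ln D%:R + 2 * L) / (r^-1 / 64).
      by field; rewrite gt_eqF //; lra.
    lra.
  have h2 : 2 + 64 * ln D%:R <= (2 + 64 * ln D%:R) / l0 * L.
    rewrite mulrAC ler_pdivlMr //; apply: ler_wpM2l => //; lra.
  have h3 := ler_wpM2l (ltW L0) (r1 : 1 <= r).
  have h4 : 2 + 64 * ln D%:R + 128 * L <= B * L by rewrite /B mulrDl; lra.
  have h5 : r * (2 + 64 * ln D%:R + 128 * L) <= r * (B * L) by apply: ler_wpM2l => //; lra.
  lra.
have HT' : T%:R <= 1100 * 1000 * (D%:R * ((J%:R + 1) * (m%:R * (1 + b%:R)))) :> R.
  by move: HT; rewrite -(ler_nat R) !(natrM, natrD).
apply: le_trans HT' _.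
have -> : 1100 * 1000 * D%:R * 60 * B * (Y * L) = 1100 * 1000 * D%:R * (B * L * (60 * Y)) by ring.
rewrite [X in X <= _]mulrA; apply: ler_wpM2l; first by rewrite !mulr_ge0.
apply: (@le_trans _ _ (r * (B * L) * (m%:R * (1 + b%:R)))).
  by apply: ler_wpM2r => //; rewrite mulr_ge0 ?addr_ge0 ?ler0n.
have -> : r * (B * L) * (m%:R * (1 + b%:R)) = B * L * ((1 + b%:R) * m%:R * r) by ring.
by apply: ler_wpM2l => //; rewrite mulr_ge0 // ltW.
Qed.

(* Each of the two step budgets is exceeded with probability at most 1/D, and Markov's
   inequality for the final error costs another 2/D. *)
Lemma failure_le (R : realType) (J D q m : nat) (rk eps f0 p delta : R) :
  (0 < J)%N -> (0 < D)%N -> (0 < q)%N -> (0 < m)%N -> 0 < eps -> 0 < f0 ->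
  D%:R * p <= eps * eps -> rk <= 5400 * m%:R -> 4 <= delta * D%:R ->
  1 - delta <= 1 - J%:R * (1 / (J * (D * q))%:R * q%:R + 1 / (J * (D * (60 * (90 * m))))%:R * rk)
     - 2 / (eps * eps * f0) * p * f0.
Proof.
move=> Jp Dp qp mp e0 f00 Hp Hrk Hd.
have [J0 D0 q0 m0] : [/\ 0 < J%:R :> R, 0 < D%:R :> R, 0 < q%:R :> R & 0 < m%:R :> R].
  by rewrite !ltr0n.
have -> : J%:R * (1 / (J * (D * q))%:R * q%:R + 1 / (J * (D * (60 * (90 * m))))%:R * rk) =
    (1 + rk / (5400 * m%:R)) / D%:R.
  by rewrite !natrM; field; rewrite !gt_eqF.
have -> : 2 / (eps * eps * f0) * p * f0 = 2 * (D%:R * p / (eps * eps)) / D%:R.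
  by field; rewrite !gt_eqF.
have h1 : rk / (5400 * m%:R) <= 1 by rewrite ler_pdivrMr ?mulr_gt0 // mul1r.
have h2 : D%:R * p / (eps * eps) <= 1 by rewrite ler_pdivrMr ?mulr_gt0 // mul1r.
have : (1 + rk / (5400 * m%:R)) / D%:R + 2 * (D%:R * p / (eps * eps)) / D%:R <= delta.
  by rewrite -mulrDl ler_pdivrMr //; lra.
lra.
Qed.

(** |a|_2^2 sqrt(s) = |a|_2 |a|_1 for every row, which is the summand of S. *)
Lemma sparsity_sum (R : realType) n d (A : 'M[R]_(n, d)) (p0 : 'I_n * 'I_d) (mu : R) :
  \sum_i norm2 (row i A) ^+ 2 / mu * Num.sqrt (num_sparsity (row i A)) =
  sumS n (size (nonzeros A)) (erA A) (evA A) / mu.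
Proof.
rewrite /sumS big_mkord mulr_suml; apply: eq_bigr => i _.
rewrite (norm1A A p0) (norm2A A p0) /num_sparsity; set v := row i A.
have a0 : 0 <= norm1 v by apply: sumr_ge0 => j _.
have b0 : 0 <= norm2 v by rewrite sqrtr_ge0.
rewrite -expr_div_n !sqrtr_sqr !ger0_norm ?divr_ge0 //.
have [->|nz] := eqVneq (norm2 v) 0; first by rewrite expr0n /= !mul0r.
by rewrite mulrAC; congr (_ / _); field.
Qed.

Lemma rank_smallest_eigenvalue (R : realType) n d (A : 'M[R]_(n, d)) (mu : R) :
  smallest_eigenvalue (A^T *m A) mu -> 0 < mu -> (0 < d)%N /\ (d <= n)%N.
Proof.
move=> [/eigenvalueP[v _ vn] mumin] mu0; split.
  rewrite lt0n; apply/eqP => d0; move/eqP: vn; apply; apply/rowP => -[j hj].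
  by exfalso; move: hj; rewrite d0.
have rf : row_free (A^T *m A).
  rewrite -kermx_eq0; apply/negPn/negP => nz.
  have : mu <= 0 by apply: mumin; rewrite /eigenvalue /eigenspace raddf0 subr0.
  by rewrite leNgt mu0.
rewrite -(eqP rf); apply: leq_trans (mxrankM_maxr _ _) (rank_leq_row A).
Qed.

(** The squared Frobenius norm is the trace of A^T A; each diagonal entry is its form at a unit
    vector and so at least mu. *)
Lemma dim_mu_le (R : realType) n d (A : 'M[R]_(n, d)) (p0 : 'I_n * 'I_d) (mu : R) :
  (forall u, mu * dot d u u <= gram n d (size (nonzeros A)) (erA A) (ecA A) (evA A) u u) ->
  d%:R * mu <= frob (size (nonzeros A)) (evA A).
Proof.
move=> ray; rewrite (frobA A p0) /frobenius sqr_sqrtr; last first.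
  by do 2![apply: sumr_ge0 => ? _]; rewrite sqr_ge0.
rewrite exchange_big /=.
have -> : d%:R * mu = \sum_(j < d) mu by rewrite sumr_const card_ord mulr_natl.
apply: ler_sum => j _; have := ray (delta R j).
rewrite dot_delta // /delta eqxx mulr1 -/(delta R j).
have := congr1 (fun M : 'M[R]_d => M j j) (form_mxA A p0); rewrite !mxE => ->.
by move/le_trans; apply; apply: ler_sum => i _; rewrite mxE expr2.
Qed.

Lemma fresh_input (R : realType) n d (A : 'M[R]_(n, d)) b mu x0 eps :
  fresh 4 (regression_input A b mu x0 eps).
Proof.
by move=> x; case: x => [|[|[|[|x]]]] // _; split; rewrite /= /load_seq /= ?nth_nil.
Qed.

Lemma normal_solution (R : realType) n d m er ec (ev : nat -> R) (mu : R) (bb : nat -> R) :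
  0 < mu -> (forall u, mu * dot d u u <= gram n d m er ec ev u u) ->
  exists xs, forall u, gram n d m er ec ev xs u =
    \sum_(0 <= i < n) bb i * dot d (wrow m er ec ev i) u.
Proof.
move=> mu0 ray.
have [xs H] := form_solve (bilin_gram n d m er ec ev) (local_gram n m er ec ev) mu0 ray
  (fun j => \sum_(0 <= i < n) bb i * wrow m er ec ev i j).
exists xs => u; rewrite H /dot.
under eq_bigr do rewrite mulr_suml; rewrite exchange_big /=.
by apply: eq_bigr => i _; rewrite mulr_sumr; apply: eq_bigr => j _; rewrite mulrA.
Qed.

Lemma approx_of_gram (R : realType) n d (A : 'M[R]_(n, d)) b mu x0 eps xs (p0 : 'I_n * 'I_d) :
  let G := gram n d (size (nonzeros A)) (erA A) (ecA A) (evA A) in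
  let s := regression_input A b mu x0 eps in
  0 < eps ->
  (forall u, G xs u = \sum_(0 <= i < n) rarr s 1 i *
      dot d (wrow (size (nonzeros A)) (erA A) (ecA A) (evA A) i) u) ->
  forall s', G (errout xs s') (errout xs s') <= eps * eps * G (err0 s xs) (err0 s xs) ->
  approx_solution A b x0 eps (regression_output d s').
Proof.
move=> G s e0 xsE s' H; exists (\col_j xs j); first exact: (argminA p0 xsE).
have HB := bilin_gram n d (size (nonzeros A)) (erA A) (ecA A) (evA A).
have LB := local_gram n (size (nonzeros A)) (erA A) (ecA A) (evA A) : local_form d _.
rewrite -(@ler_pXn2r _ 2) ?nnegrE ?mulr_ge0 ?sqrtr_ge0 // ?(ltW e0) //.
rewrite exprMn !(mxnormA A p0) [eps ^+ 2]expr2.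
have E1 : forall j, (j < d)%N -> fun_of_col (regression_output d s' - \col_j xs j) j = errout xs s' j.
  by move=> j Hj; rewrite (fun_of_colE _ (Ordinal Hj)) !mxE.
have E2 : forall j, (j < d)%N -> fun_of_col (x0 - \col_j xs j) j = err0 s xs j.
  move=> j Hj; rewrite (fun_of_colE _ (Ordinal Hj)) !mxE /err0; congr (_ - _).
  rewrite /s /= /load_seq /= (nth_map (Ordinal Hj)) ?size_enum_ord //.
  by rewrite (nth_ord_enum (Ordinal Hj) (Ordinal Hj)).
by rewrite (local2 HB LB E1) (local2 HB LB E2).
Qed.

Theorem theorem4 (R : realType) (delta : R) (hdelta : 0 < delta < 1) :
  exists prog : cmd,
  forall eps0 : R, 0 < eps0 < 1 ->
  exists C : R, 0 < C /\
  forall (n d : nat) (A : 'M[R]_(n, d)) (b : 'cV[R]_n) (mu : R)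
    (x0 : 'cV[R]_d) (eps : R),
    (forall i : 'I_n, row i A != 0) ->
    smallest_eigenvalue (A^T *m A) mu ->
    0 < mu ->
    kappa A mu <= d%:R ^+ 2 ->
    0 < eps <= eps0 ->
    let start := ([:: prog], regression_input A b mu x0 eps) in
    exists t : nat,
      [/\ t%:R <= C * runtime_bound A mu eps,
          halt_prob t (fun=> True) start = 1 &
          1 - delta <= halt_prob t
            (fun s => approx_solution A b x0 eps (regression_output d s))
            start].
Proof.
have [d0 d1] := andP hdelta.
(* The total failure probability will be at most 4 / D, whence D >= 4 / delta; the program depends
   on delta only through [D]. *)
pose D := (Num.bound (4 / delta)).+1.
have D0 : (0 < D)%N by [].
have D4 : 4 <= delta * D%:R.
  rewrite mulrC -ler_pdivrMr //; apply: ltW.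
  apply: lt_trans (archi_boundP _) _; first by rewrite divr_ge0 // ltW.
  by rewrite ltr_nat.
clearbody D; exists (prog D) => eps0 /andP[e0 e1].
pose l0 : R := ln (1 / eps0).
have l00 : 0 < l0 by apply: ln_gt0; rewrite ltr_pdivlMr // mul1r.
exists (1100 * 1000 * D%:R * 60 * ((2 + 64 * ln D%:R) / l0 + 128)); split.
  have lD : 0 <= ln D%:R :> R by apply: ln_ge0; rewrite ler1n.
  rewrite mulr_gt0 ?mulr_gt0 ?ltr0n // ltr_wpDl // divr_ge0 ?(ltW l00) // addr_ge0 // mulr_ge0 //.
move=> n d A b mu x0 eps Hrow Heig mu0 _ /andP[ep ele] start.
have [dp dn] := rank_smallest_eigenvalue Heig mu0.
have np : (0 < n)%N := leq_trans dp dn.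
pose p0 := (Ordinal np, Ordinal dp).
pose m := size (nonzeros A).
have er_lt := @erA_lt _ _ _ A p0; have ec_lt := @ecA_lt _ _ _ A p0.
have erc_inj := @ercA_inj _ _ _ A p0; have ev_nz := @evA_nz _ _ _ A p0.
have rowne := rowneA p0 Hrow.
have ray : forall u, mu * dot d u u <= gram n d m (erA A) (ecA A) (evA A) u u.
  apply: rayleigh => //; [exact: bilin_gram|exact: local_gram|move=> u; exact: gram_ge0|].
  by rewrite (form_mxA A p0).
have dF := dim_mu_le p0 ray.
pose s := regression_input A b mu x0 eps.
have [xs xsE] := normal_solution (rarr s 1) mu0 ray.
have Ps : P0 n d m (erA A) (ecA A) (evA A) s by rewrite /m size_nonzeros.
have eps01 : 0 < eps < 1 by rewrite ep (le_lt_trans ele).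
have [s9 [Tp [J [T [RO Z H]]]]] := algorithm er_lt ec_lt erc_inj ev_nz rowne np mu0 dF ray D0
  eps01 Ps (@fresh_input _ _ _ A b mu x0 eps) erefl erefl xsE.
have PO := r_pre RO; have Gd := p_good PO; have gE := g_gam Gd; have Np := g_N Gd.
have [N2 rkm] := rk_le er_lt ev_nz rowne np mu0 dF PO.
have nm : (n <= m)%N := n_le_m er_lt rowne.
have mp : (0 < m)%N := leq_trans np nm.
have F0 := F_gt0 er_lt ev_nz rowne np.
have g0 : 0 < rvar s9 19 by rewrite gE divr_gt0 // ltr0n.
exists T; split.
- have Tn := nat_time_le D0 mp Np nm (leq_trans dn nm) N2 (p_hN PO) (p_T PO) (r_T RO).
  rewrite /runtime_bound -size_nonzeros (sparsity_sum A p0) /kappa -(frobA A p0).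
  apply: (time_le D0 mu0 g0 ep l00 _ Tn (r_Jle RO)).
    rewrite ler_ln ?posrE ?divr_gt0 // ?(lt_le_trans ep) //.
    by rewrite !div1r lef_pV2 ?posrE.
  rewrite gE; apply: work_le => //.
  + by apply: le_trans dF; rewrite ler_peMl ?ler1n // ltW.
  + exact: F_le_sumS.
  + exact: sumS_le.
  + exact: (p_N PO).
  + by move=> /(p_h0 PO) /(p_nb0 PO).
  + move=> bp; have [|nb Enb Hnb] := p_nb PO; last by exists nb => //; rewrite -gE.
    by rewrite lt0n; apply/eqP => /(p_nb0 PO) E; rewrite E in bp.
- apply/eqP; rewrite eq_le halt_prob_le1 /=.
  (* All prices 0 and [dv = 1]: the constant payoff 1 has expectation at least 1, which is
     termination within T steps in every run. *)
  have := H 0 0 1 0 (fun=> 1); rewrite !mul0r !addr0 mulr0 !subr0.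
  move=> /(_ (lexx _) (lexx _) (lexx _) (lexx _) (lexx _)).
  have L1 : forall s' : store R, (1 : R) <= 1 by [].
  have L2 (s' : store R) : 1 - 0 * (gram n d m (erA A) (ecA A) (evA A) (errout xs s') (errout xs s') / 2) <= 1.
    by rewrite mul0r subr0.
  move=> /(_ L1 L2 [::] 0%N (fun=> True)); rewrite addn0; apply=> s' _.
  by rewrite /= asboolT.
pose P s' := approx_solution A b x0 eps (regression_output d s').
pose psi (s' : store R) : R := (`[< P s' >])%:R.
have Pok := approx_of_gram p0 ep xsE.
have fin v : wp (prog D) s T (fun=> True) psi v -> v <= halt_prob T P start.
  by move=> /(_ [::] 0%N P); rewrite addn0; apply.
set G := gram n d m (erA A) (ecA A) (evA A) in Z H Pok *.
set f0 := G (err0 s xs) (err0 s xs) in Z H Pok *.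
(* The price of the error below is inversely proportional to [f0], so an optimal starting point is
   handled separately. *)
have [f00|f0n] := eqVneq f0 0.
  apply: le_trans (fin 1 _); first by rewrite gerBl ltW.
  apply: Z => // s' E; rewrite /psi asboolT //.
  by apply: Pok; rewrite E f00 mulr0.
have f0p : 0 < f0 by rewrite lt0r f0n gram_ge0.
have Jp : (0 < J)%N.
  rewrite lt0n; apply/eqP => J0; have := r_J RO; rewrite J0 expr0 mulr1 => h.
  have [_ e1'] := andP eps01.
  have : eps * eps < 1 by rewrite mulr_ilt1 // ltW.
  by move=> /(le_lt_trans h); rewrite ltrn1 // ; case: (D) D0.
have mp5 : (0 < J * (D * (60 * (90 * m))))%N by rewrite !muln_gt0 Jp D0 mp.
have Np5 : (0 < J * (D * (1 + 768 * tN s9)))%N by rewrite !muln_gt0 Jp D0.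
(* Prices for Markov's inequality: using up either whole budget costs 1, and so does a final squared
   error of eps^2 * f0. A failed run therefore has payoff 0. *)
apply: le_trans (fin _ (H (1 / (J * (D * (1 + 768 * tN s9)))%:R)
  (1 / (J * (D * (60 * (90 * m))))%:R) 0 (2 / (eps * eps * f0)) psi _ _ _ _ _ _ _)).
- by apply: failure_le => //; exact: r_J RO.
- by rewrite divr_ge0.
- by rewrite divr_ge0.
- by rewrite divr_ge0 // mulr_ge0 ?mulr_ge0 // ltW.
- by rewrite add0r div1r mulVf // pnatr_eq0 -lt0n.
- by rewrite add0r div1r mulVf // pnatr_eq0 -lt0n.
- by move=> s'; rewrite /psi ler0n.
move=> s'; rewrite /psi; set g := G _ _.
have c0 : 0 < eps * eps * f0 by rewrite !mulr_gt0.
have -> : 2 / (eps * eps * f0) * (g / 2) = g / (eps * eps * f0) by field; rewrite !gt_eqF.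
case: asboolP => HP /=; first by rewrite gerBl divr_ge0 ?(ltW c0) // gram_ge0.
rewrite subr_le0 ler_pdivlMr // mul1r; apply: ltW; rewrite ltNge; apply/negP => h.
by apply: HP; exact: Pok.
Qed.
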